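(* Assume the Riemann Hypothesis, and let $\epsilon>0$ be fixed. Then there exist positive constants $K$ and $b(K)$ such that, for $T$ large, uniformly for $1/2+K/\log_2T\leq \sigma\leq 1-\epsilon$ we have $$ \frac{1}{T}\int_{T}^{2T}\zeta(\sigma+it)^{z_1}\overline{\zeta(\sigma+it)}^{z_2}\,dt= \sum_{n=1}^{\infty}\frac{d_{z_1}(n)d_{z_2}(n)}{n^{2\sigma}}+O\left(\exp\left(-\frac{\log T}{50\log_2 T}\right)\right)$$ for all complex numbers $z_1, z_2$ with $|z_i|\leq b(K)(\log T)^{2\sigma-1}$.
   Context: $\log_2=\log\log$. For complex $z$, $d_z(n)$ is the multiplicative function with $d_z(p^a)=\Gamma(z+a)/(\Gamma(z)a!)$ for primes $p$ and integers $a\ge 0$, so that $\zeta(s)^z=\sum_n d_z(n)n^{-s}$ for $\mathrm{Re}(s)>1$. Under RH, $\log\zeta(s)$ is defined in $\mathrm{Re}(s)>1/2$ by analytic continuation from $\mathrm{Re}(s)>1$ (continuous variation from the right), and $\zeta(s)^{z}:=\exp(z\log\zeta(s))$. *)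

(* Defs.v *)
From Stdlib Require Import Reals ClassicalEpsilon Factorial.
From Coquelicot Require Import Coquelicot.
From mathcomp Require prime.
Open Scope R_scope.

Definition cexp (z : C) : C :=
  (exp (Re z) * cos (Im z), exp (Re z) * sin (Im z)).

Definition npow_neg (n : nat) (s : C) : C :=
  cexp (Copp s * RtoC (ln (INR n))).

Fixpoint csum1 (f : nat -> C) (N : nat) : C :=
  match N with
  | O => RtoC 0
  | S m => Cplus (csum1 f m) (f (S m))
  end.

(* Riemann zeta function on Re s > 0, s <> 1 (analytic continuation):
   zeta(s) = lim_{N -> oo} ( sum_{n<=N} n^{-s} - N^{1-s}/(1-s) ).
   For Re s > 1 this is the Dirichlet series sum n^{-s}. *)
Definition zeta_partial (s : C) (N : nat) : C :=
  Cminus (csum1 (fun n => npow_neg n s) N)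
         (Cdiv (npow_neg N (Cminus s (RtoC 1))) (Cminus (RtoC 1) s)).

Definition zeta (s : C) : C :=
  (real (Lim_seq (fun N => Re (zeta_partial s N))),
   real (Lim_seq (fun N => Im (zeta_partial s N)))).

Definition RH : Prop :=
  forall s : C, 0 < Re s < 1 -> zeta s = RtoC 0 -> Re s = 1/2.

(* L is a continuous logarithm of zeta along the horizontal half-line
   {u + i t : u >= sigma0}, normalised so that L(u) -> 0 as u -> +oo
   (i.e. it is the analytic continuation from Re s > 1 of the principal
   log zeta(s) = sum Lambda(n)/(log n) n^{-s}, varied continuously from the right). *)
Definition log_zeta_branch (t sigma0 : R) (L : R -> C) : Prop :=
  (forall u, sigma0 <= u -> cexp (L u) = zeta (u, t)) /\
  (forall u, sigma0 <= u -> continuous L u) /\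
  filterlim L (Rbar_locally p_infty) (locally (RtoC 0)).

(* log zeta(s), defined (under RH, for Re s > 1/2, Im s <> 0) as the value at
   Re s of the unique such branch. *)
Definition log_zeta (s : C) : C :=
  epsilon (inhabits (RtoC 0))
    (fun l => exists L, log_zeta_branch (Im s) (Re s) L /\ L (Re s) = l).

Definition zeta_pow (s z : C) : C := cexp (Cmult z (log_zeta s)).
Definition zeta_conj_pow (s z : C) : C := cexp (Cmult z (Cconj (log_zeta s))).

Fixpoint rising (z : C) (a : nat) : C :=
  match a with
  | O => RtoC 1
  | S b => Cmult (rising z b) (Cplus z (RtoC (INR b)))
  end.

(* d_z(p^a) = Gamma(z+a) / (Gamma(z) a!) = z(z+1)...(z+a-1)/a! *)
Definition dz_pp (z : C) (a : nat) : C :=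
  Cmult (rising z a) (RtoC (/ INR (fact a))).

Definition dz (z : C) (n : nat) : C :=
  List.fold_right (fun p acc => Cmult (dz_pp z (prime.logn p n)) acc) (RtoC 1)
             (prime.primes n).

Definition dz_term (z1 z2 : C) (sigma : R) (n : nat) : C :=
  Cmult (Cmult (dz z1 n) (dz z2 n)) (RtoC (Rpower (INR n) (-2 * sigma))).

Definition dz_series (z1 z2 : C) (sigma : R) : C :=
  (Series (fun n => Re (dz_term z1 z2 sigma (S n))),
   Series (fun n => Im (dz_term z1 z2 sigma (S n)))).

Definition moment_integrand (z1 z2 : C) (sigma t : R) : C :=
  Cmult (zeta_pow (sigma, t) z1) (zeta_conj_pow (sigma, t) z2).

Definition moment (z1 z2 : C) (sigma T : R) : C :=
  (RInt (fun t => Re (moment_integrand z1 z2 sigma t)) T (2 * T) / T,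
   RInt (fun t => Im (moment_integrand z1 z2 sigma t)) T (2 * T) / T).

(* Main.v *)
(** Write L = log T and l = log L.

    Under RH, dividing the zeros of zeta near 2 + it out by Blaschke factors
    gives, for g = zeta'/zeta, a one-sided bound Re g >= -A log t and
    |g| <= A log t (1 + 1/(sigma - 1/2)).  Cauchy's theorem on a rectangle with
    kernels y^w e^{(w+x)^2} (1/w - 1/(w+2x)), y about L^2, turns the one-sided bound into
    |g(sigma + it)| << L^{2-2sigma} + L^{eps}, hence, by integration,
    |log zeta(sigma + it)| << L^{2-2sigma}/l + L^{eps} for sigma >= 1/2 + 4/l.

    So |z log zeta| is at most L/(10 l) when |z| <= b L^{2sigma-1} with b small,
    even a distance 10/l to the left of the line sigma.  Shifting the contour in
    the integral of zeta(s+w)^z X^w e^{w^2}/w with X = T^{1/10} therefore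
    approximates zeta(s)^z pointwise, up to exp(-L/(2l)), by a Dirichlet
    polynomial with coefficients d_z(n) W_n, where W_n decays like (X/n)^3 and
    is 1 + O(l (n/X)^{10/l}).  In the mean square the off-diagonal terms
    contribute X^6 T^{-1+o(1)}, and replacing |W_n|^2 by 1 in the diagonal costs
    exp(-L/(2l)) times a sum of d_k(n)^2 n^{-2sigma+20/l}, which is exp(o(L/l)):
    at each prime d_k^2 is compared both with the square of the factor for d_k
    and with the factor for d_{k^2}. *)

Require Import Defs.
From Stdlib Require Import Reals Lra Lia Classical ClassicalEpsilon Factorial List.
From Coquelicot Require Import Coquelicot.
From mathcomp Require ssreflect ssrfun ssrbool eqtype ssrnat seq path fintype div bigop prime binomial.
Open Scope R_scope.

(** * Complex differentiation *)

(** Every size is measured against rho = L/l, with T = exp(exp l). The shift d = 10/l and xi = log X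
    = L/10 satisfy d xi = rho, so the shifted contour gains exp(-rho); this beats the exp(rho/10)
    that zeta^z may reach there, and all remaining exponents stay below -rho/50. X is a power of T
    below 1/6 because the off-diagonal terms cost X^6, together with exp(16 |z|) from the sums of
    |d_z(n)| n^{-2}, where |z| <= L/100. The factor 1/l in the bound of log zeta is decisive: |z|
    L^{2-2 sigma} has size L, and only a small multiple of L/l is affordable. A one-sided bound of
    Re g suffices because the Poisson kernel is positive: a lower bound on Re g turns its mean
    absolute value into its mean value, hence into g(s) itself, and the small factor y^{-x} then
    lets g(s) be absorbed. The starting distance 20/l from the critical line pays for the shift by d
    and for the margin 4/l that the bound of log zeta asks for. The conjugated factor is the
    conjugate of zeta^{conj z2}, so one approximation serves both factors. *)

Lemma Cmod_sub_sym (z w : C) : Cmod (z - w) = Cmod (w - z).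
Proof. rewrite <- Cmod_opp. f_equal. ring. Qed.

Lemma Cmod_sub_le (z w : C) : Cmod z <= Cmod w + Cmod (z - w).
Proof. replace z with (w + (z - w))%C at 1 by ring. apply Cmod_triangle. Qed.

Lemma Cmod_minus_le (z w : C) : Cmod (z - w) <= Cmod z + Cmod w.
Proof. rewrite <- (Cmod_opp w). apply Cmod_triangle. Qed.

Lemma Im_le_Cmod (z : C) : Rabs (Im z) <= Cmod z.
Proof. eapply Rle_trans; [apply Rmax_r | apply Rmax_Cmod]. Qed.

Lemma Cmod_le_Re_Im (z : C) : Cmod z <= Rabs (Re z) + Rabs (Im z).
Proof.
  apply Rsqr_incr_0_var; [| generalize (Rabs_pos (Re z)) (Rabs_pos (Im z)); lra].
  unfold Rsqr. replace (Cmod z * Cmod z) with (Cmod z ^ 2) by ring.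
  rewrite Cmod2_alt, <- (pow2_abs (Re z)), <- (pow2_abs (Im z)).
  generalize (Rabs_pos (Re z)) (Rabs_pos (Im z)); nra.
Qed.

Lemma Cmod_sqr (z : C) : Cmod z * Cmod z = Re z * Re z + Im z * Im z.
Proof. generalize (Cmod2_alt z); simpl; nra. Qed.

Lemma Re_minus (a b : C) : Re (a - b) = Re a - Re b.
Proof. reflexivity. Qed.
Lemma Im_minus (a b : C) : Im (a - b) = Im a - Im b.
Proof. reflexivity. Qed.

Lemma Ceq_of (z w : C) : Re z = Re w -> Im z = Im w -> z = w.
Proof. destruct z, w; simpl; intros -> ->; reflexivity. Qed.

Lemma Cmod_pos (z : C) : z <> 0 -> 0 < Cmod z.
Proof. apply Cmod_gt_0. Qed.

Definition ccont (f : C -> C) (z : C) : Prop :=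
  forall e, 0 < e -> exists d, 0 < d /\
  forall w, Cmod (w - z) < d -> Cmod (f w - f z) < e.

Definition rcont (f : R -> C) (t : R) : Prop :=
  forall e, 0 < e -> exists d, 0 < d /\
  forall u, Rabs (u - t) < d -> Cmod (f u - f t) < e.

(** The increment form, free of quotients, admits w = z; composition then needs no case distinction
    when the inner function repeats a value. *)
Definition cderiv (f : C -> C) (z l : C) : Prop :=
  forall e, 0 < e -> exists d, 0 < d /\
  forall w, Cmod (w - z) < d ->
    Cmod (f w - f z - (w - z) * l) <= e * Cmod (w - z).

(** Taken componentwise so that the real theory of derivatives and Riemann integrals applies to each
    part; [rderiv_eps] and [rderiv_of_eps] pass to the increment form, in which the chain rule with
    [cderiv] is proved. *)
Definition rderiv (f : R -> C) (t : R) (l : C) : Prop :=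
  is_derive (fun u => Re (f u)) t (Re l) /\
  is_derive (fun u => Im (f u)) t (Im l).

Lemma ccont_const c z : ccont (fun _ => c) z.
Proof.
  intros e He; exists 1; split; [lra|]; intros w _.
  replace (c - c)%C with (RtoC 0) by ring. now rewrite Cmod_0.
Qed.

Lemma ccont_id z : ccont (fun w => w) z.
Proof. intros e He; exists e; auto. Qed.

Lemma ccont_plus f g z : ccont f z -> ccont g z -> ccont (fun w => f w + g w)%C z.
Proof.
  intros Hf Hg e He.
  destruct (Hf (e/2)) as (d1 & D1 & H1); [lra|].
  destruct (Hg (e/2)) as (d2 & D2 & H2); [lra|].
  exists (Rmin d1 d2); split; [apply Rmin_glb_lt; auto|].
  intros w Hw.
  assert (A1 := H1 w (Rlt_le_trans _ _ _ Hw (Rmin_l _ _))).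
  assert (A2 := H2 w (Rlt_le_trans _ _ _ Hw (Rmin_r _ _))).
  replace (f w + g w - (f z + g z))%C with ((f w - f z) + (g w - g z))%C by ring.
  generalize (Cmod_triangle (f w - f z) (g w - g z)); lra.
Qed.

Lemma ccont_comp f g z : ccont g z -> ccont f (g z) -> ccont (fun w => f (g w)) z.
Proof.
  intros Hg Hf e He. destruct (Hf e He) as (d1 & D1 & H1).
  destruct (Hg d1 D1) as (d & D & H). exists d; split; auto.
Qed.

Lemma rcont_comp f g t : rcont g t -> ccont f (g t) -> rcont (fun u => f (g u)) t.
Proof.
  intros Hg Hf e He. destruct (Hf e He) as (d1 & D1 & H1).
  destruct (Hg d1 D1) as (d & D & H). exists d; split; auto.
Qed.

Lemma ccont_mult f g z : ccont f z -> ccont g z -> ccont (fun w => f w * g w)%C z.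
Proof.
  intros Hf Hg e He.
  set (A := Cmod (f z)); set (B := Cmod (g z)).
  assert (HA : 0 <= A) by apply Cmod_ge_0. assert (HB : 0 <= B) by apply Cmod_ge_0.
  destruct (Hf (Rmin 1 (e / (2 * (B + 1))))) as (d1 & D1 & H1).
  { apply Rmin_glb_lt; [lra|]. apply Rdiv_lt_0_compat; lra. }
  destruct (Hg (Rmin 1 (e / (2 * (A + 1))))) as (d2 & D2 & H2).
  { apply Rmin_glb_lt; [lra|]. apply Rdiv_lt_0_compat; lra. }
  exists (Rmin d1 d2); split; [apply Rmin_glb_lt; auto|].
  intros w Hw.
  assert (A1 := H1 w (Rlt_le_trans _ _ _ Hw (Rmin_l _ _))).
  assert (A2 := H2 w (Rlt_le_trans _ _ _ Hw (Rmin_r _ _))).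
  replace (f w * g w - f z * g z)%C
    with ((f w - f z) * g w + f z * (g w - g z))%C by ring.
  eapply Rle_lt_trans; [apply Cmod_triangle|]. rewrite !Cmod_mult. fold A.
  assert (Gw : Cmod (g w) <= B + 1).
  { generalize (Cmod_sub_le (g w) (g z)) (Rmin_l 1 (e / (2 * (A + 1)))). unfold B; lra. }
  assert (E1 : Cmod (f w - f z) < e / (2 * (B + 1))).
  { eapply Rlt_le_trans; [apply A1 | apply Rmin_r]. }
  assert (E2 : Cmod (g w - g z) < e / (2 * (A + 1))).
  { eapply Rlt_le_trans; [apply A2 | apply Rmin_r]. }
  assert (I1 : Cmod (f w - f z) * (B + 1) < e / 2).
  { replace (e / 2) with (e / (2 * (B + 1)) * (B + 1)) by (field; lra).
    apply Rmult_lt_compat_r; lra. }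
  assert (I2 : Cmod (g w - g z) * (A + 1) < e / 2).
  { replace (e / 2) with (e / (2 * (A + 1)) * (A + 1)) by (field; lra).
    apply Rmult_lt_compat_r; lra. }
  generalize (Cmod_ge_0 (f w - f z)) (Cmod_ge_0 (g w - g z)) (Cmod_ge_0 (g w)). nra.
Qed.

Lemma ccont_inv_id (z : C) : z <> 0 -> ccont Cinv z.
Proof.
  intros Hz e He. assert (P := Cmod_pos z Hz). set (m := Cmod z) in *.
  exists (Rmin (m / 2) (e * (m * m) / 2)); split.
  { apply Rmin_glb_lt; [lra|]. apply Rdiv_lt_0_compat; [|lra].
    apply Rmult_lt_0_compat; nra. }
  intros w Hw.
  assert (W1 : Cmod (w - z) < m / 2) by (eapply Rlt_le_trans; [apply Hw| apply Rmin_l]).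
  assert (W2 : Cmod (w - z) < e * (m * m) / 2) by (eapply Rlt_le_trans; [apply Hw| apply Rmin_r]).
  assert (Pw : m / 2 < Cmod w).
  { generalize (Cmod_sub_le z w). rewrite Cmod_sub_sym. fold m. lra. }
  assert (Nw : w <> 0). { intros ->. rewrite Cmod_0 in Pw. lra. }
  replace (/ w - / z)%C with (- (w - z) / (w * z))%C by (field; auto).
  rewrite Cmod_div by (apply Cmult_neq_0; auto).
  rewrite Cmod_opp, Cmod_mult. fold m.
  apply (Rmult_lt_reg_r (Cmod w * m)); [nra|].
  unfold Rdiv. rewrite Rmult_assoc, Rinv_l by nra. rewrite Rmult_1_r.
  apply Rlt_trans with (1 := W2).
  replace (e * (m * m) / 2) with (e * (m / 2 * m)) by field.
  apply Rmult_lt_compat_l; auto.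
Qed.

Lemma ccont_ext_loc f g z r : 0 < r -> (forall w, Cmod (w - z) < r -> f w = g w) ->
  ccont f z -> ccont g z.
Proof.
  intros Hr E Hf e He. destruct (Hf e He) as (d & D & H).
  exists (Rmin d r); split; [apply Rmin_glb_lt; auto|]. intros w Hw.
  rewrite <- !E.
  - apply H. eapply Rlt_le_trans; [apply Hw | apply Rmin_l].
  - replace (z - z)%C with (RtoC 0) by ring. now rewrite Cmod_0.
  - eapply Rlt_le_trans; [apply Hw | apply Rmin_r].
Qed.

Lemma ccont_opp f z : ccont f z -> ccont (fun w => - f w)%C z.
Proof.
  intros Hf e He. destruct (Hf e He) as (d & D & H). exists d; split; auto.
  intros w Hw. replace (- f w - - f z)%C with (- (f w - f z))%C by ring.
  rewrite Cmod_opp; auto.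
Qed.

Lemma ccont_minus f g z : ccont f z -> ccont g z -> ccont (fun w => f w - g w)%C z.
Proof. intros; apply ccont_plus; auto; now apply ccont_opp. Qed.

Lemma ccont_inv (f : C -> C) (z : C) : f z <> 0 -> ccont f z -> ccont (fun w => / f w)%C z.
Proof. intros Hz Hf; apply (ccont_comp Cinv f); auto; now apply ccont_inv_id. Qed.

Lemma ccont_div (f g : C -> C) (z : C) : g z <> 0 -> ccont f z -> ccont g z -> ccont (fun w => f w / g w)%C z.
Proof. intros; apply ccont_mult; auto; now apply ccont_inv. Qed.

Lemma ccont_conj z : ccont Cconj z.
Proof.
  intros e He; exists e; split; auto; intros w Hw.
  rewrite <- Cminus_conj, Cmod_conj; auto.
Qed.

Lemma rcont_const c t : rcont (fun _ => c) t.
Proof.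
  intros e He; exists 1; split; [lra|]; intros w _.
  replace (c - c)%C with (RtoC 0) by ring. now rewrite Cmod_0.
Qed.

Lemma rcont_pair (f g : R -> R) t : continuous f t -> continuous g t ->
  rcont (fun u => (f u, g u)) t.
Proof.
  intros Hf Hg e He.
  assert (He2 : 0 < e / 2) by lra.
  destruct (proj1 (filterlim_locally _ _) Hf (mkposreal _ He2)) as (d1 & H1).
  destruct (proj1 (filterlim_locally _ _) Hg (mkposreal _ He2)) as (d2 & H2).
  exists (Rmin d1 d2); split; [apply Rmin_glb_lt; apply cond_pos|].
  intros u Hu.
  assert (A1 := H1 u (Rlt_le_trans _ _ _ Hu (Rmin_l _ _))).
  assert (A2 := H2 u (Rlt_le_trans _ _ _ Hu (Rmin_r _ _))).
  eapply Rle_lt_trans; [apply Cmod_le_Re_Im|]. simpl.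
  unfold ball in A1, A2; simpl in A1, A2.
  unfold AbsRing_ball, abs, minus, plus, opp in A1, A2; simpl in A1, A2.
  unfold Rminus in *. lra.
Qed.

Lemma rcont_re f t : rcont f t -> continuous (fun u => Re (f u)) t.
Proof.
  intros H. apply filterlim_locally. intros e.
  destruct (H e (cond_pos e)) as (d & D & Hd).
  exists (mkposreal d D). intros u Hu. specialize (Hd u Hu).
  eapply Rle_lt_trans; [| apply Hd]. apply (re_le_Cmod (f u - f t)).
Qed.

Lemma rcont_im f t : rcont f t -> continuous (fun u => Im (f u)) t.
Proof.
  intros H. apply filterlim_locally. intros e.
  destruct (H e (cond_pos e)) as (d & D & Hd).
  exists (mkposreal d D). intros u Hu. specialize (Hd u Hu).
  eapply Rle_lt_trans; [| apply Hd]. apply (Im_le_Cmod (f u - f t)).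
Qed.

Lemma rcont_of_re_im f t :
  continuous (fun u => Re (f u)) t -> continuous (fun u => Im (f u)) t -> rcont f t.
Proof.
  intros H1 H2 e He. destruct (rcont_pair _ _ _ H1 H2 e He) as (d & D & H).
  exists d; split; auto.
Qed.

Lemma rcont_ext f g t : (forall u, f u = g u) -> rcont f t -> rcont g t.
Proof.
  intros E H e He. destruct (H e He) as (d & D & Hd). exists d; split; auto.
  intros; rewrite <- !E; auto.
Qed.

Lemma rcont_plus f g t : rcont f t -> rcont g t -> rcont (fun u => f u + g u)%C t.
Proof.
  intros Hf Hg. apply rcont_of_re_im; simpl.
  - apply (continuous_plus (fun u => Re (f u)) (fun u => Re (g u))); now apply rcont_re.
  - apply (continuous_plus (fun u => Im (f u)) (fun u => Im (g u))); now apply rcont_im.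
Qed.

Lemma rcont_mult f g t : rcont f t -> rcont g t -> rcont (fun u => f u * g u)%C t.
Proof.
  intros Hf Hg.
  assert (a := rcont_re _ _ Hf). assert (b := rcont_im _ _ Hf).
  assert (c := rcont_re _ _ Hg). assert (d := rcont_im _ _ Hg).
  apply rcont_of_re_im; simpl.
  - apply (continuous_minus (fun u => Re (f u) * Re (g u)) (fun u => Im (f u) * Im (g u))).
    + now apply (continuous_mult (fun u => Re (f u)) (fun u => Re (g u))).
    + now apply (continuous_mult (fun u => Im (f u)) (fun u => Im (g u))).
  - apply (continuous_plus (fun u => Re (f u) * Im (g u)) (fun u => Im (f u) * Re (g u))).
    + now apply (continuous_mult (fun u => Re (f u)) (fun u => Im (g u))).
    + now apply (continuous_mult (fun u => Im (f u)) (fun u => Re (g u))).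
Qed.

Lemma rcont_opp f t : rcont f t -> rcont (fun u => - f u)%C t.
Proof.
  intros H. apply (rcont_ext (fun u => RtoC (-1) * f u)%C).
  { intros; apply Ceq_of; simpl; ring. }
  apply rcont_mult; auto using rcont_const.
Qed.

Lemma rcont_minus f g t : rcont f t -> rcont g t -> rcont (fun u => f u - g u)%C t.
Proof. intros; apply rcont_plus; auto; now apply rcont_opp. Qed.

Lemma rcont_inv (f : R -> C) t : f t <> 0 -> rcont f t -> rcont (fun u => / f u)%C t.
Proof. intros Hz Hf; apply (rcont_comp Cinv f); auto; now apply ccont_inv_id. Qed.

Lemma rcont_div (f g : R -> C) t : g t <> 0 -> rcont f t -> rcont g t -> rcont (fun u => f u / g u)%C t.
Proof. intros; apply rcont_mult; auto; now apply rcont_inv. Qed.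

Lemma rcont_conj f t : rcont f t -> rcont (fun u => Cconj (f u)) t.
Proof. intros; apply rcont_comp; auto using ccont_conj. Qed.

Lemma rcont_RtoC (f : R -> R) t : continuous f t -> rcont (fun u => RtoC (f u)) t.
Proof. intros; apply rcont_pair; auto. apply continuous_const. Qed.

Lemma rcont_mod f t : rcont f t -> continuous (fun u => Cmod (f u)) t.
Proof.
  intros H. apply filterlim_locally. intros e.
  destruct (H e (cond_pos e)) as (d & D & Hd).
  exists (mkposreal d D). intros u Hu. specialize (Hd u Hu).
  eapply Rle_lt_trans; [| apply Hd].
  change (Rabs (Cmod (f u) - Cmod (f t)) <= Cmod (f u - f t)).
  apply Rabs_le. split.
  - generalize (Cmod_sub_le (f t) (f u)). rewrite (Cmod_sub_sym (f t)). lra.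
  - generalize (Cmod_sub_le (f u) (f t)). lra.
Qed.

Lemma cderiv_const c z : cderiv (fun _ => c) z 0.
Proof.
  intros e He; exists 1; split; [lra|]; intros w _.
  replace (c - c - (w - z) * 0)%C with (RtoC 0) by ring. rewrite Cmod_0.
  apply Rmult_le_pos; [lra | apply Cmod_ge_0].
Qed.

Lemma cderiv_id z : cderiv (fun w => w) z 1.
Proof.
  intros e He; exists 1; split; [lra|]; intros w _.
  replace (w - z - (w - z) * 1)%C with (RtoC 0) by ring. rewrite Cmod_0.
  apply Rmult_le_pos; [lra | apply Cmod_ge_0].
Qed.

Lemma cderiv_eq f z l l' : l = l' -> cderiv f z l -> cderiv f z l'.
Proof. now intros ->. Qed.

Lemma cderiv_ext f g z l : (forall w, f w = g w) -> cderiv f z l -> cderiv g z l.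
Proof.
  intros E H e He. destruct (H e He) as (d & D & Hd). exists d; split; auto.
  intros; rewrite <- !E; auto.
Qed.

Lemma cderiv_ext_loc f g z l r : 0 < r -> (forall w, Cmod (w - z) < r -> f w = g w) ->
  cderiv f z l -> cderiv g z l.
Proof.
  intros Hr E Hf e He. destruct (Hf e He) as (d & D & H).
  exists (Rmin d r); split; [apply Rmin_glb_lt; auto|]. intros w Hw.
  rewrite <- !E.
  - apply H. eapply Rlt_le_trans; [apply Hw | apply Rmin_l].
  - replace (z - z)%C with (RtoC 0) by ring. now rewrite Cmod_0.
  - eapply Rlt_le_trans; [apply Hw | apply Rmin_r].
Qed.

Lemma cderiv_lip f z l : cderiv f z l -> exists d, 0 < d /\
  forall w, Cmod (w - z) < d -> Cmod (f w - f z) <= (Cmod l + 1) * Cmod (w - z).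
Proof.
  intros H. destruct (H 1 Rlt_0_1) as (d & D & Hd). exists d; split; auto.
  intros w Hw. specialize (Hd w Hw).
  generalize (Cmod_sub_le (f w - f z) ((w - z) * l)). rewrite Cmod_mult. nra.
Qed.

Lemma cderiv_ccont f z l : cderiv f z l -> ccont f z.
Proof.
  intros H e He. destruct (cderiv_lip f z l H) as (d & D & Hd).
  assert (P : 0 < Cmod l + 1) by (generalize (Cmod_ge_0 l); lra).
  exists (Rmin d (e / (Cmod l + 1))); split.
  { apply Rmin_glb_lt; auto. apply Rdiv_lt_0_compat; auto. }
  intros w Hw.
  eapply Rle_lt_trans; [apply Hd; eapply Rlt_le_trans; [apply Hw| apply Rmin_l]|].
  apply (Rmult_lt_reg_l (/ (Cmod l + 1))); [now apply Rinv_0_lt_compat|].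
  rewrite <- Rmult_assoc, Rinv_l, Rmult_1_l by lra.
  rewrite Rmult_comm. eapply Rlt_le_trans; [apply Hw| apply Rmin_r].
Qed.

Lemma cderiv_plus f g z l m : cderiv f z l -> cderiv g z m ->
  cderiv (fun w => f w + g w)%C z (l + m).
Proof.
  intros Hf Hg e He.
  destruct (Hf (e/2)) as (d1 & D1 & H1); [lra|].
  destruct (Hg (e/2)) as (d2 & D2 & H2); [lra|].
  exists (Rmin d1 d2); split; [apply Rmin_glb_lt; auto|].
  intros w Hw.
  assert (A1 := H1 w (Rlt_le_trans _ _ _ Hw (Rmin_l _ _))).
  assert (A2 := H2 w (Rlt_le_trans _ _ _ Hw (Rmin_r _ _))).
  replace (f w + g w - (f z + g z) - (w - z) * (l + m))%C
    with ((f w - f z - (w - z) * l) + (g w - g z - (w - z) * m))%C by ring.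
  eapply Rle_trans; [apply Cmod_triangle|]. lra.
Qed.

Lemma cderiv_comp f g z l m : cderiv g z m -> cderiv f (g z) l ->
  cderiv (fun w => f (g w)) z (l * m).
Proof.
  intros Hg Hf e He.
  set (A := Cmod l); set (B := Cmod m).
  assert (HA : 0 <= A) by apply Cmod_ge_0. assert (HB : 0 <= B) by apply Cmod_ge_0.
  destruct (Hf (e / (2 * (B + 1)))) as (d1 & D1 & H1).
  { apply Rdiv_lt_0_compat; lra. }
  destruct (Hg (e / (2 * (A + 1)))) as (d2 & D2 & H2).
  { apply Rdiv_lt_0_compat; lra. }
  destruct (cderiv_lip _ _ _ Hg) as (d3 & D3 & H3). fold B in H3.
  destruct (cderiv_ccont _ _ _ Hg d1 D1) as (d4 & D4 & H4).
  exists (Rmin (Rmin d2 d3) d4); split; [repeat apply Rmin_glb_lt; auto|].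
  intros w Hw.
  assert (W2 : Cmod (w - z) < d2).
  { eapply Rlt_le_trans; [apply Hw|]. eapply Rle_trans; [apply Rmin_l|]. apply Rmin_l. }
  assert (W3 : Cmod (w - z) < d3).
  { eapply Rlt_le_trans; [apply Hw|]. eapply Rle_trans; [apply Rmin_l|]. apply Rmin_r. }
  assert (W4 : Cmod (w - z) < d4).
  { eapply Rlt_le_trans; [apply Hw|]. apply Rmin_r. }
  specialize (H2 w W2). specialize (H3 w W3). specialize (H1 (g w) (H4 w W4)).
  replace (f (g w) - f (g z) - (w - z) * (l * m))%C
    with ((f (g w) - f (g z) - (g w - g z) * l) + (g w - g z - (w - z) * m) * l)%C by ring.
  eapply Rle_trans; [apply Cmod_triangle|]. rewrite Cmod_mult. fold A.
  assert (P := Cmod_ge_0 (w - z)).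
  assert (I1 : e / (2 * (B + 1)) * Cmod (g w - g z) <= e / 2 * Cmod (w - z)).
  { apply Rle_trans with (e / (2 * (B + 1)) * ((B + 1) * Cmod (w - z))).
    - apply Rmult_le_compat_l; auto. apply Rlt_le, Rdiv_lt_0_compat; lra.
    - right; field; lra. }
  assert (I2 : Cmod (g w - g z - (w - z) * m) * A <= e / 2 * Cmod (w - z)).
  { apply Rle_trans with (e / (2 * (A + 1)) * Cmod (w - z) * (A + 1)).
    - apply Rmult_le_compat; auto using Cmod_ge_0; lra.
    - right; field; lra. }
  lra.
Qed.

Lemma cderiv_mult f g z l m : cderiv f z l -> cderiv g z m ->
  cderiv (fun w => f w * g w)%C z (l * g z + f z * m).
Proof.
  intros Hf Hg e He.
  set (A := Cmod (f z)); set (B := Cmod l).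
  assert (HA : 0 <= A) by apply Cmod_ge_0. assert (HB : 0 <= B) by apply Cmod_ge_0.
  set (G := Cmod (g z)). assert (HG : 0 <= G) by apply Cmod_ge_0.
  destruct (Hf (e / (3 * (G + 1)))) as (d1 & D1 & H1). { apply Rdiv_lt_0_compat; lra. }
  destruct (Hg (e / (3 * (A + 1)))) as (d2 & D2 & H2). { apply Rdiv_lt_0_compat; lra. }
  destruct (cderiv_lip _ _ _ Hf) as (d3 & D3 & H3). fold B in H3.
  destruct (cderiv_ccont _ _ _ Hg (e / (3 * (B + 1)))) as (d4 & D4 & H4).
  { apply Rdiv_lt_0_compat; lra. }
  exists (Rmin (Rmin d1 d2) (Rmin d3 d4)); split; [repeat apply Rmin_glb_lt; auto|].
  intros w Hw.
  assert (W12 := Rlt_le_trans _ _ _ Hw (Rmin_l _ _)).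
  assert (W34 := Rlt_le_trans _ _ _ Hw (Rmin_r _ _)).
  specialize (H1 w (Rlt_le_trans _ _ _ W12 (Rmin_l _ _))).
  specialize (H2 w (Rlt_le_trans _ _ _ W12 (Rmin_r _ _))).
  specialize (H3 w (Rlt_le_trans _ _ _ W34 (Rmin_l _ _))).
  specialize (H4 w (Rlt_le_trans _ _ _ W34 (Rmin_r _ _))).
  replace (f w * g w - f z * g z - (w - z) * (l * g z + f z * m))%C with
    ((f w - f z - (w - z) * l) * g z + f z * (g w - g z - (w - z) * m)
     + (f w - f z) * (g w - g z))%C by ring.
  eapply Rle_trans; [apply Cmod_triangle|].
  eapply Rle_trans; [apply Rplus_le_compat_r, Cmod_triangle|].
  rewrite !Cmod_mult. fold A G.
  assert (P := Cmod_ge_0 (w - z)).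
  assert (I1 : Cmod (f w - f z - (w - z) * l) * G <= e / 3 * Cmod (w - z)).
  { apply Rle_trans with (e / (3 * (G + 1)) * Cmod (w - z) * (G + 1)).
    - apply Rmult_le_compat; auto using Cmod_ge_0; lra.
    - right; field; lra. }
  assert (I2 : A * Cmod (g w - g z - (w - z) * m) <= e / 3 * Cmod (w - z)).
  { rewrite Rmult_comm. apply Rle_trans with (e / (3 * (A + 1)) * Cmod (w - z) * (A + 1)).
    - apply Rmult_le_compat; auto using Cmod_ge_0; lra.
    - right; field; lra. }
  assert (I3 : Cmod (f w - f z) * Cmod (g w - g z) <= e / 3 * Cmod (w - z)).
  { apply Rle_trans with ((B + 1) * Cmod (w - z) * (e / (3 * (B + 1)))).
    - apply Rmult_le_compat; auto using Cmod_ge_0; lra.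
    - right; field; lra. }
  lra.
Qed.

Lemma cderiv_scal c f z l : cderiv f z l -> cderiv (fun w => c * f w)%C z (c * l).
Proof.
  intros H. eapply cderiv_eq; [| apply cderiv_mult; [apply cderiv_const | exact H]].
  simpl; ring.
Qed.

Lemma cderiv_opp f z l : cderiv f z l -> cderiv (fun w => - f w)%C z (- l).
Proof.
  intros H. apply (cderiv_ext (fun w => RtoC (-1) * f w)%C).
  { intros; apply Ceq_of; simpl; ring. }
  eapply cderiv_eq; [| apply cderiv_scal; exact H]. apply Ceq_of; simpl; ring.
Qed.

Lemma cderiv_minus f g z l m : cderiv f z l -> cderiv g z m ->
  cderiv (fun w => f w - g w)%C z (l - m).
Proof. intros; apply cderiv_plus; auto; now apply cderiv_opp. Qed.

Lemma cderiv_inv_id (z : C) : z <> 0 -> cderiv Cinv z (- / (z * z)).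
Proof.
  intros Hz e He. assert (P := Cmod_pos z Hz). set (m := Cmod z) in *.
  exists (Rmin (m / 2) (e * (m * m * m) / 2)); split.
  { apply Rmin_glb_lt; [lra|]. apply Rdiv_lt_0_compat; [|lra].
    repeat apply Rmult_lt_0_compat; lra. }
  intros w Hw.
  assert (W1 : Cmod (w - z) < m / 2) by (eapply Rlt_le_trans; [apply Hw| apply Rmin_l]).
  assert (W2 : Cmod (w - z) < e * (m * m * m) / 2) by (eapply Rlt_le_trans; [apply Hw| apply Rmin_r]).
  assert (Pw : m / 2 < Cmod w).
  { generalize (Cmod_sub_le z w). rewrite Cmod_sub_sym. fold m. lra. }
  assert (Nw : w <> 0). { intros ->. rewrite Cmod_0 in Pw. lra. }
  replace (/ w - / z - (w - z) * - / (z * z))%C with ((w - z) * (w - z) / (w * z * z))%C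
    by (field; auto).
  rewrite Cmod_div by (repeat apply Cmult_neq_0; auto).
  rewrite !Cmod_mult. fold m.
  unfold Rdiv. rewrite Rmult_assoc, (Rmult_comm e). apply Rmult_le_compat_l; [apply Cmod_ge_0|].
  assert (Q : 0 < Cmod w * m * m) by (repeat apply Rmult_lt_0_compat; lra).
  apply (Rmult_le_reg_r (Cmod w * m * m)); auto.
  rewrite Rmult_assoc, Rinv_l, Rmult_1_r by lra.
  apply Rle_trans with (e * (m * m * m) / 2); [lra|].
  assert (m / 2 * (m * m) <= Cmod w * (m * m)) by (apply Rmult_le_compat_r; nra). nra.
Qed.

Lemma cderiv_inv (f : C -> C) (z l : C) : f z <> 0 -> cderiv f z l ->
  cderiv (fun w => / f w)%C z (- l / (f z * f z)).
Proof.
  intros Hz Hf. eapply cderiv_eq; [| apply (cderiv_comp Cinv f); [exact Hf | now apply cderiv_inv_id]].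
  field; auto.
Qed.

Lemma cderiv_div (f g : C -> C) (z l m : C) : g z <> 0 -> cderiv f z l -> cderiv g z m ->
  cderiv (fun w => f w / g w)%C z ((l * g z - f z * m) / (g z * g z)).
Proof.
  intros Hz Hf Hg.
  eapply cderiv_eq; [| apply cderiv_mult; [exact Hf| apply cderiv_inv; [auto | exact Hg]]].
  cbv beta; field; auto.
Qed.

Lemma cderiv_unique f z l m : cderiv f z l -> cderiv f z m -> l = m.
Proof.
  intros Hl Hm. apply NNPP; intros N.
  assert (P : 0 < Cmod (l - m)) by (apply Cmod_pos, Cminus_eq_contra, N).
  destruct (Hl (Cmod (l - m) / 4)) as (d1 & D1 & H1); [lra|].
  destruct (Hm (Cmod (l - m) / 4)) as (d2 & D2 & H2); [lra|].
  set (h := Rmin d1 d2 / 2).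
  assert (Hh : 0 < h) by (unfold h; generalize (Rmin_glb_lt _ _ _ D1 D2); lra).
  set (w := (z + RtoC h)%C).
  assert (Ew : Cmod (w - z) = h).
  { unfold w. replace (z + h - z)%C with (RtoC h) by ring. rewrite Cmod_R. apply Rabs_right; lra. }
  assert (Lw : Cmod (w - z) < Rmin d1 d2) by (rewrite Ew; unfold h in *; lra).
  specialize (H1 w (Rlt_le_trans _ _ _ Lw (Rmin_l _ _))).
  specialize (H2 w (Rlt_le_trans _ _ _ Lw (Rmin_r _ _))).
  assert (E : Cmod ((w - z) * (l - m)) <= Cmod (l - m) / 2 * Cmod (w - z)).
  { replace ((w - z) * (l - m))%C with
      ((f w - f z - (w - z) * m) - (f w - f z - (w - z) * l))%C by ring.
    eapply Rle_trans; [apply Cmod_minus_le|]. lra. }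
  rewrite Cmod_mult, Ew in E. nra.
Qed.

Lemma rderiv_rcont f t l : rderiv f t l -> rcont f t.
Proof.
  intros (H1 & H2). apply rcont_of_re_im.
  - apply (ex_derive_continuous (fun u => Re (f u))). now exists (Re l).
  - apply (ex_derive_continuous (fun u => Im (f u))). now exists (Im l).
Qed.

Lemma rderiv_eps f t l : rderiv f t l -> forall e, 0 < e -> exists d, 0 < d /\
  forall u, Rabs (u - t) < d -> Cmod (f u - f t - RtoC (u - t) * l) <= e * Rabs (u - t).
Proof.
  intros (H1 & H2) e He.
  assert (He2 : 0 < e / 2) by lra.
  destruct H1 as (_ & H1). specialize (H1 t (fun P H => H) (mkposreal _ He2)).
  destruct H2 as (_ & H2). specialize (H2 t (fun P H => H) (mkposreal _ He2)).
  destruct H1 as (d1 & H1). destruct H2 as (d2 & H2).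
  exists (Rmin d1 d2); split; [apply Rmin_glb_lt; apply cond_pos|]. intros u Hu.
  specialize (H1 u (Rlt_le_trans _ _ _ Hu (Rmin_l _ _))).
  specialize (H2 u (Rlt_le_trans _ _ _ Hu (Rmin_r _ _))).
  eapply Rle_trans; [apply Cmod_le_Re_Im|].
  unfold norm, minus, plus, opp, scal in H1, H2; simpl in H1, H2.
  unfold abs, mult in H1, H2; simpl in H1, H2. simpl.
  unfold Re, Im in *.
  replace (fst (f u) + - fst (f t) + - ((u - t) * fst l - 0 * snd l)) with
    (fst (f u) + - fst (f t) + - ((u + - t) * fst l)) by ring.
  replace (snd (f u) + - snd (f t) + - ((u - t) * snd l + 0 * fst l)) with
    (snd (f u) + - snd (f t) + - ((u + - t) * snd l)) by ring.
  apply Rle_trans with (e / 2 * Rabs (u + - t) + e / 2 * Rabs (u + - t)).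
  - apply Rplus_le_compat; assumption.
  - unfold Rminus. right; field.
Qed.

Lemma rderiv_of_eps f t l : (forall e, 0 < e -> exists d, 0 < d /\
  forall u, Rabs (u - t) < d -> Cmod (f u - f t - RtoC (u - t) * l) <= e * Rabs (u - t)) ->
  rderiv f t l.
Proof.
  intros H. split.
  - split; [apply is_linear_scal_l|]. intros x Hx e.
    assert (x = t) by (symmetry; apply is_filter_lim_locally_unique, Hx). subst x.
    destruct (H e (cond_pos e)) as (d & D & Hd). exists (mkposreal d D). simpl; intros u Hu.
    specialize (Hd u Hu).
    eapply Rle_trans; [| apply Hd]. eapply Rle_trans; [| apply re_le_Cmod].
    unfold norm, minus, plus, opp, scal, abs, mult; simpl. unfold abs, mult; simpl.
    unfold Re, Im; right; f_equal; ring.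
  - split; [apply is_linear_scal_l|]. intros x Hx e.
    assert (x = t) by (symmetry; apply is_filter_lim_locally_unique, Hx). subst x.
    destruct (H e (cond_pos e)) as (d & D & Hd). exists (mkposreal d D). simpl; intros u Hu.
    specialize (Hd u Hu).
    eapply Rle_trans; [| apply Hd]. eapply Rle_trans; [| apply Im_le_Cmod].
    unfold norm, minus, plus, opp, scal, abs, mult; simpl. unfold abs, mult; simpl.
    unfold Re, Im; right; f_equal; ring.
Qed.

Lemma rderiv_comp f g t l m : rderiv g t m -> cderiv f (g t) l ->
  rderiv (fun u => f (g u)) t (l * m).
Proof.
  intros Hg Hf. apply rderiv_of_eps. intros e He.
  set (A := Cmod l); set (B := Cmod m).
  assert (HA : 0 <= A) by apply Cmod_ge_0. assert (HB : 0 <= B) by apply Cmod_ge_0.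
  destruct (Hf (e / (2 * (B + 1)))) as (d1 & D1 & H1). { apply Rdiv_lt_0_compat; lra. }
  destruct (rderiv_eps _ _ _ Hg (Rmin 1 (e / (2 * (A + 1))))) as (d2 & D2 & H2).
  { apply Rmin_glb_lt; [lra|]. apply Rdiv_lt_0_compat; lra. }
  destruct (rderiv_rcont _ _ _ Hg d1 D1) as (d4 & D4 & H4).
  exists (Rmin d2 d4); split; [repeat apply Rmin_glb_lt; auto|].
  intros w Hw.
  specialize (H2 w (Rlt_le_trans _ _ _ Hw (Rmin_l _ _))).
  specialize (H1 _ (H4 w (Rlt_le_trans _ _ _ Hw (Rmin_r _ _)))).
  assert (P := Rabs_pos (w - t)).
  assert (H3 : Cmod (g w - g t) <= (B + 1) * Rabs (w - t)).
  { generalize (Cmod_sub_le (g w - g t) (RtoC (w - t) * m)). rewrite Cmod_mult, Cmod_R. fold B.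
    generalize (Rmin_l 1 (e / (2 * (A + 1)))). nra. }
  replace (f (g w) - f (g t) - RtoC (w - t) * (l * m))%C
    with ((f (g w) - f (g t) - (g w - g t) * l) + (g w - g t - RtoC (w - t) * m) * l)%C by ring.
  eapply Rle_trans; [apply Cmod_triangle|]. rewrite Cmod_mult. fold A.
  assert (I1 : e / (2 * (B + 1)) * Cmod (g w - g t) <= e / 2 * Rabs (w - t)).
  { apply Rle_trans with (e / (2 * (B + 1)) * ((B + 1) * Rabs (w - t))).
    - apply Rmult_le_compat_l; auto. apply Rlt_le, Rdiv_lt_0_compat; lra.
    - right; field; lra. }
  assert (I2 : Cmod (g w - g t - RtoC (w - t) * m) * A <= e / 2 * Rabs (w - t)).
  { apply Rle_trans with (e / (2 * (A + 1)) * Rabs (w - t) * (A + 1)).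
    - apply Rmult_le_compat; auto using Cmod_ge_0; try lra.
      eapply Rle_trans; [apply H2|]. apply Rmult_le_compat_r; auto. apply Rmin_r.
    - right; field; lra. }
  lra.
Qed.

Lemma rderiv_eq f t l l' : l = l' -> rderiv f t l -> rderiv f t l'.
Proof. now intros ->. Qed.

Lemma rderiv_ext f g t l : (forall w, f w = g w) -> rderiv f t l -> rderiv g t l.
Proof.
  intros E (H1 & H2). split.
  - eapply is_derive_ext; [| exact H1]. intros; simpl; now rewrite E.
  - eapply is_derive_ext; [| exact H2]. intros; simpl; now rewrite E.
Qed.

Lemma rderiv_const c t : rderiv (fun _ => c) t 0.
Proof. split; apply (is_derive_const (V := R_NormedModule)). Qed.

Lemma rderiv_plus f g t l m : rderiv f t l -> rderiv g t m ->
  rderiv (fun w => f w + g w)%C t (l + m).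
Proof.
  intros (H1 & H2) (H3 & H4). split.
  - apply (is_derive_plus (fun u => Re (f u)) (fun u => Re (g u))); auto.
  - apply (is_derive_plus (fun u => Im (f u)) (fun u => Im (g u))); auto.
Qed.

Lemma rderiv_scal c f t l : rderiv f t l -> rderiv (fun w => c * f w)%C t (c * l).
Proof.
  intros H. apply (rderiv_comp (fun w => c * w)%C f t c l H).
  eapply cderiv_eq; [| apply cderiv_scal, cderiv_id]. ring.
Qed.

Lemma rderiv_mult f g t l m : rderiv f t l -> rderiv g t m ->
  rderiv (fun w => f w * g w)%C t (l * g t + f t * m).
Proof.
  intros (H1 & H2) (H3 & H4). split; simpl.
  - replace (fst l * fst (g t) - snd l * snd (g t) + (fst (f t) * fst m - snd (f t) * snd m)) with
      ((fst l * fst (g t) + fst (f t) * fst m) - (snd l * snd (g t) + snd (f t) * snd m)) by ring.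
    apply (is_derive_minus (fun u => Re (f u) * Re (g u)) (fun u => Im (f u) * Im (g u))).
    + apply (is_derive_mult (fun u => Re (f u)) (fun u => Re (g u))); auto. intros; apply Rmult_comm.
    + apply (is_derive_mult (fun u => Im (f u)) (fun u => Im (g u))); auto. intros; apply Rmult_comm.
  - replace (fst l * snd (g t) + snd l * fst (g t) + (fst (f t) * snd m + snd (f t) * fst m)) with
      ((fst l * snd (g t) + fst (f t) * snd m) + (snd l * fst (g t) + snd (f t) * fst m)) by ring.
    apply (is_derive_plus (fun u => Re (f u) * Im (g u)) (fun u => Im (f u) * Re (g u))).
    + apply (is_derive_mult (fun u => Re (f u)) (fun u => Im (g u))); auto. intros; apply Rmult_comm.
    + apply (is_derive_mult (fun u => Im (f u)) (fun u => Re (g u))); auto. intros; apply Rmult_comm.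
Qed.

Lemma rderiv_RtoC t : rderiv RtoC t 1.
Proof. split; [apply (is_derive_id (K := R_AbsRing)) | apply (is_derive_const (V := R_NormedModule) 0)]. Qed.

(* The real mean value theorem applied to the projection on the direction of
   the increment. *)
Lemma mean_value_inequality (f df : R -> C) (m : C) (M a b : R) : a <= b ->
  (forall t, a <= t <= b -> rderiv f t (df t)) ->
  (forall t, a <= t <= b -> Cmod (df t - m) <= M) ->
  Cmod (f b - f a - RtoC (b - a) * m) <= M * (b - a).
Proof.
  intros Hab Hf HM. set (D := (f b - f a - RtoC (b - a) * m)%C).
  set (psi := fun t => Re (Cconj D * (f t - RtoC t * m))).
  assert (Dpsi : forall t, a <= t <= b -> is_derive psi t (Re (Cconj D * (df t - m)))).
  { intros t Ht. refine (proj1 (_ : rderiv (fun u => Cconj D * (f u - RtoC u * m))%C t _)).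
    apply rderiv_scal. apply rderiv_plus; [auto|].
    apply (rderiv_ext (fun w => - m * RtoC w)%C); [intros; ring|].
    apply (rderiv_eq _ _ (- m * 1)); [ring|]. apply rderiv_scal, rderiv_RtoC. }
  destruct (MVT_gen psi a b (fun t => Re (Cconj D * (df t - m)))) as (c & Hc & E).
  { rewrite Rmin_left, Rmax_right by auto. intros; apply Dpsi; lra. }
  { rewrite Rmin_left, Rmax_right by auto. intros t Ht.
    apply continuity_pt_filterlim, (ex_derive_continuous psi). eexists; apply Dpsi; lra. }
  rewrite Rmin_left, Rmax_right in Hc by auto.
  assert (F : psi b - psi a = Cmod D * Cmod D).
  { rewrite Cmod_sqr. unfold psi, D. simpl. ring. }
  rewrite F in E.
  assert (G : Re (Cconj D * (df c - m)) <= Cmod D * M).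
  { eapply Rle_trans; [apply Rle_abs|]. eapply Rle_trans; [apply re_le_Cmod|].
    rewrite Cmod_mult, Cmod_conj. apply Rmult_le_compat_l; auto using Cmod_ge_0. }
  destruct (Rle_lt_or_eq_dec _ _ (Cmod_ge_0 D)) as [P | P].
  - apply (Rmult_le_reg_l (Cmod D)); auto. rewrite E.
    replace (Cmod D * (M * (b - a))) with (Cmod D * M * (b - a)) by ring.
    apply Rmult_le_compat_r; lra.
  - rewrite <- P. apply Rmult_le_pos; [| lra].
    eapply Rle_trans; [apply Cmod_ge_0 | apply (HM c Hc)].
Qed.

Lemma rderiv_line (z h : C) t : rderiv (fun u => z + RtoC u * h)%C t h.
Proof.
  apply (rderiv_eq _ _ (0 + h * 1)); [ring|]. apply rderiv_plus; [apply rderiv_const|].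
  apply (rderiv_ext (fun u => h * RtoC u)%C); [intros; ring|].
  apply rderiv_scal, rderiv_RtoC.
Qed.

(** With [m = h * g z] in the mean value inequality, the error is |h| times the oscillation of g on
    the segment from z to z + h, which continuity of g at z makes small. Both [cexp] and the
    primitives of star-shaped domains are differentiated in this way. *)
Lemma cderiv_of_segments f g z d : 0 < d -> ccont g z ->
  (forall h u, Cmod h < d -> 0 <= u <= 1 ->
     rderiv (fun v => f (z + RtoC v * h)%C) u (h * g (z + RtoC u * h)%C)) ->
  cderiv f z (g z).
Proof.
  intros Hd Hg H e He. destruct (Hg e He) as (d1 & D1 & H1).
  exists (Rmin d d1); split; [apply Rmin_glb_lt; auto|]. intros w Hw.
  set (h := (w - z)%C) in *.
  assert (Hh1 := Rlt_le_trans _ _ _ Hw (Rmin_l _ _)).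
  assert (Hh2 := Rlt_le_trans _ _ _ Hw (Rmin_r _ _)).
  assert (E := mean_value_inequality (fun v => f (z + RtoC v * h)%C)
    (fun u => h * g (z + RtoC u * h))%C (h * g z)%C (e * Cmod h) 0 1 Rle_0_1
    (fun t Ht => H h t Hh1 Ht)). cbv beta in E.
  replace (z + 1 * h)%C with w in E by (unfold h; ring).
  replace (z + 0 * h)%C with z in E by ring.
  replace (1 - 0) with 1 in E by ring.
  replace (f w - f z - h * g z)%C with (f w - f z - 1 * (h * g z))%C by ring.
  rewrite Rmult_1_r in E. apply E. intros t Ht.
  replace (h * g (z + t * h) - h * g z)%C with (h * (g (z + t * h) - g z))%C by ring.
  rewrite Cmod_mult, Rmult_comm. apply Rmult_le_compat_r; [apply Cmod_ge_0|].
  apply Rlt_le, H1. replace (z + t * h - z)%C with (RtoC t * h)%C by ring.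
  rewrite Cmod_mult, Cmod_R, Rabs_right by lra.
  generalize (Cmod_ge_0 h); nra.
Qed.

(** * The complex exponential *)

Lemma cexp_add z w : cexp (z + w) = (cexp z * cexp w)%C.
Proof.
  apply Ceq_of; unfold cexp; simpl.
  - rewrite exp_plus, cos_plus; unfold Re, Im; ring.
  - rewrite exp_plus, sin_plus; unfold Re, Im; ring.
Qed.

Lemma cexp_0 : cexp 0 = 1.
Proof. unfold cexp; simpl. rewrite exp_0, cos_0, sin_0. apply Ceq_of; simpl; ring. Qed.

Lemma Cmod_cexp z : Cmod (cexp z) = exp (Re z).
Proof.
  unfold cexp, Cmod; simpl.
  replace (exp (Re z) * cos (Im z) * (exp (Re z) * cos (Im z) * 1) +
    exp (Re z) * sin (Im z) * (exp (Re z) * sin (Im z) * 1)) with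
    ((exp (Re z))² * ((sin (Im z))² + (cos (Im z))²)) by (unfold Rsqr; ring).
  rewrite sin2_cos2, Rmult_1_r. apply sqrt_Rsqr, Rlt_le, exp_pos.
Qed.

Lemma cexp_neq_0 z : cexp z <> 0.
Proof.
  intros E. assert (H := Cmod_cexp z). rewrite E, Cmod_0 in H.
  generalize (exp_pos (Re z)); lra.
Qed.

Lemma cexp_opp z : cexp (- z) = (/ cexp z)%C.
Proof.
  assert (N := cexp_neq_0 z).
  replace (/ cexp z)%C with (cexp (- z) * cexp z / cexp z)%C.
  - field; auto.
  - rewrite <- cexp_add. replace (- z + z)%C with (RtoC 0) by ring.
    rewrite cexp_0. field; auto.
Qed.

Lemma cexp_minus z w : cexp (z - w) = (cexp z / cexp w)%C.
Proof. unfold Cminus. now rewrite cexp_add, cexp_opp. Qed.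

Lemma cexp_conj z : cexp (Cconj z) = Cconj (cexp z).
Proof. unfold cexp, Cconj; simpl. rewrite cos_neg, sin_neg. apply Ceq_of; simpl; unfold Re, Im; ring. Qed.

Lemma cexp_RtoC x : cexp (RtoC x) = RtoC (exp x).
Proof. unfold cexp; simpl. rewrite cos_0, sin_0. apply Ceq_of; simpl; ring. Qed.

Lemma ccont_of_components (f : C -> C) z :
  (forall x y : R, continuity_2d_pt (fun x y => Re (f (x, y))) x y) ->
  (forall x y : R, continuity_2d_pt (fun x y => Im (f (x, y))) x y) -> ccont f z.
Proof.
  intros H1 H2 e He. assert (He2 : 0 < e / 2) by lra.
  destruct (H1 (Re z) (Im z) (mkposreal _ He2)) as (d1 & D1).
  destruct (H2 (Re z) (Im z) (mkposreal _ He2)) as (d2 & D2).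
  exists (Rmin d1 d2); split; [apply Rmin_glb_lt; apply cond_pos|].
  intros w Hw.
  assert (W1 : Rabs (Re w - Re z) < Rmin d1 d2).
  { eapply Rle_lt_trans; [apply (re_le_Cmod (w - z)) | exact Hw]. }
  assert (W2 : Rabs (Im w - Im z) < Rmin d1 d2).
  { eapply Rle_lt_trans; [apply (Im_le_Cmod (w - z)) | exact Hw]. }
  specialize (D1 (Re w) (Im w) (Rlt_le_trans _ _ _ W1 (Rmin_l _ _)) (Rlt_le_trans _ _ _ W2 (Rmin_l _ _))).
  specialize (D2 (Re w) (Im w) (Rlt_le_trans _ _ _ W1 (Rmin_r _ _)) (Rlt_le_trans _ _ _ W2 (Rmin_r _ _))).
  replace (Re w, Im w) with w in D1, D2 by (destruct w; auto).
  replace (Re z, Im z) with z in D1, D2 by (destruct z; auto).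
  eapply Rle_lt_trans; [apply Cmod_le_Re_Im|]. rewrite Re_minus, Im_minus. simpl in *. lra.
Qed.

Lemma ccont_cexp z : ccont cexp z.
Proof.
  apply ccont_of_components; intros x y; unfold cexp; simpl.
  - apply (continuity_2d_pt_mult (fun x _ => exp x) (fun _ y => cos y)).
    + apply (continuity_1d_2d_pt_comp exp (fun x _ => x)).
      * apply derivable_continuous_pt, derivable_pt_exp.
      * apply continuity_2d_pt_id1.
    + apply (continuity_1d_2d_pt_comp cos (fun _ y => y)).
      * apply continuity_cos.
      * apply continuity_2d_pt_id2.
  - apply (continuity_2d_pt_mult (fun x _ => exp x) (fun _ y => sin y)).
    + apply (continuity_1d_2d_pt_comp exp (fun x _ => x)).
      * apply derivable_continuous_pt, derivable_pt_exp.
      * apply continuity_2d_pt_id1.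
    + apply (continuity_1d_2d_pt_comp sin (fun _ y => y)).
      * apply continuity_sin.
      * apply continuity_2d_pt_id2.
Qed.

Lemma cderiv_cexp z : cderiv cexp z (cexp z).
Proof.
  apply (cderiv_of_segments cexp cexp z 1 Rlt_0_1); [apply ccont_cexp|].
  intros h u _ _. split.
  - apply (is_derive_ext (fun v => exp (Re z + v * Re h) * cos (Im z + v * Im h))).
    + intros t. unfold cexp; simpl. f_equal; f_equal; unfold Re, Im; ring.
    + auto_derive; auto. unfold cexp; simpl.
      unfold Re, Im.
      replace (fst z + (u * fst h - 0 * snd h)) with (fst z + u * fst h) by ring.
      replace (snd z + (u * snd h + 0 * fst h)) with (snd z + u * snd h) by ring.
      ring.
  - apply (is_derive_ext (fun v => exp (Re z + v * Re h) * sin (Im z + v * Im h))).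
    + intros t. unfold cexp; simpl. f_equal; f_equal; unfold Re, Im; ring.
    + auto_derive; auto. unfold cexp; simpl.
      unfold Re, Im.
      replace (fst z + (u * fst h - 0 * snd h)) with (fst z + u * fst h) by ring.
      replace (snd z + (u * snd h + 0 * fst h)) with (snd z + u * snd h) by ring.
      ring.
Qed.

Lemma rcont_cexp f t : rcont f t -> rcont (fun u => cexp (f u)) t.
Proof. intros; apply rcont_comp; auto using ccont_cexp. Qed.

Lemma cderiv_cexp_comp f z l : cderiv f z l -> cderiv (fun w => cexp (f w)) z (cexp (f z) * l).
Proof. intros H. apply (cderiv_comp cexp f); auto using cderiv_cexp. Qed.

(** * Integration and Cauchy's theorem *)

Definition CInt (f : R -> C) (a b : R) : C :=
  (RInt (fun t => Re (f t)) a b, RInt (fun t => Im (f t)) a b).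

Definition cintegrable (f : R -> C) (a b : R) : Prop :=
  ex_RInt (fun t => Re (f t)) a b /\ ex_RInt (fun t => Im (f t)) a b.

Lemma cintegrable_cont f a b : a <= b ->
  (forall t, a <= t <= b -> rcont f t) -> cintegrable f a b.
Proof.
  intros Hab H. split; apply (ex_RInt_continuous (V := R_CompleteNormedModule));
    rewrite Rmin_left, Rmax_right by auto; intros; [apply rcont_re | apply rcont_im]; auto.
Qed.

Lemma CInt_ext f g a b : a <= b -> (forall t, a <= t <= b -> f t = g t) ->
  CInt f a b = CInt g a b.
Proof.
  intros Hab H. unfold CInt. f_equal; apply RInt_ext; rewrite Rmin_left, Rmax_right by auto;
    intros; rewrite H; auto; lra.
Qed.

Lemma CInt_plus f g a b : cintegrable f a b -> cintegrable g a b ->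
  CInt (fun t => f t + g t)%C a b = (CInt f a b + CInt g a b)%C.
Proof.
  intros (F1 & F2) (G1 & G2). apply Ceq_of; simpl.
  - apply (RInt_plus (V := R_CompleteNormedModule) (fun t => Re (f t)) (fun t => Re (g t))); auto.
  - apply (RInt_plus (V := R_CompleteNormedModule) (fun t => Im (f t)) (fun t => Im (g t))); auto.
Qed.

Lemma cintegrable_plus f g a b : cintegrable f a b -> cintegrable g a b ->
  cintegrable (fun t => f t + g t)%C a b.
Proof.
  intros (F1 & F2) (G1 & G2). split; simpl.
  - apply (ex_RInt_plus (fun t => Re (f t)) (fun t => Re (g t))); auto.
  - apply (ex_RInt_plus (fun t => Im (f t)) (fun t => Im (g t))); auto.
Qed.

Lemma cintegrable_scal c f a b : cintegrable f a b -> cintegrable (fun t => c * f t)%C a b.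
Proof.
  intros (F1 & F2). split; simpl.
  - apply (ex_RInt_minus (fun t => Re c * Re (f t)) (fun t => Im c * Im (f t))).
    + apply (ex_RInt_scal (fun t => Re (f t))); auto.
    + apply (ex_RInt_scal (fun t => Im (f t))); auto.
  - apply (ex_RInt_plus (fun t => Re c * Im (f t)) (fun t => Im c * Re (f t))).
    + apply (ex_RInt_scal (fun t => Im (f t))); auto.
    + apply (ex_RInt_scal (fun t => Re (f t))); auto.
Qed.

Lemma CInt_scal c f a b : cintegrable f a b ->
  CInt (fun t => c * f t)%C a b = (c * CInt f a b)%C.
Proof.
  intros (F1 & F2). apply Ceq_of; simpl.
  - rewrite (RInt_minus (V := R_CompleteNormedModule) (fun t => Re c * Re (f t)) (fun t => Im c * Im (f t))).
    + rewrite (RInt_scal (V := R_CompleteNormedModule) (fun t => Re (f t))) by auto.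
      rewrite (RInt_scal (V := R_CompleteNormedModule) (fun t => Im (f t))) by auto.
      reflexivity.
    + apply (ex_RInt_scal (fun t => Re (f t))); auto.
    + apply (ex_RInt_scal (fun t => Im (f t))); auto.
  - rewrite (RInt_plus (V := R_CompleteNormedModule) (fun t => Re c * Im (f t)) (fun t => Im c * Re (f t))).
    + rewrite (RInt_scal (V := R_CompleteNormedModule) (fun t => Re (f t))) by auto.
      rewrite (RInt_scal (V := R_CompleteNormedModule) (fun t => Im (f t))) by auto.
      reflexivity.
    + apply (ex_RInt_scal (fun t => Im (f t))); auto.
    + apply (ex_RInt_scal (fun t => Re (f t))); auto.
Qed.

Lemma cintegrable_minus f g a b : cintegrable f a b -> cintegrable g a b ->
  cintegrable (fun t => f t - g t)%C a b.
Proof.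
  intros (F1 & F2) (G1 & G2). split; simpl.
  - apply (ex_RInt_minus (fun t => Re (f t)) (fun t => Re (g t))); auto.
  - apply (ex_RInt_minus (fun t => Im (f t)) (fun t => Im (g t))); auto.
Qed.

Lemma CInt_minus f g a b : cintegrable f a b -> cintegrable g a b ->
  CInt (fun t => f t - g t)%C a b = (CInt f a b - CInt g a b)%C.
Proof.
  intros (F1 & F2) (G1 & G2). apply Ceq_of; simpl.
  - apply (RInt_minus (V := R_CompleteNormedModule) (fun t => Re (f t)) (fun t => Re (g t))); auto.
  - apply (RInt_minus (V := R_CompleteNormedModule) (fun t => Im (f t)) (fun t => Im (g t))); auto.
Qed.

Lemma CInt_conj f a b : cintegrable f a b ->
  CInt (fun t => Cconj (f t)) a b = Cconj (CInt f a b).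
Proof.
  intros (F1 & F2). apply Ceq_of; simpl; auto.
  apply (RInt_opp (V := R_CompleteNormedModule) (fun t => Im (f t))); auto.
Qed.

(* Rotate the integral onto the positive real axis. *)
Lemma CInt_bound f (g : R -> R) a b : a <= b -> cintegrable f a b -> ex_RInt g a b ->
  (forall t, a <= t <= b -> Cmod (f t) <= g t) -> Cmod (CInt f a b) <= RInt g a b.
Proof.
  intros Hab Hf Hg H. set (I := CInt f a b).
  destruct (Rle_lt_or_eq_dec _ _ (Cmod_ge_0 I)) as [P | P].
  - apply (Rmult_le_reg_l (Cmod I)); auto. rewrite Cmod_sqr.
    assert (E : CInt (fun t => Cconj I * f t)%C a b = (Cconj I * I)%C) by (apply CInt_scal; auto).
    replace (Re I * Re I + Im I * Im I) with (Re (Cconj I * I)) by (simpl; unfold Re, Im; ring).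
    rewrite <- E. change (Re (CInt (fun t => (Cconj I * f t)%C) a b))
      with (RInt (fun t => Re (Cconj I * f t)) a b).
    rewrite <- (RInt_scal (V := R_CompleteNormedModule) g) by auto.
    apply RInt_le; auto.
    + apply (cintegrable_scal (Cconj I) f a b Hf).
    + apply (ex_RInt_scal g); auto.
    + intros x Hx. change (Re (Cconj I * f x) <= Cmod I * g x).
      eapply Rle_trans; [apply Rle_abs|]. eapply Rle_trans; [apply re_le_Cmod|].
      rewrite Cmod_mult, Cmod_conj. apply Rmult_le_compat_l; [apply Cmod_ge_0|]. apply H; lra.
  - rewrite <- P. apply RInt_ge_0; auto. intros x Hx.
    eapply Rle_trans; [apply Cmod_ge_0 | apply H; lra].
Qed.

Lemma CInt_bound_const f M a b : a <= b -> cintegrable f a b ->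
  (forall t, a <= t <= b -> Cmod (f t) <= M) -> Cmod (CInt f a b) <= M * (b - a).
Proof.
  intros Hab Hf H. replace (M * (b - a)) with (RInt (fun _ => M) a b).
  - apply CInt_bound; auto. apply ex_RInt_const.
  - rewrite RInt_const. unfold scal; simpl; unfold mult; simpl; ring.
Qed.

Lemma CInt_deriv F f a b : a <= b ->
  (forall t, a <= t <= b -> rderiv F t (f t)) -> (forall t, a <= t <= b -> rcont f t) ->
  CInt f a b = (F b - F a)%C.
Proof.
  intros Hab HF Hf. apply Ceq_of; simpl.
  - apply is_RInt_unique, (is_RInt_derive (V := R_CompleteNormedModule) (fun t => Re (F t)));
      rewrite Rmin_left, Rmax_right by auto; intros; [apply (HF x) | apply rcont_re]; auto.
  - apply is_RInt_unique, (is_RInt_derive (V := R_CompleteNormedModule) (fun t => Im (F t)));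
      rewrite Rmin_left, Rmax_right by auto; intros; [apply (HF x) | apply rcont_im]; auto.
Qed.

Lemma CInt_const c a b : CInt (fun _ => c) a b = (RtoC (b - a) * c)%C.
Proof.
  apply Ceq_of; simpl; rewrite RInt_const; unfold scal; simpl; unfold mult; simpl;
    unfold Re, Im; ring.
Qed.

Definition ccont2 (F : R -> R -> C) (u t : R) : Prop :=
  forall e, 0 < e -> exists d, 0 < d /\
  forall v s, Rabs (v - u) < d -> Rabs (s - t) < d -> Cmod (F v s - F u t) < e.

Lemma ccont2_comp f (F : R -> R -> C) u t : ccont2 F u t -> ccont f (F u t) ->
  ccont2 (fun v s => f (F v s)) u t.
Proof.
  intros HF Hf e He. destruct (Hf e He) as (d1 & D1 & H1).
  destruct (HF d1 D1) as (d & D & H). exists d; split; auto.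
Qed.

Lemma ccont2_pair (f g : R -> R -> R) u t : continuity_2d_pt f u t -> continuity_2d_pt g u t ->
  ccont2 (fun v s => (f v s, g v s)) u t.
Proof.
  intros Hf Hg e He. assert (He2 : 0 < e / 2) by lra.
  destruct (Hf (mkposreal _ He2)) as (d1 & D1). destruct (Hg (mkposreal _ He2)) as (d2 & D2).
  exists (Rmin d1 d2); split; [apply Rmin_glb_lt; apply cond_pos|]. intros v s Hv Hs.
  specialize (D1 v s (Rlt_le_trans _ _ _ Hv (Rmin_l _ _)) (Rlt_le_trans _ _ _ Hs (Rmin_l _ _))).
  specialize (D2 v s (Rlt_le_trans _ _ _ Hv (Rmin_r _ _)) (Rlt_le_trans _ _ _ Hs (Rmin_r _ _))).
  eapply Rle_lt_trans; [apply Cmod_le_Re_Im|]. simpl in *. unfold Rminus in *. lra.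
Qed.

Lemma ccont2_re F u t : ccont2 F u t -> continuity_2d_pt (fun v s => Re (F v s)) u t.
Proof.
  intros H e. destruct (H e (cond_pos e)) as (d & D & Hd). exists (mkposreal d D). simpl.
  intros v s Hv Hs. eapply Rle_lt_trans; [apply (re_le_Cmod (F v s - F u t))|]. auto.
Qed.

Lemma ccont2_im F u t : ccont2 F u t -> continuity_2d_pt (fun v s => Im (F v s)) u t.
Proof.
  intros H e. destruct (H e (cond_pos e)) as (d & D & Hd). exists (mkposreal d D). simpl.
  intros v s Hv Hs. eapply Rle_lt_trans; [apply (Im_le_Cmod (F v s - F u t))|]. auto.
Qed.

Lemma ccont2_plus F G u t : ccont2 F u t -> ccont2 G u t ->
  ccont2 (fun v s => F v s + G v s)%C u t.
Proof.
  intros HF HG.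
  apply (ccont2_pair (fun v s => Re (F v s) + Re (G v s)) (fun v s => Im (F v s) + Im (G v s)));
    apply continuity_2d_pt_plus; auto using ccont2_re, ccont2_im.
Qed.

Lemma ccont2_mult F G u t : ccont2 F u t -> ccont2 G u t ->
  ccont2 (fun v s => F v s * G v s)%C u t.
Proof.
  intros HF HG.
  apply (ccont2_pair (fun v s => Re (F v s) * Re (G v s) - Im (F v s) * Im (G v s))
    (fun v s => Re (F v s) * Im (G v s) + Im (F v s) * Re (G v s))).
  - apply continuity_2d_pt_minus; apply continuity_2d_pt_mult; auto using ccont2_re, ccont2_im.
  - apply continuity_2d_pt_plus; apply continuity_2d_pt_mult; auto using ccont2_re, ccont2_im.
Qed.

Lemma ccont2_snd f u t : rcont f t -> ccont2 (fun _ s => f s) u t.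
Proof. intros H e He. destruct (H e He) as (d & D & Hd). exists d; auto. Qed.

Lemma ccont2_fst f u t : rcont f u -> ccont2 (fun v _ => f v) u t.
Proof. intros H e He. destruct (H e He) as (d & D & Hd). exists d; auto. Qed.

(** The margin r around [a, b] is there because continuity of the parametric derivative at an end
    point concerns a full two-dimensional neighbourhood, on which [df] has to be the derivative. *)
Lemma is_derive_RInt_cont (f df : R -> R -> R) (a b u r : R) : a <= b -> 0 < r ->
  (forall v t, Rabs (v - u) < r -> a - r < t < b + r -> is_derive (fun w => f w t) v (df v t)) ->
  (forall t, a <= t <= b -> continuity_2d_pt df u t) ->
  (forall v, Rabs (v - u) < r -> ex_RInt (f v) a b) ->
  is_derive (fun v => RInt (f v) a b) u (RInt (df u) a b).
Proof.
  intros Hab Hr Hd Hc Hi.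
  replace (RInt (df u) a b) with (RInt (fun t => Derive (fun w => f w t) u) a b).
  - apply (is_derive_RInt_param f a b u).
    + exists (mkposreal r Hr). rewrite Rmin_left, Rmax_right by auto. intros v Hv t Ht.
      exists (df v t). apply Hd; [exact Hv | lra].
    + rewrite Rmin_left, Rmax_right by auto. intros t Ht.
      apply (continuity_2d_pt_ext_loc df); auto.
      exists (mkposreal r Hr). simpl. intros v s Hv Hs. symmetry.
      apply is_derive_unique, Hd; auto. apply Rabs_def2 in Hs. lra.
    + exists (mkposreal r Hr). intros v Hv. apply Hi, Hv.
  - apply RInt_ext. rewrite Rmin_left, Rmax_right by auto. intros t Ht.
    apply is_derive_unique, Hd; [| lra]. rewrite Rminus_diag, Rabs_R0; auto.
Qed.

Lemma rderiv_CInt (F dF : R -> R -> C) (a b u r : R) : a <= b -> 0 < r ->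
  (forall v t, Rabs (v - u) < r -> a - r < t < b + r -> rderiv (fun w => F w t) v (dF v t)) ->
  (forall t, a <= t <= b -> ccont2 dF u t) ->
  (forall v t, Rabs (v - u) < r -> a <= t <= b -> rcont (F v) t) ->
  rderiv (fun v => CInt (F v) a b) u (CInt (dF u) a b).
Proof.
  intros Hab Hr Hd Hc Hi. split; simpl.
  - apply (is_derive_RInt_cont (fun v t => Re (F v t)) (fun v t => Re (dF v t)) a b u r); auto.
    + intros; now apply Hd.
    + intros; apply ccont2_re; auto.
    + intros v Hv. exact (proj1 (cintegrable_cont (F v) a b Hab (fun t => Hi v t Hv))).
  - apply (is_derive_RInt_cont (fun v t => Im (F v t)) (fun v t => Im (dF v t)) a b u r); auto.
    + intros; now apply Hd.
    + intros; apply ccont2_im; auto.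
    + intros v Hv. exact (proj2 (cintegrable_cont (F v) a b Hab (fun t => Hi v t Hv))).
Qed.

(** Continuity of the derivative is built in because the proof of Cauchy's theorem differentiates
    under the integral sign. The derivative is an explicit argument, so that formulas for it can be
    carried along. *)
Definition holo (U : C -> Prop) (f df : C -> C) : Prop :=
  forall z, U z -> cderiv f z (df z) /\ ccont df z.

(* The derivative in u of the integral of G(u p)p'/p is the integral of
   G'(u p)p', which has the primitive G(u p)/u. *)
Lemma path_dilation (U : C -> Prop) (G dG : C -> C) (p dp : R -> C) (a b r : R) :
  a <= b -> 0 < r -> holo U G dG ->
  (forall u t, - r < u < 1 + r -> a - r < t < b + r -> U (RtoC u * p t)%C) ->
  (forall t, a - r < t < b + r -> rderiv p t (dp t) /\ rcont dp t /\ p t <> 0) ->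
  forall u, 0 <= u <= 1 -> exists d,
    rderiv (fun v => CInt (fun t => G (RtoC v * p t)%C * dp t / p t)%C a b) u d /\
    (RtoC u * d = G (RtoC u * p b)%C - G (RtoC u * p a)%C)%C.
Proof.
  intros Hab Hr HG HU Hp u Hu.
  exists (CInt (fun t => dG (RtoC u * p t)%C * dp t)%C a b). split.
  - apply (rderiv_CInt _ (fun v t => dG (RtoC v * p t) * dp t)%C a b u r); auto.
    + intros v t Hv Ht. apply Rabs_def2 in Hv. destruct (Hp t Ht) as (P1 & P2 & P3).
      apply (rderiv_ext (fun w => (dp t / p t) * G (RtoC w * p t))%C).
      { intros; field; auto. }
      eapply rderiv_eq; [| apply rderiv_scal, (rderiv_comp G (fun w => RtoC w * p t)%C)].
      2: { eapply rderiv_ext; [| apply (rderiv_line 0 (p t))]. intros; cbv beta; ring. }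
      2: { apply HG, HU; auto; lra. }
      field; auto.
    + intros t Ht. apply ccont2_mult.
      * apply (ccont2_comp dG (fun v s => RtoC v * p s)%C).
        -- apply ccont2_mult.
           ++ apply (ccont2_fst (fun v => RtoC v)), rcont_RtoC, continuous_id.
           ++ apply ccont2_snd. eapply rderiv_rcont; apply Hp; lra.
        -- apply HG, HU; lra.
      * apply ccont2_snd. apply Hp; lra.
    + intros v t Hv Ht. apply Rabs_def2 in Hv. assert (Ht' : a - r < t < b + r) by lra.
      destruct (Hp t Ht') as (P1 & P2 & P3).
      apply rcont_div; auto; [| eapply rderiv_rcont; eauto].
      apply rcont_mult; auto.
      apply (rcont_comp G (fun t => RtoC v * p t)%C).
      * apply rcont_mult; [apply rcont_const| eapply rderiv_rcont; eauto].
      * eapply cderiv_ccont. apply HG, HU; lra.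
  - assert (Hc : forall t, a <= t <= b -> rcont (fun t => dG (RtoC u * p t) * dp t)%C t).
    { intros t Ht. assert (Ht' : a - r < t < b + r) by lra. destruct (Hp t Ht') as (P1 & P2 & P3).
      apply rcont_mult; auto. apply (rcont_comp dG (fun t => RtoC u * p t)%C).
      - apply rcont_mult; [apply rcont_const| eapply rderiv_rcont; eauto].
      - apply HG, HU; lra. }
    rewrite <- CInt_scal by (apply cintegrable_cont; auto).
    apply (CInt_deriv (fun t => G (RtoC u * p t)%C)); auto.
    + intros t Ht. assert (Ht' : a - r < t < b + r) by lra. destruct (Hp t Ht') as (P1 & P2 & P3).
      eapply rderiv_eq; [| apply (rderiv_comp G (fun t => RtoC u * p t)%C)].
      2: { apply rderiv_scal, P1. }
      2: { apply HG, HU; lra. }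
      ring.
    + intros t Ht. apply rcont_mult; [apply rcont_const | auto].
Qed.

(** The derivative is asked to vanish only inside the interval: the dilation argument yields u times
    the derivative, which says nothing at u = 0. *)
Lemma rconst_of_rderiv_0 (f df : R -> C) :
  (forall u, 0 <= u <= 1 -> rderiv f u (df u)) -> (forall u, 0 < u < 1 -> df u = 0) ->
  f 1 = f 0.
Proof.
  intros H Z.
  assert (Q : forall (g dg : R -> R), (forall u, 0 <= u <= 1 -> is_derive g u (dg u)) ->
    (forall u, 0 < u < 1 -> dg u = 0) -> g 1 = g 0).
  { intros g dg Hg Zg. destruct (MVT_cor2 g dg 0 1 Rlt_0_1) as (c & E & Hc).
    - intros c Hc. apply is_derive_Reals, Hg, Hc.
    - rewrite Zg in E by auto. lra. }
  apply Ceq_of.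
  - apply (Q (fun u => Re (f u)) (fun u => Re (df u))); [intros; apply H; auto|].
    intros; rewrite Z; auto.
  - apply (Q (fun u => Im (f u)) (fun u => Im (df u))); [intros; apply H; auto|].
    intros; rewrite Z; auto.
Qed.

(** * Cauchy's theorem on a rectangle around the origin *)

Lemma Cmod_vert c v : 0 <= c -> c <= Cmod (c, v).
Proof. intros H. eapply Rle_trans; [| apply (re_le_Cmod (c, v))]. simpl. apply Rle_abs. Qed.

Lemma pair_re_neq_0 (c v : R) : c <> 0 -> (c, v) <> RtoC 0.
Proof. intros H E. apply H. apply (f_equal Re) in E. exact E. Qed.

Lemma pair_im_neq_0 (c v : R) : v <> 0 -> (c, v) <> RtoC 0.
Proof. intros H E. apply H. apply (f_equal Im) in E. exact E. Qed.

Lemma rderiv_vert c t : rderiv (fun v => (c, v)) t Ci.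
Proof. split; [apply (is_derive_const (V := R_NormedModule) c) | apply (is_derive_id (K := R_AbsRing))]. Qed.

Lemma rderiv_horiz c t : rderiv (fun v => (v, c)) t 1.
Proof. split; [apply (is_derive_id (K := R_AbsRing)) | apply (is_derive_const (V := R_NormedModule) c)]. Qed.

Lemma rcont_vert c t : rcont (fun v => (c, v)) t.
Proof. eapply rderiv_rcont, rderiv_vert. Qed.
Lemma rcont_horiz c t : rcont (fun v => (v, c)) t.
Proof. eapply rderiv_rcont, rderiv_horiz. Qed.

Lemma atan_add_inv u : 0 < u -> atan u + atan (/ u) = PI / 2.
Proof. intros H. rewrite atan_inv by auto. lra. Qed.

(** The primitive is log w written in real coordinates: half the logarithm of |w|^2, and an
    arctangent for the angle. Dividing by the constant coordinate c keeps the angle continuous along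
    the whole side, also when c is negative. *)
Lemma winding_vert c H : c <> 0 -> 0 < H ->
  CInt (fun v => 1 * Ci / (c, v))%C (- H) H = (Ci * RtoC (2 * atan (H / c)))%C.
Proof.
  intros Hc HH.
  rewrite (CInt_deriv (fun v => (/ 2 * ln (c * c + v * v), atan (v / c)))); [| lra | |].
  - replace (- H / c) with (- (H / c)) by (field; auto). rewrite atan_opp.
    replace (c * c + - H * - H) with (c * c + H * H) by ring.
    apply Ceq_of; simpl; ring.
  - intros t Ht. assert (P : 0 < c * c + t * t) by (nra).
    split; simpl.
    + auto_derive; auto. field; repeat split; auto; nra.
    + auto_derive; auto. unfold Rsqr. field; repeat split; auto; nra.
  - intros t Ht. apply rcont_div; [now apply pair_re_neq_0 | apply rcont_const | apply rcont_vert].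
Qed.

Lemma winding_horiz a b H : a <= b -> H <> 0 ->
  CInt (fun u => 1 * 1 / (u, H))%C a b =
  (/ 2 * (ln (b * b + H * H) - ln (a * a + H * H)), - (atan (b / H) - atan (a / H))).
Proof.
  intros Hab HH.
  rewrite (CInt_deriv (fun v => (/ 2 * ln (v * v + H * H), - atan (v / H)))); [| lra | |].
  - apply Ceq_of; simpl; ring.
  - intros t Ht. assert (P : 0 < t * t + H * H) by (nra).
    split; simpl.
    + auto_derive; auto. field; repeat split; auto; nra.
    + auto_derive; auto. unfold Rsqr. field; repeat split; auto; nra.
  - intros t Ht. apply rcont_div; [now apply pair_im_neq_0 | apply rcont_const | apply rcont_horiz].
Qed.

Section Rectangle.

Variables (U : C -> Prop) (G dG : C -> C) (x c H r : R).
Hypotheses (Hx : 0 < x) (Hc : 0 < c) (HH : 0 < H) (Hr : 0 < r).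
Hypothesis HG : holo U G dG.
Hypothesis HU : forall w, - x - r < Re w < c + r -> - H - r < Im w < H + r -> U w.

Lemma cauchy_rectangle_contour :
  (CInt (fun v => G (c, v) * Ci / (c, v)) (- H) H
   - CInt (fun v => G (- x, v)%R * Ci / (- x, v)%R) (- H) H
   + CInt (fun u => G (u, - H)%R * 1 / (u, - H)%R) (- x) c
   - CInt (fun u => G (u, H) * 1 / (u, H)) (- x) c = 2 * PI * Ci * G 0)%C.
Proof.
  (* [path_dilation] needs u in (-e, 1 + e) and sides prolonged by e at both ends. The choice of e
     makes the total displacement of such dilated points at most r, the margin on which G is known
     to be holomorphic. *)
  set (e := Rmin 1 (r / (x + c + H + 3))).
  assert (Q : 0 < x + c + H + 3) by lra.
  assert (He : 0 < e) by (apply Rmin_glb_lt; [lra | apply Rdiv_lt_0_compat; auto]).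
  assert (He1 : e <= 1) by apply Rmin_l.
  assert (He2 : e * (x + c + H + 3) <= r).
  { apply Rle_trans with (r / (x + c + H + 3) * (x + c + H + 3)).
    - apply Rmult_le_compat_r; [lra | apply Rmin_r].
    - right; field; lra. }
  assert (B1 : e * x + e * c + e * H + 3 * e <= r) by lra.
  assert (Kh : forall A B u t, 0 < A -> 0 < B -> - e < u < 1 + e -> - A - e < t < B + e ->
    - A - e * (A + B + 3) < u * t < B + e * (A + B + 3)).
  { intros A B u t HA HB Hu Ht. destruct (Rle_or_lt 0 u).
    - split.
      + apply Rlt_le_trans with (u * (- A - e)); [| apply Rmult_le_compat_l; lra]. nra.
      + apply Rle_lt_trans with (u * (B + e)); [apply Rmult_le_compat_l; lra |]. nra.
    - split; nra. }
  assert (K1 : forall u t, - e < u < 1 + e -> - H - e < t < H + e -> U (RtoC u * (c, t))%C).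
  { intros u t Hu Ht. apply HU; simpl; split; nra. }
  assert (K2 : forall u t, - e < u < 1 + e -> - H - e < t < H + e -> U (RtoC u * (- x, t)%R)%C).
  { intros u t Hu Ht. apply HU; simpl; split; nra. }
  assert (K3 : forall u t, - e < u < 1 + e -> - x - e < t < c + e -> U (RtoC u * (t, - H)%R)%C).
  { intros u t Hu Ht. generalize (Kh x c u t Hx Hc Hu Ht). intros. apply HU; simpl; split; nra. }
  assert (K4 : forall u t, - e < u < 1 + e -> - x - e < t < c + e -> U (RtoC u * (t, H))%C).
  { intros u t Hu Ht. generalize (Kh x c u t Hx Hc Hu Ht). intros. apply HU; simpl; split; nra. }
  assert (P1 := fun A => path_dilation U G dG (fun t => (c, t)) (fun _ => Ci) (- H) H e A He HG K1).
  assert (P2 := fun A => path_dilation U G dG (fun t => (- x, t)) (fun _ => Ci) (- H) H e A He HG K2).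
  assert (P3 := fun A => path_dilation U G dG (fun t => (t, - H)) (fun _ => RtoC 1) (- x) c e A He HG K3).
  assert (P4 := fun A => path_dilation U G dG (fun t => (t, H)) (fun _ => RtoC 1) (- x) c e A He HG K4).
  assert (A1 : - H <= H) by lra. assert (A2 : - x <= c) by lra.
  specialize (P1 A1). specialize (P2 A1). specialize (P3 A2). specialize (P4 A2).
  assert (P1' := P1 (fun t _ => conj (rderiv_vert c t) (conj (rcont_const _ _) (pair_re_neq_0 c t ltac:(lra))))).
  assert (P2' := P2 (fun t _ => conj (rderiv_vert (-x) t) (conj (rcont_const _ _) (pair_re_neq_0 (-x) t ltac:(lra))))).
  assert (P3' := P3 (fun t _ => conj (rderiv_horiz (-H) t) (conj (rcont_const _ _) (pair_im_neq_0 t (-H) ltac:(lra))))).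
  assert (P4' := P4 (fun t _ => conj (rderiv_horiz H t) (conj (rcont_const _ _) (pair_im_neq_0 t H ltac:(lra))))).
  clear P1 P2 P3 P4.
  set (F1 := fun v => CInt (fun t => G (RtoC v * (c, t)) * Ci / (c, t))%C (- H) H) in *.
  set (F2 := fun v => CInt (fun t => G (RtoC v * (- x, t)%R) * Ci / (- x, t)%R)%C (- H) H) in *.
  set (F3 := fun v => CInt (fun t => G (RtoC v * (t, - H)%R) * 1 / (t, - H)%R)%C (- x) c) in *.
  set (F4 := fun v => CInt (fun t => G (RtoC v * (t, H)) * 1 / (t, H))%C (- x) c) in *.
  set (F := fun v => (F1 v - F2 v + F3 v - F4 v)%C).
  assert (D : forall u, 0 <= u <= 1 -> exists d, rderiv F u d /\ (0 < u -> d = 0)).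
  { intros u Hu.
    destruct (P1' u Hu) as (d1 & R1 & E1). destruct (P2' u Hu) as (d2 & R2 & E2).
    destruct (P3' u Hu) as (d3 & R3 & E3). destruct (P4' u Hu) as (d4 & R4 & E4).
    exists (d1 - d2 + d3 - d4)%C. split.
    - assert (N : forall f t l, rderiv f t l -> rderiv (fun w => - f w)%C t (- l)).
      { intros f t l (N1 & N2). split; [apply (is_derive_opp (fun u => Re (f u)))
          | apply (is_derive_opp (fun u => Im (f u)))]; auto. }
      unfold F, Cminus. repeat apply rderiv_plus; auto.
    - intros P. assert (N : RtoC u <> 0) by (intros E; apply RtoC_inj in E; lra).
      assert (Z : (RtoC u * (d1 - d2 + d3 - d4))%C = 0).
      { replace (RtoC u * (d1 - d2 + d3 - d4))%C with
          (RtoC u * d1 - RtoC u * d2 + RtoC u * d3 - RtoC u * d4)%C by ring.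
        rewrite E1, E2, E3, E4. ring. }
      replace (d1 - d2 + d3 - d4)%C with (/ u * (u * (d1 - d2 + d3 - d4)))%C by (field; auto).
      rewrite Z. ring. }
  assert (EF : F 1 = F 0).
  { apply (rconst_of_rderiv_0 F (fun u => epsilon (inhabits (RtoC 0))
      (fun d => 0 <= u <= 1 -> rderiv F u d /\ (0 < u -> d = 0)))).
    - intros u Hu. set (d := epsilon _ _).
      assert (S : 0 <= u <= 1 -> rderiv F u d /\ (0 < u -> d = 0)); [| now apply S].
      apply epsilon_spec. destruct (D u Hu) as (d0 & Hd0). exists d0; auto.
    - intros u Hu. set (d := epsilon _ _).
      assert (S : 0 <= u <= 1 -> rderiv F u d /\ (0 < u -> d = 0)); [| apply S; lra].
      apply epsilon_spec. destruct (D u) as (d0 & Hd0); [lra|]. exists d0; auto. }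
  assert (L : F 1 = (CInt (fun v => G (c, v) * Ci / (c, v)) (- H) H
   - CInt (fun v => G (- x, v)%R * Ci / (- x, v)%R) (- H) H
   + CInt (fun u => G (u, - H)%R * 1 / (u, - H)%R) (- x) c
   - CInt (fun u => G (u, H) * 1 / (u, H)) (- x) c)%C).
  { unfold F, F1, F2, F3, F4. apply (f_equal2 Cminus); [apply (f_equal2 Cplus); [apply (f_equal2 Cminus)|]|];
      apply CInt_ext; auto; intros; now rewrite Cmult_1_l. }
  rewrite <- L, EF.
  (* At u = 0 only the winding integrals are left. The logarithms cancel between opposite sides, and
     the arctangents add up in complementary pairs [atan a + atan (/ a) = PI / 2] to 2 PI. *)
  assert (I1 : forall (p : R -> C) (d : C) a b, a <= b -> (forall t, p t <> 0) ->
    (forall t, rcont p t) ->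
    CInt (fun t => G (0 * p t) * d / p t)%C a b = (G 0 * CInt (fun t => 1 * d / p t) a b)%C).
  { intros p d a b Hab Np Cp. rewrite <- CInt_scal.
    - apply CInt_ext; auto. intros. rewrite Cmult_0_l. field; auto.
    - apply cintegrable_cont; auto. intros. apply rcont_div; auto. apply rcont_const. }
  unfold F, F1, F2, F3, F4.
  rewrite (I1 (fun t => (c, t))), (I1 (fun t => (- x, t))), (I1 (fun t => (t, - H))), (I1 (fun t => (t, H)));
    auto using rcont_vert, rcont_horiz;
    try (intros; apply pair_re_neq_0; lra); try (intros; apply pair_im_neq_0; lra).
  rewrite !winding_vert, !winding_horiz by lra.
  replace (H / - x) with (- (H / x)) by (field; lra).
  replace (c / - H) with (- (c / H)) by (field; lra).
  replace (- x / - H) with (x / H) by (field; lra).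
  replace (- x / H) with (- (x / H)) by (field; lra).
  rewrite !atan_opp.
  assert (T1 : atan (c / H) = PI / 2 - atan (H / c)).
  { replace (c / H) with (/ (H / c)) by (field; lra).
    generalize (atan_add_inv (H / c) ltac:(apply Rdiv_lt_0_compat; lra)); lra. }
  assert (T2 : atan (x / H) = PI / 2 - atan (H / x)).
  { replace (x / H) with (/ (H / x)) by (field; lra).
    generalize (atan_add_inv (H / x) ltac:(apply Rdiv_lt_0_compat; lra)); lra. }
  rewrite T1, T2.
  replace (- H * - H) with (H * H) by ring.
  apply Ceq_of; simpl; field.
Qed.

(** The contour identity divided by i, with the horizontal sides estimated: in every application a
    Gaussian factor makes them negligible, while the two vertical integrals and the residue carry
    the information. *)
Lemma cauchy_rectangle_bound (M : R) :
  (forall u, - x <= u <= c -> Cmod (G (u, H) / (u, H)) <= M) ->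
  (forall u, - x <= u <= c -> Cmod (G (u, - H)%R / (u, - H)%R) <= M) ->
  Cmod (CInt (fun v => G (c, v) / (c, v))%C (- H) H
   - CInt (fun v => G (- x, v)%R / (- x, v)%R)%C (- H) H - 2 * PI * G 0) <= 2 * M * (x + c).
Proof.
  intros M1 M2. assert (E := cauchy_rectangle_contour).
  assert (A1 : - H <= H) by lra. assert (A2 : - x <= c) by lra.
  assert (Cv : forall a v, - x <= a <= c -> a <> 0 -> - H <= v <= H ->
     rcont (fun v => G (a, v) / (a, v))%C v).
  { intros a v Ha Na Hv. apply rcont_div; [now apply pair_re_neq_0| | apply rcont_vert].
    apply (rcont_comp G (fun v => (a, v))); [apply rcont_vert|].
    eapply cderiv_ccont, HG, HU; simpl; lra. }
  assert (Ch : forall a v, - H <= a <= H -> a <> 0 -> - x <= v <= c ->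
     rcont (fun v => G (v, a) / (v, a))%C v).
  { intros a v Ha Na Hv. apply rcont_div; [now apply pair_im_neq_0| | apply rcont_horiz].
    apply (rcont_comp G (fun v => (v, a))); [apply rcont_horiz|].
    eapply cderiv_ccont, HG, HU; simpl; lra. }
  assert (V : forall a, - x <= a <= c -> a <> 0 -> CInt (fun v => G (a, v) * Ci / (a, v))%C (- H) H =
     (Ci * CInt (fun v => G (a, v) / (a, v)) (- H) H)%C).
  { intros a Ha Na. rewrite <- CInt_scal by (apply cintegrable_cont; auto).
    apply CInt_ext; auto. intros; field. now apply pair_re_neq_0. }
  assert (W : forall a, a <> 0 -> CInt (fun v => G (v, a) * 1 / (v, a))%C (- x) c =
     CInt (fun v => G (v, a) / (v, a))%C (- x) c).
  { intros a Na. apply CInt_ext; auto. intros; field. now apply pair_im_neq_0. }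
  rewrite !V, !W in E by lra.
  set (I1 := CInt (fun v => G (c, v) / (c, v))%C (- H) H) in *.
  set (I2 := CInt (fun v => G (- x, v)%R / (- x, v)%R)%C (- H) H) in *.
  set (J1 := CInt (fun v => G (v, - H)%R / (v, - H)%R)%C (- x) c) in *.
  set (J2 := CInt (fun v => G (v, H) / (v, H))%C (- x) c) in *.
  assert (B1 : Cmod J1 <= M * (c - - x)) by
   (apply CInt_bound_const; auto; apply cintegrable_cont; auto; intros; apply Ch; lra).
  assert (B2 : Cmod J2 <= M * (c - - x)) by
   (apply CInt_bound_const; auto; apply cintegrable_cont; auto; intros; apply Ch; lra).
  replace (I1 - I2 - 2 * PI * G 0)%C with (Ci * (J1 - J2))%C.
  - rewrite Cmod_mult, Cmod_Ci, Rmult_1_l. eapply Rle_trans; [apply Cmod_minus_le|]. lra.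
  - assert (Z : (Ci * (I1 - I2 - 2 * PI * G 0))%C = (- (J1 - J2))%C).
    { replace (Ci * (I1 - I2 - 2 * PI * G 0))%C with
       (Ci * I1 - Ci * I2 + J1 - J2 - 2 * PI * Ci * G 0 - (J1 - J2))%C by ring.
      rewrite E. ring. }
    replace (I1 - I2 - 2 * PI * G 0)%C with (- Ci * (Ci * (I1 - I2 - 2 * PI * G 0)))%C.
    + rewrite Z. ring.
    + rewrite Cmult_assoc. replace (- Ci * Ci)%C with (RtoC 1); [ring|].
      apply Ceq_of; simpl; ring.
Qed.

End Rectangle.

(** * Cauchy's formula on circles *)

Definition circ (r t : R) : C := (r * cos t, r * sin t).

Lemma Cmod_circ r t : 0 <= r -> Cmod (circ r t) = r.
Proof.
  intros Hr. unfold circ, Cmod; simpl.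
  replace (r * cos t * (r * cos t * 1) + r * sin t * (r * sin t * 1)) with
    (r² * ((sin t)² + (cos t)²)) by (unfold Rsqr; ring).
  rewrite sin2_cos2, Rmult_1_r. now apply sqrt_Rsqr.
Qed.

Lemma rderiv_circ r t : rderiv (circ r) t (Ci * circ r t).
Proof. split; simpl; auto_derive; auto; ring. Qed.

Lemma rcont_circ r t : rcont (circ r) t.
Proof. eapply rderiv_rcont, rderiv_circ. Qed.

Lemma circ_neq_0 r t : 0 < r -> circ r t <> 0.
Proof. intros H E. assert (P := Cmod_circ r t ltac:(lra)). rewrite E, Cmod_0 in P. lra. Qed.

Lemma circ_sub_neq_0 r t (z : C) : Cmod z < r -> (circ r t - z <> 0)%C.
Proof.
  intros H E. assert (circ r t = z) by (replace z with (0 + z)%C by ring; rewrite <- E; ring).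
  subst z. rewrite Cmod_circ in H; [lra|]. apply Rle_trans with (2 := Rlt_le _ _ H), Cmod_ge_0.
Qed.

Lemma circ_period r : circ r (2 * PI) = circ r 0.
Proof. unfold circ. now rewrite cos_2PI, sin_2PI, cos_0, sin_0. Qed.

(** The dilation argument again. Now the path itself is closed, so the increment of G(u p) between
    its end points vanishes and the integral does not depend on u. *)
Lemma closed_path_const (U : C -> Prop) (G dG : C -> C) (p dp : R -> C) (a b r : R) :
  a <= b -> 0 < r -> holo U G dG ->
  (forall u t, - r < u < 1 + r -> a - r < t < b + r -> U (RtoC u * p t)%C) ->
  (forall t, a - r < t < b + r -> rderiv p t (dp t) /\ rcont dp t /\ p t <> 0) ->
  p a = p b ->
  CInt (fun t => G (p t) * dp t / p t)%C a b = (G 0 * CInt (fun t => dp t / p t) a b)%C.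
Proof.
  intros Hab Hr HG HU Hp E.
  set (F := fun v => CInt (fun t => G (RtoC v * p t)%C * dp t / p t)%C a b).
  assert (D := path_dilation U G dG p dp a b r Hab Hr HG HU Hp). fold F in D.
  assert (EF : F 1 = F 0).
  { apply (rconst_of_rderiv_0 F (fun u => epsilon (inhabits (RtoC 0))
      (fun d => 0 <= u <= 1 -> rderiv F u d /\ (0 < u -> d = 0)))).
    - intros u Hu. set (d := epsilon _ _).
      assert (S : 0 <= u <= 1 -> rderiv F u d /\ (0 < u -> d = 0)); [| now apply S].
      apply epsilon_spec. destruct (D u Hu) as (d0 & R0 & E0). exists d0. intros _. split; auto.
      intros P. assert (N : RtoC u <> 0) by (intros Z; apply RtoC_inj in Z; lra).
      replace d0 with (/ u * (u * d0))%C by (field; auto). rewrite E0, E. ring.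
    - intros u Hu. set (d := epsilon _ _).
      assert (S : 0 <= u <= 1 -> rderiv F u d /\ (0 < u -> d = 0)); [| apply S; lra].
      apply epsilon_spec. destruct (D u) as (d0 & R0 & E0); [lra|]. exists d0. intros _. split; auto.
      intros P. assert (N : RtoC u <> 0) by (intros Z; apply RtoC_inj in Z; lra).
      replace d0 with (/ u * (u * d0))%C by (field; auto). rewrite E0, E. ring. }
  assert (C0 : forall t, a <= t <= b -> rcont (fun t => dp t / p t)%C t).
  { intros t Ht. assert (Ht' : a - r < t < b + r) by lra. destruct (Hp t Ht') as (P1 & P2 & P3).
    apply rcont_div; auto. eapply rderiv_rcont; eauto. }
  transitivity (F 1).
  { apply CInt_ext; auto. intros; now rewrite Cmult_1_l. }
  rewrite EF, <- CInt_scal by (apply cintegrable_cont; auto).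
  apply CInt_ext; auto. intros t Ht. rewrite Cmult_0_l. field. apply Hp; lra.
Qed.

Lemma twoPI_pos : 0 <= 2 * PI.
Proof. generalize PI_RGT_0; lra. Qed.

Lemma mean_value_circle U G dG r e : 0 < r -> 0 < e -> holo U G dG ->
  (forall w, Cmod w < r + e -> U w) ->
  CInt (fun t => G (circ r t)) 0 (2 * PI) = (2 * PI * G 0)%C.
Proof.
  intros Hr He HG HU.
  assert (Hd : 0 < e / (r + 1)) by (apply Rdiv_lt_0_compat; lra).
  assert (E := closed_path_const U G dG (circ r) (fun t => Ci * circ r t)%C 0 (2 * PI)
    (e / (r + 1)) twoPI_pos Hd HG). cbv beta in E.
  rewrite (CInt_ext (fun t => Ci * circ r t / circ r t)%C (fun _ => Ci)) in E by (auto using twoPI_pos; intros; field; now apply circ_neq_0).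
  rewrite (CInt_ext (fun t => G (circ r t) * (Ci * circ r t) / circ r t)%C (fun t => Ci * G (circ r t))%C) in E
    by (auto using twoPI_pos; intros; field; now apply circ_neq_0).
  rewrite CInt_const, CInt_scal in E.
  - assert (E' : (Ci * CInt (fun t => G (circ r t)) 0 (2 * PI) = G 0 * ((2 * PI - 0)%R * Ci))%C).
    { apply E.
      - intros u t Hu Ht. apply HU. rewrite Cmod_mult, Cmod_circ, Cmod_R by lra.
        assert (Rabs u < 1 + e / (r + 1)) by (apply Rabs_def1; lra).
        assert (e / (r + 1) * r < e).
        { replace e with (e / (r + 1) * (r + 1)) at 2 by (field; lra). nra. }
        nra.
      - intros t Ht. split; [apply rderiv_circ|]. split; [| now apply circ_neq_0].
        apply rcont_mult; auto using rcont_const, rcont_circ.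
      - symmetry; apply circ_period. }
    replace (CInt (fun t => G (circ r t)) 0 (2 * PI)) with
      (- Ci * (Ci * CInt (fun t => G (circ r t)) 0 (2 * PI)))%C.
    + rewrite E'. replace (2 * PI - 0) with (2 * PI) by ring. rewrite RtoC_mult.
      replace (- Ci * (G 0 * (2 * PI * Ci)))%C with ((- Ci * Ci) * (2 * PI * G 0))%C by ring.
      replace (- Ci * Ci)%C with (RtoC 1); [ring|]. apply Ceq_of; simpl; ring.
    + rewrite Cmult_assoc. replace (- Ci * Ci)%C with (RtoC 1); [ring|]. apply Ceq_of; simpl; ring.
  - apply cintegrable_cont; [apply twoPI_pos|]. intros t Ht.
    apply (rcont_comp G (circ r)); [apply rcont_circ|].
    eapply cderiv_ccont, HG, HU. rewrite Cmod_circ; lra.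
Qed.

Lemma conj_circ r t : 0 < r -> Cconj (circ r t) = (RtoC (r * r) / circ r t)%C.
Proof.
  intros Hr. assert (N := circ_neq_0 r t Hr).
  replace (RtoC (r * r)) with (circ r t * Cconj (circ r t))%C.
  - field; auto.
  - assert (S := sin2_cos2 t). unfold Rsqr in S. apply Ceq_of; simpl; [| ring].
    replace (r * cos t * (r * cos t) - r * sin t * - (r * sin t)) with
      (r * r * (sin t * sin t + cos t * cos t)) by ring. rewrite S. ring.
Qed.

(** On the circle the conjugate of w is r^2/w. Hence the conjugate of w/(w - z) equals r^2/(r^2 -
    conj(z) w), which is holomorphic on a larger disc and takes the value 1 at 0; the mean value
    property applies to it. *)
Lemma cauchy_kernel_mass r (z : C) : 0 < r -> Cmod z < r ->
  CInt (fun t => circ r t / (circ r t - z))%C 0 (2 * PI) = RtoC (2 * PI).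
Proof.
  intros Hr Hz. assert (Pz := Cmod_ge_0 z).
  set (G := fun w => (RtoC (r * r) / (RtoC (r * r) - Cconj z * w))%C).
  set (U := fun w => (RtoC (r * r) - Cconj z * w <> 0)%C).
  assert (HG : holo U G (fun w => RtoC (r * r) * Cconj z / ((RtoC (r * r) - Cconj z * w) * (RtoC (r * r) - Cconj z * w)))%C).
  { intros w Hw. unfold U in Hw. split.
    - eapply cderiv_eq; [| apply cderiv_div; [exact Hw | apply cderiv_const |
        apply cderiv_minus; [apply cderiv_const | apply cderiv_scal, cderiv_id]]].
      cbv beta; field; auto.
    - apply ccont_div; [now apply Cmult_neq_0 | apply ccont_const|].
      apply ccont_mult; apply ccont_minus; try apply ccont_const; apply ccont_mult;
        try apply ccont_const; apply ccont_id. }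
  assert (E : CInt (fun t => G (circ r t)) 0 (2 * PI) = (2 * PI * G 0)%C).
  { apply (mean_value_circle U G _ r (r - Cmod z) Hr ltac:(lra) HG).
    intros w Hw Z.
    assert (Cmod (RtoC (r * r)) = Cmod (Cconj z * w)).
    { f_equal. apply (f_equal (fun v => v + Cconj z * w)%C) in Z.
      replace (RtoC (r * r) - Cconj z * w + Cconj z * w)%C with (RtoC (r * r)) in Z by ring.
      rewrite Z. ring. }
    rewrite Cmod_R, Cmod_mult, Cmod_conj, Rabs_right in H by nra.
    generalize (Cmod_ge_0 w). nra. }
  assert (N0 : RtoC (r * r) <> 0) by (intros Z; apply RtoC_inj in Z; nra).
  apply (f_equal Cconj) in E. rewrite <- CInt_conj in E.
  - rewrite <- RtoC_mult in E. unfold G in E.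
    rewrite Cmult_0_r in E. replace (RtoC (r * r) / (RtoC (r * r) - 0))%C with (RtoC 1) in E by (field; auto).
    rewrite Cmult_1_r in E. replace (Cconj (RtoC (2 * PI))) with (RtoC (2 * PI)) in E by (apply Ceq_of; simpl; ring).
    rewrite <- E. apply CInt_ext; [apply twoPI_pos|]. intros t Ht.
    assert (N := circ_neq_0 r t Hr). assert (N1 := circ_sub_neq_0 r t z Hz).
    assert (Ec := conj_circ r t Hr).
    assert (N2 : Cconj (circ r t) <> 0).
    { intros Z. apply N. rewrite <- (Cconj_conj (circ r t)), Z. apply Ceq_of; simpl; ring. }
    assert (E2 : RtoC (r * r) = (circ r t * Cconj (circ r t))%C) by (rewrite Ec; field; auto).
    assert (N3 : (Cconj (circ r t) - Cconj z <> 0)%C).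
    { intros Z. apply N1. rewrite <- Cminus_conj in Z. rewrite <- (Cconj_conj (circ r t - z)), Z. apply Ceq_of; simpl; ring. }
    rewrite E2.
    replace (circ r t * Cconj (circ r t) / (circ r t * Cconj (circ r t) - Cconj z * circ r t))%C
      with (Cconj (circ r t) / (Cconj (circ r t) - Cconj z))%C.
    + rewrite Cdiv_conj, Cminus_conj, !Cconj_conj; auto.
    + field; repeat split; auto.
      replace (circ r t * Cconj (circ r t) - Cconj z * circ r t)%C with
        (circ r t * (Cconj (circ r t) - Cconj z))%C by ring.
      now apply Cmult_neq_0.
  - apply cintegrable_cont; [apply twoPI_pos|]. intros t Ht.
    apply (rcont_comp G (circ r)); [apply rcont_circ|]. eapply cderiv_ccont, HG.
    intros Z. assert (Cmod (RtoC (r * r)) = Cmod (Cconj z * circ r t)).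
    { f_equal. apply (f_equal (fun v => v + Cconj z * circ r t)%C) in Z.
      replace (RtoC (r * r) - Cconj z * circ r t + Cconj z * circ r t)%C with (RtoC (r * r)) in Z by ring.
      rewrite Z. ring. }
    rewrite Cmod_R, Cmod_mult, Cmod_conj, Rabs_right, Cmod_circ in H by nra. nra.
Qed.

(** The circle is contracted towards z instead of 0, that is, [closed_path_const] is applied to the
    path w - z and to F(z + .). The remaining winding integral around z is i times the mass of the
    Cauchy kernel. *)
Lemma cauchy_formula U F dF r e (z : C) : 0 < r -> 0 < e -> holo U F dF ->
  (forall w, Cmod w < r + e -> U w) -> Cmod z < r ->
  CInt (fun t => F (circ r t) * (circ r t / (circ r t - z)))%C 0 (2 * PI) = (2 * PI * F z)%C.
Proof.
  intros Hr He HF HU Hz.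
  (* For u in (-d, 1 + d) the point (1 - u) z + u w has modulus at most (1 + 2 d) r, and 2 r d <
     e. *)
  set (d := e / (2 * r + 1)).
  assert (Hd : 0 < d) by (apply Rdiv_lt_0_compat; lra).
  assert (Hd2 : d * (2 * r) < e).
  { replace e with (d * (2 * r + 1)) by (unfold d; field; lra). nra. }
  assert (HG : holo (fun w => U (z + w)%C) (fun w => F (z + w)%C) (fun w => dF (z + w)%C)).
  { intros w Hw. destruct (HF _ Hw) as (A & B). split.
    - eapply cderiv_eq; [| apply (cderiv_comp F (fun w => z + w)%C); [apply cderiv_plus;
       [apply cderiv_const | apply cderiv_id] | exact A]]. ring.
    - apply (ccont_comp dF (fun w => z + w)%C); auto. apply ccont_plus; [apply ccont_const | apply ccont_id]. }
  assert (E := closed_path_const _ _ _ (fun t => circ r t - z)%C (fun t => Ci * circ r t)%C 0 (2 * PI)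
    d twoPI_pos Hd HG). cbv beta in E.
  assert (N1 := fun t => circ_sub_neq_0 r t z Hz).
  assert (E' : (CInt (fun t => F (z + (circ r t - z)) * (Ci * circ r t) / (circ r t - z)) 0 (2 * PI) =
      F (z + 0) * CInt (fun t => Ci * circ r t / (circ r t - z)) 0 (2 * PI))%C).
  { apply E.
    - intros u t Hu Ht. apply HU.
      replace (z + u * (circ r t - z))%C with (RtoC (1 - u) * z + RtoC u * circ r t)%C
        by (rewrite RtoC_minus; ring).
      eapply Rle_lt_trans; [apply Cmod_triangle|].
      rewrite !Cmod_mult, Cmod_circ, !Cmod_R by lra.
      assert (Rabs (1 - u) <= 1 - u + 2 * d) by (apply Rabs_le; lra).
      assert (Rabs u <= u + 2 * d) by (apply Rabs_le; lra).
      assert (Rabs (1 - u) + Rabs u <= 1 + 2 * d).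
      { unfold Rabs; destruct (Rcase_abs (1 - u)), (Rcase_abs u); lra. }
      generalize (Rabs_pos (1 - u)) (Rabs_pos u) (Cmod_ge_0 z). nra.
    - intros t Ht. split; [| split; auto].
      + eapply rderiv_eq; [| apply rderiv_plus; [apply rderiv_circ | apply rderiv_const]]. ring.
      + apply rcont_mult; auto using rcont_const, rcont_circ.
    - now rewrite circ_period. }
  rewrite Cplus_0_r in E'.
  assert (Ck : forall t, rcont (fun t => circ r t / (circ r t - z))%C t).
  { intros t. apply rcont_div; auto using rcont_circ. apply rcont_minus; auto using rcont_circ, rcont_const. }
  rewrite (CInt_ext (fun t => Ci * circ r t / (circ r t - z))%C (fun t => Ci * (circ r t / (circ r t - z)))%C) in E'
    by (auto using twoPI_pos; intros; field; auto).
  rewrite CInt_scal, cauchy_kernel_mass in E'; auto.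
  2: { apply cintegrable_cont; auto using twoPI_pos. }
  rewrite (CInt_ext _ (fun t => Ci * (F (circ r t) * (circ r t / (circ r t - z))))%C) in E'.
  2: auto using twoPI_pos.
  2: { intros t _. replace (z + (circ r t - z))%C with (circ r t) by ring. field; auto. }
  rewrite CInt_scal in E'.
  2: { apply cintegrable_cont; [apply twoPI_pos|]. intros t _. apply rcont_mult; auto.
    apply (rcont_comp F (circ r)); [apply rcont_circ|]. eapply cderiv_ccont, HF, HU. rewrite Cmod_circ; lra. }
  clear E. set (I := CInt _ _ _) in *.
  replace I with (- Ci * (Ci * I))%C.
  - rewrite E'. rewrite RtoC_mult.
    replace (- Ci * (F z * (Ci * (2 * PI))))%C with ((- Ci * Ci) * (2 * PI * F z))%C by ring.
    replace (- Ci * Ci)%C with (RtoC 1); [ring|]. apply Ceq_of; simpl; ring.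
  - rewrite Cmult_assoc. replace (- Ci * Ci)%C with (RtoC 1); [ring|]. apply Ceq_of; simpl; ring.
Qed.

(** * Local theory of holomorphic functions *)

Definition copen (U : C -> Prop) : Prop :=
  forall z, U z -> exists r, 0 < r /\ forall w, Cmod (w - z) < r -> U w.

(** The derivative as a function, chosen by [epsilon], so that holomorphy can be stated when no
    formula for the derivative is at hand. By [cder_unique] it agrees with every derivative that
    exists. *)
Definition cder (f : C -> C) (z : C) : C :=
  epsilon (inhabits (RtoC 0)) (fun l => cderiv f z l).

Definition ccvg (u : nat -> C) (l : C) : Prop :=
  forall e, 0 < e -> exists N, forall n, (N <= n)%nat -> Cmod (u n - l) < e.

Lemma cder_unique f z l : cderiv f z l -> cder f z = l.
Proof.
  intros H. apply (cderiv_unique f z); auto. unfold cder.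
  apply (epsilon_spec (inhabits (RtoC 0)) (fun l => cderiv f z l)). now exists l.
Qed.

Lemma Cmod_self (z : C) : Cmod (z - z) = 0.
Proof. replace (z - z)%C with (RtoC 0) by ring. apply Cmod_0. Qed.

Lemma open_ball c r : copen (fun w => Cmod (w - c) < r).
Proof.
  intros z Hz. exists (r - Cmod (z - c)). split; [lra|]. intros w Hw.
  replace (w - c)%C with ((w - z) + (z - c))%C by ring.
  eapply Rle_lt_trans; [apply Cmod_triangle|]. lra.
Qed.

Lemma holo_sub (U V : C -> Prop) f df : (forall z, V z -> U z) -> holo U f df -> holo V f df.
Proof. intros H1 H2 z Hz; auto. Qed.

Lemma holo_ext (U : C -> Prop) f g df : copen U -> (forall z, U z -> f z = g z) ->
  holo U f df -> holo U g df.
Proof.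
  intros HU E H z Hz. destruct (H z Hz). split; auto.
  destruct (HU z Hz) as (r & Hr & HB). apply (cderiv_ext_loc f g z _ r); auto.
Qed.

Lemma holo_cder (U : C -> Prop) f :
  (forall z, U z -> exists r df, 0 < r /\ holo (fun w => Cmod (w - z) < r) f df) ->
  holo U f (cder f).
Proof.
  intros H z Hz. destruct (H z Hz) as (r & df & Hr & Hf).
  assert (E : forall w, Cmod (w - z) < r -> df w = cder f w).
  { intros w Hw. symmetry. apply cder_unique, Hf, Hw. }
  assert (Z : Cmod (z - z) < r) by (rewrite Cmod_self; auto).
  split.
  - rewrite <- E by auto. apply Hf; auto.
  - apply (ccont_ext_loc df _ z r); auto. apply Hf; auto.
Qed.

Lemma holo_to_cder (U : C -> Prop) f df : copen U -> holo U f df -> holo U f (cder f).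
Proof.
  intros HU H. apply holo_cder. intros z Hz. destruct (HU z Hz) as (r & Hr & HB).
  exists r, df. split; auto. intros w Hw; auto.
Qed.

Lemma holo_shift U c f df : holo U f df ->
  holo (fun w => U (c + w)%C) (fun w => f (c + w)%C) (fun w => df (c + w)%C).
Proof.
  intros HF w Hw. destruct (HF _ Hw) as (A & B). split.
  - eapply cderiv_eq; [| apply (cderiv_comp f (fun w => c + w)%C); [apply cderiv_plus;
      [apply cderiv_const | apply cderiv_id] | exact A]]. ring.
  - apply (ccont_comp df (fun w => c + w)%C); auto. apply ccont_plus; [apply ccont_const | apply ccont_id].
Qed.

Lemma holo_unshift c r f df : holo (fun w => Cmod w < r) (fun w => f (c + w)%C) df ->
  holo (fun z => Cmod (z - c) < r) f (fun z => df (z - c)%C).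
Proof.
  intros H z Hz. destruct (holo_shift _ (- c)%C _ _ H z) as (A & B).
  - replace (- c + z)%C with (z - c)%C by ring; auto.
  - replace (- c + z)%C with (z - c)%C in A by ring. split.
    + eapply cderiv_ext; [| exact A]. intros w. cbv beta. f_equal; ring.
    + apply (ccont_ext_loc (fun w => df (- c + w)%C) _ z 1); auto; [lra|]. intros; f_equal; ring.
Qed.

Lemma holo_const U c : holo U (fun _ => c) (fun _ => 0).
Proof. intros z _; split; [apply cderiv_const | apply ccont_const]. Qed.

Lemma holo_ccont U f df z : holo U f df -> U z -> ccont f z.
Proof. intros H Hz. eapply cderiv_ccont, H, Hz. Qed.

Lemma holo_plus U f g df dg : holo U f df -> holo U g dg ->
  holo U (fun w => f w + g w)%C (fun w => df w + dg w)%C.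
Proof. intros Hf Hg z Hz. destruct (Hf z Hz), (Hg z Hz). split; [apply cderiv_plus | apply ccont_plus]; auto. Qed.

Lemma holo_mult U f g df dg : holo U f df -> holo U g dg ->
  holo U (fun w => f w * g w)%C (fun w => df w * g w + f w * dg w)%C.
Proof.
  intros Hf Hg z Hz. destruct (Hf z Hz) as (F1 & F2), (Hg z Hz) as (G1 & G2).
  assert (F3 := cderiv_ccont _ _ _ F1). assert (G3 := cderiv_ccont _ _ _ G1).
  split; [apply cderiv_mult | apply ccont_plus; apply ccont_mult]; auto.
Qed.

Lemma holo_div (U : C -> Prop) (f g df dg : C -> C) : holo U f df -> holo U g dg -> (forall z, U z -> g z <> 0) ->
  holo U (fun w => f w / g w)%C (fun w => (df w * g w - f w * dg w) / (g w * g w))%C.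
Proof.
  intros Hf Hg N z Hz. destruct (Hf z Hz) as (F1 & F2), (Hg z Hz) as (G1 & G2).
  assert (F3 := cderiv_ccont _ _ _ F1). assert (G3 := cderiv_ccont _ _ _ G1).
  split; [apply cderiv_div; auto|].
  apply ccont_div; [apply Cmult_neq_0; auto| apply ccont_minus; apply ccont_mult; auto | apply ccont_mult; auto].
Qed.

Lemma holo_comp U V f g df dg : holo U f df -> holo V g dg -> (forall z, V z -> U (g z)) ->
  holo V (fun w => f (g w)) (fun w => df (g w) * dg w)%C.
Proof.
  intros Hf Hg N z Hz. destruct (Hg z Hz) as (G1 & G2). destruct (Hf _ (N z Hz)) as (F1 & F2).
  split; [apply (cderiv_comp f g); auto|].
  apply ccont_mult; auto. apply (ccont_comp df g); auto. eapply cderiv_ccont; eauto.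
Qed.

Lemma holo_id U : holo U (fun w => w) (fun _ => 1).
Proof. intros z _; split; [apply cderiv_id | apply ccont_const]. Qed.

Lemma holo_cexp U f df : holo U f df ->
  holo U (fun w => cexp (f w)) (fun w => cexp (f w) * df w)%C.
Proof.
  intros Hf. apply (holo_comp (fun _ => True) U cexp f cexp); auto.
  intros z _; split; [apply cderiv_cexp | apply ccont_cexp].
Qed.

Lemma holo_scal U c f df : holo U f df -> holo U (fun w => c * f w)%C (fun w => c * df w)%C.
Proof.
  intros Hf z Hz. destruct (Hf z Hz). split; [apply cderiv_scal | apply ccont_mult; [apply ccont_const|]]; auto.
Qed.

Lemma rcont_bounded f a b : a <= b -> (forall t, a <= t <= b -> rcont f t) ->
  exists M, 0 < M /\ forall t, a <= t <= b -> Cmod (f t) <= M.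
Proof.
  intros Hab H. destruct (continuity_ab_maj (fun t => Cmod (f t)) a b Hab) as (m & Hm & _).
  - intros t Ht. apply continuity_pt_filterlim, rcont_mod, H, Ht.
  - exists (Cmod (f m) + 1). split; [generalize (Cmod_ge_0 (f m)); lra|].
    intros t Ht. generalize (Hm t Ht); lra.
Qed.

Lemma circ_dist_ge r t z : 0 < r -> r - Cmod z <= Cmod (circ r t - z).
Proof. intros Hr. generalize (Cmod_sub_le (circ r t) z). rewrite Cmod_circ; lra. Qed.

(** Any continuous density on the circle has a holomorphic Cauchy transform. Derivatives, quotients
    by a zero and uniform limits are all shown to be holomorphic by exhibiting them as such
    transforms. The estimates use that, with d the distance of z from the circle, points within d/2
    of z still have distance at least d/2. *)
Lemma cauchy_transform_holo phi r : 0 < r ->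
  (forall t, 0 <= t <= 2 * PI -> rcont phi t) ->
  holo (fun z => Cmod z < r)
    (fun z => CInt (fun t => phi t / (circ r t - z))%C 0 (2 * PI))
    (fun z => CInt (fun t => phi t / ((circ r t - z) * (circ r t - z)))%C 0 (2 * PI)).
Proof.
  intros Hr Hphi. destruct (rcont_bounded phi 0 (2 * PI) twoPI_pos Hphi) as (M & HM & BM).
  assert (I1 : forall z, Cmod z < r -> cintegrable (fun t => phi t / (circ r t - z))%C 0 (2 * PI)).
  { intros z Hz. apply cintegrable_cont; [apply twoPI_pos|]. intros t Ht.
    apply rcont_div; auto using circ_sub_neq_0. apply rcont_minus; auto using rcont_circ, rcont_const. }
  assert (I2 : forall z, Cmod z < r -> cintegrable (fun t => phi t / ((circ r t - z) * (circ r t - z)))%C 0 (2 * PI)).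
  { intros z Hz. apply cintegrable_cont; [apply twoPI_pos|]. intros t Ht.
    apply rcont_div; auto using Cmult_neq_0, circ_sub_neq_0.
    apply rcont_mult; apply rcont_minus; auto using rcont_circ, rcont_const. }
  intros z Hz. set (d := r - Cmod z). assert (Hd : 0 < d) by (unfold d; lra).
  assert (Near : forall w, Cmod (w - z) < d / 2 -> Cmod w < r).
  { intros w Hw. generalize (Cmod_sub_le w z). unfold d in *. lra. }
  assert (LB1 : forall t, d <= Cmod (circ r t - z)) by (intros; apply circ_dist_ge; auto).
  assert (LB2 : forall w t, Cmod (w - z) < d / 2 -> d / 2 <= Cmod (circ r t - w)).
  { intros w t Hw. generalize (circ_dist_ge r t w Hr) (Cmod_sub_le w z). unfold d in *. lra. }
  assert (PIp := PI_RGT_0).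
  split.
  - intros e He.
    set (A := M * (2 / (d * d * d)) * (2 * PI)).
    assert (HA : 0 < A).
    { unfold A; apply Rmult_lt_0_compat; [apply Rmult_lt_0_compat; [lra |
        apply Rdiv_lt_0_compat; [lra | repeat apply Rmult_lt_0_compat; lra]] | lra]. }
    exists (Rmin (d / 2) (e / A)). split; [apply Rmin_glb_lt; [lra | apply Rdiv_lt_0_compat; auto]|].
    intros w Hw.
    assert (W1 := Rlt_le_trans _ _ _ Hw (Rmin_l _ _)).
    assert (W2 := Rlt_le_trans _ _ _ Hw (Rmin_r _ _)).
    rewrite <- CInt_minus, <- CInt_scal, <- CInt_minus by (auto using cintegrable_minus, cintegrable_scal).
    apply Rle_trans with (A * Cmod (w - z) * Cmod (w - z)).
    + eapply Rle_trans.
      * apply CInt_bound_const with (M := M * (2 / (d * d * d)) * Cmod (w - z) * Cmod (w - z)); [apply twoPI_pos | |].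
        -- auto using cintegrable_minus, cintegrable_scal.
        -- intros t Ht. assert (N1 := circ_sub_neq_0 r t z Hz). assert (N2 := circ_sub_neq_0 r t w (Near w W1)).
           replace (phi t / (circ r t - w) - phi t / (circ r t - z) - (w - z) * (phi t / ((circ r t - z) * (circ r t - z))))%C
             with (phi t * ((w - z) * (w - z)) / ((circ r t - z) * (circ r t - z) * (circ r t - w)))%C
             by (field; auto).
           rewrite Cmod_div, !Cmod_mult by (auto using Cmult_neq_0).
           specialize (LB1 t). specialize (LB2 w t W1). specialize (BM t Ht).
           set (p := Cmod (circ r t - z)) in *. set (q := Cmod (circ r t - w)) in *.
           assert (Q : d * d * d / 2 <= p * p * q).
           { replace (d * d * d / 2) with (d * d * (d / 2)) by field.
             apply Rmult_le_compat; try nra. }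
           assert (Q0 : 0 < d * d * d / 2) by (apply Rdiv_lt_0_compat; [repeat apply Rmult_lt_0_compat|]; lra).
           replace (M * (2 / (d * d * d)) * Cmod (w - z) * Cmod (w - z))
             with (M * (Cmod (w - z) * Cmod (w - z)) * / (d * d * d / 2)) by (field; lra).
           apply Rmult_le_compat.
           ++ apply Rmult_le_pos; [apply Cmod_ge_0 | apply Rmult_le_pos; apply Cmod_ge_0].
           ++ apply Rlt_le, Rinv_0_lt_compat; lra.
           ++ apply Rmult_le_compat_r; auto. apply Rmult_le_pos; apply Cmod_ge_0.
           ++ apply Rinv_le_contravar; auto.
      * unfold A. right; ring.
    + apply Rmult_le_compat_r; [apply Cmod_ge_0|].
      apply Rlt_le in W2. apply (Rmult_le_compat_l A) in W2; [| lra].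
      replace (A * (e / A)) with e in W2 by (field; lra). auto.
  - intros e He.
    set (A := M * (6 / (d * d * d)) * (2 * PI)).
    assert (HA : 0 < A).
    { unfold A; apply Rmult_lt_0_compat; [apply Rmult_lt_0_compat; [lra |
        apply Rdiv_lt_0_compat; [lra | repeat apply Rmult_lt_0_compat; lra]] | lra]. }
    exists (Rmin (d / 2) (e / A)). split; [apply Rmin_glb_lt; [lra | apply Rdiv_lt_0_compat; auto]|].
    intros w Hw.
    assert (W1 := Rlt_le_trans _ _ _ Hw (Rmin_l _ _)).
    assert (W2 := Rlt_le_trans _ _ _ Hw (Rmin_r _ _)).
    rewrite <- CInt_minus by auto.
    apply Rle_lt_trans with (A * Cmod (w - z)).
    + eapply Rle_trans.
      * apply CInt_bound_const with (M := M * (6 / (d * d * d)) * Cmod (w - z)); [apply twoPI_pos | |].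
        -- auto using cintegrable_minus.
        -- intros t Ht. assert (N1 := circ_sub_neq_0 r t z Hz). assert (N2 := circ_sub_neq_0 r t w (Near w W1)).
           replace (phi t / ((circ r t - w) * (circ r t - w)) - phi t / ((circ r t - z) * (circ r t - z)))%C
             with (phi t * (w - z) * (/ ((circ r t - w) * (circ r t - z) * (circ r t - z))
                + / ((circ r t - w) * (circ r t - w) * (circ r t - z))))%C by (field; auto).
           rewrite !Cmod_mult.
           specialize (LB1 t). specialize (LB2 w t W1). specialize (BM t Ht).
           replace (M * (6 / (d * d * d)) * Cmod (w - z)) with
             (M * Cmod (w - z) * (/ (d * d * d / 2) + / (d * d * d / 4))) by (field; lra).
           apply Rmult_le_compat; [apply Rmult_le_pos; apply Cmod_ge_0 | apply Cmod_ge_0 | |].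
           { apply Rmult_le_compat_r; auto using Cmod_ge_0. }
           eapply Rle_trans; [apply Cmod_triangle|].
           rewrite !Cmod_inv, !Cmod_mult by (auto using Cmult_neq_0).
           set (p := Cmod (circ r t - z)) in *. set (q := Cmod (circ r t - w)) in *.
           assert (0 < d * d * d) by (repeat apply Rmult_lt_0_compat; lra).
           apply Rplus_le_compat; apply Rinv_le_contravar; try lra.
           ++ replace (d * d * d / 2) with (d / 2 * d * d) by field.
              apply Rmult_le_compat; try nra.
           ++ replace (d * d * d / 4) with (d / 2 * (d / 2) * d) by field.
              apply Rmult_le_compat; try nra.
      * unfold A. right; ring.
    + apply (Rmult_lt_compat_l A) in W2; [| lra].
      replace (A * (e / A)) with e in W2 by (field; lra). auto.
Qed.

Section Circle.

Variables (U : C -> Prop) (F dF : C -> C) (r e : R).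
Hypotheses (Hr : 0 < r) (He : 0 < e) (HF : holo U F dF).
Hypothesis HU : forall w, Cmod w < r + e -> U w.

Lemma circle_rcont t : rcont (fun t => F (circ r t)) t.
Proof.
  apply (rcont_comp F (circ r)); [apply rcont_circ|]. eapply cderiv_ccont, HF, HU. rewrite Cmod_circ; lra.
Qed.

Lemma circle_rcont_deriv t : rcont (fun t => dF (circ r t)) t.
Proof.
  apply (rcont_comp dF (circ r)); [apply rcont_circ|]. apply HF, HU. rewrite Cmod_circ; lra.
Qed.

Lemma cauchy_formula_transform (z : C) : Cmod z < r ->
  CInt (fun t => F (circ r t) * circ r t / (circ r t - z))%C 0 (2 * PI) = (2 * PI * F z)%C.
Proof.
  intros Hz. rewrite <- (cauchy_formula U F dF r e z Hr He HF HU Hz).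
  apply CInt_ext; [apply twoPI_pos|]. intros; field. now apply circ_sub_neq_0.
Qed.

Lemma cauchy_formula_deriv (z : C) : Cmod z < r ->
  CInt (fun t => F (circ r t) * circ r t / ((circ r t - z) * (circ r t - z)))%C 0 (2 * PI)
  = (2 * PI * dF z)%C.
Proof.
  intros Hz.
  assert (D := cauchy_transform_holo (fun t => F (circ r t) * circ r t)%C r Hr
    (fun t _ => rcont_mult _ _ _ (circle_rcont t) (rcont_circ r t)) z Hz).
  destruct D as (D & _).
  apply (cderiv_unique (fun z => 2 * PI * F z)%C z).
  - eapply (cderiv_ext_loc _ _ z _ (r - Cmod z)); [lra | | exact D].
    intros w Hw. cbv beta. apply cauchy_formula_transform.
    generalize (Cmod_sub_le w z); lra.
  - apply cderiv_scal, HF, HU. lra.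
Qed.

(** Integration by parts on the circle: the difference of the two integrands is, up to the factor i,
    the derivative of the periodic function F/(w - z). This represents [dF] by its own boundary
    values while it is only known to be continuous, and opens the way to [holo_deriv]. *)
Lemma cauchy_formula_of_deriv (z : C) : Cmod z < r ->
  CInt (fun t => dF (circ r t) * circ r t / (circ r t - z))%C 0 (2 * PI) = (2 * PI * dF z)%C.
Proof.
  intros Hz. rewrite <- cauchy_formula_deriv by auto.
  assert (N := fun t => circ_sub_neq_0 r t z Hz).
  assert (Cz : forall t, rcont (fun t => circ r t - z)%C t).
  { intros; apply rcont_minus; auto using rcont_circ, rcont_const. }
  assert (C1 : forall t, rcont (fun t => dF (circ r t) * circ r t / (circ r t - z))%C t).
  { intros t. apply rcont_div; auto. apply rcont_mult; auto using rcont_circ, circle_rcont_deriv. }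
  assert (C2 : forall t, rcont (fun t => F (circ r t) * circ r t / ((circ r t - z) * (circ r t - z)))%C t).
  { intros t. apply rcont_div; auto using Cmult_neq_0, rcont_mult.
    apply rcont_mult; auto using rcont_circ, circle_rcont. }
  set (f1 := fun t => (dF (circ r t) * circ r t / (circ r t - z))%C) in *.
  set (f2 := fun t => (F (circ r t) * circ r t / ((circ r t - z) * (circ r t - z)))%C) in *.
  assert (E : CInt (fun t => Ci * (f1 t - f2 t))%C 0 (2 * PI) = 0).
  { rewrite (CInt_deriv (fun t => F (circ r t) / (circ r t - z))%C).
    - rewrite circ_period. ring.
    - apply twoPI_pos.
    - intros t Ht. unfold f1, f2.
      eapply rderiv_eq; [| apply rderiv_mult; [apply (rderiv_comp F (circ r)); [apply rderiv_circ | apply HF, HU; rewrite Cmod_circ; lra]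
        | apply (rderiv_comp Cinv (fun t => circ r t - z)%C); [apply rderiv_plus; [apply rderiv_circ| apply rderiv_const] | apply cderiv_inv_id; auto]]].
      cbv beta. field. auto.
    - intros t Ht. apply rcont_mult; [apply rcont_const | apply rcont_minus; auto]. }
  assert (J1 : cintegrable f1 0 (2 * PI)) by (apply cintegrable_cont; auto using twoPI_pos).
  assert (J2 : cintegrable f2 0 (2 * PI)) by (apply cintegrable_cont; auto using twoPI_pos).
  rewrite CInt_scal in E by (apply cintegrable_minus; assumption).
  rewrite CInt_minus in E by assumption.
  set (a := CInt f1 _ _) in *. set (b := CInt f2 _ _) in *.
  assert (Z : (- Ci * (Ci * (a - b)))%C = 0) by (rewrite E; ring).
  apply Ceq_minus. rewrite <- Z, Cmult_assoc. replace (- Ci * Ci)%C with (RtoC 1); [ring|].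
  apply Ceq_of; simpl; ring.
Qed.

(** A maximum principle with a loss: the kernel w/(w - z) is bounded by r/(r - |z|) on the circle.
    At the centre there is no loss, which [growth_exponent_nonneg] exploits. *)
Lemma cauchy_estimate (M : R) (z : C) : Cmod z < r ->
  (forall w, Cmod w = r -> Cmod (F w) <= M) -> Cmod (F z) <= M * (r / (r - Cmod z)).
Proof.
  intros Hz HM. assert (E := cauchy_formula_transform z Hz). assert (P := PI_RGT_0).
  assert (N := fun t => circ_sub_neq_0 r t z Hz).
  assert (B : Cmod (2 * PI * F z) <= M * (r / (r - Cmod z)) * (2 * PI - 0)).
  { rewrite <- E. apply CInt_bound_const; [apply twoPI_pos | |].
    - apply cintegrable_cont; [apply twoPI_pos|]. intros t Ht. apply rcont_div; auto.
      + apply rcont_mult; auto using rcont_circ, circle_rcont.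
      + apply rcont_minus; auto using rcont_circ, rcont_const.
    - intros t Ht. rewrite Cmod_div, Cmod_mult, Cmod_circ by (auto; lra).
      assert (L := circ_dist_ge r t z Hr).
      assert (K := HM (circ r t) (Cmod_circ r t ltac:(lra))).
      unfold Rdiv. rewrite Rmult_assoc.
      apply Rmult_le_compat; auto using Cmod_ge_0.
      + apply Rmult_le_pos; [lra | apply Rlt_le, Rinv_0_lt_compat; lra].
      + apply Rmult_le_compat_l; [lra|]. apply Rinv_le_contravar; lra. }
  rewrite Cmod_mult, <- RtoC_mult, Cmod_R, Rabs_right in B by lra. nra.
Qed.

(** With k = w/(w - z)^2, the integral of F k is 2 PI F'(z), while those of conj(F) k and of k
    vanish. Hence 2 PI F'(z) is the integral of 2 (Re F - M) k; here M - Re F is nonnegative, so its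
    integral is known exactly from the mean value M - Re F(0). *)
Lemma borel_caratheodory (M : R) (z : C) : Cmod z < r ->
  (forall w, Cmod w = r -> Re (F w) <= M) ->
  Cmod (dF z) <= 2 * r * (M - Re (F 0)) / ((r - Cmod z) * (r - Cmod z)).
Proof.
  intros Hz HM. assert (P := PI_RGT_0). assert (Pz := Cmod_ge_0 z).
  assert (N := fun t => circ_sub_neq_0 r t z Hz).
  set (k := fun t => (circ r t / ((circ r t - z) * (circ r t - z)))%C).
  assert (Ck : forall t, rcont k t).
  { intros t. unfold k. apply rcont_div; auto using Cmult_neq_0, rcont_circ.
    apply rcont_mult; apply rcont_minus; auto using rcont_circ, rcont_const. }
  assert (CF := circle_rcont).
  assert (Int : forall f, (forall t, rcont f t) -> cintegrable f 0 (2 * PI)).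
  { intros; apply cintegrable_cont; auto using twoPI_pos. }
  assert (A : CInt (fun t => F (circ r t) * k t)%C 0 (2 * PI) = (2 * PI * dF z)%C).
  { rewrite <- cauchy_formula_deriv by auto. apply CInt_ext; [apply twoPI_pos|].
    intros; unfold k. field; auto. }
  (* On the circle conj(k) equals r^2 w/(r^2 - conj(z) w)^2, which is holomorphic on a larger disc
     and vanishes at 0; the mean value property then applies to its product with F. *)
  assert (B : CInt (fun t => Cconj (F (circ r t)) * k t)%C 0 (2 * PI) = 0).
  { set (V := fun w => U w /\ (RtoC (r * r) - Cconj z * w <> 0)%C).
    assert (N0 : forall w, Cmod w < r + (r - Cmod z) -> (RtoC (r * r) - Cconj z * w <> 0)%C).
    { intros w Hw Z.
      assert (Q : Cmod (RtoC (r * r)) = Cmod (Cconj z * w)).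
      { f_equal. apply (f_equal (fun v => v + Cconj z * w)%C) in Z.
        replace (RtoC (r * r) - Cconj z * w + Cconj z * w)%C with (RtoC (r * r)) in Z by ring.
        rewrite Z. ring. }
      rewrite Cmod_R, Cmod_mult, Cmod_conj, Rabs_right in Q by nra.
      generalize (Cmod_ge_0 w). nra. }
    set (D := fun w : C => (RtoC (r * r) - Cconj z * w)%C).
    assert (HD : holo V D (fun w => - Cconj z)%C).
    { intros w Hw. split; [| apply ccont_const].
      eapply cderiv_eq; [| apply cderiv_minus; [apply cderiv_const | apply cderiv_scal, cderiv_id]]. ring. }
    assert (HG := holo_mult _ _ _ _ _ (holo_sub U V _ _ (fun w H => proj1 H) HF)
       (holo_div V _ _ _ _ (holo_scal V (RtoC (r * r)) _ _ (holo_id V)) (holo_mult _ _ _ _ _ HD HD)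
         (fun w Hw => Cmult_neq_0 _ _ (proj2 Hw) (proj2 Hw)))).
    assert (EG := mean_value_circle _ _ _ r (Rmin e (r - Cmod z)) Hr ltac:(apply Rmin_glb_lt; lra) HG).
    assert (EG' := EG (fun w Hw => conj
        (HU w (Rlt_le_trans _ _ _ Hw (Rplus_le_compat_l _ _ _ (Rmin_l _ _))))
        (N0 w (Rlt_le_trans _ _ _ Hw (Rplus_le_compat_l _ _ _ (Rmin_r _ _)))))).
    clear EG. cbv beta in EG'.
    replace (2 * PI * (F 0 * (RtoC (r * r) * 0 / (D 0 * D 0))))%C with (RtoC 0) in EG' by (unfold Cdiv; ring).
    rewrite (CInt_ext _ (fun t => Cconj (Cconj (F (circ r t)) * k t))) in EG'.
    - rewrite CInt_conj in EG' by (apply Int; intros; apply rcont_mult; auto; apply rcont_conj; auto).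
      rewrite <- (Cconj_conj (CInt _ _ _)), EG'. apply Ceq_of; simpl; ring.
    - apply twoPI_pos.
    - intros t Ht. rewrite Cmult_conj, Cconj_conj. f_equal. unfold k, D.
      assert (Nc := circ_neq_0 r t Hr).
      assert (Ec := conj_circ r t Hr).
      assert (N2 : Cconj (circ r t) <> 0).
      { intros Z. apply Nc. rewrite <- (Cconj_conj (circ r t)), Z. apply Ceq_of; simpl; ring. }
      assert (E2 : RtoC (r * r) = (circ r t * Cconj (circ r t))%C) by (rewrite Ec; field; auto).
      assert (N3 : (Cconj (circ r t) - Cconj z <> 0)%C).
      { intros Z. apply (N t). rewrite <- Cminus_conj in Z. rewrite <- (Cconj_conj (circ r t - z)), Z. apply Ceq_of; simpl; ring. }
      rewrite Cdiv_conj, Cmult_conj, Cminus_conj by auto using Cmult_neq_0.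
      rewrite E2. field. repeat split; auto.
      replace (circ r t * Cconj (circ r t) - Cconj z * circ r t)%C with
        (circ r t * (Cconj (circ r t) - Cconj z))%C by ring.
      now apply Cmult_neq_0. }
  (* The kernel mass is constant in z, and its derivative in z is the integral of k. *)
  assert (K : CInt k 0 (2 * PI) = 0).
  { assert (D := cauchy_transform_holo (fun t => circ r t) r Hr (fun t _ => rcont_circ r t) z Hz).
    destruct D as (D & _).
    apply (cderiv_unique (fun _ => RtoC (2 * PI)) z); [| apply cderiv_const].
    eapply (cderiv_ext_loc _ _ z _ (r - Cmod z)); [lra | | exact D].
    intros w Hw. cbv beta. apply cauchy_kernel_mass; auto.
    generalize (Cmod_sub_le w z); lra. }
  assert (E : CInt (fun t => RtoC (2 * (Re (F (circ r t)) - M)) * k t)%C 0 (2 * PI) = (2 * PI * dF z)%C).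
  { rewrite (CInt_ext _ (fun t => F (circ r t) * k t + Cconj (F (circ r t)) * k t - RtoC (2 * M) * k t)%C); [| apply twoPI_pos |].
    - assert (J1 : cintegrable (fun t => F (circ r t) * k t)%C 0 (2 * PI))
        by (apply Int; intros; apply rcont_mult; auto).
      assert (J2 : cintegrable (fun t => Cconj (F (circ r t)) * k t)%C 0 (2 * PI))
        by (apply Int; intros; apply rcont_mult; auto; apply rcont_conj; auto).
      rewrite CInt_minus, CInt_plus, CInt_scal, A, B, K; auto; [ring | |].
      + apply cintegrable_plus; assumption.
      + apply cintegrable_scal; auto.
    - intros t _. replace (RtoC (2 * (Re (F (circ r t)) - M))) with
        (F (circ r t) + Cconj (F (circ r t)) - RtoC (2 * M))%C; [ring|].
      apply Ceq_of; simpl; unfold Re, Im; ring. }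
  assert (MV := mean_value_circle U F dF r e Hr He HF HU).
  apply (f_equal Re) in MV. rewrite <- RtoC_mult, re_scal_l in MV.
  change (Re (CInt (fun t => F (circ r t)) 0 (2 * PI))) with
    (RInt (fun t => Re (F (circ r t))) 0 (2 * PI)) in MV.
  assert (IR : ex_RInt (fun t => Re (F (circ r t))) 0 (2 * PI)) by (apply (Int _ CF)).
  set (q := r / ((r - Cmod z) * (r - Cmod z))).
  assert (Hq : 0 < q) by (apply Rdiv_lt_0_compat; nra).
  assert (G : Cmod (2 * PI * dF z) <= RInt (fun t => 2 * q * (M - Re (F (circ r t)))) 0 (2 * PI)).
  { rewrite <- E. apply CInt_bound; [apply twoPI_pos | | |].
    - apply Int. intros t. apply rcont_mult; auto. apply rcont_RtoC.
      apply (continuous_scal_r 2 (fun t => Re (F (circ r t)) - M)).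
      apply (continuous_minus (fun t => Re (F (circ r t))) (fun _ => M)); [apply rcont_re; auto | apply continuous_const].
    - apply (ex_RInt_scal (fun t => M - Re (F (circ r t)))).
      apply (ex_RInt_minus (fun _ => M) (fun t => Re (F (circ r t)))); auto. apply ex_RInt_const.
    - intros t _. rewrite Cmod_mult, Cmod_R.
      specialize (HM (circ r t) (Cmod_circ r t ltac:(lra))).
      rewrite Rabs_left1 by lra. unfold k.
      rewrite Cmod_div, Cmod_mult, Cmod_circ by (auto using Cmult_neq_0; lra).
      assert (L := circ_dist_ge r t z Hr).
      replace (2 * q * (M - Re (F (circ r t)))) with (- (2 * (Re (F (circ r t)) - M)) * q) by ring.
      apply Rmult_le_compat_l; [lra|]. unfold q, Rdiv. apply Rmult_le_compat_l; [lra|].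
      apply Rinv_le_contravar; [nra|]. apply Rmult_le_compat; lra. }
  rewrite (RInt_scal (V := R_CompleteNormedModule) (fun t => M - Re (F (circ r t)))) in G by
    (apply (ex_RInt_minus (fun _ => M) (fun t => Re (F (circ r t)))); auto; apply ex_RInt_const).
  rewrite (RInt_minus (V := R_CompleteNormedModule) (fun _ => M) (fun t => Re (F (circ r t)))) in G by
    (auto; apply ex_RInt_const).
  rewrite MV, RInt_const in G.
  unfold scal, minus, plus, opp in G; simpl in G; unfold mult in G; simpl in G.
  rewrite Cmod_mult, <- RtoC_mult, Cmod_R, Rabs_right in G by lra.
  replace (2 * r * (M - Re (F 0)) / ((r - Cmod z) * (r - Cmod z))) with (2 * q * (M - Re (F 0))) by (unfold q; field; lra).
  apply (Rmult_le_reg_l (2 * PI)); [lra|].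
  eapply Rle_trans; [apply G|]. right; ring.
Qed.

End Circle.

(** By [cauchy_formula_of_deriv] the derivative is locally the Cauchy transform of its own boundary
    values. *)
Lemma holo_deriv (U : C -> Prop) F dF : copen U -> holo U F dF -> holo U dF (cder dF).
Proof.
  intros HU HF. apply holo_cder. intros z Hz. destruct (HU z Hz) as (R0 & HR & HB).
  set (r := R0 / 2). assert (Hr : 0 < r) by (unfold r; lra).
  assert (HG := holo_shift U z F dF HF).
  assert (HV : forall w, Cmod w < r + r -> U (z + w)%C).
  { intros w Hw. apply HB. replace (z + w - z)%C with w by ring. unfold r in Hw; lra. }
  assert (T := cauchy_transform_holo (fun t => dF (z + circ r t) * circ r t / (2 * PI))%C r Hr).
  exists r. eexists. split; auto. apply holo_unshift.
  eapply holo_ext; [| | apply T].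
  - intros w Hw. destruct (open_ball 0 r w) as (d & Hd & Hd'); [now replace (w - 0)%C with w by ring|].
    exists d; split; auto. intros v Hv. specialize (Hd' v Hv). now replace (v - 0)%C with v in Hd' by ring.
  - intros w Hw. cbv beta.
    assert (P : RtoC PI <> 0) by (intros E; apply RtoC_inj in E; generalize PI_RGT_0; lra).
    assert (P2 : RtoC 2 <> 0) by (intros E; apply RtoC_inj in E; lra).
    assert (E := cauchy_formula_of_deriv _ _ _ r r Hr Hr HG HV w Hw). cbv beta in E.
    replace (dF (z + w)%C) with (/ (2 * PI) * (2 * PI * dF (z + w)))%C by (field; auto).
    rewrite <- E, <- CInt_scal.
    + apply CInt_ext; [apply twoPI_pos|]. intros t Ht. field. repeat split; auto.
      now apply circ_sub_neq_0.
    + apply cintegrable_cont; [apply twoPI_pos|]. intros t Ht.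
      apply rcont_div; [now apply circ_sub_neq_0 | | apply rcont_minus; auto using rcont_circ, rcont_const].
      apply rcont_mult; [| apply rcont_circ].
      apply (circle_rcont_deriv _ _ _ r r Hr Hr HG HV t).
  - intros t Ht. apply rcont_mult; [| apply rcont_const].
    apply rcont_mult; [| apply rcont_circ].
    apply (circle_rcont_deriv _ _ _ r r Hr Hr HG HV t).
Qed.

(** Removable singularity. Around the zero, with w measured from it and c on a small circle, c/(c -
    w) - 1 = w/(c - w); subtracting Cauchy's formulas at w and at 0 and dividing by w shows that the
    quotient is the Cauchy transform of F/(2 PI). At w = 0 the same transform gives F', which is why
    the quotient is filled in with [dF rho]. *)
Lemma holo_divide (U : C -> Prop) F dF (rho : C) : copen U -> holo U F dF -> U rho -> F rho = 0 ->
  let F1 := fun w => if Ceq_dec w rho then dF rho else (F w / (w - rho))%C in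
  holo U F1 (cder F1).
Proof.
  intros HU HF Hrho E0 F1. apply holo_cder. intros z Hz.
  destruct (Ceq_dec z rho) as [-> | N].
  - destruct (HU rho Hz) as (R0 & HR & HB).
    set (r := R0 / 2). assert (Hr : 0 < r) by (unfold r; lra).
    assert (HG := holo_shift U rho F dF HF).
    assert (HV : forall w, Cmod w < r + r -> U (rho + w)%C).
    { intros w Hw. apply HB. replace (rho + w - rho)%C with w by ring. unfold r in Hw; lra. }
    assert (CF := circle_rcont _ _ _ r r Hr Hr HG HV). cbv beta in CF.
    assert (T := cauchy_transform_holo (fun t => F (rho + circ r t) / (2 * PI))%C r Hr).
    exists r. eexists. split; auto. apply holo_unshift.
    eapply holo_ext; [| | apply T].
    + intros w Hw. destruct (open_ball 0 r w) as (d & Hd & Hd'); [now replace (w - 0)%C with w by ring|].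
      exists d; split; auto. intros v Hv. specialize (Hd' v Hv). now replace (v - 0)%C with v in Hd' by ring.
    + intros w Hw. cbv beta. unfold F1.
      assert (P : RtoC PI <> 0) by (intros E; apply RtoC_inj in E; generalize PI_RGT_0; lra).
      assert (P2 : RtoC 2 <> 0) by (intros E; apply RtoC_inj in E; lra).
      assert (Ck : forall t, rcont (fun t => circ r t - w)%C t).
      { intros; apply rcont_minus; auto using rcont_circ, rcont_const. }
      assert (Nw := fun t => circ_sub_neq_0 r t w Hw).
      destruct (Ceq_dec (rho + w) rho) as [Z | Z].
      * assert (w = 0) by (replace w with ((rho + w) - rho)%C by ring; rewrite Z; ring). subst w.
        assert (E := cauchy_formula_deriv _ _ _ r r Hr Hr HG HV 0 Hw). cbv beta in E.
        rewrite Cplus_0_r in E.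
        replace (dF rho) with (/ (2 * PI) * (2 * PI * dF rho))%C by (field; auto).
        rewrite <- E, <- CInt_scal.
        -- apply CInt_ext; [apply twoPI_pos|]. intros t Ht. assert (Nc := circ_neq_0 r t Hr).
           field. auto.
        -- apply cintegrable_cont; [apply twoPI_pos|]. intros t Ht.
           apply rcont_div; auto using Cmult_neq_0, rcont_mult, rcont_circ.
      * assert (Nz : w <> 0) by (intros ->; apply Z; ring).
        replace (rho + w - rho)%C with w by ring.
        assert (E := cauchy_formula_transform _ _ _ r r Hr Hr HG HV w Hw).
        assert (E' := cauchy_formula_transform _ _ _ r r Hr Hr HG HV 0 ltac:(rewrite Cmod_0; auto)).
        cbv beta in E, E'. rewrite Cplus_0_r, E0, Cmult_0_r in E'.
        assert (I1 : cintegrable (fun t => F (rho + circ r t) * circ r t / (circ r t - w))%C 0 (2 * PI)).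
        { apply cintegrable_cont; [apply twoPI_pos|]. intros t Ht.
          apply rcont_div; auto using rcont_mult, rcont_circ. }
        assert (I2 : cintegrable (fun t => F (rho + circ r t) * circ r t / (circ r t - 0))%C 0 (2 * PI)).
        { apply cintegrable_cont; [apply twoPI_pos|]. intros t Ht. assert (Nc := circ_neq_0 r t Hr).
          apply rcont_div; auto using rcont_mult, rcont_circ.
          - now replace (circ r t - 0)%C with (circ r t) by ring.
          - apply rcont_minus; auto using rcont_circ, rcont_const. }
        replace (F (rho + w)%C / w)%C with (/ (2 * PI * w) * (2 * PI * F (rho + w) - 0))%C by (field; auto).
        rewrite <- E, <- E', <- CInt_minus, <- CInt_scal; auto using cintegrable_minus.
        apply CInt_ext; [apply twoPI_pos|]. intros t Ht. assert (Nc := circ_neq_0 r t Hr).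
        field. repeat split; auto.
    + intros t Ht. apply rcont_mult; [apply CF | apply rcont_const].
  - destruct (HU z Hz) as (R0 & HR & HB).
    assert (Pn : 0 < Cmod (z - rho)) by (apply Cmod_pos, Cminus_eq_contra, N).
    set (r := Rmin R0 (Cmod (z - rho))).
    assert (Hr : 0 < r) by (apply Rmin_glb_lt; auto).
    assert (Nr : forall w, Cmod (w - z) < r -> w <> rho).
    { intros w Hw ->. rewrite Cmod_sub_sym in Hw. generalize (Rmin_r R0 (Cmod (z - rho))). fold r. lra. }
    exists r. eexists. split; auto.
    eapply (holo_ext _ (fun w => F w / (w - rho))%C); [apply open_ball | |].
    + intros w Hw. unfold F1. destruct (Ceq_dec w rho); [exfalso; eapply Nr; eauto | auto].
    + apply (holo_div _ F (fun w => w - rho)%C dF (fun w => 1 - 0)%C).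
      * intros w Hw. apply HF, HB. eapply Rlt_le_trans; [apply Hw | apply Rmin_l].
      * intros w Hw. split; [apply cderiv_minus; [apply cderiv_id | apply cderiv_const] | apply ccont_const].
      * intros w Hw. apply Cminus_eq_contra. eapply Nr; eauto.
Qed.

Lemma ccvg_unique u l m : ccvg u l -> ccvg u m -> l = m.
Proof.
  intros Hl Hm. apply NNPP; intros N.
  assert (P : 0 < Cmod (l - m)) by (apply Cmod_pos, Cminus_eq_contra, N).
  destruct (Hl (Cmod (l - m) / 2)) as (N1 & H1); [lra|].
  destruct (Hm (Cmod (l - m) / 2)) as (N2 & H2); [lra|].
  specialize (H1 (max N1 N2) (Nat.le_max_l _ _)). specialize (H2 (max N1 N2) (Nat.le_max_r _ _)).
  set (v := u (max N1 N2)) in *.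
  assert (E : Cmod (l - m) <= Cmod (v - m) + Cmod (v - l)).
  { replace (l - m)%C with ((v - m) - (v - l))%C by ring. apply Cmod_minus_le. }
  lra.
Qed.

Lemma Cmod_le_eps (z : C) K : (forall e, 0 < e -> Cmod z <= e * K) -> z = 0.
Proof.
  intros H. apply Cmod_eq_0. destruct (Rle_lt_or_eq_dec _ _ (Cmod_ge_0 z)) as [P|P]; auto.
  exfalso. assert (K0 := Rabs_pos K).
  specialize (H (Cmod z / (2 * (Rabs K + 1))) ltac:(apply Rdiv_lt_0_compat; lra)).
  assert (Q : Cmod z / (2 * (Rabs K + 1)) * K <= Cmod z / (2 * (Rabs K + 1)) * (Rabs K + 1)).
  { apply Rmult_le_compat_l; [apply Rlt_le, Rdiv_lt_0_compat; lra | generalize (Rle_abs K); lra]. }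
  replace (Cmod z / (2 * (Rabs K + 1)) * (Rabs K + 1)) with (Cmod z / 2) in Q by (field; lra). lra.
Qed.

Lemma ccvg_le u l e N : (forall n, (N <= n)%nat -> Cmod (u n) <= e) -> ccvg u l -> Cmod l <= e.
Proof.
  intros H Hl. apply Rnot_lt_le; intros P.
  destruct (Hl (Cmod l - e)) as (N1 & H1); [lra|].
  specialize (H1 (max N N1) (Nat.le_max_r _ _)). specialize (H (max N N1) (Nat.le_max_l _ _)).
  generalize (Cmod_sub_le l (u (max N N1))). rewrite Cmod_sub_sym. lra.
Qed.

Definition unif_cvg (U : C -> Prop) (Fn : nat -> C -> C) (F : C -> C) : Prop :=
  forall e, 0 < e -> exists N, forall n z, (N <= n)%nat -> U z -> Cmod (Fn n z - F z) <= e.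

(** The limit is continuous on the circle of radius r, so its Cauchy transform makes sense, and
    passing to the limit in Cauchy's formulas for [Fn] and [dFn] identifies the limit and its
    derivative. The radius r + r leaves room for the circle. *)
Lemma weierstrass_disc Fn dFn F r : 0 < r ->
  (forall n, holo (fun z => Cmod z < r + r) (Fn n) (dFn n)) ->
  unif_cvg (fun z => Cmod z < r + r) Fn F ->
  exists dF, holo (fun z => Cmod z < r) F dF /\
    forall z, Cmod z < r -> ccvg (fun n => dFn n z) (dF z).
Proof.
  intros Hr HF Hcv. assert (Pp := PI_RGT_0).
  assert (Cc : forall t, rcont (fun t => F (circ r t)) t).
  { intros t e He. destruct (Hcv (e / 3) ltac:(lra)) as (N & HN).
    destruct (circle_rcont _ _ _ r r Hr Hr (HF N) (fun w H => H) t (e / 3) ltac:(lra)) as (d & Hd & H).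
    exists d; split; auto. intros u Hu. specialize (H u Hu). cbv beta in H.
    assert (B : forall t, Cmod (Fn N (circ r t) - F (circ r t)) <= e / 3).
    { intros s. apply HN; auto. rewrite Cmod_circ; lra. }
    assert (B1 := B u). assert (B2 := B t). rewrite Cmod_sub_sym in B1.
    replace (F (circ r u) - F (circ r t))%C with ((F (circ r u) - Fn N (circ r u)) +
      (Fn N (circ r u) - Fn N (circ r t)) + (Fn N (circ r t) - F (circ r t)))%C by ring.
    eapply Rle_lt_trans; [apply Cmod_triangle|].
    generalize (Cmod_triangle (F (circ r u) - Fn N (circ r u)) (Fn N (circ r u) - Fn N (circ r t))). lra. }
  assert (P : RtoC PI <> 0) by (intros E; apply RtoC_inj in E; lra).
  assert (P2 : RtoC 2 <> 0) by (intros E; apply RtoC_inj in E; lra).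
  set (phi := fun t => (/ (2 * PI) * (F (circ r t) * circ r t))%C).
  assert (Cphi : forall t, 0 <= t <= 2 * PI -> rcont phi t).
  { intros t _. apply rcont_mult; [apply rcont_const|]. apply rcont_mult; auto using rcont_circ. }
  assert (Ck : forall z t, rcont (fun t => circ r t - z)%C t).
  { intros; apply rcont_minus; auto using rcont_circ, rcont_const. }
  assert (Cn : forall n t, rcont (fun t => Fn n (circ r t)) t).
  { intros n. apply (circle_rcont _ _ _ r r Hr Hr (HF n) (fun w H => H)). }
  assert (Mod2 : Cmod (/ (2 * PI)) = / (2 * PI)).
  { rewrite <- RtoC_mult, <- RtoC_inv by lra. rewrite Cmod_R. apply Rabs_right.
    apply Rle_ge, Rlt_le, Rinv_0_lt_compat; lra. }
  assert (Diff : forall n z (q : R -> C) m, Cmod z < r ->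
     (forall t, rcont q t) -> (forall t, Cmod (q t) <= m) -> forall e, 0 <= e ->
     (forall w, Cmod w < r + r -> Cmod (Fn n w - F w) <= e) ->
     Cmod (/ (2 * PI) * CInt (fun t => Fn n (circ r t) * circ r t * q t)%C 0 (2 * PI)
        - CInt (fun t => phi t * q t)%C 0 (2 * PI)) <= e * (r * m)).
  { intros n z q m Hz Cq Bq e He HB.
    assert (J1 : cintegrable (fun t => Fn n (circ r t) * circ r t * q t)%C 0 (2 * PI)).
    { apply cintegrable_cont; [apply twoPI_pos|]. intros t Ht.
      apply rcont_mult; [apply rcont_mult; [apply Cn | apply rcont_circ] | apply Cq]. }
    assert (J2 : cintegrable (fun t => phi t * q t)%C 0 (2 * PI)).
    { apply cintegrable_cont; [apply twoPI_pos|]. intros t Ht. apply rcont_mult; auto. }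
    rewrite <- CInt_scal by assumption. rewrite <- CInt_minus by (try assumption; apply cintegrable_scal; assumption).
    replace (e * (r * m)) with (/ (2 * PI) * (e * (r * m)) * (2 * PI - 0)) by (field; lra).
    apply CInt_bound_const; [apply twoPI_pos | |].
    - apply cintegrable_minus; [apply cintegrable_scal|]; assumption.
    - intros t Ht. unfold phi.
      replace (/ (2 * PI) * (Fn n (circ r t) * circ r t * q t) - / (2 * PI) * (F (circ r t) * circ r t) * q t)%C
        with (/ (2 * PI) * ((Fn n (circ r t) - F (circ r t)) * (circ r t * q t)))%C by ring.
      rewrite !Cmod_mult, Mod2, Cmod_circ by lra.
      apply Rmult_le_compat_l; [apply Rlt_le, Rinv_0_lt_compat; lra|].
      apply Rmult_le_compat; [apply Cmod_ge_0 | apply Rmult_le_pos; [lra | apply Cmod_ge_0] | |].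
      + apply HB. rewrite Cmod_circ; lra.
      + apply Rmult_le_compat_l; auto; lra. }
  assert (Inv : forall z t, Cmod z < r -> Cmod (/ (circ r t - z)) <= / (r - Cmod z)).
  { intros z t Hz. rewrite Cmod_inv by (now apply circ_sub_neq_0).
    apply Rinv_le_contravar; [lra | now apply circ_dist_ge]. }
  eexists. split.
  - eapply holo_ext; [| | apply (cauchy_transform_holo phi r Hr Cphi)].
    + intros w Hw. destruct (open_ball 0 r w) as (d & Hd & Hd'); [now replace (w - 0)%C with w by ring|].
      exists d; split; auto. intros v Hv. specialize (Hd' v Hv). now replace (v - 0)%C with v in Hd' by ring.
    + intros z Hz. cbv beta. symmetry. apply Ceq_minus.
      apply (Cmod_le_eps _ (1 + r * / (r - Cmod z))). intros e He.
      destruct (Hcv e He) as (N & HN).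
      assert (D := Diff N z (fun t => / (circ r t - z))%C (/ (r - Cmod z)) Hz).
      assert (D' := D (fun t => rcont_inv _ t (circ_sub_neq_0 r t z Hz) (Ck z t)) (fun t => Inv z t Hz) e ltac:(lra)
         (fun w Hw => HN N w (le_n N) Hw)). clear D.
      assert (E := cauchy_formula_transform _ _ _ r r Hr Hr (HF N) (fun w H => H) z Hz).
      cbv beta in D'. unfold Cdiv in E. rewrite E in D'.
      replace (/ (2 * PI) * (2 * PI * Fn N z))%C with (Fn N z) in D' by (field; auto).
      assert (B := HN N z (le_n N) ltac:(lra)). rewrite Cmod_sub_sym in B.
      unfold Cdiv. set (I := CInt _ _ _) in *.
      replace (F z - I)%C with ((F z - Fn N z) + (Fn N z - I))%C by ring.
      eapply Rle_trans; [apply Cmod_triangle|]. lra.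
  - intros z Hz e He.
    set (m := / (r - Cmod z) * / (r - Cmod z)).
    assert (Hm : 0 < m) by (unfold m; apply Rmult_lt_0_compat; apply Rinv_0_lt_compat; lra).
    assert (Hrm : 0 < r * m) by nra.
    destruct (Hcv (e / (2 * (r * m))) ltac:(apply Rdiv_lt_0_compat; lra)) as (N & HN).
    exists N. intros n Hn.
    assert (D := Diff n z (fun t => / ((circ r t - z) * (circ r t - z)))%C m Hz).
    assert (E := cauchy_formula_deriv _ _ _ r r Hr Hr (HF n) (fun w H => H) z Hz).
    cbv beta in D. unfold Cdiv in E |- *. rewrite E in D.
    replace (/ (2 * PI) * (2 * PI * dFn n z))%C with (dFn n z) in D by (field; auto).
    eapply Rle_lt_trans; [apply (D) with (e := e / (2 * (r * m)))|].
    + intros t. apply rcont_inv; [apply Cmult_neq_0; now apply circ_sub_neq_0 | apply rcont_mult; auto].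
    + intros t. assert (Nz := circ_sub_neq_0 r t z Hz).
      replace (/ ((circ r t - z) * (circ r t - z)))%C with (/ (circ r t - z) * / (circ r t - z))%C by (field; auto).
      rewrite Cmod_mult. apply Rmult_le_compat; auto using Cmod_ge_0.
    + apply Rlt_le, Rdiv_lt_0_compat; lra.
    + intros w Hw. apply HN; auto.
    + replace (e / (2 * (r * m)) * (r * m)) with (e / 2) by (field; split; lra). lra.
Qed.

Lemma weierstrass (U : C -> Prop) Fn dFn F :
  (forall n, holo U (Fn n) (dFn n)) ->
  (forall z, U z -> exists r, 0 < r /\ (forall w, Cmod (w - z) < r -> U w) /\
     unif_cvg (fun w => Cmod (w - z) < r) Fn F) ->
  holo U F (cder F) /\ forall z, U z -> ccvg (fun n => dFn n z) (cder F z).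
Proof.
  intros HF Hcv.
  assert (L : forall z, U z -> exists r dF, 0 < r /\ holo (fun w => Cmod (w - z) < r) F dF /\
     forall w, Cmod (w - z) < r -> ccvg (fun n => dFn n w) (dF w)).
  { intros z Hz. destruct (Hcv z Hz) as (R0 & HR & HB & Hu).
    set (r := R0 / 2). assert (Hr : 0 < r) by (unfold r; lra).
    destruct (weierstrass_disc (fun n w => Fn n (z + w)%C) (fun n w => dFn n (z + w)%C)
      (fun w => F (z + w)%C) r Hr) as (dF & H1 & H2).
    - intros n. eapply holo_sub; [| apply holo_shift, HF]. intros w Hw. apply HB.
      replace (z + w - z)%C with w by ring. unfold r in Hw; lra.
    - intros e He. destruct (Hu e He) as (N & HN). exists N. intros n w Hn Hw. apply HN; auto.
      replace (z + w - z)%C with w by ring. unfold r in Hw; lra.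
    - exists r, (fun w => dF (w - z)%C). split; auto. split; [now apply holo_unshift|].
      intros w Hw. specialize (H2 (w - z)%C Hw). now replace (z + (w - z))%C with w in H2 by ring. }
  split.
  - apply holo_cder. intros z Hz. destruct (L z Hz) as (r & dF & Hr & H1 & _). now exists r, dF.
  - intros z Hz. destruct (L z Hz) as (r & dF & Hr & H1 & H2).
    assert (Z : Cmod (z - z) < r) by (rewrite Cmod_self; auto).
    rewrite (cder_unique F z (dF z)); auto. apply H1; auto.
Qed.

(** The integral of g along the segment from c to z. Along a line in z it is differentiated by the
    product rule and under the integral sign; an integration by parts in u recombines both
    contributions into g at the moving end point. *)
Lemma primitive_star (U : C -> Prop) g dg (c : C) : copen U -> U c ->
  (forall z u, U z -> 0 <= u <= 1 -> U (c + RtoC u * (z - c))%C) -> holo U g dg ->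
  holo U (fun z => (z - c) * CInt (fun u => g (c + RtoC u * (z - c))%C) 0 1)%C g.
Proof.
  intros HU Hc Hs Hg z Hz. assert (Cg : forall w, U w -> ccont g w) by (intros; eapply holo_ccont; eauto).
  split; auto.
  destruct (HU z Hz) as (d & Hd & HB).
  apply (cderiv_of_segments _ g z d Hd); auto.
  intros h v Hh Hv.
  set (zv := (z + RtoC v * h)%C).
  assert (Uzv : U zv).
  { apply HB. unfold zv. replace (z + v * h - z)%C with (RtoC v * h)%C by ring.
    rewrite Cmod_mult, Cmod_R, Rabs_right by lra. generalize (Cmod_ge_0 h). nra. }
  destruct (HU c Hc) as (d1 & Hd1 & HB1). destruct (HU zv Uzv) as (d2 & Hd2 & HB2).
  (* A bounds the length of the segments involved. The radius r is so small that parameters u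
     slightly below 0 stay near c and those slightly above 1 stay near the end point, both inside
     balls contained in U; star-shapedness covers the rest. *)
  set (A := Cmod h + Cmod (zv - c) + 1).
  assert (HA : 0 < A) by (unfold A; generalize (Cmod_ge_0 h) (Cmod_ge_0 (zv - c)); lra).
  set (r := Rmin 1 (Rmin d1 d2 / (2 * A + 1))).
  assert (Hr : 0 < r).
  { apply Rmin_glb_lt; [lra|]. apply Rdiv_lt_0_compat; [apply Rmin_glb_lt; auto | lra]. }
  assert (Hr1 : r <= 1) by apply Rmin_l.
  assert (HrA : r * (2 * A) < Rmin d1 d2).
  { apply Rlt_le_trans with (r * (2 * A + 1)); [nra|].
    apply Rle_trans with (Rmin d1 d2 / (2 * A + 1) * (2 * A + 1)).
    - apply Rmult_le_compat_r; [lra | apply Rmin_r].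
    - right; field; lra. }
  assert (Dir : forall v', (z + RtoC v' * h - c = (zv - c) + RtoC (v' - v) * h)%C).
  { intros v'. unfold zv. rewrite RtoC_minus. ring. }
  assert (Reg : forall v' u, Rabs (v' - v) < r -> 0 - r < u < 1 + r -> U (c + RtoC u * (z + RtoC v' * h - c))%C).
  { intros v' u Hv' Hu. rewrite Dir.
    assert (Sz : Cmod ((zv - c) + RtoC (v' - v) * h) <= A).
    { eapply Rle_trans; [apply Cmod_triangle|]. rewrite Cmod_mult, Cmod_R. unfold A.
      generalize (Cmod_ge_0 h) (Rabs_pos (v' - v)). nra. }
    assert (Uz' : U (c + ((zv - c) + RtoC (v' - v) * h))%C).
    { apply HB2. replace (c + (zv - c + RtoC (v' - v) * h) - zv)%C with (RtoC (v' - v) * h)%C by ring.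
      rewrite Cmod_mult, Cmod_R. apply Rle_lt_trans with (r * A).
      - apply Rmult_le_compat; try lra; auto using Rabs_pos, Cmod_ge_0.
        unfold A. generalize (Cmod_ge_0 (zv - c)). lra.
      - generalize (Rmin_r d1 d2). nra. }
    destruct (Rlt_or_le u 0) as [N|N].
    - apply HB1. replace (c + RtoC u * (zv - c + RtoC (v' - v) * h) - c)%C with
        (RtoC u * (zv - c + RtoC (v' - v) * h))%C by ring.
      rewrite Cmod_mult, Cmod_R, Rabs_left by auto. apply Rle_lt_trans with (r * A).
      + apply Rmult_le_compat; try lra; auto using Cmod_ge_0.
      + generalize (Rmin_l d1 d2). nra.
    - destruct (Rlt_or_le 1 u) as [N1|N1].
      + apply HB2. replace (c + RtoC u * (zv - c + RtoC (v' - v) * h) - zv)%C with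
          (RtoC (u - 1) * (zv - c + RtoC (v' - v) * h) + RtoC (v' - v) * h)%C by (rewrite (RtoC_minus u 1); ring).
        eapply Rle_lt_trans; [apply Cmod_triangle|]. rewrite !Cmod_mult, !Cmod_R, (Rabs_right (u - 1)) by lra.
        apply Rle_lt_trans with (r * A + r * A).
        * apply Rplus_le_compat; apply Rmult_le_compat; try lra; auto using Rabs_pos, Cmod_ge_0.
          unfold A. generalize (Cmod_ge_0 (zv - c)). lra.
        * generalize (Rmin_r d1 d2). nra.
      + assert (S := Hs _ u Uz' (conj N N1)).
        now replace (c + (zv - c + RtoC (v' - v) * h) - c)%C with (zv - c + RtoC (v' - v) * h)%C in S by ring. }
  assert (Zr : Rabs (v - v) < r) by (rewrite Rminus_diag, Rabs_R0; auto).
  set (I := fun v' => CInt (fun u => g (c + RtoC u * (z + RtoC v' * h - c))%C) 0 1).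
  set (dI := CInt (fun u => dg (c + RtoC u * (zv - c)) * (RtoC u * h))%C 0 1).
  assert (CL : forall v' t, rcont (fun u => c + RtoC u * (z + RtoC v' * h - c))%C t).
  { intros. eapply rderiv_rcont. apply rderiv_line. }
  assert (DI : rderiv I v dI).
  { apply (rderiv_CInt (fun v' u => g (c + RtoC u * (z + RtoC v' * h - c))%C)
      (fun v' u => dg (c + RtoC u * (z + RtoC v' * h - c)) * (RtoC u * h))%C 0 1 v r); auto; try lra.
    - intros v' t Hv' Ht.
      apply (rderiv_comp g (fun w => c + RtoC t * (z + RtoC w * h - c))%C); [| now apply Hg, Reg].
      apply (rderiv_ext (fun w => (c + RtoC t * (z - c)) + RtoC w * (RtoC t * h))%C); [intros; ring|].
      apply rderiv_line.
    - intros t Ht. apply ccont2_mult.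
      + apply (ccont2_comp dg (fun v' u => c + RtoC u * (z + RtoC v' * h - c))%C).
        * apply ccont2_plus; [apply ccont2_snd, rcont_const|].
          apply ccont2_mult.
          -- apply (ccont2_snd RtoC). apply rcont_RtoC, continuous_id.
          -- apply (ccont2_fst (fun v' => z + RtoC v' * h - c)%C).
             apply rcont_minus; [| apply rcont_const]. eapply rderiv_rcont, rderiv_line.
        * apply Hg, Reg; auto; lra.
      + apply (ccont2_snd (fun u => RtoC u * h)%C). apply rcont_mult; [apply rcont_RtoC, continuous_id | apply rcont_const].
    - intros v' t Hv' Ht. apply (rcont_comp g); auto. apply Cg, Reg; auto; lra. }
  (* The sum under the integral is the u-derivative of u g(c + u (zv - c)), whose increment over
     [0, 1] is [g zv]. *)
  assert (EI : (I v + (zv - c) * (CInt (fun u => dg (c + RtoC u * (zv - c)) * RtoC u) 0 1))%C = g zv).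
  { assert (Reg' : forall u, 0 <= u <= 1 -> U (c + RtoC u * (zv - c))%C).
    { intros u Hu. apply (Reg v u); auto; lra. }
    assert (C1 : forall u, 0 <= u <= 1 -> rcont (fun u => g (c + RtoC u * (zv - c))%C) u).
    { intros u Hu. apply (rcont_comp g); auto. apply (CL v). }
    assert (C2 : forall u, 0 <= u <= 1 -> rcont (fun u => dg (c + RtoC u * (zv - c)) * RtoC u)%C u).
    { intros u Hu. apply rcont_mult; [apply (rcont_comp dg) | apply rcont_RtoC, continuous_id].
      - apply (CL v).
      - apply Hg; auto. }
    rewrite <- CInt_scal by (apply cintegrable_cont; auto; lra).
    unfold I. rewrite <- CInt_plus.
    - rewrite (CInt_deriv (fun u => RtoC u * g (c + RtoC u * (zv - c)))%C); [| lra | |].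
      + replace (c + 1 * (zv - c))%C with zv by ring. ring.
      + intros u Hu. fold zv.
        eapply rderiv_eq; [| apply rderiv_mult; [apply rderiv_RtoC | apply (rderiv_comp g (fun u => c + RtoC u * (zv - c))%C);
          [apply rderiv_line | now apply Hg, Reg']]]. cbv beta. ring.
      + intros u Hu. fold zv. apply rcont_plus; auto. apply rcont_mult; [apply rcont_const | auto].
    - apply cintegrable_cont; auto; lra.
    - apply cintegrable_scal, cintegrable_cont; auto; lra. }
  eapply rderiv_eq; [| apply (rderiv_mult (fun v' => z + RtoC v' * h - c)%C I)].
  2: { apply (rderiv_ext (fun w => (z - c) + RtoC w * h)%C); [intros; ring|]. apply rderiv_line. }
  2: exact DI.
  fold zv. rewrite <- EI.
  replace dI with (h * CInt (fun u => dg (c + RtoC u * (zv - c)) * RtoC u)%C 0 1)%C; [ring|].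
  unfold dI. rewrite <- CInt_scal.
  - apply CInt_ext; [lra|]. intros; ring.
  - apply cintegrable_cont; [lra|]. intros u Hu. apply rcont_mult; [apply (rcont_comp dg) | apply rcont_RtoC, continuous_id].
    + apply (CL v).
    + apply Hg. apply (Reg v u); auto; lra.
Qed.

Lemma holo_const_star (U : C -> Prop) f df (c z : C) : holo U f df ->
  (forall w u, U w -> 0 <= u <= 1 -> U (c + RtoC u * (w - c))%C) ->
  (forall w, U w -> df w = 0) -> U z -> f z = f c.
Proof.
  intros Hf Hs Z Hz.
  assert (E := rconst_of_rderiv_0 (fun u => f (c + RtoC u * (z - c))%C) (fun u => df (c + RtoC u * (z - c)) * (z - c))%C).
  cbv beta in E. replace (c + 1 * (z - c))%C with z in E by ring. replace (c + 0 * (z - c))%C with c in E by ring.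
  apply E.
  - intros u Hu. apply (rderiv_comp f (fun u => c + RtoC u * (z - c))%C); [apply rderiv_line|]. apply Hf; auto.
  - intros u Hu. rewrite Z by (apply Hs; auto; lra). ring.
Qed.

(** * Finite sums and the zeta function *)

Fixpoint rsum1 (f : nat -> R) (N : nat) : R :=
  match N with O => 0 | S m => rsum1 f m + f (S m) end.

Lemma rsum1_le f g N : (forall n, (1 <= n <= N)%nat -> f n <= g n) -> rsum1 f N <= rsum1 g N.
Proof.
  induction N as [|N IH]; intros H; simpl; [lra|].
  apply Rplus_le_compat; [apply IH; intros; apply H; lia | apply H; lia].
Qed.

Lemma rsum1_ext f g N : (forall n, (1 <= n <= N)%nat -> f n = g n) -> rsum1 f N = rsum1 g N.
Proof. induction N as [|N IH]; intros H; simpl; auto. rewrite IH, H; auto; intros; try apply H; lia. Qed.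

Lemma rsum1_scal c f N : rsum1 (fun n => c * f n) N = c * rsum1 f N.
Proof. induction N as [|N IH]; simpl; [ring | rewrite IH; ring]. Qed.

Lemma rsum1_nonneg f N : (forall n, (1 <= n)%nat -> 0 <= f n) -> 0 <= rsum1 f N.
Proof. intros H. induction N as [|N IH]; simpl; [lra|]. generalize (H (S N) ltac:(lia)). lra. Qed.

Lemma rsum1_mono f N M : (N <= M)%nat -> (forall n, (1 <= n)%nat -> 0 <= f n) -> rsum1 f N <= rsum1 f M.
Proof.
  intros L H. induction L as [|M L IH]; simpl; [lra|]. generalize (H (S M) ltac:(lia)). lra.
Qed.

Lemma csum1_ext f g N : (forall n, (1 <= n <= N)%nat -> f n = g n) -> csum1 f N = csum1 g N.
Proof. induction N as [|N IH]; intros H; simpl; auto. rewrite IH, H; auto; intros; try apply H; lia. Qed.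

Lemma csum1_scal c f N : csum1 (fun n => c * f n)%C N = (c * csum1 f N)%C.
Proof. induction N as [|N IH]; simpl; [ring | rewrite IH; ring]. Qed.

Lemma csum1_plus f g N : csum1 (fun n => f n + g n)%C N = (csum1 f N + csum1 g N)%C.
Proof. induction N as [|N IH]; simpl; [ring | rewrite IH; ring]. Qed.

Lemma csum1_minus f g N : csum1 (fun n => f n - g n)%C N = (csum1 f N - csum1 g N)%C.
Proof. induction N as [|N IH]; simpl; [ring | rewrite IH; ring]. Qed.

Lemma csum1_conj f N : csum1 (fun n => Cconj (f n)) N = Cconj (csum1 f N).
Proof.
  induction N as [|N IH]; simpl; [apply Ceq_of; simpl; ring|]. now rewrite IH, Cplus_conj.
Qed.

Lemma csum1_diff_bound f g N M : (N <= M)%nat ->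
  (forall n, (N < n <= M)%nat -> Cmod (f n) <= g n) ->
  Cmod (csum1 f M - csum1 f N) <= rsum1 g M - rsum1 g N.
Proof.
  intros L. induction L as [|M L IH]; intros H.
  - rewrite Cmod_self. lra.
  - simpl. replace (csum1 f M + f (S M) - csum1 f N)%C with ((csum1 f M - csum1 f N) + f (S M))%C by ring.
    eapply Rle_trans; [apply Cmod_triangle|].
    assert (A := IH (fun n Hn => H n ltac:(lia))). generalize (H (S M) ltac:(lia)). lra.
Qed.

Lemma csum1_bound f g N : (forall n, (1 <= n <= N)%nat -> Cmod (f n) <= g n) ->
  Cmod (csum1 f N) <= rsum1 g N.
Proof.
  intros H. replace (csum1 f N) with (csum1 f N - csum1 f 0)%C by (simpl; ring).
  replace (rsum1 g N) with (rsum1 g N - rsum1 g 0) by (simpl; ring).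
  apply csum1_diff_bound; [lia|]. intros; apply H; lia.
Qed.

Lemma holo_csum1 U (f df : nat -> C -> C) N : (forall n, (1 <= n <= N)%nat -> holo U (f n) (df n)) ->
  holo U (fun z => csum1 (fun n => f n z) N) (fun z => csum1 (fun n => df n z) N).
Proof.
  induction N as [|N IH]; intros H; simpl; [apply holo_const|].
  apply holo_plus; [apply IH; intros; apply H; lia | apply H; lia].
Qed.

Lemma ccvg_of_components u l : is_lim_seq (fun n => Re (u n)) (Re l) ->
  is_lim_seq (fun n => Im (u n)) (Im l) -> ccvg u l.
Proof.
  intros H1 H2 e He. apply is_lim_seq_spec in H1. apply is_lim_seq_spec in H2.
  assert (He2 : 0 < e / 2) by lra.
  destruct (H1 (mkposreal _ He2)) as (N1 & A1). destruct (H2 (mkposreal _ He2)) as (N2 & A2).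
  exists (max N1 N2). intros n Hn.
  specialize (A1 n ltac:(lia)). specialize (A2 n ltac:(lia)). simpl in A1, A2.
  eapply Rle_lt_trans; [apply Cmod_le_Re_Im|]. rewrite Re_minus, Im_minus. lra.
Qed.

Lemma ccvg_re u l : ccvg u l -> is_lim_seq (fun n => Re (u n)) (Re l).
Proof.
  intros H. apply is_lim_seq_spec. intros e. destruct (H e (cond_pos e)) as (N & HN).
  exists N. intros n Hn. eapply Rle_lt_trans; [apply (re_le_Cmod (u n - l))|]. auto.
Qed.

Lemma ccvg_im u l : ccvg u l -> is_lim_seq (fun n => Im (u n)) (Im l).
Proof.
  intros H. apply is_lim_seq_spec. intros e. destruct (H e (cond_pos e)) as (N & HN).
  exists N. intros n Hn. eapply Rle_lt_trans; [apply (Im_le_Cmod (u n - l))|]. auto.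
Qed.

Lemma ccvg_cauchy u :
  (forall e, 0 < e -> exists N, forall n m, (N <= n)%nat -> (N <= m)%nat -> Cmod (u n - u m) < e) ->
  exists l, ccvg u l.
Proof.
  intros H.
  assert (Q : forall v : nat -> R, (forall e, 0 < e -> exists N, forall n m, (N <= n)%nat -> (N <= m)%nat ->
    Rabs (v n - v m) < e) -> exists l : R, is_lim_seq v l).
  { intros v Hv. assert (E : ex_finite_lim_seq v).
    { apply ex_lim_seq_cauchy_corr. intros e. apply Hv, cond_pos. }
    destruct E as (l & Hl). now exists l. }
  destruct (Q (fun n => Re (u n))) as (a & Ha).
  { intros e He. destruct (H e He) as (N & HN). exists N. intros n m Hn Hm.
    eapply Rle_lt_trans; [apply (re_le_Cmod (u n - u m))|]. auto. }
  destruct (Q (fun n => Im (u n))) as (b & Hb).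
  { intros e He. destruct (H e He) as (N & HN). exists N. intros n m Hn Hm.
    eapply Rle_lt_trans; [apply (Im_le_Cmod (u n - u m))|]. auto. }
  exists (a, b). now apply ccvg_of_components.
Qed.

Lemma ccvg_plus u v l m : ccvg u l -> ccvg v m -> ccvg (fun n => u n + v n)%C (l + m).
Proof.
  intros H1 H2 e He. destruct (H1 (e/2)) as (N1 & A1); [lra|]. destruct (H2 (e/2)) as (N2 & A2); [lra|].
  exists (max N1 N2). intros n Hn. specialize (A1 n ltac:(lia)). specialize (A2 n ltac:(lia)).
  replace (u n + v n - (l + m))%C with ((u n - l) + (v n - m))%C by ring.
  eapply Rle_lt_trans; [apply Cmod_triangle|]. lra.
Qed.

Lemma ccvg_comp f u l : ccont f l -> ccvg u l -> ccvg (fun n => f (u n)) (f l).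
Proof.
  intros Hf Hu e He. destruct (Hf e He) as (d & Hd & H). destruct (Hu d Hd) as (N & HN).
  exists N. intros n Hn. apply H, HN, Hn.
Qed.

Lemma ccvg_const c : ccvg (fun _ => c) c.
Proof. intros e He. exists O. intros. now rewrite Cmod_self. Qed.

Lemma ccvg_scal c u l : ccvg u l -> ccvg (fun n => c * u n)%C (c * l).
Proof.
  intros H. apply (ccvg_comp (fun w => c * w)%C); auto. apply ccont_mult; [apply ccont_const | apply ccont_id].
Qed.

Lemma ccvg_ext u v l : (forall n, u n = v n) -> ccvg u l -> ccvg v l.
Proof. intros E H e He. destruct (H e He) as (N & HN). exists N. intros. rewrite <- E. auto. Qed.

Lemma ccvg_0 (u : nat -> C) (v : nat -> R) l : (forall n, Cmod (u n - l) <= v n) -> is_lim_seq v 0 -> ccvg u l.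
Proof.
  intros H Hv e He. apply is_lim_seq_spec in Hv. destruct (Hv (mkposreal e He)) as (N & HN).
  exists N. intros n Hn. specialize (HN n Hn). simpl in HN. specialize (H n).
  rewrite Rminus_0_r in HN. generalize (Rle_abs (v n)). lra.
Qed.

Lemma ccvg_shift u l k : ccvg (fun n => u (n + k)%nat) l <-> ccvg u l.
Proof.
  split; intros H e He; destruct (H e He) as (N & HN).
  - exists (N + k)%nat. intros n Hn. replace n with ((n - k) + k)%nat by lia. apply HN; lia.
  - exists N. intros n Hn. apply HN; lia.
Qed.

Lemma Rpower_pos x a : 0 < Rpower x a.
Proof. apply exp_pos. Qed.

Lemma Cmod_cexp_ln s x : Cmod (cexp (- s * RtoC x)) = exp (- Re s * x).
Proof. rewrite Cmod_cexp. f_equal. simpl. unfold Re; ring. Qed.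

Lemma Cmod_npow n s : Cmod (npow_neg n s) = Rpower (INR n) (- Re s).
Proof. apply Cmod_cexp_ln. Qed.

Lemma Cmod_RtoC_le x : 0 <= x -> Cmod (RtoC x) = x.
Proof. intros; rewrite Cmod_R; apply Rabs_right; lra. Qed.

Lemma rderiv_xpow s x : 0 < x ->
  rderiv (fun x => cexp (- s * RtoC (ln x))) x (cexp (- s * RtoC (ln x)) * (- s * RtoC (/ x))).
Proof.
  intros Hx. apply (rderiv_comp cexp (fun x => - s * RtoC (ln x))%C); [| apply cderiv_cexp].
  apply rderiv_scal. split; simpl.
  - apply is_derive_ln; auto.
  - apply (is_derive_const (V := R_NormedModule) 0).
Qed.

Lemma exp_le x y : x <= y -> exp x <= exp y.
Proof. intros [H| ->]; [left; now apply exp_increasing | lra]. Qed.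

Lemma ln_le_mono x y : 0 < x -> x <= y -> ln x <= ln y.
Proof. intros H1 [H| ->]; [left; now apply ln_increasing | lra]. Qed.

Lemma xpow_increment s a x : 0 < a -> a <= x <= a + 1 -> 0 <= Re s ->
  Cmod (cexp (- s * RtoC (ln (a + 1))) - cexp (- s * RtoC (ln x))) <= Cmod s * exp ((- Re s - 1) * ln a).
Proof.
  intros Ha Hx Hs.
  assert (H := mean_value_inequality (fun x => cexp (- s * RtoC (ln x)))
    (fun x => cexp (- s * RtoC (ln x)) * (- s * RtoC (/ x)))%C 0 (Cmod s * exp ((- Re s - 1) * ln a)) x (a + 1) ltac:(lra)).
  cbv beta in H.
  replace (cexp (- s * ln (a + 1)) - cexp (- s * ln x) - (a + 1 - x)%R * 0)%C with
    (cexp (- s * ln (a + 1)) - cexp (- s * ln x))%C in H by ring.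
  assert (P : 0 <= Cmod s * exp ((- Re s - 1) * ln a)).
  { apply Rmult_le_pos; [apply Cmod_ge_0 | left; apply exp_pos]. }
  eapply Rle_trans; [apply H |].
  - intros t Ht. apply rderiv_xpow. lra.
  - intros t Ht. replace (cexp (- s * ln t) * (- s * (/ t)%R) - 0)%C with (cexp (- s * ln t) * (- s * (/ t)%R))%C by ring.
    rewrite !Cmod_mult, Cmod_opp, Cmod_cexp_ln, Cmod_RtoC_le by (left; apply Rinv_0_lt_compat; lra).
    replace (exp (- Re s * ln t) * (Cmod s * / t)) with (Cmod s * (exp (- Re s * ln t) * / t)) by ring.
    apply Rmult_le_compat_l; [apply Cmod_ge_0|].
    replace (/ t) with (exp (- ln t)) by (rewrite exp_Ropp, exp_ln; lra).
    rewrite <- exp_plus. apply exp_le.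
    assert (ln a <= ln t) by (apply ln_le_mono; lra). nra.
  - nra.
Qed.

(** The increment is (n+1)^{-s} minus the integral of x^{-s} over [n, n+1]. It is read off from the
    primitive x^{1-s}/(1-s) by the mean value inequality, with (n+1)^{-s} as the comparison slope
    and [xpow_increment] for the oscillation of x^{-s}. *)
Lemma zeta_partial_step s n : (1 <= n)%nat -> 0 <= Re s -> s <> 1 ->
  Cmod (zeta_partial s (S n) - zeta_partial s n) <= Cmod s * Rpower (INR n) (- Re s - 1).
Proof.
  intros Hn Hs Hs1. assert (Hp : 0 < INR n) by (apply lt_0_INR; lia).
  assert (N1 : (1 - s <> 0)%C) by (intros E; apply Hs1; symmetry; now apply Ceq_minus).
  unfold zeta_partial. simpl csum1. unfold npow_neg. rewrite S_INR.
  set (a := INR n) in *.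
  assert (H := mean_value_inequality (fun x => cexp (- (s - 1) * RtoC (ln x)) / (1 - s))%C
    (fun x => cexp (- s * RtoC (ln x))) (cexp (- s * RtoC (ln (a + 1)))) (Cmod s * exp ((- Re s - 1) * ln a)) a (a + 1) ltac:(lra)).
  cbv beta in H.
  replace (Cmod s * exp ((- Re s - 1) * ln a) * (a + 1 - a)) with (Cmod s * Rpower a (- Re s - 1)) in H
    by (unfold Rpower; ring).
  set (q := csum1 _ n).
  replace (q + cexp (- s * ln (a + 1)) - cexp (- (s - 1) * ln (a + 1)) / (1 - s) -
     (q - cexp (- (s - 1) * ln a) / (1 - s)))%C with
    (- (cexp (- (s - 1) * ln (a + 1)) / (1 - s) - cexp (- (s - 1) * ln a) / (1 - s) -
       (a + 1 - a)%R * cexp (- s * ln (a + 1))))%C.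
  - rewrite Cmod_opp. apply H.
    + intros t Ht. assert (Ht0 : 0 < t) by lra.
      apply (rderiv_ext (fun x => / (1 - s) * cexp (- (s - 1) * RtoC (ln x)))%C); [intros; field; auto|].
      eapply rderiv_eq; [| apply rderiv_scal, rderiv_xpow; auto].
      replace (cexp (- (s - 1) * ln t)) with (cexp (- s * ln t) * RtoC t)%C.
      * replace (RtoC (/ t)) with (/ RtoC t)%C by (rewrite RtoC_inv; auto; lra).
        field. split; auto. intros E; apply RtoC_inj in E; lra.
      * replace (- (s - 1) * ln t)%C with (- s * ln t + RtoC (ln t))%C by ring.
        rewrite cexp_add, cexp_RtoC, exp_ln; auto.
    + intros t Ht. rewrite Cmod_sub_sym. apply xpow_increment; auto.
  - replace (a + 1 - a) with 1 by ring. field; auto.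
Qed.

Lemma Rpower_tail_step a n : 0 < a -> (1 <= n)%nat ->
  a * Rpower (INR (S n)) (- a - 1) <= Rpower (INR n) (- a) - Rpower (INR (S n)) (- a).
Proof.
  intros Ha Hn. assert (Hp : 0 < INR n) by (apply lt_0_INR; lia). rewrite S_INR.
  set (x := INR n) in *.
  destruct (MVT_cor2 (fun x => Rpower x (- a)) (fun x => - a * Rpower x (- a - 1)) x (x + 1) ltac:(lra)) as (c & E & Hc).
  - intros c Hc. apply derivable_pt_lim_power. lra.
  - replace (x + 1 - x) with 1 in E by ring.
    assert (Rpower (x + 1) (- a - 1) <= Rpower c (- a - 1)).
    { unfold Rpower. apply exp_le. assert (ln c <= ln (x + 1)) by (apply ln_le_mono; lra). nra. }
    nra.
Qed.

Lemma Rpower_sum_tail a N M : 0 < a -> (1 <= N <= M)%nat ->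
  rsum1 (fun n => Rpower (INR n) (- a - 1)) M - rsum1 (fun n => Rpower (INR n) (- a - 1)) N
   <= (Rpower (INR N) (- a) - Rpower (INR M) (- a)) / a.
Proof.
  intros Ha (HN & L). induction L as [|M L IH].
  - unfold Rdiv; lra.
  - cbn [rsum1]. assert (St := Rpower_tail_step a M Ha ltac:(lia)).
    assert (Rpower (INR (S M)) (- a - 1) <= (Rpower (INR M) (- a) - Rpower (INR (S M)) (- a)) / a).
    { apply (Rmult_le_reg_l a); auto. replace (a * ((Rpower (INR M) (- a) - Rpower (INR (S M)) (- a)) / a))
       with (Rpower (INR M) (- a) - Rpower (INR (S M)) (- a)) by (field; lra). auto. }
    unfold Rdiv in *. lra.
Qed.

Lemma Rpower_sum_tail_le a N M : 0 < a -> (1 <= N <= M)%nat ->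
  rsum1 (fun n => Rpower (INR n) (- a - 1)) M - rsum1 (fun n => Rpower (INR n) (- a - 1)) N
   <= Rpower (INR N) (- a) / a.
Proof.
  intros Ha H. eapply Rle_trans; [apply Rpower_sum_tail; auto|]. unfold Rdiv.
  apply Rmult_le_compat_r; [left; now apply Rinv_0_lt_compat|].
  generalize (Rpower_pos (INR M) (- a)); lra.
Qed.

Lemma Rpower_1_l a : Rpower 1 a = 1.
Proof. unfold Rpower. rewrite ln_1, Rmult_0_r. apply exp_0. Qed.

Lemma Rpower_sum_le a N : 0 < a -> rsum1 (fun n => Rpower (INR n) (- a - 1)) N <= 1 + / a.
Proof.
  intros Ha. assert (P := Rinv_0_lt_compat a Ha).
  destruct N as [|N]; [simpl; lra|].
  assert (H := Rpower_sum_tail_le a 1 (S N) Ha ltac:(lia)). simpl rsum1 in H at 2.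
  rewrite Rpower_1_l in H. change (INR 1) with 1 in H. rewrite Rpower_1_l in H. unfold Rdiv in H. lra.
Qed.

Lemma zeta_partial_diff s N M : (1 <= N <= M)%nat -> 0 < Re s -> s <> 1 ->
  Cmod (zeta_partial s M - zeta_partial s N) <= Cmod s * ((1 + / Re s) * Rpower (INR N) (- Re s)).
Proof.
  intros (HN & L) Hs Hs1.
  (* The steps from N to M use the indices N, ..., M - 1, whereas the difference of the two sums
     runs over N + 1, ..., M; hence the added term at N and the subtracted term at M, which also
     keeps the induction exact. *)
  assert (A : Cmod (zeta_partial s M - zeta_partial s N) <=
    Cmod s * (Rpower (INR N) (- Re s - 1) + (rsum1 (fun n => Rpower (INR n) (- Re s - 1)) M
       - rsum1 (fun n => Rpower (INR n) (- Re s - 1)) N) - Rpower (INR M) (- Re s - 1))).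
  { induction L as [|M L IH].
    - rewrite Cmod_self. right. ring.
    - cbn [rsum1]. replace (zeta_partial s (S M) - zeta_partial s N)%C with
       ((zeta_partial s (S M) - zeta_partial s M) + (zeta_partial s M - zeta_partial s N))%C by ring.
      eapply Rle_trans; [apply Cmod_triangle|].
      assert (B := zeta_partial_step s M ltac:(lia) ltac:(lra) Hs1).
      generalize (Cmod_ge_0 s). nra. }
  eapply Rle_trans; [apply A|]. apply Rmult_le_compat_l; [apply Cmod_ge_0|].
  assert (T := Rpower_sum_tail_le (Re s) N M Hs (conj HN L)).
  assert (Q : Rpower (INR N) (- Re s - 1) <= Rpower (INR N) (- Re s)).
  { unfold Rpower. apply exp_le. assert (0 <= ln (INR N)).
    { rewrite <- ln_1. apply ln_le_mono; [lra|]. change 1 with (INR 1). now apply le_INR. }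
    nra. }
  generalize (Rpower_pos (INR M) (- Re s - 1)). unfold Rdiv in T. lra.
Qed.

Lemma is_lim_seq_Rpower_neg a : 0 < a -> is_lim_seq (fun n => Rpower (INR n) (- a)) 0.
Proof.
  intros Ha. apply is_lim_seq_spec. intros e.
  destruct (nfloor_ex (exp (- ln e / a)) ltac:(left; apply exp_pos)) as (N & HN1 & HN2).
  exists (S N). intros n Hn. rewrite Rminus_0_r, Rabs_right by (left; apply Rpower_pos).
  assert (L : exp (- ln e / a) < INR n).
  { eapply Rlt_le_trans; [apply HN2|]. rewrite <- S_INR. now apply le_INR. }
  apply ln_increasing in L; [| apply exp_pos]. rewrite ln_exp in L.
  rewrite <- (exp_ln e) by apply cond_pos. unfold Rpower. apply exp_increasing.
  apply (Rmult_lt_compat_l a) in L; auto. replace (a * (- ln e / a)) with (- ln e) in L by (field; lra). lra.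
Qed.

Lemma zeta_partial_cvg s : 0 < Re s -> s <> 1 -> ccvg (zeta_partial s) (zeta s).
Proof.
  intros Hs Hs1.
  assert (E : exists l, ccvg (zeta_partial s) l).
  { apply ccvg_cauchy. intros e He.
    set (K := Cmod s * (1 + / Re s) + 1).
    assert (HK : 0 < K).
    { unfold K. generalize (Cmod_ge_0 s) (Rinv_0_lt_compat _ Hs). nra. }
    assert (L := is_lim_seq_Rpower_neg (Re s) Hs). apply is_lim_seq_spec in L.
    destruct (L (mkposreal (e / (2 * K)) ltac:(apply Rdiv_lt_0_compat; lra))) as (N & HN). simpl in HN.
    exists (S N). intros n m Hn Hm.
    assert (B : forall k, (S N <= k)%nat -> Cmod (zeta_partial s k - zeta_partial s (S N)) < e / 2).
    { intros k Hk. eapply Rle_lt_trans; [apply zeta_partial_diff; auto; lia|].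
      specialize (HN (S N) ltac:(lia)). rewrite Rminus_0_r, Rabs_right in HN by (left; apply Rpower_pos).
      set (p := Rpower (INR (S N)) (- Re s)) in *.
      assert (0 < p) by apply Rpower_pos.
      apply (Rmult_lt_compat_r (2 * K)) in HN; [| lra].
      replace (e / (2 * K) * (2 * K)) with e in HN by (field; lra).
      unfold K in HN. nra. }
    replace (zeta_partial s n - zeta_partial s m)%C with
      ((zeta_partial s n - zeta_partial s (S N)) - (zeta_partial s m - zeta_partial s (S N)))%C by ring.
    eapply Rle_lt_trans; [apply Cmod_minus_le|]. generalize (B n Hn) (B m Hm). lra. }
  destruct E as (l & Hl). replace (zeta s) with l; auto.
  unfold zeta. apply ccvg_re in Hl as H1. apply ccvg_im in Hl as H2.
  apply is_lim_seq_unique in H1. apply is_lim_seq_unique in H2. rewrite H1, H2. destruct l; reflexivity.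
Qed.

Lemma zeta_approx s N : (1 <= N)%nat -> 0 < Re s -> s <> 1 ->
  Cmod (zeta s - zeta_partial s N) <= Cmod s * ((1 + / Re s) * Rpower (INR N) (- Re s)).
Proof.
  intros HN Hs Hs1. apply (ccvg_le (fun n => zeta_partial s n - zeta_partial s N)%C _ _ N).
  - intros n Hn. apply zeta_partial_diff; auto.
  - unfold Cminus. apply ccvg_plus; [now apply zeta_partial_cvg | apply ccvg_const].
Qed.

Lemma npow_1 s : npow_neg 1 s = 1.
Proof.
  unfold npow_neg. change (INR 1) with 1. rewrite ln_1.
  replace (- s * 0)%C with (RtoC 0) by ring. apply cexp_0.
Qed.

(** The approximation by a single term, N = 1. Linear growth is enough, since only the logarithm of
    this bound enters the count of zeros. *)
Lemma zeta_growth s : / 4 <= Re s -> 1 <= Rabs (Im s) -> Cmod (zeta s) <= 6 * Cmod s.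
Proof.
  intros Hs Ht. assert (Hs1 : s <> 1).
  { intros ->. simpl in Ht. rewrite Rabs_R0 in Ht. lra. }
  assert (A := zeta_approx s 1 ltac:(lia) ltac:(lra) Hs1).
  change (INR 1) with 1 in A. rewrite Rpower_1_l in A.
  assert (N1 : (1 - s <> 0)%C) by (intros E; apply Hs1; symmetry; now apply Ceq_minus).
  assert (I : / Re s <= 4).
  { replace 4 with (/ / 4) by field. apply Rinv_le_contravar; lra. }
  assert (Z1 : Cmod (zeta_partial s 1) <= Cmod s).
  { unfold zeta_partial. simpl. rewrite !npow_1.
    replace (0 + 1 - 1 / (1 - s))%C with (- s / (1 - s))%C by (field; auto).
    rewrite Cmod_div, Cmod_opp by auto.
    assert (1 <= Cmod (1 - s)).
    { eapply Rle_trans; [| apply Im_le_Cmod]. simpl. rewrite Rplus_0_l, Rabs_Ropp. exact Ht. }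
    unfold Rdiv. rewrite <- (Rmult_1_r (Cmod s)) at 2. apply Rmult_le_compat_l; [apply Cmod_ge_0|].
    apply Rle_trans with (/ 1); [apply Rinv_le_contravar; lra | lra]. }
  generalize (Cmod_sub_le (zeta s) (zeta_partial s 1)) (Cmod_ge_0 s). nra.
Qed.

Lemma zeta_dirichlet s : 1 < Re s -> ccvg (csum1 (fun n => npow_neg n s)) (zeta s).
Proof.
  intros Hs. assert (Hs1 : s <> 1) by (intros ->; simpl in Hs; lra).
  assert (N1 : (1 - s <> 0)%C) by (intros E; apply Hs1; symmetry; now apply Ceq_minus).
  apply (ccvg_ext (fun n => zeta_partial s n + npow_neg n (s - 1) / (1 - s))%C).
  { intros n. unfold zeta_partial. ring. }
  replace (zeta s) with (zeta s + 0)%C by ring.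
  apply ccvg_plus; [apply zeta_partial_cvg; auto; lra|].
  apply (ccvg_0 _ (fun n => Rpower (INR n) (- (Re s - 1)) * / Cmod (1 - s))).
  - intros n. replace (npow_neg n (s - 1) / (1 - s) - 0)%C with (npow_neg n (s - 1) / (1 - s))%C by ring.
    rewrite Cmod_div, Cmod_npow by auto. right. reflexivity.
  - replace (Finite 0) with (Rbar_mult 0 (/ Cmod (1 - s))) by (simpl; f_equal; ring).
    apply is_lim_seq_scal_r. apply is_lim_seq_Rpower_neg. lra.
Qed.

Lemma holo_npow U n : holo U (fun s => npow_neg n s) (fun s => npow_neg n s * - RtoC (ln (INR n)))%C.
Proof.
  unfold npow_neg. apply (holo_cexp U (fun s => - s * RtoC (ln (INR n)))%C (fun _ => - RtoC (ln (INR n)))%C).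
  intros z _. split; [| apply ccont_const].
  apply (cderiv_ext (fun s => - RtoC (ln (INR n)) * s)%C); [intros; ring|].
  eapply cderiv_eq; [| apply cderiv_scal, cderiv_id]. ring.
Qed.

Definition zeta_dom (s : C) : Prop := 0 < Re s /\ s <> 1.

Lemma zeta_dom_open : copen zeta_dom.
Proof.
  intros z (H1 & H2). assert (P : 0 < Cmod (z - 1)) by (apply Cmod_pos, Cminus_eq_contra, H2).
  exists (Rmin (Re z) (Cmod (z - 1))). split; [apply Rmin_glb_lt; auto|].
  intros w Hw. assert (W1 := Rlt_le_trans _ _ _ Hw (Rmin_l _ _)). assert (W2 := Rlt_le_trans _ _ _ Hw (Rmin_r _ _)).
  split.
  - generalize (re_le_Cmod (w - z)). rewrite Re_minus. intros Q.
    assert (Rabs (Re w - Re z) < Re z) by lra. apply Rabs_def2 in H. lra.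
  - intros ->. rewrite Cmod_sub_sym in W2. lra.
Qed.

(** The error in [zeta_approx] is uniform on a small disc, because Re w stays above Re z / 2 there,
    so Weierstrass's theorem applies to the partial expressions. They are indexed by [S n] because
    that estimate starts at N = 1. *)
Lemma holo_zeta : holo zeta_dom zeta (cder zeta).
Proof.
  apply (weierstrass zeta_dom (fun n s => zeta_partial s (S n))
    (fun n s => (csum1 (fun n => npow_neg n s * - RtoC (ln (INR n)))%C (S n)
      - ((npow_neg (S n) (s - 1) * - RtoC (ln (INR (S n)))) * (1 - s) - npow_neg (S n) (s - 1) * - (1)) / ((1 - s) * (1 - s)))%C)).
  - intros n. unfold zeta_partial.
    assert (A : holo zeta_dom (fun s => csum1 (fun n => npow_neg n s) (S n))
       (fun s => csum1 (fun n => npow_neg n s * - RtoC (ln (INR n)))%C (S n))).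
    { apply holo_csum1. intros; apply holo_npow. }
    assert (B : holo zeta_dom (fun s => npow_neg (S n) (s - 1))
      (fun s => npow_neg (S n) (s - 1) * - RtoC (ln (INR (S n))))%C).
    { assert (B := holo_shift (fun _ => True) (- (1))%C _ _ (holo_npow (fun _ => True) (S n))).
      intros z Hz. destruct (B z I) as (B1 & B2). split.
      - replace (z - 1)%C with (- (1) + z)%C by ring. eapply cderiv_ext; [| exact B1].
        intros w; cbv beta; f_equal; ring.
      - eapply (ccont_ext_loc _ _ z 1 Rlt_0_1); [| exact B2]. intros w _; cbv beta. f_equal; f_equal; ring. }
    assert (D : holo zeta_dom (fun s => 1 - s)%C (fun _ => - (1))%C).
    { intros z Hz. split; [| apply ccont_const].
      eapply cderiv_eq; [| apply cderiv_minus; [apply cderiv_const | apply cderiv_id]]. ring. }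
    assert (Q := holo_div _ _ _ _ _ B D (fun z Hz => Cminus_eq_contra _ _ (fun E => proj2 Hz (eq_sym E)))).
    intros z Hz. destruct (A z Hz) as (A1 & A2). destruct (Q z Hz) as (Q1 & Q2).
    split; [apply cderiv_minus; auto | apply ccont_minus; auto].
  - intros z Hz. destruct (zeta_dom_open z Hz) as (r0 & Hr0 & HB). destruct Hz as (Hz1 & Hz2).
    set (r := Rmin r0 (Re z / 2)). assert (Hr : 0 < r) by (apply Rmin_glb_lt; lra).
    exists r. split; auto. split.
    { intros w Hw. apply HB. eapply Rlt_le_trans; [apply Hw | apply Rmin_l]. }
    intros e He. set (A := Cmod z + Re z). set (a := Re z / 2).
    assert (Ha : 0 < a) by (unfold a; lra).
    set (K := A * (1 + / a) + 1).
    assert (HA : 0 < A) by (unfold A; generalize (Cmod_ge_0 z); lra).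
    assert (HK : 0 < K) by (unfold K; generalize (Rinv_0_lt_compat _ Ha); nra).
    assert (L := is_lim_seq_Rpower_neg a Ha). apply is_lim_seq_spec in L.
    destruct (L (mkposreal (e / K) ltac:(apply Rdiv_lt_0_compat; lra))) as (N & HN). simpl in HN.
    exists N. intros n w Hn Hw.
    assert (W1 := Rlt_le_trans _ _ _ Hw (Rmin_l _ _)). assert (W2 := Rlt_le_trans _ _ _ Hw (Rmin_r _ _)).
    destruct (HB w W1) as (Hw1 & Hw2).
    assert (Ra : a <= Re w).
    { generalize (re_le_Cmod (w - z)). rewrite Re_minus. intros Q.
      assert (Rabs (Re w - Re z) < Re z / 2) by lra. apply Rabs_def2 in H. unfold a. lra. }
    assert (Wm : Cmod w <= A) by (generalize (Cmod_sub_le w z); unfold A; lra).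
    rewrite Cmod_sub_sym. eapply Rle_trans; [apply zeta_approx; auto; lia|].
    specialize (HN (S n) ltac:(lia)). rewrite Rminus_0_r, Rabs_right in HN by (left; apply Rpower_pos).
    assert (PP : Rpower (INR (S n)) (- Re w) <= Rpower (INR (S n)) (- a)).
    { unfold Rpower. apply exp_le. assert (0 <= ln (INR (S n))).
      { rewrite <- ln_1. apply ln_le_mono; [lra|]. change 1 with (INR 1). apply le_INR; lia. }
      nra. }
    assert (I : / Re w <= / a) by (apply Rinv_le_contravar; auto).
    assert (Ip : 0 < / Re w) by (apply Rinv_0_lt_compat; lra).
    assert (Q : (1 + / Re w) * Rpower (INR (S n)) (- Re w) <= (1 + / a) * (e / K)).
    { apply Rmult_le_compat; try lra. left; apply Rpower_pos. }
    apply Rle_trans with (A * ((1 + / a) * (e / K))).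
    + apply Rmult_le_compat; auto using Cmod_ge_0. apply Rmult_le_pos; [lra | left; apply Rpower_pos].
    + apply (Rmult_le_reg_r K); auto. replace (A * ((1 + / a) * (e / K)) * K) with (A * (1 + / a) * e) by (field; lra).
      unfold K. nra.
Qed.

(** * Prime factorisation and the Chebyshev bound *)

Module PrimeFacts.
Import ssreflect ssrfun ssrbool eqtype ssrnat seq path fintype div bigop prime binomial.

Local Open Scope nat_scope.

Lemma pow_expn p a : Nat.pow p a = expn p a.
Proof. elim: a => [|a IH] //=. by rewrite expnS IH. Qed.

Lemma prime_dvd_pow_mul (p q a m : nat) : prime p -> prime q ->
  dvdn q (Nat.mul (Nat.pow p a) m) -> q = p \/ dvdn q m.
Proof.
rewrite pow_expn => pp qp. rewrite Euclid_dvdM // => /orP [|->]; last by right.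
rewrite Euclid_dvdX // => /andP [H _]. left. apply/eqP. by rewrite -(dvdn_prime2 qp pp).
Qed.

Lemma pow_mul_inj (p a b m m' : nat) : prime p -> ~ dvdn p m -> ~ dvdn p m' ->
  (0 < m)%N -> (0 < m')%N ->
  Nat.mul (Nat.pow p a) m = Nat.mul (Nat.pow p b) m' -> a = b /\ m = m'.
Proof.
rewrite !pow_expn => pp /negP n1 /negP n2 m0 m0' E.
have L : forall c k, ~~ dvdn p k -> (0 < k)%N -> logn p (Nat.mul (expn p c) k) = c.
  move=> c k nk k0.
  rewrite lognM // ?expn_gt0 ?prime_gt0 // pfactorK // (lognE p k) pp k0 /= (negbTE nk) addn0 //.
have Eab : a = b by rewrite -(L a m n1 m0) -(L b m' n2 m0') E.
split=> //. apply/eqP. rewrite -(@eqn_pmul2l (expn p a)) ?expn_gt0 ?prime_gt0 //.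
by apply/eqP; rewrite {2}Eab.
Qed.

Lemma pow_mul_exists (p n : nat) : prime p -> (0 < n)%N ->
  exists a m, n = Nat.mul (Nat.pow p a) m /\ ~ dvdn p m /\ (0 < m)%N /\ (a < n)%N.
Proof.
move=> pp n0. case: (pfactor_coprime pp n0) => m cop E.
exists (logn p n), m. rewrite pow_expn. split; first by rewrite {1}E mulnC.
have m0 : (0 < m)%N by move: n0; rewrite {1}E muln_gt0 => /andP [].
split; first by apply/negP; rewrite -prime_coprime.
split=> //.
apply: leq_trans (ltn_expl _ (prime_gt1 pp)) _. by apply: dvdn_leq => //; apply: pfactor_dvdnn.
Qed.

Lemma prime_divisor (n : nat) : (1 < n)%N -> exists p, prime p /\ dvdn p n /\ (p <= n)%N.
Proof.
move=> n1. exists (pdiv n). split; first exact: pdiv_prime. split; first exact: pdiv_dvd.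
by apply: pdiv_leq; apply: ltnW.
Qed.

Lemma prime_ge2 p : prime p -> (2 <= p)%coq_nat.
Proof. by move=> /prime_gt1 /ltP. Qed.

Lemma dvdn_le_pos p n : (0 < n)%N -> dvdn p n -> (p <= n)%coq_nat.
Proof. by move=> n0 /(dvdn_leq n0) /leP. Qed.

Lemma not_prime_1_dvd q : prime q -> ~ dvdn q 1.
Proof. by move=> qp /eqP; rewrite modn_small ?prime_gt1. Qed.

(** [dz] multiplies over the ordered list of prime divisors; independence of the order allows a
    chosen prime p to be moved to the front of the list for p^a m. *)
Lemma fold_mult_perm (f : nat -> C) (s t : seq nat) : perm_eq s t ->
  List.fold_right (fun p acc => Cmult (f p) acc) (RtoC 1) s =
  List.fold_right (fun p acc => Cmult (f p) acc) (RtoC 1) t.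
Proof.
have Fcat : forall u v, List.fold_right (fun p acc => Cmult (f p) acc) (RtoC 1) (u ++ v) =
   Cmult (List.fold_right (fun p acc => Cmult (f p) acc) (RtoC 1) u)
     (List.fold_right (fun p acc => Cmult (f p) acc) (RtoC 1) v).
  elim=> [|x u IH] v /=; first by rewrite Cmult_1_l. by rewrite IH Cmult_assoc.
elim: s t => [|x s IH] t.
  by move=> /perm_size /esym /size0nil ->.
move=> P. have xt : x \in t by rewrite -(perm_mem P) mem_head.
case/splitPr: xt P => t1 t2 P.
have P2 : perm_eq s (t1 ++ t2).
  rewrite -(perm_cons x). apply: perm_trans P _. by rewrite perm_catC /= perm_cons perm_catC.
rewrite /= (IH _ P2) !Fcat /= !Cmult_assoc. congr Cmult. exact: Cmult_comm.
Qed.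

Lemma dz_one (z : C) : dz z 1 = RtoC 1.
Proof. by []. Qed.

Lemma dz_pow_mul (z : C) (p a m : nat) : prime p -> ~ dvdn p m -> (0 < m)%N ->
  dz z (Nat.mul (Nat.pow p a) m) = Cmult (dz_pp z a) (dz z m).
Proof.
rewrite pow_expn multE => pp /negP nm m0.
have p0 := prime_gt0 pp.
case: a => [|a].
  rewrite expn0 mul1n.
  have -> : dz_pp z 0 = RtoC 1 by rewrite /dz_pp /= Rinv_1 Cmult_1_l.
  by rewrite Cmult_1_l.
have x0 : (0 < expn p a.+1)%N by rewrite expn_gt0 p0.
have nl : logn p m = 0 by rewrite lognE pp m0 /= (negbTE nm).
have P : perm_eq (primes (expn p a.+1 * m)%N) (p :: primes m).
  apply: uniq_perm; first exact: primes_uniq.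
    by rewrite /= primes_uniq andbT mem_primes pp m0.
  move=> q. rewrite (primesM q x0 m0) primesX // in_cons.
  by rewrite primes_prime // mem_seq1.
rewrite /dz (fold_mult_perm (fun q => dz_pp z (logn q (expn p a.+1 * m)%N)) _ _ P) /=.
congr Cmult.
  by rewrite lognM // pfactorK // nl addn0.
have : forall q, q \in primes m -> q != p.
  move=> q. rewrite mem_primes => /and3P [qp _ qm]. apply/negP => /eqP qE. by rewrite -qE qm in nm.
have : all prime (primes m) by apply/allP => q; rewrite mem_primes => /andP [].
elim: (primes m) => [|q s IH] //= /andP [qp sp] H.
congr Cmult; last by apply: IH => // r rs; apply: H; rewrite in_cons rs orbT.
have qneq : q != p by apply: H; rewrite mem_head.
by rewrite lognM // lognX (logn_prime q pp) (negbTE qneq) muln0.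
Qed.

Lemma prime_list_dvd (s : seq nat) n : uniq s -> all prime s -> all (fun p => dvdn p n) s ->
  dvdn (foldr muln 1 s) n.
Proof.
elim: s => [|p s IH] /=; first by rewrite dvd1n.
move=> /andP [ps us] /andP [pp ap] /andP [pn an].
rewrite Gauss_dvd; first by rewrite pn IH.
elim: s ps ap {IH us an} => [|q s IH] /=; first by rewrite coprimen1.
rewrite in_cons negb_or => /andP [pq ps] /andP [qp aq].
rewrite coprimeMr IH // andbT. by rewrite prime_coprime // dvdn_prime2.
Qed.

(** Such a prime divides (2m)! but not m!, hence it divides the quotient of (2m)! by (m!)^2. *)
Lemma prime_dvd_central (m p : nat) : prime p -> (m < p)%N -> (p <= m.*2)%N -> dvdn p 'C(m.*2, m).
Proof.
move=> pp mp pm.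
have E : 'C(m.*2, m) * (m`! * (m.*2 - m)`!) = (m.*2)`! by apply: bin_fact; rewrite -addnn leq_addr.
have D : dvdn p (m.*2)`! by apply: dvdn_fact; rewrite pm prime_gt0.
move: D. rewrite -E Euclid_dvdM // => /orP [//|].
have -> : m.*2 - m = m by rewrite -addnn addnK.
have nd : forall k, (k < p)%N -> ~~ dvdn p k`!.
  elim=> [|k IH] kp; first by rewrite fact0 dvdn1; case: (p) pp => [|[|]].
  rewrite factS Euclid_dvdM // negb_or IH ?andbT; last exact: ltnW.
  by rewrite gtnNdvd.
by rewrite Euclid_dvdM // => /orP []; rewrite (negbTE (nd m mp)).
Qed.

(** Chebyshev's function: the logarithm of the product of the primes up to N. *)
Definition theta (N : nat) : R :=
  List.fold_right (fun p acc => (ln (INR p) + acc)%R) 0%R (List.filter prime (List.seq 1 N)).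

Lemma central_le m : ('C(m.*2, m) <= 4 ^ m)%N.
Proof.
have -> : (4 ^ m = 2 ^ (m.*2))%N by rewrite -[4]/(2 ^ 2)%N -expnM mul2n.
rewrite -[2]/(1 + 1)%N expnDn (bigD1 (inord m)) //= inordK; last by rewrite ltnS -addnn leq_addr.
by rewrite !exp1n !muln1 leq_addr.
Qed.

Lemma ln_foldr_mul (s : seq nat) : all prime s ->
  ln (INR (foldr muln 1%N s)) = List.fold_right (fun p acc => (ln (INR p) + acc)%R) 0%R s /\ (0 < foldr muln 1 s)%N.
Proof.
elim: s => [|p s IH] /=; first by rewrite ln_1.
move=> /andP [pp ap]. case: (IH ap) => E P. split.
  have H1 : (0 < INR p)%R by apply: lt_0_INR; apply/ltP; exact: prime_gt0.
  have H2 : (0 < INR (foldr muln 1%N s))%R by apply: lt_0_INR; apply/ltP.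
  by rewrite -multE mult_INR ln_mult // E.
by rewrite muln_gt0 prime_gt0.
Qed.

Lemma filter_listE (s : seq nat) : List.filter prime s = seq.filter prime s.
Proof. by elim: s => [|x s IH] //=; rewrite IH. Qed.

Lemma seq_iotaE a n : List.seq a n = iota a n.
Proof. by elim: n a => [|n IH] a //=; rewrite IH. Qed.

Lemma fold_cat (s t : seq nat) :
  List.fold_right (fun p acc => (ln (INR p) + acc)%R) 0%R (s ++ t) =
  (List.fold_right (fun p acc => (ln (INR p) + acc)%R) 0%R s +
   List.fold_right (fun p acc => (ln (INR p) + acc)%R) 0%R t)%R.
Proof. elim: s => [|x s IH] /=; first by rewrite Rplus_0_l. by rewrite IH Rplus_assoc. Qed.

(** The product of the primes in (m, 2m] divides the central binomial coefficient, which is one term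
    in the expansion of (1 + 1)^{2m} = 4^m. *)
Lemma theta_double (m : nat) : (theta (m.*2) <= theta m + INR m * ln 4)%R.
Proof.
rewrite /theta !filter_listE !seq_iotaE -addnn iotaD filter_cat fold_cat.
apply: Rplus_le_compat_l.
set s := seq.filter prime (iota (1 + m) m).
have As : all prime s by apply: filter_all.
case: (ln_foldr_mul s As) => <- P.
have D : dvdn (foldr muln 1 s) 'C(m.*2, m).
  apply: prime_list_dvd => //; first by apply: filter_uniq; exact: iota_uniq.
  apply/allP => p. rewrite mem_filter mem_iota => /andP [pp /andP [H1 H2]].
  apply: prime_dvd_central => //. by rewrite -addnn; rewrite add1n addSn ltnS in H2.
have C0 : (0 < 'C(m.*2, m))%N by rewrite bin_gt0 -addnn leq_addr.
have L : (foldr muln 1 s <= 4 ^ m)%N := leq_trans (dvdn_leq C0 D) (central_le m).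
have <- : ln (INR (4 ^ m)%N) = (INR m * ln 4)%R.
  rewrite -pow_expn pow_INR ln_pow; first by rewrite /=; congr (_ * ln _)%R; lra.
  by rewrite /=; lra.
have H1 : (0 < INR (foldr muln 1%N s))%R by apply: lt_0_INR; apply/ltP.
have H2 : (INR (foldr muln 1%N s) <= INR (4 ^ m)%N)%R by apply: le_INR; apply/leP.
case: (Rle_lt_or_eq_dec _ _ H2) => [H|->]; last exact: Rle_refl.
left. exact: ln_increasing.
Qed.

Lemma theta_mono a b : (a <= b)%coq_nat -> (theta a <= theta b)%R.
Proof.
move=> /leP ab. rewrite /theta !filter_listE !seq_iotaE -(subnKC ab) iotaD filter_cat fold_cat.
have : (0 <= List.fold_right (fun p acc => (ln (INR p) + acc)%R) 0%R (seq.filter prime (iota (1 + a) (b - a))))%R.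
  have : all prime (seq.filter prime (iota (1 + a) (b - a))) by apply: filter_all.
  elim: (seq.filter _ _) => [|p s IH] /=; first by move=> _; exact: Rle_refl.
  move=> /andP [pp ap]. apply: Rplus_le_le_0_compat; last exact: IH.
  have H : (1 <= INR p)%R by rewrite -[1%R]/(INR 1); apply: le_INR; apply/leP; exact: prime_gt0.
  rewrite -ln_1. case: (Rle_lt_or_eq_dec _ _ H) => [H'|<-]; last exact: Rle_refl.
  left. apply: ln_increasing => //. exact: Rlt_0_1.
lra.
Qed.

Lemma theta_pow2 k : (theta (2 ^ k)%N <= INR (2 ^ k)%N * ln 4)%R.
Proof.
elim: k => [|k IH].
  rewrite expn0 /theta /=. rewrite Rmult_1_l -ln_1. left. apply: ln_increasing; lra.
rewrite expnS mul2n.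
apply: Rle_trans (theta_double _) _.
rewrite -addnn -plusE plus_INR. lra.
Qed.

(** Iterating the doubling bound gives 2^k log 4 at powers of two; passing to the next power of two
    above n costs the factor 2. *)
Lemma theta_le (n : nat) : (theta n <= 2 * ln 4 * INR n)%R.
Proof.
case: n => [|n]; first by rewrite /theta /=; lra.
set k := trunc_log 2 n.+1.
have /andP [H1 H2] : (2 ^ k <= n.+1 < 2 ^ k.+1)%N by apply: trunc_log_bounds.
have A : (theta n.+1 <= theta (2 ^ k.+1)%N)%R by apply: theta_mono; apply/leP; exact: ltnW.
have B := theta_pow2 k.+1.
have D : (INR (2 ^ k.+1)%N <= 2 * INR n.+1)%R.
  rewrite expnS -multE mult_INR. have : (INR (2 ^ k)%N <= INR n.+1)%R by apply: le_INR; apply/leP.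
  rewrite /= ; lra.
have P : (0 < ln 4)%R by rewrite -ln_1; apply: ln_increasing; lra.
nra.
Qed.

Lemma ltn_lt a b : (a < b)%N <-> (a < b)%coq_nat.
Proof. by split=> /ltP. Qed.

End PrimeFacts.

Import PrimeFacts.

(** * Euler products and the series of [d_z] *)

Definition csum0 (f : nat -> C) (N : nat) : C := (f O + csum1 f N)%C.

Definition clim (u : nat -> C) : C :=
  epsilon (inhabits (RtoC 0)) (fun l => ccvg u l).

Lemma clim_unique u l : ccvg u l -> clim u = l.
Proof.
  intros H. apply (ccvg_unique u); auto. unfold clim.
  apply (epsilon_spec (inhabits (RtoC 0)) (fun l => ccvg u l)). now exists l.
Qed.

Lemma clim_ccvg u : (exists l, ccvg u l) -> ccvg u (clim u).
Proof. intros (l & H). now rewrite (clim_unique u l). Qed.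

Lemma rsum1_sum_n (f : nat -> R) N : f O + rsum1 f N = sum_n f N.
Proof.
  induction N as [|N IH]; simpl.
  - rewrite sum_O. ring.
  - rewrite sum_Sn, <- IH. unfold plus; simpl. ring.
Qed.

Lemma ex_series_tail (g : nat -> R) : (forall n, 0 <= g n) -> ex_series g ->
  forall e, 0 < e -> exists N, forall n m, (N <= n <= m)%nat -> rsum1 g m - rsum1 g n <= e.
Proof.
  intros Hg Hs e He. destruct Hs as (l & Hl).
  assert (L : is_lim_seq (sum_n g) l) by exact Hl.
  apply is_lim_seq_spec in L.
  destruct (L (mkposreal (e / 2) ltac:(lra))) as (N & HN). simpl in HN.
  exists N. intros n m Hnm. assert (A := HN n ltac:(lia)). assert (B := HN m ltac:(lia)).
  rewrite <- rsum1_sum_n in A, B. apply Rabs_def2 in A. apply Rabs_def2 in B. lra.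
Qed.

Lemma bounded_tail (g : nat -> R) B : (forall n, (1 <= n)%nat -> 0 <= g n) -> (forall n, rsum1 g n <= B) ->
  forall e, 0 < e -> exists N, forall n m, (N <= n <= m)%nat -> rsum1 g m - rsum1 g n <= e.
Proof.
  intros Hg HB e He.
  assert (L : ex_finite_lim_seq (rsum1 g)).
  { apply (ex_finite_lim_seq_incr _ B); auto. intros n. simpl. generalize (Hg (S n) ltac:(lia)). lra. }
  destruct L as (l & Hl). apply is_lim_seq_spec in Hl.
  destruct (Hl (mkposreal (e / 2) ltac:(lra))) as (N & HN). simpl in HN.
  exists N. intros n m Hnm. assert (A := HN n ltac:(lia)). assert (B' := HN m ltac:(lia)).
  apply Rabs_def2 in A. apply Rabs_def2 in B'. lra.
Qed.

(** The Weierstrass M-test, with the summability of the majorant given as smallness of its tails. *)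
Lemma unif_cvg_series (U : C -> Prop) (f : nat -> C -> C) (g : nat -> R) :
  (forall e, 0 < e -> exists N, forall n m, (N <= n <= m)%nat -> rsum1 g m - rsum1 g n <= e) ->
  (forall n z, (1 <= n)%nat -> U z -> Cmod (f n z) <= g n) ->
  unif_cvg U (fun N z => csum1 (fun n => f n z) N) (fun z => clim (csum1 (fun n => f n z))) /\
  forall z, U z -> ccvg (csum1 (fun n => f n z)) (clim (csum1 (fun n => f n z))).
Proof.
  intros Hg Hf.
  assert (P : forall z, U z -> ccvg (csum1 (fun n => f n z)) (clim (csum1 (fun n => f n z)))).
  { intros z Hz. apply clim_ccvg, ccvg_cauchy. intros e He.
    destruct (Hg (e / 3) ltac:(lra)) as (N & HN). exists N. intros n m Hn Hm.
    assert (Q : forall k, (N <= k)%nat -> Cmod (csum1 (fun n => f n z) k - csum1 (fun n => f n z) N) <= e / 3).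
    { intros k Hk. eapply Rle_trans; [apply (csum1_diff_bound _ g); auto|]; [| apply HN; lia].
      intros; apply Hf; auto; lia. }
    replace (csum1 (fun n => f n z) n - csum1 (fun n => f n z) m)%C with
      ((csum1 (fun n => f n z) n - csum1 (fun n => f n z) N) - (csum1 (fun n => f n z) m - csum1 (fun n => f n z) N))%C by ring.
    eapply Rle_lt_trans; [apply Cmod_minus_le|]. generalize (Q n Hn) (Q m Hm). lra. }
  split; auto.
  intros e He. destruct (Hg e He) as (N & HN). exists N. intros n z Hn Hz.
  rewrite Cmod_sub_sym.
  apply (ccvg_le (fun m => csum1 (fun n => f n z) m - csum1 (fun n => f n z) n)%C _ _ n).
  - intros m Hm. eapply Rle_trans; [apply (csum1_diff_bound _ g); auto|]; [| apply HN; lia].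
    intros; apply Hf; auto; lia.
  - unfold Cminus. apply ccvg_plus; [auto | apply ccvg_const].
Qed.

Fixpoint rrising (k : R) (a : nat) : R :=
  match a with O => 1 | S b => rrising k b * (k + INR b) end.

(** The Taylor coefficients of (1 - x)^{-k}; for k >= |z| they dominate the absolute values of
    [dz_pp z]. *)
Definition rdz_pp (k : R) (a : nat) : R := rrising k a * / INR (fact a).

Lemma rrising_nonneg k a : 0 <= k -> 0 <= rrising k a.
Proof. intros Hk. induction a as [|a IH]; simpl; [lra|]. generalize (pos_INR a). intros. apply Rmult_le_pos; lra. Qed.

Lemma rdz_pp_nonneg k a : 0 <= k -> 0 <= rdz_pp k a.
Proof.
  intros Hk. apply Rmult_le_pos; [now apply rrising_nonneg|].
  left. apply Rinv_0_lt_compat, INR_fact_lt_0.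
Qed.

Lemma Cmod_dz_pp_le z k a : Cmod z <= k -> Cmod (dz_pp z a) <= rdz_pp k a.
Proof.
  intros Hz. unfold dz_pp, rdz_pp. rewrite Cmod_mult.
  assert (F : 0 < / INR (fact a)) by (apply Rinv_0_lt_compat, INR_fact_lt_0).
  rewrite Cmod_RtoC_le by lra. apply Rmult_le_compat_r; [lra|].
  induction a as [|a IH]; simpl; [rewrite Cmod_1; lra|].
  rewrite Cmod_mult. assert (F' : 0 < / INR (fact a)) by (apply Rinv_0_lt_compat, INR_fact_lt_0).
  apply Rmult_le_compat; auto using Cmod_ge_0.
  eapply Rle_trans; [apply Cmod_triangle|]. rewrite Cmod_RtoC_le by apply pos_INR. lra.
Qed.

Lemma dz_pp_RtoC k a : dz_pp (RtoC k) a = RtoC (rdz_pp k a).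
Proof.
  unfold dz_pp, rdz_pp. rewrite RtoC_mult. f_equal.
  induction a as [|a IH]; simpl; auto. now rewrite IH, RtoC_mult, RtoC_plus.
Qed.

Lemma dz_pp_S z a : (dz_pp z (S a) * RtoC (INR (S a)) = dz_pp z a * (z + RtoC (INR a)))%C.
Proof.
  unfold dz_pp. cbn [rising].
  replace (fact (S a)) with (S a * fact a)%nat by reflexivity. rewrite mult_INR.
  assert (P1 : INR (S a) <> 0) by (apply not_0_INR; lia).
  assert (P2 : INR (fact a) <> 0) by apply INR_fact_neq_0.
  rewrite Rinv_mult, !RtoC_mult.
  replace (RtoC (/ INR (S a))) with (/ RtoC (INR (S a)))%C by (now rewrite RtoC_inv).
  field. intros E; apply RtoC_inj in E; auto.
Qed.

Lemma rdz_pp_S k a : rdz_pp k (S a) * INR (S a) = rdz_pp k a * (k + INR a).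
Proof.
  unfold rdz_pp. cbn [rrising].
  replace (fact (S a)) with (S a * fact a)%nat by reflexivity. rewrite mult_INR.
  assert (P1 : INR (S a) <> 0) by (apply not_0_INR; lia).
  assert (P2 : INR (fact a) <> 0) by apply INR_fact_neq_0.
  field. auto.
Qed.

Lemma ex_series_rdz_pp k r : 0 < k -> 0 < r < 1 -> ex_series (fun a => rdz_pp k a * r ^ a).
Proof.
  intros Hk Hr.
  assert (Pos : forall a, 0 < rdz_pp k a).
  { intros a. unfold rdz_pp. apply Rmult_lt_0_compat; [| apply Rinv_0_lt_compat, INR_fact_lt_0].
    induction a as [|a IH]; simpl; [lra|]. generalize (pos_INR a). nra. }
  apply ex_series_Rabs, (ex_series_DAlembert _ r); [lra | |].
  - intros a. assert (P := pow_lt r a ltac:(lra)). generalize (Pos a). nra.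
  - apply (is_lim_seq_ext (fun a => r * (1 + (k - 1) * / INR (S a)))).
    + intros a. assert (P := pow_lt r a ltac:(lra)). assert (Q := Pos a). assert (Q' := Pos (S a)).
      assert (P1 : 0 < INR (S a)) by (apply lt_0_INR; lia).
      assert (E := rdz_pp_S k a).
      replace (rdz_pp k (S a)) with (rdz_pp k a * (k + INR a) / INR (S a)) by (rewrite <- E; field; lra).
      simpl (r ^ S a).
      replace (rdz_pp k a * (k + INR a) / INR (S a) * (r * r ^ a) / (rdz_pp k a * r ^ a)) with
        (r * ((k + INR a) / INR (S a))) by (field; lra).
      rewrite Rabs_right.
      * rewrite S_INR in *. field. lra.
      * apply Rle_ge, Rmult_le_pos; [lra|]. apply Rmult_le_pos; [generalize (pos_INR a); lra|].
        left; now apply Rinv_0_lt_compat.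
    + replace (Finite r) with (Rbar_mult r (Rbar_plus 1 (Rbar_mult (k - 1) 0))) by (simpl; f_equal; ring).
      apply is_lim_seq_scal_l. apply is_lim_seq_plus'; [apply is_lim_seq_const|].
      apply (is_lim_seq_scal_l _ (k - 1) 0). apply (is_lim_seq_incr_1 (fun n => / INR n)).
      replace (Finite 0) with (Rbar_inv p_infty) by reflexivity.
      apply is_lim_seq_inv; [apply is_lim_seq_INR | discriminate].
Qed.

Lemma cderiv_pow n z : cderiv (fun w => w ^ S n)%C z (RtoC (INR (S n)) * z ^ n)%C.
Proof.
  induction n as [|n IH].
  - simpl. apply (cderiv_ext (fun w => w)); [intros; ring|]. eapply cderiv_eq; [| apply cderiv_id]. simpl. ring.
  - apply (cderiv_ext (fun w => w * w ^ S n)%C); [reflexivity|].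
    eapply cderiv_eq; [| apply cderiv_mult; [apply cderiv_id | exact IH]].
    rewrite (S_INR (S n)), RtoC_plus. simpl Cpow. ring.
Qed.

Lemma ccont_pow n z : ccont (fun w => w ^ n)%C z.
Proof. destruct n; [exact (ccont_const 1 z) | eapply cderiv_ccont, cderiv_pow]. Qed.

Definition unit_disc (z : C) : Prop := Cmod z < 1.

Section PowerSeries.

Variable c : nat -> C.
Variable g : nat -> R.
Hypothesis Hc : forall n, Cmod (c n) <= g n.
Hypothesis Hg : forall r, 0 < r < 1 -> ex_series (fun n => g n * r ^ n).

Let fn (N : nat) (z : C) : C := csum1 (fun n => c n * z ^ n)%C N.
Let dfn (N : nat) (z : C) : C := csum1 (fun n => c n * (RtoC (INR n) * z ^ (n - 1)))%C N.

(** The sum starts at n = 1, as [csum1] does; a constant term is added by hand where it matters. *)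
Definition psum (z : C) : C := clim (csum1 (fun n => c n * z ^ n)%C).

Lemma psum_holo : holo unit_disc psum (cder psum) /\
  (forall z, unit_disc z -> ccvg (fun N => dfn N z) (cder psum z)) /\
  (forall z, unit_disc z -> ccvg (fun N => fn N z) (psum z)).
Proof.
  assert (Gp : forall n, 0 <= g n) by (intros n; eapply Rle_trans; [apply Cmod_ge_0 | apply Hc]).
  assert (M : forall r, 0 < r < 1 ->
     unif_cvg (fun z => Cmod z < r) fn psum /\ forall z, Cmod z < r -> ccvg (fun N => fn N z) (psum z)).
  { intros r Hr. apply (unif_cvg_series (fun z => Cmod z < r) (fun n z => c n * z ^ n)%C (fun n => g n * r ^ n)).
    - apply ex_series_tail; [| now apply Hg].
      intros n. apply Rmult_le_pos; auto. apply pow_le; lra.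
    - intros n z _ Hz. rewrite Cmod_mult, Cmod_pow. apply Rmult_le_compat; auto using Cmod_ge_0.
      + apply pow_le, Cmod_ge_0.
      + apply pow_incr. split; [apply Cmod_ge_0 | lra]. }
  assert (W := weierstrass unit_disc fn dfn psum).
  destruct W as (W1 & W2).
  - intros N. apply holo_csum1. intros n Hn z Hz. destruct n as [|n]; [lia|].
    replace (S n - 1)%nat with n by lia. split.
    + apply cderiv_scal. apply cderiv_pow.
    + apply ccont_mult; [apply ccont_const|]. apply ccont_mult; [apply ccont_const | apply ccont_pow].
  - intros z Hz. unfold unit_disc in *. exists ((1 - Cmod z) / 2). split; [lra|].
    assert (Near : forall w, Cmod (w - z) < (1 - Cmod z) / 2 -> Cmod w < (1 + Cmod z) / 2).
    { intros w Hw. generalize (Cmod_sub_le w z). lra. }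
    assert (Pz := Cmod_ge_0 z).
    split; [intros w Hw; specialize (Near w Hw); lra|].
    destruct (M ((1 + Cmod z) / 2)) as (M1 & _); [lra|].
    intros e He. destruct (M1 e He) as (N & HN). exists N. intros n w Hn Hw. apply HN; auto.
  - split; auto. split; auto. intros z Hz. unfold unit_disc in Hz. assert (Pz := Cmod_ge_0 z).
    destruct (M ((1 + Cmod z) / 2)) as (_ & M2); [lra|]. apply M2. lra.
Qed.

End PowerSeries.

Lemma disc_star r (w : C) u : Cmod w < r -> 0 <= u <= 1 -> Cmod (0 + RtoC u * (w - 0)) < r.
Proof.
  intros Hw Hu. replace (0 + u * (w - 0))%C with (RtoC u * w)%C by ring.
  rewrite Cmod_mult, Cmod_RtoC_le by lra. generalize (Cmod_ge_0 w). nra.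
Qed.

(* [-log (1 - x)]. *)
Definition nlog (x : C) : C := psum (fun n => RtoC (/ INR n)) x.

(** The termwise derivative is the geometric series, whose partial sums telescope against 1 - z to 1
    - z^N. *)
Lemma nlog_facts : holo unit_disc nlog (cder nlog) /\
  (forall z, unit_disc z -> ((1 - z) * cder nlog z = 1)%C) /\ nlog 0 = 0 /\
  (forall z, unit_disc z -> ccvg (csum1 (fun n => RtoC (/ INR n) * z ^ n)%C) (nlog z)).
Proof.
  assert (Hc : forall n, Cmod (RtoC (/ INR n)) <= 1).
  { intros [|n].
    - simpl INR. rewrite Rinv_0, Cmod_0. lra.
    - assert (P1 : 1 <= INR (S n)) by (change 1 with (INR 1); apply le_INR; lia).
      rewrite Cmod_RtoC_le by (left; apply Rinv_0_lt_compat; lra).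
      apply Rle_trans with (/ 1); [apply Rinv_le_contravar; lra | lra]. }
  assert (Hg : forall r, 0 < r < 1 -> ex_series (fun n => 1 * r ^ n)).
  { intros r Hr. apply (ex_series_ext (fun n => r ^ n)); [intros; symmetry; apply Rmult_1_l|].
    apply ex_series_geom. rewrite Rabs_right; lra. }
  destruct (psum_holo (fun n => RtoC (/ INR n)) (fun _ => 1) Hc Hg) as (H1 & H2 & H3).
  change (psum (fun n => RtoC (/ INR n))) with nlog in *.
  split; [exact H1 | split; [| split; [| exact H3]]].
  - intros z Hz. specialize (H2 z Hz).
    assert (E : forall N, ((1 - z) * csum1 (fun n => RtoC (/ INR n) * (RtoC (INR n) * z ^ (n - 1)))%C N = 1 - z ^ N)%C).
    { intros N. rewrite (csum1_ext _ (fun n => z ^ (n - 1))%C).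
      - induction N as [|N IH]; [simpl; ring|].
        cbn [csum1]. rewrite Cmult_plus_distr_l, IH. replace (S N - 1)%nat with N by lia. simpl Cpow. ring.
      - intros n Hn. rewrite Cmult_assoc, <- RtoC_mult, Rinv_l; [ring|]. apply not_0_INR; lia. }
    apply (ccvg_unique (fun N => (1 - z) * csum1 (fun n => RtoC (/ INR n) * (RtoC (INR n) * z ^ (n - 1)))%C N)%C).
    + now apply ccvg_scal.
    + apply (ccvg_0 _ (fun N => Cmod z ^ N)).
      * intros N. rewrite E. replace (1 - z ^ N - 1)%C with (- z ^ N)%C by ring.
        rewrite Cmod_opp, Cmod_pow. lra.
      * apply is_lim_seq_geom. rewrite Rabs_right; [exact Hz | apply Rle_ge, Cmod_ge_0].
  - assert (Z : unit_disc 0) by (unfold unit_disc; rewrite Cmod_0; lra).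
    apply (ccvg_unique (csum1 (fun n => RtoC (/ INR n) * 0 ^ n)%C)); [now apply H3|].
    apply (ccvg_ext (fun _ => RtoC 0)); [| apply ccvg_const].
    intros N. rewrite (csum1_ext _ (fun _ => 0 * 0)%C), csum1_scal; [ring|].
    intros [|n] Hn; [lia|]. simpl. ring.
Qed.

(** The recurrence of the coefficients says that the sum S of the series solves (1 - w) S' = z S.
    Since (1 - w) nlog' = 1, the product S exp(-z nlog) has zero derivative and equals its value 1
    at the origin. Here S is [1 + P w], as [psum] leaves out the constant term. *)
Lemma binomial_series (z x : C) : unit_disc x ->
  ccvg (csum0 (fun a => dz_pp z a * x ^ a)%C) (cexp (z * nlog x)).
Proof.
  intros Hx. set (k := Cmod z + 1). assert (Hk : 0 < k) by (unfold k; generalize (Cmod_ge_0 z); lra).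
  assert (Hc : forall n, Cmod (dz_pp z n) <= rdz_pp k n) by (intros; apply Cmod_dz_pp_le; unfold k; lra).
  destruct (psum_holo (dz_pp z) (rdz_pp k) Hc (fun r Hr => ex_series_rdz_pp k r Hk Hr)) as (H1 & H2 & H3).
  set (P := psum (dz_pp z)) in *.
  destruct nlog_facts as (L1 & L2 & L3 & L4).
  assert (dz0 : dz_pp z 0 = 1) by (unfold dz_pp; simpl; rewrite Rinv_1; ring).
  assert (ODE : forall w, unit_disc w -> ((1 - w) * cder P w = z * (1 + P w))%C).
  { intros w Hw. specialize (H2 w Hw). specialize (H3 w Hw).
    set (dn := fun N => csum1 (fun n => dz_pp z n * (RtoC (INR n) * w ^ (n - 1)))%C N) in *.
    (* The differential equation for partial sums. The defect is the next term of the derivative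
       series, written as a difference of consecutive partial sums so that it visibly tends to 0. *)
    assert (E : forall N, ((1 - w) * dn N = z * (1 + csum1 (fun n => dz_pp z n * w ^ n)%C N)
       - (dn (S N) - dn N))%C).
    { intros N. assert (Q : (dn (S N) - dn N = dz_pp z (S N) * RtoC (INR (S N)) * w ^ N)%C).
      { unfold dn. cbn [csum1]. replace (S N - 1)%nat with N by lia. ring. }
      rewrite Q, dz_pp_S. clear Q. induction N as [|N IH].
      - unfold dn. simpl csum1. rewrite dz0. simpl. ring.
      - replace (dn (S N)) with (dn N + dz_pp z (S N) * RtoC (INR (S N)) * w ^ N)%C
          by (unfold dn; cbn [csum1]; replace (S N - 1)%nat with N by lia; ring).
        rewrite Cmult_plus_distr_l, IH. cbn [csum1]. rewrite dz_pp_S.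
        replace ((1 - w) * (dz_pp z N * (z + RtoC (INR N)) * w ^ N))%C with
          (dz_pp z N * (z + RtoC (INR N)) * w ^ N - (dz_pp z N * (z + RtoC (INR N))) * (w * w ^ N))%C by ring.
        rewrite <- (dz_pp_S z N) at 3. simpl Cpow. ring. }
    apply (ccvg_unique (fun N => (1 - w) * dn N)%C); [now apply ccvg_scal|].
    apply (ccvg_ext (fun N => z * (1 + csum1 (fun n => dz_pp z n * w ^ n)%C N) - (dn (S N) - dn N))%C); [intros; now rewrite E|].
    replace (z * (1 + P w))%C with (z * (1 + P w) + - (cder P w + - cder P w))%C by ring.
    assert (O : forall u l, ccvg u l -> ccvg (fun n => - u n)%C (- l)).
    { intros u l Hu. apply (ccvg_comp (fun w => - w)%C); auto. apply ccont_opp, ccont_id. }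
    unfold Cminus. apply ccvg_plus; [apply ccvg_scal, ccvg_plus; [apply ccvg_const | exact H3]|].
    apply O. apply ccvg_plus; [| now apply O].
    assert (Sh := proj2 (ccvg_shift (fun N => dn N) (cder P w) 1) H2).
    eapply ccvg_ext; [| exact Sh]. intros n; cbv beta. f_equal; lia. }
  set (G := fun w => ((1 + P w) * cexp (- z * nlog w))%C).
  assert (N1 : forall w, unit_disc w -> (1 - w <> 0)%C).
  { intros w Hw E. assert (w = 1) by (symmetry; now apply Ceq_minus). subst w. unfold unit_disc in Hw.
    rewrite Cmod_1 in Hw. lra. }
  assert (HG : holo unit_disc G (fun w => (0 + cder P w) * cexp (- z * nlog w) + (1 + P w) * (cexp (- z * nlog w) * (- z * cder nlog w)))%C).
  { apply holo_mult; [apply holo_plus; [apply holo_const | exact H1]|]. apply holo_cexp. now apply holo_scal. }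
  assert (EG : G x = G 0).
  { apply (holo_const_star _ _ _ 0 x HG); auto; [intros w u; apply disc_star|]. intros w Hw.
    assert (A := ODE w Hw). assert (B := L2 w Hw). assert (Nw := N1 w Hw).
    replace (cder P w) with (z * (1 + P w) / (1 - w))%C by (rewrite <- A; field; auto).
    replace (cder nlog w) with (1 / (1 - w))%C by (transitivity ((1 - w) * cder nlog w / (1 - w))%C; [now rewrite B | field; auto]).
    field. auto. }
  assert (P0 : P 0 = 0).
  { assert (Z : unit_disc 0) by (unfold unit_disc; rewrite Cmod_0; lra).
    apply (ccvg_unique (csum1 (fun n => dz_pp z n * 0 ^ n)%C)); [now apply H3|].
    apply (ccvg_ext (fun _ => RtoC 0)); [| apply ccvg_const].
    intros N. rewrite (csum1_ext _ (fun _ => 0 * 0)%C), csum1_scal; [ring|].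
    intros [|n] Hn; [lia|]. simpl. ring. }
  unfold G in EG. rewrite P0, L3, Cplus_0_r, Cmult_0_r, cexp_0, Cmult_1_r in EG.
  replace (cexp (z * nlog x)) with (1 + P x)%C.
  - unfold csum0. rewrite dz0. simpl (x ^ 0)%C. rewrite Cmult_1_l.
    apply ccvg_plus; [apply ccvg_const | now apply H3].
  - replace (- z * nlog x)%C with (- (z * nlog x))%C in EG by ring. rewrite cexp_opp in EG.
    assert (N := cexp_neq_0 (z * nlog x)).
    replace (1 + P x)%C with ((1 + P x) * / cexp (z * nlog x) * cexp (z * nlog x))%C by (field; auto).
    rewrite EG. ring.
Qed.

(** The threshold 3/4 exceeds 2^{-1/2}, so it covers p^{-s} for every prime p once Re s >= 1/2; the
    factor 4 is the sum of the geometric series of ratio 3/4. *)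
Lemma nlog_bound x : Cmod x <= 3 / 4 -> Cmod (nlog x) <= 4 * Cmod x.
Proof.
  intros Hx. destruct nlog_facts as (_ & _ & _ & L4).
  assert (Px := Cmod_ge_0 x).
  apply (ccvg_le (csum1 (fun n => RtoC (/ INR n) * x ^ n)%C) _ _ 0).
  - intros N _. eapply Rle_trans; [apply (csum1_bound _ (fun n => Cmod x * (3 / 4) ^ (n - 1)))|].
    + intros [|n] Hn; [lia|]. replace (S n - 1)%nat with n by lia.
      rewrite Cmod_mult, Cmod_pow.
      assert (P1 : 1 <= INR (S n)) by (change 1 with (INR 1); apply le_INR; lia).
      rewrite Cmod_RtoC_le by (left; apply Rinv_0_lt_compat; lra).
      assert (/ INR (S n) <= 1) by (apply Rle_trans with (/ 1); [apply Rinv_le_contravar; lra | lra]).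
      assert (0 < / INR (S n)) by (apply Rinv_0_lt_compat; lra).
      simpl pow. assert (Q : Cmod x ^ n <= (3 / 4) ^ n) by (apply pow_incr; lra).
      assert (0 <= Cmod x ^ n) by (apply pow_le; auto).
      apply Rle_trans with (1 * (Cmod x * Cmod x ^ n)).
      * apply Rmult_le_compat_r; [apply Rmult_le_pos|]; auto.
      * rewrite Rmult_1_l. apply Rmult_le_compat_l; auto.
    + rewrite rsum1_scal.
      assert (S : forall M, rsum1 (fun n => (3 / 4) ^ (n - 1)) M = 4 - 4 * (3 / 4) ^ M).
      { induction M as [|M IH]; [simpl; ring|]. cbn [rsum1]. rewrite IH. replace (S M - 1)%nat with M by lia.
        simpl pow. field. }
      rewrite S. assert (0 < (3 / 4) ^ N) by (apply pow_lt; lra). nra.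
  - apply L4. unfold unit_disc. lra.
Qed.

(** * Finite Euler products over integers with prescribed prime factors *)

Notation isprime p := (prime.prime p = true).
Notation divides p n := (div.dvdn p n = true).

(** Coprimality is phrased for one prime at a time: this is the form in which factors are split off
    along a list of primes. *)
Definition multiplicative (f : nat -> C) : Prop :=
  f 1%nat = 1 /\ forall p a m, isprime p -> ~ divides p m -> (0 < m)%nat ->
    f (Nat.pow p a * m)%nat = (f (Nat.pow p a) * f m)%C.

(** The integers whose prime factors lie in [ps], with exponents at most A. Bounding the exponents
    as well makes the Euler product an identity between finite sums. *)
Fixpoint smooth (A : nat) (ps : list nat) : list nat :=
  match ps with
  | nil => 1%nat :: nil
  | p :: ps' => flat_map (fun a => map (fun m => Nat.pow p a * m)%nat (smooth A ps')) (seq 0 (S A))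
  end.

Fixpoint plist (N : nat) : list nat :=
  match N with
  | O => nil
  | S m => if prime.prime (S m) then S m :: plist m else plist m
  end.

Fixpoint pprod (h : nat -> C) (N : nat) : C :=
  match N with
  | O => 1
  | S m => if prime.prime (S m) then (h (S m) * pprod h m)%C else pprod h m
  end.

Definition lsum (f : nat -> C) (l : list nat) : C := fold_right (fun n acc => (f n + acc)%C) (RtoC 0) l.

Lemma lsum_app f l1 l2 : lsum f (l1 ++ l2) = (lsum f l1 + lsum f l2)%C.
Proof. induction l1 as [|x l IH]; simpl; [ring | rewrite IH; ring]. Qed.

Lemma in_plist p N : In p (plist N) <-> isprime p /\ (p <= N)%nat.
Proof.
  induction N as [|N IH]; simpl.
  - split; [tauto|]. intros (H1 & H2). apply prime_ge2 in H1. lia.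
  - destruct (prime.prime (S N)) eqn:E; simpl; rewrite IH.
    + split.
      * intros [<- | (H1 & H2)]; split; auto.
      * intros (H1 & H2). destruct (Nat.eq_dec p (S N)); [left; auto | right; split; auto; lia].
    + split; intros (H1 & H2); split; auto. destruct (Nat.eq_dec p (S N)); [subst; congruence | lia].
Qed.

Lemma nodup_plist N : NoDup (plist N).
Proof.
  induction N as [|N IH]; simpl; [constructor|].
  destruct (prime.prime (S N)); auto. constructor; auto. rewrite in_plist. lia.
Qed.

Lemma prime_pos p : isprime p -> (0 < p)%nat.
Proof. intros H. apply prime_ge2 in H. lia. Qed.

Lemma smooth_facts A ps : (forall p, In p ps -> isprime p) -> forall n, In n (smooth A ps) ->
  (0 < n)%nat /\ forall q, isprime q -> ~ In q ps -> ~ divides q n.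
Proof.
  induction ps as [|p ps IH]; intros Hps n Hn; cbn [smooth] in Hn.
  - destruct Hn as [<- | []]. split; [lia|]. intros q Hq _. now apply not_prime_1_dvd.
  - apply in_flat_map in Hn as (a & _ & Hn). apply in_map_iff in Hn as (m & <- & Hm).
    destruct (IH (fun p Hp => Hps p (or_intror Hp)) m Hm) as (M1 & M2).
    assert (Pp := Hps p (or_introl eq_refl)). assert (P0 := prime_pos p Pp).
    split.
    + apply Nat.mul_pos_pos; auto. apply Nat.neq_0_lt_0, Nat.pow_nonzero. lia.
    + intros q Hq Nq D. apply prime_dvd_pow_mul in D; auto. destruct D as [-> | D].
      * apply Nq; now left.
      * apply (M2 q Hq); auto. intros I; apply Nq; now right.
Qed.

Lemma nodup_flat_map (g : nat -> list nat) l : NoDup l -> (forall a, In a l -> NoDup (g a)) ->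
  (forall a b x, In a l -> In b l -> In x (g a) -> In x (g b) -> a = b) -> NoDup (flat_map g l).
Proof.
  induction l as [|a l IH]; intros H1 H2 H3; simpl; [constructor|].
  inversion H1; subst. apply NoDup_app.
  - apply H2; now left.
  - apply IH; auto; intros; [apply H2; now right | eapply H3; eauto; now right].
  - intros x Hx Hx'. apply in_flat_map in Hx' as (b & Hb & Hx').
    assert (a = b) by (apply (H3 a b x); simpl; auto). subst; auto.
Qed.

Lemma nodup_map_inj (g : nat -> nat) l : (forall x y, In x l -> In y l -> g x = g y -> x = y) ->
  NoDup l -> NoDup (map g l).
Proof.
  induction l as [|a l IH]; intros H1 H2; simpl; [constructor|]. inversion H2; subst. constructor.
  - intros H. apply in_map_iff in H as (x & E & Hx). apply H3.
    rewrite (H1 a x); simpl; auto.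
  - apply IH; auto. intros; apply H1; simpl; auto.
Qed.

Lemma smooth_nodup A ps : (forall p, In p ps -> isprime p) -> NoDup ps -> NoDup (smooth A ps).
Proof.
  induction ps as [|p ps IH]; intros Hps Hn; cbn [smooth]; [constructor; simpl; [tauto | constructor]|].
  inversion Hn; subst.
  assert (Hps' := fun p Hp => Hps p (or_intror Hp)). assert (Pp := Hps p (or_introl eq_refl)).
  assert (F := smooth_facts A ps Hps').
  assert (Inj : forall a b x y, In x (smooth A ps) -> In y (smooth A ps) ->
    (Nat.pow p a * x)%nat = (Nat.pow p b * y)%nat -> a = b /\ x = y).
  { intros a b x y Hx Hy E. destruct (F x Hx) as (X1 & X2). destruct (F y Hy) as (Y1 & Y2).
    apply (pow_mul_inj p); auto; try (apply ltn_lt; auto).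
    - exact (X2 p Pp H1).
    - exact (Y2 p Pp H1). }
  apply nodup_flat_map.
  - apply seq_NoDup.
  - intros a _. apply nodup_map_inj; auto. intros x y Hx Hy E. eapply Inj; eauto.
  - intros a b x _ _ Ha Hb. apply in_map_iff in Ha as (u & <- & Hu). apply in_map_iff in Hb as (v & E & Hv).
    symmetry. exact (proj1 (Inj b a v u Hv Hu E)).
Qed.

Lemma smooth_complete A ps n : (forall p, In p ps -> isprime p) -> NoDup ps -> (0 < n <= A)%nat ->
  (forall q, isprime q -> divides q n -> In q ps) -> In n (smooth A ps).
Proof.
  revert n. induction ps as [|p ps IH]; intros n Hps Hnd Hn H; cbn [smooth].
  - left. destruct (Nat.eq_dec n 1) as [|N1]; auto. exfalso.
    destruct (prime_divisor n) as (p & P1 & P2 & _); [apply ltn_lt; lia|]. apply (H p P1 P2).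
  - assert (Pp := Hps p (or_introl eq_refl)). inversion Hnd; subst.
    destruct (pow_mul_exists p n Pp) as (a & m & E & Nm & M0 & La); [apply ltn_lt; lia|].
    apply ltn_lt in M0. apply ltn_lt in La.
    assert (Pw : (0 < Nat.pow p a)%nat).
    { apply Nat.neq_0_lt_0, Nat.pow_nonzero. apply prime_pos in Pp. lia. }
    apply in_flat_map. exists a. split; [apply in_seq; lia|]. apply in_map_iff. exists m. split; auto.
    apply IH; auto.
    + intros; apply Hps; now right.
    + nia.
    + intros q Hq Dq. destruct (H q Hq) as [-> | Hin]; auto.
      * rewrite E. apply div.dvdn_mull. exact Dq.
      * contradiction.
Qed.

Lemma lsum_map_scal f c (g : nat -> nat) l : (forall m, In m l -> f (g m) = (c * f m)%C) ->
  lsum f (map g l) = (c * lsum f l)%C.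
Proof.
  induction l as [|x l IH]; intros H; simpl; [ring|].
  rewrite H by (left; auto). rewrite IH by (intros; apply H; now right). ring.
Qed.

Lemma csum0_seq h A : fold_right (fun a acc => (h a + acc)%C) (RtoC 0) (seq 0 (S A)) = csum0 h A.
Proof.
  unfold csum0. induction A as [|A IH]; [simpl; ring|].
  rewrite seq_S, fold_right_app. cbn [fold_right]. rewrite Nat.add_0_l.
  assert (G : forall l x, fold_right (fun a acc => (h a + acc)%C) x l = (fold_right (fun a acc => (h a + acc)%C) (RtoC 0) l + x)%C).
  { induction l as [|y l IHl]; intros x; simpl; [ring | rewrite IHl; ring]. }
  rewrite G, IH. cbn [csum1]. ring.
Qed.

Lemma lsum_smooth f A ps : multiplicative f -> (forall p, In p ps -> isprime p) -> NoDup ps ->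
  lsum f (smooth A ps) =
  fold_right (fun p acc => (csum0 (fun a => f (Nat.pow p a)) A * acc)%C) (RtoC 1) ps.
Proof.
  intros (F1 & F2) Hps Hnd. induction ps as [|p ps IH].
  - cbn [smooth lsum fold_right]. rewrite F1. ring.
  - inversion Hnd; subst. assert (Hps' := fun p Hp => Hps p (or_intror Hp)). assert (Pp := Hps p (or_introl eq_refl)).
    cbn [smooth fold_right]. rewrite <- (IH Hps' H2), <- csum0_seq.
    assert (Q : forall l, lsum f (flat_map (fun a => map (fun m => Nat.pow p a * m)%nat (smooth A ps)) l) =
      (fold_right (fun a acc => f (Nat.pow p a) + acc) (RtoC 0) l * lsum f (smooth A ps))%C).
    { induction l as [|a l IHl]; [simpl; ring|]. cbn [flat_map fold_right]. rewrite lsum_app, IHl.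
      rewrite (lsum_map_scal f (f (Nat.pow p a))); [ring|].
      intros m Hm. destruct (smooth_facts A ps Hps' m Hm) as (M1 & M2). apply F2; auto. }
    apply Q.
Qed.

Lemma fold_plist h N : fold_right (fun p acc => (h p * acc)%C) (RtoC 1) (plist N) = pprod h N.
Proof. induction N as [|N IH]; simpl; auto. destruct (prime.prime (S N)); simpl; now rewrite IH. Qed.

Lemma euler_finite f A N : multiplicative f ->
  lsum f (smooth A (plist N)) = pprod (fun p => csum0 (fun a => f (Nat.pow p a)) A) N.
Proof.
  intros Hf. rewrite lsum_smooth; auto using nodup_plist; [apply fold_plist|].
  intros p Hp. now apply in_plist in Hp.
Qed.

Lemma lsum_csum1 f l M : NoDup l -> (forall n, In n l -> (1 <= n <= M)%nat) ->
  lsum f l = csum1 (fun n => if in_dec Nat.eq_dec n l then f n else 0) M.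
Proof.
  intros Hnd Hb. induction l as [|x l IH].
  - simpl lsum. symmetry. rewrite (csum1_ext _ (fun _ => 0 * 0)%C), csum1_scal; [ring|].
    intros n _. destruct (in_dec Nat.eq_dec n nil) as [[] | _]. ring.
  - inversion Hnd; subst. cbn [lsum fold_right]. fold (lsum f l).
    rewrite IH; auto; [| intros; apply Hb; now right].
    assert (Hx := Hb x (or_introl eq_refl)).
    assert (D : forall M, (x <= M)%nat -> csum1 (fun n => if Nat.eq_dec n x then f n else 0) M = f x).
    { intros K HK. assert (Z : forall j, (j < x)%nat -> csum1 (fun n => if Nat.eq_dec n x then f n else 0) j = 0).
      { induction j as [|K' IHK]; intros L; cbn [csum1]; auto. rewrite IHK by lia.
        destruct (Nat.eq_dec (S K') x); [lia | ring]. }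
      destruct x as [|x]; [lia|]. induction HK as [|K HK IHK]; cbn [csum1].
      - rewrite Z by lia. destruct (Nat.eq_dec (S x) (S x)); [ring | lia].
      - rewrite IHK. destruct (Nat.eq_dec (S K) (S x)); [lia | ring]. }
    rewrite <- (D M) at 1 by lia. rewrite <- csum1_plus. apply csum1_ext. intros n _.
    destruct (Nat.eq_dec n x) as [-> | Ne].
    + destruct (in_dec Nat.eq_dec x l); [contradiction|].
      destruct (in_dec Nat.eq_dec x (x :: l)) as [_ | Q]; [ring | exfalso; apply Q; now left].
    + destruct (in_dec Nat.eq_dec n l), (in_dec Nat.eq_dec n (x :: l)) as [Q|Q]; try ring.
      * exfalso; apply Q; now right.
      * destruct Q; [congruence | contradiction].
Qed.

Lemma list_bound (l : list nat) : exists M, forall n, In n l -> (n <= M)%nat.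
Proof.
  induction l as [|x l (M & HM)]; [exists O; simpl; tauto|].
  exists (max x M). intros n [<- | H]; [lia|]. specialize (HM n H). lia.
Qed.

Lemma smooth_plist_in A N n : (1 <= n <= N)%nat -> (N <= A)%nat -> In n (smooth A (plist N)).
Proof.
  intros Hn HA. apply smooth_complete; [| apply nodup_plist | lia |].
  - intros p Hp. now apply in_plist in Hp.
  - intros q Hq Dq. apply in_plist. split; auto. apply dvdn_le_pos in Dq; [lia|]. apply ltn_lt; lia.
Qed.

(** Expanding the product gives a sum over the smooth numbers, each occurring once by unique
    factorisation. Since the exponent of any prime in n is less than n, taking A >= N makes every n
    <= N occur; nothing more about the set is used than the indicator b. *)
Lemma euler_indicator f A N : multiplicative f -> (N <= A)%nat -> exists M (b : nat -> bool), (N <= M)%nat /\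
  (forall n, (1 <= n <= N)%nat -> b n = true) /\
  pprod (fun p => csum0 (fun a => f (Nat.pow p a)) A) N = csum1 (fun n => if b n then f n else 0) M.
Proof.
  intros Hf HA. destruct (list_bound (smooth A (plist N))) as (M & HM).
  exists (max N M), (fun n => if in_dec Nat.eq_dec n (smooth A (plist N)) then true else false).
  assert (Pl : forall p, In p (plist N) -> isprime p) by (intros p Hp; now apply in_plist in Hp).
  split; [lia|]. split.
  - intros n Hn. destruct (in_dec _ n _) as [|Q]; auto. exfalso; apply Q. now apply smooth_plist_in.
  - rewrite <- euler_finite by auto. rewrite (lsum_csum1 f _ (max N M)).
    + apply csum1_ext. intros n _. destruct (in_dec _ n _); auto.
    + apply smooth_nodup; auto using nodup_plist.
    + intros n Hn. destruct (smooth_facts A _ Pl n Hn). specialize (HM n Hn). lia.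
Qed.

Lemma euler_approx f g A N : multiplicative f -> (N <= A)%nat ->
  (forall n, (1 <= n)%nat -> Cmod (f n) <= g n) -> exists M, (N <= M)%nat /\
  Cmod (pprod (fun p => csum0 (fun a => f (Nat.pow p a)) A) N - csum1 f N) <= rsum1 g M - rsum1 g N.
Proof.
  intros Hf HA Hg. destruct (euler_indicator f A N Hf HA) as (M & b & HM & Hb & E).
  exists M. split; auto. rewrite E.
  rewrite (csum1_ext f (fun n => if b n then f n else 0) N) by (intros n Hn; now rewrite Hb).
  apply csum1_diff_bound; auto. intros n Hn. destruct (b n); [apply Hg; lia|].
  rewrite Cmod_0. eapply Rle_trans; [apply Cmod_ge_0 | apply (Hg n); lia].
Qed.

Definition psumR (c : nat -> R) (N : nat) : R := rsum1 (fun n => if prime.prime n then c n else 0) N.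

Lemma Cmod_pprod_le h c N : (forall p, isprime p -> (p <= N)%nat -> Cmod (h p) <= exp (c p)) ->
  Cmod (pprod h N) <= exp (psumR c N).
Proof.
  unfold psumR. induction N as [|N IH]; intros H; cbn [pprod rsum1].
  - rewrite exp_0, Cmod_1. lra.
  - destruct (prime.prime (S N)) eqn:E.
    + rewrite Cmod_mult, Rplus_comm, exp_plus. apply Rmult_le_compat; auto using Cmod_ge_0.
    + rewrite Rplus_0_r. auto.
Qed.

(** For nonnegative f the initial segment 1, ..., N is part of the expanded product, so a bound for
    each truncated local factor bounds the partial sum. *)
Lemma euler_upper (f : nat -> R) (c : nat -> R) N : multiplicative (fun n => RtoC (f n)) ->
  (forall n, (1 <= n)%nat -> 0 <= f n) ->
  (forall p, isprime p -> (p <= N)%nat -> forall A, Cmod (csum0 (fun a => RtoC (f (Nat.pow p a))) A) <= exp (c p)) ->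
  rsum1 f N <= exp (psumR c N).
Proof.
  intros Hf Hp Hc. destruct (euler_indicator _ N N Hf (le_n N)) as (M & b & HM & Hb & E).
  apply Rle_trans with (Cmod (pprod (fun p => csum0 (fun a => RtoC (f (Nat.pow p a))) N) N)).
  - rewrite E. eapply Rle_trans; [| apply re_le_Cmod]. eapply Rle_trans; [| apply Rle_abs].
    assert (R0 : forall K, Re (csum1 (fun n => if b n then RtoC (f n) else 0) K) = rsum1 (fun n => if b n then f n else 0) K).
    { induction K as [|K IH]; [reflexivity|]. cbn [csum1 rsum1]. rewrite re_plus, IH. destruct (b (S K)); reflexivity. }
    rewrite R0. eapply Rle_trans; [| apply (rsum1_mono _ N M); auto].
    + right. apply rsum1_ext. intros n Hn. now rewrite Hb.
    + intros n Hn. destruct (b n); auto. lra.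
  - apply Cmod_pprod_le. intros; apply Hc; auto.
Qed.

Lemma INR_prime_ge2 p : isprime p -> 2 <= INR p.
Proof. intros H. apply prime_ge2 in H. change 2 with (INR 2). now apply le_INR. Qed.

Lemma npow_mul a b s : (0 < a)%nat -> (0 < b)%nat -> npow_neg (a * b) s = (npow_neg a s * npow_neg b s)%C.
Proof.
  intros Ha Hb. unfold npow_neg. rewrite mult_INR, ln_mult by (apply lt_0_INR; auto).
  rewrite RtoC_plus, <- cexp_add. f_equal. ring.
Qed.

Lemma pow_pos_nat p a : (0 < p)%nat -> (0 < Nat.pow p a)%nat.
Proof. intros H. apply Nat.neq_0_lt_0, Nat.pow_nonzero. lia. Qed.

Lemma npow_pow p a s : (0 < p)%nat -> npow_neg (Nat.pow p a) s = (npow_neg p s ^ a)%C.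
Proof.
  intros Hp. induction a as [|a IH]; [apply npow_1|].
  rewrite Nat.pow_succ_r', npow_mul, IH by auto using pow_pos_nat. reflexivity.
Qed.

Lemma rpow_mul a b x : (0 < a)%nat -> (0 < b)%nat -> Rpower (INR (a * b)) x = Rpower (INR a) x * Rpower (INR b) x.
Proof. intros Ha Hb. rewrite mult_INR. symmetry. apply Rpower_mult_distr; apply lt_0_INR; auto. Qed.

Lemma rpow_pow p a x : (0 < p)%nat -> Rpower (INR (Nat.pow p a)) x = Rpower (INR p) x ^ a.
Proof.
  intros Hp. induction a as [|a IH]; [apply Rpower_1_l|].
  rewrite Nat.pow_succ_r', rpow_mul, IH by auto using pow_pos_nat. reflexivity.
Qed.

Lemma dz_pow z p a : isprime p -> dz z (Nat.pow p a) = dz_pp z a.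
Proof.
  intros Hp. replace (Nat.pow p a) with (Nat.pow p a * 1)%nat by lia.
  rewrite dz_pow_mul; auto.
  - rewrite dz_one. ring.
  - now apply not_prime_1_dvd.
Qed.

Lemma dz_mul z p a m : isprime p -> ~ divides p m -> (0 < m)%nat ->
  dz z (Nat.pow p a * m) = (dz z (Nat.pow p a) * dz z m)%C.
Proof. intros Hp Hd Hm. rewrite dz_pow by auto. apply dz_pow_mul; auto. now apply ltn_lt. Qed.

Lemma multiplicative_dz_npow z s : multiplicative (fun n => dz z n * npow_neg n s)%C.
Proof.
  split; [rewrite dz_one, npow_1; ring|].
  intros p a m Hp Hd Hm. rewrite dz_mul, npow_mul by (auto using pow_pos_nat, prime_pos). ring.
Qed.

Lemma Rpower_prime_le p x a : isprime p -> 0 <= x -> Rpower 2 (- x) <= a -> Rpower (INR p) (- x) <= a.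
Proof.
  intros Hp Hx Ha. eapply Rle_trans; [| exact Ha]. unfold Rpower. apply exp_le.
  assert (ln 2 <= ln (INR p)) by (apply ln_le_mono; [lra | now apply INR_prime_ge2]). nra.
Qed.

Lemma Rpower_2_neg_half x : / 2 <= x -> Rpower 2 (- x) <= 3 / 4.
Proof.
  intros Hx. apply Rle_trans with (Rpower 2 (- (/ 2))).
  - apply Rle_Rpower; lra.
  - rewrite Rpower_Ropp. assert (4 / 3 <= Rpower 2 (/ 2)).
    { rewrite Rpower_sqrt by lra. apply Rsqr_incr_0_var; [| apply sqrt_pos].
      rewrite Rsqr_sqrt by lra. unfold Rsqr. lra. }
    replace (3 / 4) with (/ (4 / 3)) by field. apply Rinv_le_contravar; lra.
Qed.

(** The terms are nonnegative, so the partial sum is at most its limit (1 - x)^{-k} = exp(k nlog x),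
    and [nlog_bound] finishes. *)
Lemma local_factor_le k x A : 0 <= k -> 0 < x <= 3 / 4 ->
  rdz_pp k 0 + rsum1 (fun a => rdz_pp k a * x ^ a) A <= exp (4 * k * x).
Proof.
  intros Hk Hx.
  assert (Hu : unit_disc (RtoC x)) by (unfold unit_disc; rewrite Cmod_RtoC_le; lra).
  assert (B := binomial_series (RtoC k) (RtoC x) Hu).
  assert (E : forall N, csum0 (fun a => dz_pp (RtoC k) a * RtoC x ^ a)%C N =
    RtoC (rdz_pp k 0 + rsum1 (fun a => rdz_pp k a * x ^ a) N)).
  { intros N. unfold csum0. rewrite dz_pp_RtoC. simpl (RtoC x ^ 0)%C. rewrite RtoC_plus, Cmult_1_r. f_equal.
    induction N as [|N IH]; auto. cbn [csum1 rsum1]. rewrite IH, dz_pp_RtoC, <- RtoC_pow, <- RtoC_mult, RtoC_plus. auto. }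
  assert (M : forall N, (A <= N)%nat -> rdz_pp k 0 + rsum1 (fun a => rdz_pp k a * x ^ a) A <=
     Re (csum0 (fun a => dz_pp (RtoC k) a * RtoC x ^ a)%C N)).
  { intros N HN. rewrite E. simpl. apply Rplus_le_compat_l. apply rsum1_mono; auto.
    intros n _. apply Rmult_le_pos; [now apply rdz_pp_nonneg | apply pow_le; lra]. }
  apply Rle_trans with (Re (cexp (RtoC k * nlog (RtoC x)))).
  - apply ccvg_re in B. apply (is_lim_seq_le_loc (fun _ => rdz_pp k 0 + rsum1 (fun a => rdz_pp k a * x ^ a) A)
      _ (rdz_pp k 0 + rsum1 (fun a => rdz_pp k a * x ^ a) A) _) in B; auto.
    + exists A. exact M.
    + apply is_lim_seq_const.
  - eapply Rle_trans; [apply Rle_abs|]. eapply Rle_trans; [apply re_le_Cmod|]. rewrite Cmod_cexp. apply exp_le.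
    eapply Rle_trans; [apply Rle_abs|]. eapply Rle_trans; [apply re_le_Cmod|].
    rewrite Cmod_mult, Cmod_RtoC_le by auto.
    assert (Nb := nlog_bound (RtoC x)). rewrite Cmod_RtoC_le in Nb by lra. specialize (Nb ltac:(lra)). nra.
Qed.

Lemma rsum1_dz_le z k sigma N : 1 < sigma -> Cmod z <= k ->
  rsum1 (fun n => Cmod (dz z n) * Rpower (INR n) (- sigma)) N
   <= exp (4 * k * psumR (fun p => Rpower (INR p) (- sigma)) N).
Proof.
  intros Hs Hk. assert (Hk0 : 0 <= k) by (eapply Rle_trans; [apply Cmod_ge_0 | exact Hk]).
  replace (4 * k * psumR (fun p => Rpower (INR p) (- sigma)) N) with
    (psumR (fun p => 4 * k * Rpower (INR p) (- sigma)) N).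
  2: { unfold psumR. rewrite <- rsum1_scal. apply rsum1_ext. intros n _. destruct (prime.prime n); ring. }
  apply euler_upper.
  - split.
    + rewrite dz_one, Cmod_1. change (INR 1) with 1. rewrite Rpower_1_l. f_equal; ring.
    + intros p a m Hp Hd Hm. rewrite <- RtoC_mult. f_equal.
      rewrite dz_mul, rpow_mul, Cmod_mult by (auto using pow_pos_nat, prime_pos). ring.
  - intros n _. apply Rmult_le_pos; [apply Cmod_ge_0 | left; apply Rpower_pos].
  - intros p Hp _ A.
    set (x := Rpower (INR p) (- sigma)).
    assert (Hx : 0 < x <= 3 / 4).
    { split; [apply Rpower_pos|]. apply Rpower_prime_le; auto; [lra|]. apply Rpower_2_neg_half. lra. }
    eapply Rle_trans; [| apply (local_factor_le k x A Hk0 Hx)].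
    unfold csum0. eapply Rle_trans; [apply Cmod_triangle|]. apply Rplus_le_compat.
    + simpl Nat.pow. rewrite dz_one, Cmod_1. change (INR 1) with 1. rewrite Rpower_1_l, Rmult_1_r, Cmod_1.
      unfold rdz_pp. simpl. lra.
    + apply csum1_bound. intros a _.
      rewrite dz_pow, rpow_pow by (auto using prime_pos). fold x.
      rewrite Cmod_RtoC_le by (apply Rmult_le_pos; [apply Cmod_ge_0 | apply pow_le; lra]).
      apply Rmult_le_compat_r; [apply pow_le; lra | now apply Cmod_dz_pp_le].
Qed.

Lemma psumR_le (c d : nat -> R) N : (forall n, (1 <= n)%nat -> 0 <= d n) ->
  (forall p, isprime p -> (p <= N)%nat -> c p <= d p) -> psumR c N <= rsum1 d N.
Proof.
  intros H1 H2. apply rsum1_le. intros n Hn. destruct (prime.prime n) eqn:E.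
  - apply H2; auto; lia.
  - apply H1; lia.
Qed.

Lemma psumR_Rpower_le sigma N : 1 < sigma -> psumR (fun p => Rpower (INR p) (- sigma)) N <= 1 + / (sigma - 1).
Proof.
  intros Hs. eapply Rle_trans; [apply psumR_le with (d := fun n => Rpower (INR n) (- (sigma - 1) - 1))|].
  - intros; left; apply Rpower_pos.
  - intros p _ _. right. f_equal. ring.
  - apply Rpower_sum_le. lra.
Qed.

(** * The Euler product and the logarithm of zeta to the right of 1 *)

Definition half_plane (a : R) (s : C) : Prop := a < Re s.

Lemma half_plane_open a : copen (half_plane a).
Proof.
  intros z Hz. unfold half_plane in *. exists (Re z - a). split; [lra|]. intros w Hw.
  assert (Rabs (Re w - Re z) < Re z - a).
  { eapply Rle_lt_trans; [apply (re_le_Cmod (w - z)) | exact Hw]. }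
  apply Rabs_def2 in H. lra.
Qed.

Definition pterm (f : nat -> C) (n : nat) : C := if prime.prime n then f n else 0.

(* [log zeta(s)] for [Re s > 1]. *)
Definition LF (s : C) : C := clim (csum1 (pterm (fun p => nlog (npow_neg p s)))).

Lemma Cmod_npow_prime_le p s : isprime p -> / 2 <= Re s -> Cmod (npow_neg p s) <= 3 / 4.
Proof.
  intros Hp Hs. rewrite Cmod_npow. apply Rpower_prime_le; auto; [lra|]. now apply Rpower_2_neg_half.
Qed.

Lemma pterm_nlog_bound n s a : (1 <= n)%nat -> 1 < a -> a <= Re s ->
  Cmod (pterm (fun p => nlog (npow_neg p s)) n) <= 4 * Rpower (INR n) (- (a - 1) - 1).
Proof.
  intros Hn Ha Hs. unfold pterm. destruct (prime.prime n) eqn:E.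
  - eapply Rle_trans; [apply nlog_bound, Cmod_npow_prime_le; auto; lra|].
    rewrite Cmod_npow. apply Rmult_le_compat_l; [lra|]. unfold Rpower. apply exp_le.
    assert (0 <= ln (INR n)).
    { rewrite <- ln_1. apply ln_le_mono; [lra|]. change 1 with (INR 1). now apply le_INR. }
    nra.
  - rewrite Cmod_0. generalize (Rpower_pos (INR n) (- (a - 1) - 1)). lra.
Qed.

Lemma Rpower_tail_small a : 0 < a -> forall e, 0 < e -> exists N, forall n m, (N <= n <= m)%nat ->
  rsum1 (fun n => 4 * Rpower (INR n) (- a - 1)) m - rsum1 (fun n => 4 * Rpower (INR n) (- a - 1)) n <= e.
Proof.
  intros Ha. apply (bounded_tail _ (4 * (1 + / a))).
  - intros; generalize (Rpower_pos (INR n) (- a - 1)); lra.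
  - intros n. rewrite rsum1_scal. apply Rmult_le_compat_l; [lra|]. now apply Rpower_sum_le.
Qed.

Lemma LF_unif a : 1 < a ->
  unif_cvg (fun s => a <= Re s) (fun N s => csum1 (pterm (fun p => nlog (npow_neg p s))) N) LF /\
  forall s, a <= Re s -> ccvg (csum1 (pterm (fun p => nlog (npow_neg p s)))) (LF s).
Proof.
  intros Ha. apply (unif_cvg_series (fun s => a <= Re s) (fun n s => pterm (fun p => nlog (npow_neg p s)) n)
    (fun n => 4 * Rpower (INR n) (- (a - 1) - 1))).
  - apply Rpower_tail_small. lra.
  - intros n s Hn Hs. apply pterm_nlog_bound; auto.
Qed.

Lemma LF_cvg s : 1 < Re s -> ccvg (csum1 (pterm (fun p => nlog (npow_neg p s)))) (LF s).
Proof. intros Hs. apply (LF_unif (Re s)); auto. lra. Qed.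

Lemma LF_bound s : 1 < Re s -> Cmod (LF s) <= 4 * (1 + / (Re s - 1)).
Proof.
  intros Hs. apply (ccvg_le (csum1 (pterm (fun p => nlog (npow_neg p s)))) _ _ 0); [| now apply LF_cvg].
  intros N _. eapply Rle_trans; [apply (csum1_bound _ (fun n => 4 * Rpower (INR n) (- (Re s - 1) - 1)))|].
  - intros n Hn. apply pterm_nlog_bound; auto; [lia | lra].
  - rewrite rsum1_scal. apply Rmult_le_compat_l; [lra|]. apply Rpower_sum_le. lra.
Qed.

Lemma Rpower_2_shift n x : 2 <= INR n -> 2 <= x -> Rpower (INR n) (- x) <= Rpower 2 (2 - x) * Rpower (INR n) (- (1) - 1).
Proof.
  intros Hn Hx. replace (- x) with ((2 - x) + (- (1) - 1)) by ring. rewrite Rpower_plus.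
  apply Rmult_le_compat_r; [left; apply Rpower_pos|]. unfold Rpower. apply exp_le.
  assert (ln 2 <= ln (INR n)) by (apply ln_le_mono; lra). nra.
Qed.

(** Each p >= 2 contributes at most 2^{2 - Re s} p^{-2}. The decay is what the normalisation at +oo
    in [log_zeta_branch] calls for. *)
Lemma LF_decay s : 2 <= Re s -> Cmod (LF s) <= 8 * Rpower 2 (2 - Re s).
Proof.
  intros Hs. apply (ccvg_le (csum1 (pterm (fun p => nlog (npow_neg p s)))) _ _ 0); [| apply LF_cvg; lra].
  intros N _. eapply Rle_trans; [apply (csum1_bound _ (fun n => (4 * Rpower 2 (2 - Re s)) * Rpower (INR n) (- (1) - 1)))|].
  - intros n Hn. unfold pterm. destruct (prime.prime n) eqn:E.
    + eapply Rle_trans; [apply nlog_bound, Cmod_npow_prime_le; auto; lra|].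
      rewrite Cmod_npow, Rmult_assoc. apply Rmult_le_compat_l; [lra|]. apply Rpower_2_shift; auto.
      now apply INR_prime_ge2.
    + rewrite Cmod_0. generalize (Rpower_pos (INR n) (- (1) - 1)) (Rpower_pos 2 (2 - Re s)). nra.
  - rewrite rsum1_scal. assert (Q := Rpower_sum_le 1 N Rlt_0_1). rewrite Rinv_1 in Q.
    generalize (Rpower_pos 2 (2 - Re s)). nra.
Qed.

(** The contribution of p to -zeta'/zeta with all its powers summed; grouping by primes lets the
    bound for the Chebyshev function be applied directly. *)
Definition lterm (s : C) (p : nat) : C := (RtoC (ln (INR p)) * npow_neg p s / (1 - npow_neg p s))%C.

Lemma npow_prime_neq_1 p s : isprime p -> / 2 <= Re s -> (1 - npow_neg p s <> 0)%C.
Proof.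
  intros Hp Hs E. assert (B := Cmod_npow_prime_le p s Hp Hs).
  assert (Q : npow_neg p s = 1) by (symmetry; now apply Ceq_minus). rewrite Q, Cmod_1 in B. lra.
Qed.

Lemma holo_nlog_npow p : isprime p -> holo (half_plane (/ 2)) (fun s => nlog (npow_neg p s)) (fun s => - lterm s p)%C.
Proof.
  intros Hp. destruct nlog_facts as (L1 & L2 & _).
  assert (H := holo_comp _ (half_plane (/ 2)) _ _ _ _ L1 (holo_npow (half_plane (/ 2)) p)).
  assert (U : forall z, half_plane (/ 2) z -> unit_disc (npow_neg p z)).
  { intros z Hz. unfold unit_disc, half_plane in *. generalize (Cmod_npow_prime_le p z Hp ltac:(lra)). lra. }
  specialize (H U).
  assert (E : forall z, half_plane (/ 2) z -> (cder nlog (npow_neg p z) * (npow_neg p z * - ln (INR p)))%C = (- lterm z p)%C).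
  { intros z Hz. assert (N := npow_prime_neq_1 p z Hp ltac:(unfold half_plane in Hz; lra)).
    assert (B := L2 _ (U z Hz)). unfold lterm.
    replace (cder nlog (npow_neg p z)) with ((1 - npow_neg p z) * cder nlog (npow_neg p z) / (1 - npow_neg p z))%C by (field; auto).
    rewrite B. field; auto. }
  intros z Hz. destruct (H z Hz) as (A & B). rewrite E in A by auto. split; auto.
  destruct (half_plane_open (/ 2) z Hz) as (r & Hr & HB).
  apply (ccont_ext_loc _ _ z r Hr (fun w Hw => E w (HB w Hw)) B).
Qed.

Lemma holo_LF : holo (half_plane 1) LF (cder LF) /\
  forall s, half_plane 1 s -> ccvg (csum1 (pterm (fun p => - lterm s p)%C)) (cder LF s).
Proof.
  apply (weierstrass (half_plane 1) (fun N s => csum1 (pterm (fun p => nlog (npow_neg p s))) N)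
    (fun N s => csum1 (pterm (fun p => - lterm s p)%C) N) LF).
  - intros N. apply (holo_csum1 (half_plane 1) (fun n s => pterm (fun p => nlog (npow_neg p s)) n)
      (fun n s => pterm (fun p => - lterm s p)%C n)).
    intros n Hn. unfold pterm. destruct (prime.prime n) eqn:E; [| apply holo_const].
    eapply holo_sub; [| now apply holo_nlog_npow]. unfold half_plane; intros; lra.
  - intros z Hz. unfold half_plane in *. exists ((Re z - 1) / 2). split; [lra|].
    assert (Near : forall w, Cmod (w - z) < (Re z - 1) / 2 -> (1 + Re z) / 2 <= Re w).
    { intros w Hw. assert (Q := re_le_Cmod (w - z)). rewrite Re_minus in Q.
      assert (Q' : Rabs (Re w - Re z) < (Re z - 1) / 2) by lra. apply Rabs_def2 in Q'. lra. }
    split; [intros w Hw; specialize (Near w Hw); lra|].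
    destruct (LF_unif ((1 + Re z) / 2)) as (U & _); [lra|].
    intros e He. destruct (U e He) as (N & HN). exists N. intros n w Hn Hw. apply HN; auto.
Qed.

Lemma pprod_cexp z h N : pprod (fun p => cexp (z * h p)%C) N = cexp (z * csum1 (pterm h) N)%C.
Proof.
  induction N as [|N IH]; cbn [pprod csum1].
  - rewrite Cmult_0_r, cexp_0. reflexivity.
  - unfold pterm at 2. destruct (prime.prime (S N)); rewrite IH.
    + rewrite <- cexp_add. f_equal. ring.
    + f_equal. ring.
Qed.

Lemma pprod_ccvg (h : nat -> nat -> C) l N : (forall p, isprime p -> ccvg (h p) (l p)) ->
  ccvg (fun A => pprod (fun p => h p A) N) (pprod l N).
Proof.
  intros H. induction N as [|N IH]; cbn [pprod]; [apply ccvg_const|].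
  destruct (prime.prime (S N)) eqn:E; auto.
  specialize (H (S N) E). intros e He.
  set (a := l (S N)) in *. set (b := pprod l N) in *.
  assert (K : 0 < Cmod a + Cmod b + 1) by (generalize (Cmod_ge_0 a) (Cmod_ge_0 b); lra).
  set (d := Rmin 1 (e / (2 * (Cmod a + Cmod b + 1)))).
  assert (Hd : 0 < d) by (apply Rmin_glb_lt; [lra | apply Rdiv_lt_0_compat; lra]).
  destruct (H d Hd) as (N1 & A1). destruct (IH d Hd) as (N2 & A2).
  exists (max N1 N2). intros n Hn. specialize (A1 n ltac:(lia)). specialize (A2 n ltac:(lia)). cbv beta in A2.
  set (u := h (S N) n) in *. set (v := pprod (fun p => h p n) N) in *.
  replace (u * v - a * b)%C with ((u - a) * (v - b) + (u - a) * b + a * (v - b))%C by ring.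
  eapply Rle_lt_trans; [apply Cmod_triangle|]. eapply Rle_lt_trans; [apply Rplus_le_compat_r, Cmod_triangle|].
  rewrite !Cmod_mult.
  assert (D1 : d <= 1) by apply Rmin_l.
  assert (D2 : d * (Cmod a + Cmod b + 1) <= e / 2).
  { apply Rle_trans with (e / (2 * (Cmod a + Cmod b + 1)) * (Cmod a + Cmod b + 1)).
    - apply Rmult_le_compat_r; [lra | apply Rmin_r].
    - right; field; lra. }
  generalize (Cmod_ge_0 a) (Cmod_ge_0 b) (Cmod_ge_0 (u - a)) (Cmod_ge_0 (v - b)). nra.
Qed.

(** For fixed N let the exponent bound A tend to infinity: the truncated Euler product tends to the
    exponential of z times the prime sum up to N, and differs from the partial sum of the series by
    at most a tail of the absolutely convergent majorant. Then let N grow. *)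
Lemma dz_dirichlet z s : 1 < Re s -> ccvg (csum1 (fun n => dz z n * npow_neg n s)%C) (cexp (z * LF s)).
Proof.
  intros Hs. set (f := fun n => (dz z n * npow_neg n s)%C).
  set (g := fun n => Cmod (dz z n) * Rpower (INR n) (- Re s)).
  assert (Hf : multiplicative f) by apply multiplicative_dz_npow.
  assert (Hg : forall n, (1 <= n)%nat -> Cmod (f n) <= g n).
  { intros n _. unfold f, g. rewrite Cmod_mult, Cmod_npow. lra. }
  assert (gp : forall n, (1 <= n)%nat -> 0 <= g n).
  { intros n Hn. eapply Rle_trans; [apply Cmod_ge_0 | now apply Hg]. }
  assert (T : forall e, 0 < e -> exists N, forall n m, (N <= n <= m)%nat -> rsum1 g m - rsum1 g n <= e).
  { apply (bounded_tail g (exp (4 * Cmod z * (1 + / (Re s - 1))))); auto.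
    intros n. eapply Rle_trans; [apply (rsum1_dz_le z (Cmod z) (Re s) n Hs (Rle_refl _))|].
    apply exp_le. apply Rmult_le_compat_l; [generalize (Cmod_ge_0 z); lra | now apply psumR_Rpower_le]. }
  set (S := csum1 (pterm (fun p => nlog (npow_neg p s)))).
  assert (Loc : forall p, isprime p -> ccvg (csum0 (fun a => f (Nat.pow p a))) (cexp (z * nlog (npow_neg p s)))).
  { intros p Hp. assert (B := binomial_series z (npow_neg p s)).
    eapply ccvg_ext; [| apply B].
    - intros n. unfold csum0, f. assert (P := prime_pos p Hp).
      rewrite (csum1_ext (fun a => dz_pp z a * npow_neg p s ^ a)%C (fun a => dz z (Nat.pow p a) * npow_neg (Nat.pow p a) s)%C).
      + rewrite dz_pow, npow_pow by auto. reflexivity.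
      + intros a _. rewrite dz_pow, npow_pow by auto. reflexivity.
    - unfold unit_disc. generalize (Cmod_npow_prime_le p s Hp ltac:(lra)). lra. }
  assert (App : forall e, 0 < e -> exists N, forall n, (N <= n)%nat -> Cmod (cexp (z * S n) - csum1 f n) <= e).
  { intros e He. destruct (T e He) as (N & HN). exists N. intros n Hn.
    assert (P := pprod_ccvg (fun p => csum0 (fun a => f (Nat.pow p a))) (fun p => cexp (z * nlog (npow_neg p s))%C) n Loc).
    rewrite (pprod_cexp z (fun p => nlog (npow_neg p s))) in P.
    apply (ccvg_le (fun A => pprod (fun p => csum0 (fun a => f (Nat.pow p a)) A) n - csum1 f n)%C _ _ n).
    - intros A HA. destruct (euler_approx f g A n Hf HA Hg) as (M & HM & B).
      eapply Rle_trans; [exact B|]. apply HN; lia.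
    - unfold Cminus. apply ccvg_plus; [exact P | apply ccvg_const]. }
  assert (Q : ccvg (fun n => cexp (z * S n)) (cexp (z * LF s))).
  { apply (ccvg_comp cexp); [apply ccont_cexp|]. apply ccvg_scal. now apply LF_cvg. }
  intros e He. destruct (App (e / 2) ltac:(lra)) as (N1 & A1). destruct (Q (e / 2) ltac:(lra)) as (N2 & A2).
  exists (max N1 N2). intros n Hn. specialize (A1 n ltac:(lia)). specialize (A2 n ltac:(lia)).
  rewrite Cmod_sub_sym in A1.
  replace (csum1 f n - cexp (z * LF s))%C with ((csum1 f n - cexp (z * S n)) + (cexp (z * S n) - cexp (z * LF s)))%C by ring.
  eapply Rle_lt_trans; [apply Cmod_triangle|]. lra.
Qed.

Lemma dz_1_l n : dz 1 n = 1.
Proof.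
  unfold dz. assert (E : forall a, dz_pp 1 a = 1).
  { intros a. unfold dz_pp. assert (H : rising 1 a = RtoC (INR (fact a))).
    { induction a as [|a IH]; [reflexivity|]. cbn [rising]. rewrite IH.
      replace (fact (S a)) with (S a * fact a)%nat by reflexivity.
      rewrite mult_INR, S_INR, RtoC_mult, RtoC_plus. ring. }
    rewrite H, <- RtoC_mult, Rinv_r; [reflexivity | apply INR_fact_neq_0]. }
  induction (prime.primes n) as [|p l IH]; [reflexivity|]. simpl. rewrite E, IH. ring.
Qed.

(** The case z = 1 of [dz_dirichlet], all coefficients being 1. *)
Lemma zeta_exp_LF s : 1 < Re s -> zeta s = cexp (LF s).
Proof.
  intros Hs. apply (ccvg_unique (csum1 (fun n => npow_neg n s))); [now apply zeta_dirichlet|].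
  assert (D := dz_dirichlet 1 s Hs). rewrite Cmult_1_l in D.
  eapply ccvg_ext; [| exact D]. intros n. apply csum1_ext. intros m _. rewrite dz_1_l. ring.
Qed.

(** * Zeros and the logarithmic derivative of zeta *)

Lemma ccvg_re_ge_0 u l : ccvg u l -> (forall n, 0 <= Re (u n)) -> 0 <= Re l.
Proof.
  intros H P. apply ccvg_re in H.
  apply (is_lim_seq_le (fun _ => 0) _ 0 _ P (is_lim_seq_const 0)) in H. exact H.
Qed.

Lemma Re_npow_pow n s k : Re (npow_neg n s ^ k)%C =
  exp (- (INR k * (Re s * ln (INR n)))) * cos (INR k * (Im s * ln (INR n))).
Proof.
  assert (E : forall k, (npow_neg n s ^ k)%C = cexp (RtoC (INR k) * (- s * RtoC (ln (INR n))))).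
  { induction k0 as [|j IH].
    - simpl. rewrite Cmult_0_l, cexp_0. reflexivity.
    - cbn [Cpow]. rewrite IH. unfold npow_neg. rewrite <- cexp_add, S_INR, RtoC_plus. f_equal. ring. }
  rewrite E. unfold cexp. cbn [Re fst]. rewrite <- cos_neg. simpl.
  f_equal; f_equal; unfold Re, Im; simpl; ring.
Qed.

(** Term by term, over primes and over their powers, from 3 + 4 cos phi + cos 2 phi = 2 (1 + cos
    phi)^2. *)
Lemma three_four_one sigma t : 1 < sigma ->
  0 <= 3 * Re (LF (sigma, 0)) + 4 * Re (LF (sigma, t)) + Re (LF (sigma, 2 * t)).
Proof.
  intros Hs.
  assert (Lc := fun y => LF_cvg (sigma, y) Hs).
  assert (C3 := ccvg_plus _ _ _ _ (ccvg_plus _ _ _ _ (ccvg_scal 3 _ _ (Lc 0)) (ccvg_scal 4 _ _ (Lc t))) (Lc (2 * t))).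
  replace (3 * Re (LF (sigma, 0)) + 4 * Re (LF (sigma, t)) + Re (LF (sigma, 2 * t))) with
    (Re (3 * LF (sigma, 0) + 4 * LF (sigma, t) + LF (sigma, 2 * t)%R)%C).
  2: { rewrite !re_plus, !re_scal_l. reflexivity. }
  apply (ccvg_re_ge_0 _ _ C3). intros N. cbv beta.
  rewrite <- !csum1_scal, <- !csum1_plus.
  induction N as [|N IH]; [simpl; lra|]. cbn [csum1]. rewrite re_plus. apply Rplus_le_le_0_compat; auto.
  clear IH. set (p := S N). unfold pterm. destruct (prime.prime p) eqn:E.
  2: { simpl; lra. }
  destruct nlog_facts as (_ & _ & _ & L4).
  assert (Ud : forall y, unit_disc (npow_neg p (sigma, y))).
  { intros y. unfold unit_disc. generalize (Cmod_npow_prime_le p (sigma, y) E ltac:(simpl; lra)). lra. }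
  assert (D3 := ccvg_plus _ _ _ _ (ccvg_plus _ _ _ _ (ccvg_scal 3 _ _ (L4 _ (Ud 0))) (ccvg_scal 4 _ _ (L4 _ (Ud t)))) (L4 _ (Ud (2 * t)))).
  apply (ccvg_re_ge_0 _ _ D3). intros K. cbv beta.
  rewrite <- !csum1_scal, <- !csum1_plus.
  induction K as [|K IH]; [simpl; lra|]. cbn [csum1]. rewrite re_plus. apply Rplus_le_le_0_compat; auto.
  rewrite !re_plus, !re_scal_l, !Re_npow_pow. cbn [Re Im fst snd].
  set (a := exp _). set (phi := INR (S K) * (t * ln (INR p))).
  replace (INR (S K) * (0 * ln (INR p))) with 0 by ring.
  replace (INR (S K) * (2 * t * ln (INR p))) with (2 * phi) by (unfold phi; ring).
  rewrite cos_0, cos_2a_cos.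
  assert (0 < a) by apply exp_pos. assert (0 < / INR (S K)) by (apply Rinv_0_lt_compat, lt_0_INR; lia).
  replace (3 * (/ INR (S K) * (a * 1)) + 4 * (/ INR (S K) * (a * cos phi)) + / INR (S K) * (a * (2 * cos phi * cos phi - 1)))
    with (2 * (/ INR (S K) * a) * ((1 + cos phi) * (1 + cos phi))) by ring.
  apply Rmult_le_pos; [nra | apply Rle_0_sqr].
Qed.

Lemma Cmod_zeta_exp s : 1 < Re s -> Cmod (zeta s) = exp (Re (LF s)).
Proof. intros Hs. rewrite zeta_exp_LF by auto. apply Cmod_cexp. Qed.

Lemma zeta_near_1 d : 0 < d <= 1 -> Cmod (zeta (1 + d, 0)) <= 6 / d.
Proof.
  intros Hd. set (s := (1 + d, 0) : C).
  assert (Hs1 : s <> 1). { intros E. apply (f_equal Re) in E. simpl in E. lra. }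
  assert (A := zeta_approx s 1 ltac:(lia) ltac:(simpl; lra) Hs1).
  change (INR 1) with 1 in A. rewrite Rpower_1_l in A.
  assert (N1 : (1 - s <> 0)%C) by (intros E; apply Hs1; symmetry; now apply Ceq_minus).
  assert (Ms : Cmod s = 1 + d).
  { replace s with (RtoC (1 + d)) by (apply Ceq_of; reflexivity). apply Cmod_RtoC_le. lra. }
  assert (I : / Re s <= 1).
  { simpl. apply Rle_trans with (/ 1); [apply Rinv_le_contravar; lra | lra]. }
  assert (Z1 : Cmod (zeta_partial s 1) = (1 + d) / d).
  { unfold zeta_partial. simpl. rewrite !npow_1.
    replace (0 + 1 - 1 / (1 - s))%C with (- s / (1 - s))%C by (field; auto).
    rewrite Cmod_div, Cmod_opp, Ms by auto. f_equal.
    replace (1 - s)%C with (RtoC (- d)) by (apply Ceq_of; simpl; ring). rewrite Cmod_R, Rabs_left; lra. }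
  assert (Q : (1 + d) / d + (1 + d) * 2 <= 6 / d).
  { apply (Rmult_le_reg_r d); [lra|]. replace (((1 + d) / d + (1 + d) * 2) * d) with (1 + d + (1 + d) * 2 * d) by (field; lra).
    replace (6 / d * d) with 6 by (field; lra). nra. }
  generalize (Cmod_sub_le (zeta s) (zeta_partial s 1)). rewrite Ms in A. rewrite Z1 in *. nra.
Qed.

(** At distance d to the right of the line, zeta is at most 6/d near the pole, at most A d near the
    supposed zero 1 + it, and bounded by B near 1 + 2it. Then the product of third power, fourth
    power and first power is O(d), although [three_four_one] makes it at least 1. *)
Lemma zeta_line_1 t : t <> 0 -> zeta (1, t) <> 0.
Proof.
  intros Ht Z.
  assert (D1 : zeta_dom (1, t)). { split; [simpl; lra|]. intros E. apply (f_equal Im) in E. simpl in E. lra. }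
  assert (D2 : zeta_dom (1, 2 * t)). { split; [simpl; lra|]. intros E. apply (f_equal Im) in E. simpl in E. lra. }
  destruct (cderiv_lip _ _ _ (proj1 (holo_zeta _ D1))) as (d1 & Hd1 & L1).
  set (A := Cmod (cder zeta (1, t)) + 1) in *.
  assert (HA : 0 < A) by (unfold A; generalize (Cmod_ge_0 (cder zeta (1, t))); lra).
  destruct (holo_ccont _ _ _ _ holo_zeta D2 1 Rlt_0_1) as (d2 & Hd2 & L2).
  set (B := Cmod (zeta (1, 2 * t)) + 1).
  assert (HB : 0 < B) by (unfold B; generalize (Cmod_ge_0 (zeta (1, 2 * t))); lra).
  assert (HAB : 0 < 216 * (A * A * A * A) * B) by (repeat apply Rmult_lt_0_compat; lra).
  (* The first two constraints keep the points inside the discs where the local bounds hold; the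
     third makes (6/d)^3 (A d)^4 B = 216 A^4 B d at most 1/2. *)
  set (d := Rmin (Rmin (1 / 2) (Rmin d1 d2 / 2)) (/ (2 * (216 * (A * A * A * A) * B)))).
  assert (Hd : 0 < d).
  { repeat apply Rmin_glb_lt; try lra.
    - generalize (Rmin_glb_lt _ _ _ Hd1 Hd2). lra.
    - apply Rinv_0_lt_compat. lra. }
  assert (B1 : d <= 1 / 2) by (eapply Rle_trans; [apply Rmin_l | apply Rmin_l]).
  assert (B2 : d <= Rmin d1 d2 / 2) by (eapply Rle_trans; [apply Rmin_l | apply Rmin_r]).
  assert (B3 : d * (216 * (A * A * A * A) * B) <= / 2).
  { apply Rle_trans with (/ (2 * (216 * (A * A * A * A) * B)) * (216 * (A * A * A * A) * B)).
    - apply Rmult_le_compat_r; [lra | apply Rmin_r].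
    - right. field. repeat split; lra. }
  assert (Df : forall y, Cmod ((1 + d, y) - (1, y)) = d).
  { intros y. replace ((1 + d, y)%R - (1, y))%C with (RtoC d) by (apply Ceq_of; simpl; ring).
    apply Cmod_RtoC_le. lra. }
  assert (Z0 := zeta_near_1 d ltac:(lra)).
  assert (Z1 := L1 (1 + d, t)). rewrite Df, Z in Z1.
  assert (Z1' : Cmod (zeta (1 + d, t)) <= A * d).
  { replace (zeta (1 + d, t)) with (zeta (1 + d, t)%R - 0)%C by ring. apply Z1. generalize (Rmin_l d1 d2). lra. }
  assert (Z2 := L2 (1 + d, 2 * t)). rewrite Df in Z2.
  assert (Z2' : Cmod (zeta (1 + d, 2 * t)) <= B).
  { generalize (Cmod_sub_le (zeta (1 + d, 2 * t)) (zeta (1, 2 * t))) (Z2 ltac:(generalize (Rmin_r d1 d2); lra)).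
    unfold B. lra. }
  assert (T := three_four_one (1 + d) t ltac:(lra)).
  rewrite !Cmod_zeta_exp in * by (simpl; lra).
  set (e0 := exp (Re (LF (1 + d, 0)))) in *. set (e1 := exp (Re (LF (1 + d, t)))) in *.
  set (e2 := exp (Re (LF (1 + d, 2 * t)))) in *.
  assert (P0 : 0 < e0) by apply exp_pos. assert (P1 : 0 < e1) by apply exp_pos. assert (P2 : 0 < e2) by apply exp_pos.
  assert (Pr : 1 <= e0 * e0 * e0 * (e1 * e1 * e1 * e1) * e2).
  { unfold e0, e1, e2. rewrite <- !exp_plus.
    apply Rle_trans with (exp 0); [rewrite exp_0; lra|]. apply exp_le. lra. }
  assert (Pp : forall a b : R, 0 < a -> 0 < b -> 0 <= a * b) by (intros; apply Rmult_le_pos; lra).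
  assert (U00 : e0 * e0 <= 6 / d * (6 / d)) by (apply Rmult_le_compat; lra).
  assert (U0 : e0 * e0 * e0 <= 6 / d * (6 / d) * (6 / d)).
  { apply Rmult_le_compat; [apply Pp | | |]; lra. }
  assert (U11 : e1 * e1 <= A * d * (A * d)) by (apply Rmult_le_compat; lra).
  assert (U12 : e1 * e1 * e1 <= A * d * (A * d) * (A * d)).
  { apply Rmult_le_compat; [apply Pp | | |]; lra. }
  assert (U1 : e1 * e1 * e1 * e1 <= A * d * (A * d) * (A * d) * (A * d)).
  { apply Rmult_le_compat; [apply Rmult_le_pos; [apply Pp|] | | |]; lra. }
  assert (F : e0 * e0 * e0 * (e1 * e1 * e1 * e1) * e2 <= 6 / d * (6 / d) * (6 / d) * (A * d * (A * d) * (A * d) * (A * d)) * B).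
  { apply Rmult_le_compat; try lra; [repeat apply Rmult_le_pos; lra|].
    apply Rmult_le_compat; auto; repeat apply Rmult_le_pos; lra. }
  replace (6 / d * (6 / d) * (6 / d) * (A * d * (A * d) * (A * d) * (A * d)) * B) with
    (d * (216 * (A * A * A * A) * B)) in F by (field; lra).
  lra.
Qed.

(** The hypothesis [RH] speaks of the open critical strip only; the line Re s = 1 is settled by
    [zeta_line_1], and the half-plane to its right by the exponential formula. *)
Lemma zeta_nz (s : C) : RH -> 1 / 2 < Re s -> s <> 1 -> zeta s <> 0.
Proof.
  intros HRH Hs Hs1 Z. destruct (Rlt_or_le (Re s) 1) as [H|H].
  - assert (E := HRH s ltac:(lra) Z). lra.
  - destruct (Rle_lt_or_eq_dec _ _ H) as [H1|H1].
    + rewrite zeta_exp_LF in Z by auto. now apply cexp_neq_0 in Z.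
    + assert (N : Im s <> 0). { intros E. apply Hs1. apply Ceq_of; simpl; auto. }
      apply (zeta_line_1 (Im s) N). replace (1, Im s) with s; auto.
      apply Ceq_of; simpl; auto.
Qed.

(* Blaschke factors divide out the zeros one at a time; each division lowers [M]
   by at least [ln (R1 / r1)], so the recursion stops. *)
Section LocalFactorization.

(** Radii around 2 + it, all larger than the distance 3/2 to the critical line: holomorphy within
    9/5, where Re s > 0; growth measured on 7/4, where [zeta_growth] applies; zeros divided out
    within 8/5; the Borel-Caratheodory inequality on 31/20. *)
Let R0 : R := 9 / 5.
Let R1 : R := 7 / 4.
Let r1 : R := 8 / 5.
Let r2 : R := 31 / 20.

Let U (z : C) : Prop := Cmod z < R0.

Lemma U_open : copen U.
Proof.
  intros w Hw. unfold U in *. exists (R0 - Cmod w). split; [lra|]. intros v Hv.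
  generalize (Cmod_sub_le v w). lra.
Qed.

(** The Cauchy estimate at the centre, where it is lossless, gives |F(0)| <= e^M |F(0)|. This is
    what ends the division of zeros: M cannot fall below 0. *)
Lemma growth_exponent_nonneg F dF M : holo U F dF -> F 0 <> 0 ->
  (forall z, Cmod z = R1 -> Cmod (F z) <= exp M * Cmod (F 0)) -> 0 <= M.
Proof.
  intros HF N0 HM.
  assert (CE := cauchy_estimate U F dF R1 (1 / 20) ltac:(unfold R1; lra) ltac:(lra) HF).
  assert (CE' := CE (fun z Hz => ltac:(unfold U, R0; unfold R1 in Hz; lra)) (exp M * Cmod (F 0)) 0
    ltac:(rewrite Cmod_0; unfold R1; lra) HM).
  rewrite Cmod_0, Rminus_0_r in CE'. replace (R1 / R1) with 1 in CE' by (unfold R1; field).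
  assert (P0 := Cmod_pos _ N0). apply Rnot_lt_le. intros H. apply exp_increasing in H. rewrite exp_0 in H. nra.
Qed.

(** Without zeros F has a holomorphic logarithm on the disc. Its real part is bounded above by the
    growth of F, and the Borel-Caratheodory inequality bounds its derivative. *)
Lemma logderiv_no_zeros F dF M x : holo U F dF -> F 0 <> 0 ->
  (forall z, Cmod z = R1 -> Cmod (F z) <= exp M * Cmod (F 0)) ->
  (forall z, Cmod z <= r1 -> F z <> 0) -> - (3 / 2) < x <= 0 ->
  Cmod (dF (RtoC x) / F (RtoC x)) <= 1240 * (M + 3).
Proof.
  intros HF N0 HM NZ Hx.
  set (V := fun z : C => Cmod z < r1).
  assert (VU : forall z, V z -> U z) by (unfold V, U, r1, R0; intros; lra).
  assert (VO : copen V).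
  { intros w Hw. unfold V in *. exists (r1 - Cmod w). split; [lra|]. intros v Hv.
    generalize (Cmod_sub_le v w). lra. }
  assert (NV : forall z, V z -> F z <> 0) by (unfold V; intros; apply NZ; lra).
  assert (HFV := holo_sub U V F dF VU HF).
  assert (HdV := holo_sub U V _ _ VU (holo_deriv U F dF U_open HF)).
  set (g := fun z => (dF z / F z)%C).
  assert (Hg := holo_div V dF F _ _ HdV HFV NV). fold g in Hg.
  assert (V0 : V 0) by (unfold V, r1; rewrite Cmod_0; lra).
  assert (St : forall z u, V z -> 0 <= u <= 1 -> V (0 + RtoC u * (z - 0))%C).
  { intros z u Hz Hu. now apply disc_star. }
  assert (Hf := primitive_star V g _ 0 VO V0 St Hg).
  set (f := fun z => ((z - 0) * CInt (fun u => g (0 + RtoC u * (z - 0))%C) 0 1)%C) in *.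
  assert (f0 : f 0 = 0) by (unfold f; ring).
  assert (E : forall z, V z -> F z = (F 0 * cexp (f z))%C).
  { intros z Hz.
    assert (HG := holo_mult V F (fun z => cexp (- (1) * f z))%C _ _ HFV
      (holo_cexp V _ _ (holo_scal V (- (1))%C _ _ Hf))).
    assert (Q := holo_const_star V _ _ 0 z HG St).
    cbv beta in Q. rewrite f0, Cmult_0_r, cexp_0, Cmult_1_r in Q. rewrite <- Q; auto.
    - replace (- (1) * f z)%C with (- f z)%C by ring. rewrite cexp_opp.
      assert (N := cexp_neq_0 (f z)). field. auto.
    - intros w Hw. unfold g. assert (N := NV w Hw). field. auto. }
  (* Moving from the circle 7/4 in to 31/20 loses the factor (7/4)/(1/5) = 35/4, which is less than
     e^3. *)
  assert (Bd : forall w, Cmod w = r2 -> Re (f w) <= M + 3).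
  { intros w Hw. assert (Vw : V w) by (unfold V, r1; rewrite Hw; unfold r2; lra).
    assert (CE := cauchy_estimate U F dF R1 (1 / 20) ltac:(unfold R1; lra) ltac:(lra) HF).
    assert (CE' := CE (fun z Hz => ltac:(unfold U, R0; unfold R1 in Hz; lra)) (exp M * Cmod (F 0)) w
      ltac:(rewrite Hw; unfold r2, R1; lra) HM). clear CE.
    rewrite (E w Vw), Cmod_mult, Cmod_cexp, Hw in CE'.
    assert (P0 := Cmod_pos _ N0).
    assert (Q : exp (Re (f w)) <= exp (M + 3)).
    { rewrite exp_plus. apply (Rmult_le_reg_l (Cmod (F 0))); auto.
      eapply Rle_trans; [exact CE'|]. replace (Cmod (F 0) * (exp M * exp 3)) with (exp M * Cmod (F 0) * exp 3) by ring.
      apply Rmult_le_compat_l; [apply Rmult_le_pos; [left; apply exp_pos | lra]|].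
      assert (E1 : 3 <= exp 2) by (generalize (exp_ineq1 2 ltac:(lra)); lra).
      replace 3 with (1 + 2) by ring. rewrite exp_plus.
      assert (E2 : exp 2 = exp 1 * exp 1) by (rewrite <- exp_plus; f_equal; ring).
      assert (E3 : 5 / 2 <= exp 1).
      { assert (H1 : 3 / 2 <= exp (/ 2)) by (generalize (exp_ineq1 (/ 2) ltac:(lra)); lra).
        assert (H2 : exp 1 = exp (/ 2) * exp (/ 2)) by (rewrite <- exp_plus; f_equal; field).
        assert (H3 : 5 / 4 <= exp (/ 4)) by (generalize (exp_ineq1 (/ 4) ltac:(lra)); lra).
        assert (H4 : 9 / 8 <= exp (/ 8)) by (generalize (exp_ineq1 (/ 8) ltac:(lra)); lra).
        assert (H5 : exp (/ 4) = exp (/ 8) * exp (/ 8)) by (rewrite <- exp_plus; f_equal; field).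
        assert (H6 : exp (/ 2) = exp (/ 4) * exp (/ 4)) by (rewrite <- exp_plus; f_equal; field).
        assert (H7 : 81 / 64 <= exp (/ 4)) by nra. assert (H8 : 8 / 5 <= exp (/ 2)) by nra. nra. }
      unfold R1, r2. nra. }
    apply Rnot_lt_le. intros H. apply exp_increasing in H. lra. }
  assert (BC := borel_caratheodory V f g r2 (1 / 20) ltac:(unfold r2; lra) ltac:(lra) Hf).
  assert (BC' := BC (fun w Hw => ltac:(unfold V, r1; unfold r2 in Hw; lra)) (M + 3) (RtoC x)). clear BC.
  assert (Mx : Cmod (RtoC x) = - x) by (rewrite Cmod_R; apply Rabs_left1; lra).
  rewrite Mx, f0 in BC'. simpl Re in BC'.
  eapply Rle_trans; [apply BC'; auto; unfold r2; lra|].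
  assert (P := growth_exponent_nonneg F dF M HF N0 HM).
  (* As |x| < 3/2, the distance to the circle exceeds 1/20, and (31/10)/(1/20)^2 = 1240. *)
  unfold r2. replace (2 * (31 / 20) * (M + 3 - 0) / ((31 / 20 - - x) * (31 / 20 - - x))) with
    ((M + 3) * (31 / 10 / ((31 / 20 + x) * (31 / 20 + x)))) by (field; lra).
  rewrite Rmult_comm. apply Rmult_le_compat_r; [lra|].
  apply (Rmult_le_reg_r ((31 / 20 + x) * (31 / 20 + x))); [nra|].
  unfold Rdiv at 1. rewrite Rmult_assoc, Rinv_l by nra. nra.
Qed.

Let c1 : R := ln (R1 / r1).

Lemma c1_pos : 0 < c1.
Proof. unfold c1. rewrite <- ln_1. apply ln_increasing; unfold R1, r1; lra. Qed.

(** Each zero divided out adds at most 3 in absolute value, plus a term 1/(X - rho). All zeros lie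
    to the left of X, so that term has nonnegative real part: it is harmless for the lower bound and
    is counted only in the bound of the modulus. M/c1 bounds the number of divisions. *)
Lemma logderiv_bounds n : forall F dF M, holo U F dF -> F 0 <> 0 ->
  (forall z, Cmod z = R1 -> Cmod (F z) <= exp M * Cmod (F 0)) ->
  (forall z, Cmod z <= r1 -> F z = 0 -> Re z <= - (3 / 2)) -> M < INR n * c1 ->
  forall x, - (3 / 2) < x <= 0 ->
  - (1240 * (M + 3) + 3 * (M / c1)) <= Re (dF (RtoC x) / F (RtoC x)) /\
  Cmod (dF (RtoC x) / F (RtoC x)) <= 1240 * (M + 3) + (3 + / (x + 3 / 2)) * (M / c1).
Proof.
  assert (Hc := c1_pos).
  induction n as [|n IH]; intros F dF M HF N0 HM HZ Hn x Hx.
  all: assert (Mpos := growth_exponent_nonneg F dF M HF N0 HM).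
  { simpl in Hn. lra. }
  assert (Ix : 0 < / (x + 3 / 2)) by (apply Rinv_0_lt_compat; lra).
  assert (Mc : 0 <= M / c1) by (apply Rmult_le_pos; [lra | left; now apply Rinv_0_lt_compat]).
  destruct (classic (exists rho, Cmod rho <= r1 /\ F rho = 0)) as [(rho & Hr & Zr)|NZ].
  - assert (Ur : U rho) by (unfold U, R0; unfold r1 in Hr; lra).
    assert (Rr := HZ rho Hr Zr).
    assert (Nr : rho <> 0) by (intros ->; auto).
    assert (Pr := Cmod_pos _ Nr).
    assert (HD := holo_divide U F dF rho U_open HF Ur Zr). cbv zeta in HD.
    set (Fd := fun w => if Ceq_dec w rho then dF rho else (F w / (w - rho))%C) in *.
    assert (Fac : forall w, F w = ((w - rho) * Fd w)%C).
    { intros w. unfold Fd. destruct (Ceq_dec w rho) as [->|Nw]; [rewrite Zr; ring|].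
      field. now apply Cminus_eq_contra. }
    (* On the circle |w| = R1 the factor q has the modulus of w - rho, so F1 has the same size there
       as F; at the centre F1 exceeds F by the factor R1/|rho|, which lowers the relative growth
       M. *)
    set (q := fun w => ((RtoC (R1 * R1) - Cconj rho * w) / RtoC R1)%C).
    assert (NR : RtoC R1 <> 0) by (intros E; apply RtoC_inj in E; unfold R1 in E; lra).
    assert (Hq : holo U q (fun _ => - Cconj rho / RtoC R1)%C).
    { intros w _. split; [| apply ccont_const]. unfold q.
      apply (cderiv_ext (fun w => / RtoC R1 * (RtoC (R1 * R1) - Cconj rho * w))%C); [intros; field; auto|].
      eapply cderiv_eq; [| apply cderiv_scal, cderiv_minus; [apply cderiv_const | apply cderiv_scal, cderiv_id]].
      field; auto. }
    assert (HF1 := holo_mult U _ _ _ _ HD Hq).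
    set (F1 := fun w => (Fd w * q w)%C) in *.
    assert (Nq : forall w, Cmod w <= r1 -> (RtoC (R1 * R1) - Cconj rho * w <> 0)%C).
    { intros w Hw Z. assert (Q : Cmod (RtoC (R1 * R1)) = Cmod (Cconj rho * w)).
      { f_equal. apply (f_equal (fun v => v + Cconj rho * w)%C) in Z.
        replace (RtoC (R1 * R1) - Cconj rho * w + Cconj rho * w)%C with (RtoC (R1 * R1)) in Z by ring.
        rewrite Z. ring. }
      rewrite Cmod_mult, Cmod_conj, Cmod_RtoC_le in Q by (unfold R1; lra).
      assert (Cmod rho * Cmod w <= r1 * r1) by (apply Rmult_le_compat; auto using Cmod_ge_0).
      unfold R1, r1 in *. lra. }
    assert (q0 : q 0 = RtoC R1).
    { unfold q. rewrite RtoC_mult. field. auto. }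
    assert (F10 : Cmod (F1 0) = Cmod (F 0) * (R1 / Cmod rho)).
    { unfold F1. rewrite q0, Fac, !Cmod_mult.
      replace (0 - rho)%C with (- rho)%C by ring. rewrite Cmod_opp, Cmod_RtoC_le by (unfold R1; lra). field. lra. }
    set (M1 := M - ln (R1 / Cmod rho)).
    assert (Lr : c1 <= ln (R1 / Cmod rho)).
    { apply ln_le_mono; [unfold R1, r1; lra|]. unfold Rdiv. apply Rmult_le_compat_l; [unfold R1; lra|].
      apply Rinv_le_contravar; auto. }
    assert (Hr1 : 0 < R1 / Cmod rho) by (apply Rdiv_lt_0_compat; auto; unfold R1; lra).
    assert (NF1 : F1 0 <> 0).
    { intros Z. assert (Q := F10). rewrite Z, Cmod_0 in Q. assert (P0 := Cmod_pos _ N0).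
      assert (0 < Cmod (F 0) * (R1 / Cmod rho)) by (apply Rmult_lt_0_compat; auto). lra. }
    assert (Bd1 : forall z, Cmod z = R1 -> Cmod (F1 z) <= exp M1 * Cmod (F1 0)).
    { intros z Hz. rewrite F10. unfold M1, Rminus. rewrite exp_plus, exp_Ropp, exp_ln by auto.
      replace (exp M * / (R1 / Cmod rho) * (Cmod (F 0) * (R1 / Cmod rho))) with (exp M * Cmod (F 0)).
      2: { field. split; unfold R1; lra. }
      eapply Rle_trans; [| apply (HM z Hz)]. right.
      unfold F1, q. rewrite (Fac z), !Cmod_mult, Cmod_div by auto.
      assert (Ez : RtoC (R1 * R1) = (z * Cconj z)%C).
      { rewrite <- Cmod2_conj, Hz. f_equal. simpl. ring. }
      rewrite Ez. replace (z * Cconj z - Cconj rho * z)%C with (z * Cconj (z - rho))%C by (rewrite Cminus_conj; ring).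
      rewrite Cmod_mult, Cmod_conj, Hz, Cmod_RtoC_le by (unfold R1; lra). field. unfold R1; lra. }
    assert (HZ1 : forall z, Cmod z <= r1 -> F1 z = 0 -> Re z <= - (3 / 2)).
    { intros z Hz Z. apply HZ; auto. rewrite Fac. unfold F1 in Z.
      assert (Fz : Fd z = 0).
      { apply NNPP. intros Nf. apply (Cmult_neq_0 (Fd z) (q z)); auto. unfold q.
        intros E. apply (Nq z Hz).
        replace (RtoC (R1 * R1) - Cconj rho * z)%C with ((RtoC (R1 * R1) - Cconj rho * z) / RtoC R1 * RtoC R1)%C by (field; auto).
        rewrite E. ring. }
      rewrite Fz. ring. }
    assert (Hn1 : M1 < INR n * c1) by (rewrite S_INR in Hn; unfold M1; lra).
    destruct (IH F1 _ M1 HF1 NF1 Bd1 HZ1 Hn1 x Hx) as (I1 & I2). cbv beta in I1, I2.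
    set (X := RtoC x) in *.
    assert (MX : Cmod X <= 3 / 2) by (unfold X; rewrite Cmod_R, Rabs_left1; lra).
    assert (UX : U X) by (unfold U, R0; lra).
    assert (NX : F X <> 0). { intros Z. assert (Q := HZ X ltac:(unfold r1; lra) Z). unfold X in Q. simpl in Q. lra. }
    assert (NX1 : (X - rho <> 0)%C). { intros Z. apply NX. rewrite Fac, Z. ring. }
    assert (NXd : Fd X <> 0). { intros Z. apply NX. rewrite Fac, Z. ring. }
    assert (NXq := Nq X ltac:(unfold r1; lra)).
    assert (EdF : dF X = (Fd X + (X - rho) * cder Fd X)%C).
    { apply (cderiv_unique F X); [now apply HF|].
      apply (cderiv_ext (fun w => (w - rho) * Fd w)%C); [intros; now rewrite Fac|].
      eapply cderiv_eq; [| apply cderiv_mult; [apply cderiv_minus; [apply cderiv_id | apply cderiv_const] | now apply HD]].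
      cbv beta; ring. }
    (* Logarithmic derivative of F = (w - rho) F1/q. The last term is at most 3, since |rho| <= 8/5
       and the denominator is at least (7/4)^2 - (8/5)(3/2) = 53/80. *)
    assert (EQ : (dF X / F X = (cder Fd X * q X + Fd X * (- Cconj rho / RtoC R1)) / F1 X
       + (/ (X - rho) + Cconj rho / (RtoC (R1 * R1) - Cconj rho * X)))%C).
    { rewrite EdF, (Fac X). unfold F1, q. field. repeat split; auto. }
    rewrite EQ. set (G1 := ((cder Fd X * q X + Fd X * (- Cconj rho / RtoC R1)) / F1 X)%C) in *.
    assert (ReX : x + 3 / 2 <= Re (X - rho)) by (unfold X; simpl; unfold Re in Rr; lra).
    assert (P1 : 0 <= Re (/ (X - rho))).
    { simpl. apply Rmult_le_pos; [unfold Re in ReX; simpl in ReX |- *; lra|].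
      left. apply Rinv_0_lt_compat. assert (Q := Cmod_pos _ NX1).
      assert (S := Cmod_sqr (X - rho)). simpl in S. unfold Re, Im in *. simpl in *. nra. }
    assert (P2 : Cmod (/ (X - rho)) <= / (x + 3 / 2)).
    { rewrite Cmod_inv by auto. apply Rinv_le_contravar; [lra|].
      eapply Rle_trans; [exact ReX|]. eapply Rle_trans; [apply Rle_abs | apply re_le_Cmod]. }
    assert (P3 : Cmod (Cconj rho / (RtoC (R1 * R1) - Cconj rho * X)) <= 3).
    { rewrite Cmod_div, Cmod_conj by auto.
      assert (Q : 53 / 80 <= Cmod (RtoC (R1 * R1) - Cconj rho * X)).
      { generalize (Cmod_sub_le (RtoC (R1 * R1)) (Cconj rho * X)). rewrite Cmod_mult, Cmod_conj, Cmod_RtoC_le by (unfold R1; lra).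
        assert (Cmod rho * Cmod X <= r1 * (3 / 2)) by (apply Rmult_le_compat; auto using Cmod_ge_0).
        unfold R1, r1 in *. lra. }
      apply (Rmult_le_reg_r (Cmod (RtoC (R1 * R1) - Cconj rho * X))); [lra|].
      unfold Rdiv. rewrite Rmult_assoc, Rinv_l by lra. unfold r1 in Hr. lra. }
    assert (A1 : M1 + c1 <= M) by (unfold M1; lra).
    assert (A2 : M1 / c1 + 1 <= M / c1).
    { apply (Rmult_le_reg_r c1); auto. replace ((M1 / c1 + 1) * c1) with (M1 + c1) by (field; lra).
      replace (M / c1 * c1) with M by (field; lra). auto. }
    split.
    + rewrite !re_plus. assert (Q := re_le_Cmod (Cconj rho / (RtoC (R1 * R1) - Cconj rho * X))).
      set (y := Re (Cconj rho / (RtoC (R1 * R1) - Cconj rho * X))) in *.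
      assert (- 3 <= y).
      { assert (Rabs y <= 3) by lra. unfold Rabs in H; destruct (Rcase_abs y); lra. }
      lra.
    + eapply Rle_trans; [apply Cmod_triangle|].
      eapply Rle_trans; [apply Rplus_le_compat_l, Cmod_triangle|]. nra.
  - assert (NZ' : forall z, Cmod z <= r1 -> F z <> 0) by (intros z Hz Z; apply NZ; eauto).
    assert (B := logderiv_no_zeros F dF M x HF N0 HM NZ' Hx).
    split; [| nra].
    assert (Q := re_le_Cmod (dF (RtoC x) / F (RtoC x))).
    set (y := Re (dF (RtoC x) / F (RtoC x))) in *.
    assert (Rabs y <= 1240 * (M + 3)) by lra. unfold Rabs in H; destruct (Rcase_abs y); lra.
Qed.

Definition gz (s : C) : C := (cder zeta s / zeta s)%C.

(** The local factorisation at 2 + it. RH enters by placing every zero in the disc at relative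
    abscissa at most -3/2, and M is of order log t. *)
Lemma gz_local : RH -> exists A, 0 < A /\ forall sigma t, 3 <= t -> 1 / 2 < sigma <= 2 ->
  - (A * ln t) <= Re (gz (sigma, t)) /\
  Cmod (gz (sigma, t)) <= A * ln t * (1 + / (sigma - 1 / 2)).
Proof.
  intros HRH. assert (Hc := c1_pos).
  set (A0 := 12 / c1). assert (HA0 : 0 < A0) by (apply Rdiv_lt_0_compat; lra).
  exists (1240 * 15 + 3 * A0). split; [lra|].
  intros sigma t Ht Hs.
  assert (Lt : 1 <= ln t).
  { assert (E : exp 1 <= t) by (generalize exp_le_3; lra).
    rewrite <- (ln_exp 1). apply ln_le_mono; auto. apply exp_pos. }
  set (s0 := (2, t) : C).
  assert (Im1 : forall z, U z -> 1 <= Im (s0 + z)).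
  { intros z Hz. unfold U, R0 in Hz. generalize (Im_le_Cmod z). intros Q.
    assert (Rabs (Im z) < 9 / 5) by lra. apply Rabs_def2 in H. simpl. unfold Im in *. lra. }
  assert (Dom : forall z, U z -> zeta_dom (s0 + z)%C).
  { intros z Hz. assert (I1 := Im1 z Hz). unfold U, R0 in Hz. split.
    - generalize (re_le_Cmod z). intros Q. assert (Rabs (Re z) < 9 / 5) by lra. apply Rabs_def2 in H.
      simpl. unfold Re in *. lra.
    - intros E. rewrite E in I1. simpl in I1. lra. }
  set (F := fun z => zeta (s0 + z)%C).
  assert (HF : holo U F (fun z => cder zeta (s0 + z)%C)).
  { apply (holo_sub (fun w => zeta_dom (s0 + w)%C)); auto. apply holo_shift, holo_zeta. }
  assert (F0 : F 0 = zeta s0) by (unfold F; f_equal; ring).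
  (* [LF_bound] at Re s = 2 gives |log zeta| <= 8. *)
  assert (Z0 : exp (- 8) <= Cmod (F 0)).
  { rewrite F0, Cmod_zeta_exp by (simpl; lra). apply exp_le.
    assert (B := LF_bound s0 ltac:(simpl; lra)). simpl Re in B.
    replace (4 * (1 + / (2 - 1))) with 8 in B by field.
    generalize (re_le_Cmod (LF s0)). intros Q. assert (Rabs (Re (LF s0)) <= 8) by lra.
    unfold Rabs in H; destruct (Rcase_abs (Re (LF s0))); lra. }
  assert (N0 : F 0 <> 0). { intros Z. rewrite Z, Cmod_0 in Z0. generalize (exp_pos (- 8)). lra. }
  (* Of the 11, 8 compensates the lower bound e^{-8} at the centre; the other 3 gives e^3 t >= 15 t,
     which dominates the growth bound 6 (t + 4) for t >= 3. *)
  set (M := 11 + ln t).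
  assert (HM : forall z, Cmod z = R1 -> Cmod (F z) <= exp M * Cmod (F 0)).
  { intros z Hz. unfold F at 1. assert (Uz : U z) by (unfold U, R0; rewrite Hz; unfold R1; lra).
    assert (I1 := Im1 z Uz).
    eapply Rle_trans; [apply zeta_growth|].
    - generalize (re_le_Cmod z). rewrite Hz. unfold R1. intros Q. simpl.
      assert (- (7 / 4) <= Re z). { unfold Rabs in Q; destruct (Rcase_abs (Re z)); lra. }
      unfold Re in *. lra.
    - rewrite Rabs_right; lra.
    - assert (B : Cmod (s0 + z) <= t + 4).
      { eapply Rle_trans; [apply Cmod_triangle|]. rewrite Hz.
        assert (Cmod s0 <= 2 + t).
        { eapply Rle_trans; [apply Cmod_le_Re_Im|]. simpl. rewrite !Rabs_right; lra. }
        unfold R1. lra. }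
      apply Rle_trans with (exp M * exp (- 8)).
      + unfold M. rewrite <- exp_plus. replace (11 + ln t + -8) with (3 + ln t) by ring.
        rewrite exp_plus, exp_ln by lra.
        assert (E1 : 5 / 2 <= exp 1).
        { assert (H4 : 9 / 8 <= exp (/ 8)) by (generalize (exp_ineq1 (/ 8) ltac:(lra)); lra).
          assert (H5 : exp (/ 4) = exp (/ 8) * exp (/ 8)) by (rewrite <- exp_plus; f_equal; field).
          assert (H6 : exp (/ 2) = exp (/ 4) * exp (/ 4)) by (rewrite <- exp_plus; f_equal; field).
          assert (H2 : exp 1 = exp (/ 2) * exp (/ 2)) by (rewrite <- exp_plus; f_equal; field).
          assert (H7 : 81 / 64 <= exp (/ 4)) by nra. assert (H8 : 8 / 5 <= exp (/ 2)) by nra. nra. }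
        assert (E3 : exp 3 = exp 1 * exp 1 * exp 1) by (rewrite <- !exp_plus; f_equal; ring).
        assert (E4 : 25 / 4 <= exp 1 * exp 1) by nra.
        assert (15 <= exp 3) by (rewrite E3; nra).
        nra.
      + apply Rmult_le_compat_l; [left; apply exp_pos | lra]. }
  assert (HZ : forall z, Cmod z <= r1 -> F z = 0 -> Re z <= - (3 / 2)).
  { intros z Hz Z. apply Rnot_lt_le. intros N.
    assert (Uz : U z) by (unfold U, R0; unfold r1 in Hz; lra).
    apply (zeta_nz (s0 + z) HRH); auto.
    - simpl. unfold Re in N. lra.
    - apply (Dom z Uz). }
  (* Each division lowers M by at least c1, so any integer above M/c1 is an admissible induction
     parameter. *)
  destruct (nfloor_ex (M / c1)) as (n & _ & Hn).
  { apply Rmult_le_pos; [unfold M; lra | left; now apply Rinv_0_lt_compat]. }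
  assert (Hn' : M < INR (S n) * c1).
  { rewrite S_INR. apply (Rmult_lt_compat_r c1) in Hn; auto. replace (M / c1 * c1) with M in Hn by (field; lra). auto. }
  destruct (logderiv_bounds (S n) F _ M HF N0 HM HZ Hn' (sigma - 2) ltac:(lra)) as (B1 & B2).
  assert (Ex : (s0 + RtoC (sigma - 2))%C = (sigma, t)) by (apply Ceq_of; simpl; ring).
  unfold F in B1, B2. rewrite Ex in B1, B2. fold (gz (sigma, t)) in B1, B2.
  replace (sigma - 2 + 3 / 2) with (sigma - 1 / 2) in B2 by field.
  assert (M12 : M <= 12 * ln t) by (unfold M; lra).
  assert (Mc : M / c1 <= A0 * ln t).
  { unfold A0. replace (12 / c1 * ln t) with (12 * ln t / c1) by (field; lra).
    unfold Rdiv. apply Rmult_le_compat_r; auto. left; now apply Rinv_0_lt_compat. }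
  assert (Is : 0 < / (sigma - 1 / 2)) by (apply Rinv_0_lt_compat; lra).
  assert (Mc0 : 0 <= M / c1) by (apply Rmult_le_pos; [unfold M; lra | left; now apply Rinv_0_lt_compat]).
  split.
  - eapply Rle_trans; [| exact B1]. lra.
  - eapply Rle_trans; [exact B2|].
    apply Rle_trans with (1240 * 15 * ln t + (3 + / (sigma - 1 / 2)) * (A0 * ln t)).
    + apply Rplus_le_compat; [lra|]. apply Rmult_le_compat_l; lra.
    + assert (P : 0 <= / (sigma - 1 / 2) * ln t) by nra. nra.
Qed.

End LocalFactorization.

(** * Prime sums for the logarithmic derivative *)

Definition gz_dom (s : C) : Prop := 1 / 2 < Re s /\ s <> 1.

Lemma gz_dom_open : copen gz_dom.
Proof.
  intros z (H1 & H2). assert (P : 0 < Cmod (z - 1)) by (apply Cmod_pos, Cminus_eq_contra, H2).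
  exists (Rmin (Re z - 1 / 2) (Cmod (z - 1))). split; [apply Rmin_glb_lt; auto; lra|].
  intros w Hw. assert (W1 := Rlt_le_trans _ _ _ Hw (Rmin_l _ _)). assert (W2 := Rlt_le_trans _ _ _ Hw (Rmin_r _ _)).
  split.
  - generalize (re_le_Cmod (w - z)). rewrite Re_minus. intros Q.
    assert (Q' : Rabs (Re w - Re z) < Re z - 1 / 2) by lra. apply Rabs_def2 in Q'. lra.
  - intros ->. rewrite Cmod_sub_sym in W2. lra.
Qed.

Lemma holo_gz : RH -> holo gz_dom gz (cder gz).
Proof.
  intros HRH.
  assert (S : forall z, gz_dom z -> zeta_dom z) by (intros z (H1 & H2); split; auto; lra).
  apply (holo_to_cder _ _ (fun w => (cder (cder zeta) w * zeta w - cder zeta w * cder zeta w) / (zeta w * zeta w))%C gz_dom_open).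
  apply holo_div.
  - eapply holo_sub; [exact S|]. apply (holo_deriv _ _ _ zeta_dom_open holo_zeta).
  - eapply holo_sub; [exact S|]. apply holo_zeta.
  - intros z (H1 & H2). now apply zeta_nz.
Qed.

Lemma gz_LF s : 1 < Re s -> gz s = cder LF s.
Proof.
  intros Hs. unfold gz. assert (N := cexp_neq_0 (LF s)).
  assert (E : cder zeta s = (cexp (LF s) * cder LF s)%C).
  { apply cder_unique.
    destruct (half_plane_open 1 s Hs) as (r & Hr & HB).
    apply (cderiv_ext_loc (fun w => cexp (LF w)) zeta s _ r Hr).
    - intros w Hw. symmetry. apply zeta_exp_LF. now apply HB.
    - apply cderiv_cexp_comp. now apply (proj1 holo_LF). }
  rewrite E, zeta_exp_LF by auto. field; auto.
Qed.

(** The part p <= N of the series of -zeta'/zeta; [gz + Sy N] is therefore the tail, with a plus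
    sign. It is small far to the right, and near the critical line it still inherits a lower bound
    on its real part. *)
Definition Sy (N : nat) (s : C) : C := csum1 (pterm (lterm s)) N.

Lemma Sy_cvg s : 1 < Re s -> ccvg (fun N => - Sy N s)%C (gz s).
Proof.
  intros Hs. rewrite gz_LF by auto. eapply ccvg_ext; [| apply (proj2 holo_LF s Hs)].
  intros N. unfold Sy. induction N as [|N IH]; [simpl; ring|]. cbn [csum1]. rewrite IH.
  unfold pterm. destruct (prime.prime (S N)); ring.
Qed.

Lemma holo_Sy N : holo (half_plane (/ 2)) (Sy N) (cder (Sy N)).
Proof.
  assert (H : holo (half_plane (/ 2)) (Sy N) (fun z => csum1 (fun n => cder (fun s => pterm (lterm s) n) z) N)).
  { unfold Sy. apply (holo_csum1 _ (fun n s => pterm (lterm s) n) (fun n z => cder (fun s => pterm (lterm s) n) z)).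
    intros n Hn. apply (holo_to_cder _ _ (fun z => - (if prime.prime n then cder (fun s => - lterm s n)%C z else 0))%C (half_plane_open (/ 2))).
    unfold pterm. destruct (prime.prime n) eqn:E.
    - assert (Q := holo_scal _ (- (1))%C _ _ (holo_deriv _ _ _ (half_plane_open (/ 2)) (holo_nlog_npow n E))).
      intros z Hz. destruct (Q z Hz) as (Q1 & Q2). split.
      + apply (cderiv_ext (fun w => - (1) * - lterm w n)%C); [intros; ring|].
        eapply cderiv_eq; [| exact Q1]. ring.
      + apply (ccont_ext_loc (fun w => - (1) * cder (fun s => - lterm s n) w)%C _ z 1 Rlt_0_1); auto. intros; ring.
    - intros z Hz. split; [eapply cderiv_eq; [| apply cderiv_const]; ring|].
      apply ccont_const. }
  apply (holo_to_cder _ _ _ (half_plane_open (/ 2)) H).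
Qed.

Lemma lterm_bound p s : isprime p -> / 2 <= Re s ->
  Cmod (lterm s p) <= 4 * (ln (INR p) * Rpower (INR p) (- Re s)).
Proof.
  intros Hp Hs. unfold lterm. assert (B := Cmod_npow_prime_le p s Hp Hs).
  assert (L : 0 <= ln (INR p)).
  { rewrite <- ln_1. apply ln_le_mono; [lra|]. generalize (INR_prime_ge2 p Hp). lra. }
  rewrite Cmod_div, Cmod_mult, Cmod_npow, Cmod_RtoC_le by (auto; now apply npow_prime_neq_1).
  assert (D : / 4 <= Cmod (1 - npow_neg p s)).
  { generalize (Cmod_sub_le 1 (npow_neg p s)). rewrite Cmod_1. lra. }
  assert (P : 0 <= ln (INR p) * Rpower (INR p) (- Re s)) by (apply Rmult_le_pos; auto; left; apply Rpower_pos).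
  unfold Rdiv. rewrite Rmult_comm. apply Rmult_le_compat_r; auto.
  replace 4 with (/ / 4) by field. apply Rinv_le_contravar; lra.
Qed.

Definition plog (n : nat) : R := if prime.prime n then ln (INR n) else 0.

Lemma plog_nonneg n : 0 <= plog n.
Proof.
  unfold plog. destruct (prime.prime n) eqn:E; [| lra].
  rewrite <- ln_1. apply ln_le_mono; [lra|]. generalize (INR_prime_ge2 n E). lra.
Qed.

Definition cheb : R := 2 * ln 4.

Lemma cheb_pos : 0 < cheb.
Proof. unfold cheb. assert (ln 1 < ln 4) by (apply ln_increasing; lra). rewrite ln_1 in H. lra. Qed.

Lemma chebyshev N : rsum1 plog N <= cheb * INR N.
Proof.
  replace (rsum1 plog N) with (theta N); [apply theta_le|].
  unfold theta. induction N as [|N IH]; [reflexivity|].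
  rewrite List.seq_S, List.filter_app, List.fold_right_app. cbn [rsum1]. rewrite <- IH. clear IH.
  simpl. unfold plog.
  assert (G : forall l x, List.fold_right (fun p acc => ln (INR p) + acc) x l = List.fold_right (fun p acc => ln (INR p) + acc) 0 l + x).
  { induction l as [|y l IHl]; intros x; simpl; [ring | rewrite IHl; ring]. }
  destruct (prime.prime (S N)); cbn [List.fold_right].
  - rewrite G. simpl. ring.
  - ring.
Qed.

(** Partial summation: if the partial sums of a never exceed those of the constant c, the same holds
    after weighting by a decreasing nonnegative phi. *)
Lemma abel_upper (a phi : nat -> R) c N :
  (forall n, rsum1 a n <= c * INR n) -> (forall n, (1 <= n)%nat -> phi (S n) <= phi n) ->
  (forall n, (1 <= n)%nat -> 0 <= phi n) ->
  rsum1 (fun n => a n * phi n) N <= c * rsum1 phi N.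
Proof.
  intros Ha Hd Hp.
  (* The strengthened induction keeps the surplus c N minus the partial sum of a, weighted by phi N;
     monotonicity of phi carries it to the next index. *)
  assert (E : forall N, (1 <= N)%nat -> rsum1 (fun n => a n * phi n) N <= c * rsum1 phi N - (c * INR N - rsum1 a N) * phi N).
  { induction N0 as [|K IH]; intros H; [lia|].
    destruct K as [|K].
    - simpl. right; ring.
    - specialize (IH ltac:(lia)). change (rsum1 (fun n => a n * phi n) (S (S K))) with
        (rsum1 (fun n => a n * phi n) (S K) + a (S (S K)) * phi (S (S K))).
      change (rsum1 phi (S (S K))) with (rsum1 phi (S K) + phi (S (S K))).
      change (rsum1 a (S (S K))) with (rsum1 a (S K) + a (S (S K))).
      rewrite (S_INR (S K)).
      assert (Q := Ha (S K)). assert (D := Hd (S K) ltac:(lia)). nra. }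
  destruct N as [|N]; [simpl; lra|].
  eapply Rle_trans; [apply E; lia|]. assert (Q := Ha (S N)). assert (P := Hp (S N) ltac:(lia)). nra.
Qed.

Lemma Rpower_decr n a : (1 <= n)%nat -> 0 <= a -> Rpower (INR (S n)) (- a) <= Rpower (INR n) (- a).
Proof.
  intros Hn Ha. unfold Rpower. apply exp_le.
  assert (ln (INR n) <= ln (INR (S n))).
  { apply ln_le_mono; [apply lt_0_INR; lia | apply le_INR; lia]. }
  nra.
Qed.

Lemma Rpower_sum_sub1 a N : 0 < a < 1 -> (1 <= N)%nat ->
  rsum1 (fun n => Rpower (INR n) (- a)) N <= Rpower (INR N) (1 - a) / (1 - a).
Proof.
  intros Ha HN. induction HN as [|N HN IH].
  - simpl. rewrite !Rpower_1_l. apply (Rmult_le_reg_r (1 - a)); [lra|].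
    replace (1 / (1 - a) * (1 - a)) with 1 by (field; lra). lra.
  - cbn [rsum1]. assert (Hp : 0 < INR N) by (apply lt_0_INR; lia). rewrite S_INR in *. set (x := INR N) in *.
    destruct (MVT_cor2 (fun x => Rpower x (1 - a)) (fun x => (1 - a) * Rpower x (1 - a - 1)) x (x + 1) ltac:(lra)) as (c & E & Hc).
    { intros c Hc. apply derivable_pt_lim_power. lra. }
    replace (x + 1 - x) with 1 in E by ring. replace (1 - a - 1) with (- a) in E by ring.
    assert (Q : Rpower (x + 1) (- a) <= Rpower c (- a)).
    { unfold Rpower. apply exp_le. assert (ln c <= ln (x + 1)) by (apply ln_le_mono; lra). nra. }
    apply (Rmult_le_compat_r (1 - a)) in IH; [| lra].
    replace (Rpower x (1 - a) / (1 - a) * (1 - a)) with (Rpower x (1 - a)) in IH by (field; lra).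
    apply (Rmult_le_reg_r (1 - a)); [lra|].
    replace (Rpower (x + 1) (1 - a) / (1 - a) * (1 - a)) with (Rpower (x + 1) (1 - a)) by (field; lra). nra.
Qed.

Lemma pterm_lterm_bound n s a : (1 <= n)%nat -> / 2 <= a <= Re s ->
  Cmod (pterm (lterm s) n) <= 4 * (plog n * Rpower (INR n) (- a)).
Proof.
  intros Hn Ha. unfold pterm, plog. destruct (prime.prime n) eqn:E.
  - eapply Rle_trans; [apply lterm_bound; auto; lra|]. apply Rmult_le_compat_l; [lra|].
    assert (P := plog_nonneg n). unfold plog in P. rewrite E in P.
    apply Rmult_le_compat_l; auto. unfold Rpower. apply exp_le. nra.
  - rewrite Cmod_0. right; ring.
Qed.

Lemma Sy_bound N s a : (1 <= N)%nat -> / 2 <= a < 1 -> a <= Re s ->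
  Cmod (Sy N s) <= 4 * cheb / (1 - a) * Rpower (INR N) (1 - a).
Proof.
  intros HN Ha Hs.
  eapply Rle_trans; [apply (csum1_bound _ (fun n => 4 * (plog n * Rpower (INR n) (- a))))|].
  - intros n Hn. apply pterm_lterm_bound; [lia | lra].
  - rewrite rsum1_scal.
    assert (A := abel_upper plog (fun n => Rpower (INR n) (- a)) cheb N chebyshev
      (fun n Hn => Rpower_decr n a Hn ltac:(lra)) (fun n _ => Rlt_le _ _ (Rpower_pos _ _))).
    assert (B := Rpower_sum_sub1 a N ltac:(lra) HN). assert (P := cheb_pos).
    apply Rle_trans with (4 * (cheb * (Rpower (INR N) (1 - a) / (1 - a)))).
    + apply Rmult_le_compat_l; [lra|]. eapply Rle_trans; [exact A|]. apply Rmult_le_compat_l; lra.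
    + right. field. lra.
Qed.

(** Partial summation with Chebyshev's bound. The constant 12 is 4 from [lterm_bound] times 3: one
    N^{1-a} from the flat part of the weight and two from its tail, as 1/(a - 1) <= 2. *)
Lemma gz_tail N s : (1 <= N)%nat -> 3 / 2 <= Re s ->
  Cmod (gz s + Sy N s) <= 12 * cheb * Rpower (INR N) (1 - Re s).
Proof.
  intros HN Hs. set (a := Re s). assert (P := cheb_pos).
  assert (HNp : 0 < INR N) by (apply lt_0_INR; lia).
  apply (ccvg_le (fun M => - Sy M s + Sy N s)%C _ _ N).
  2: { apply ccvg_plus; [apply Sy_cvg; lra | apply ccvg_const]. }
  intros M HM. replace (- Sy M s + Sy N s)%C with (- (Sy M s - Sy N s))%C by ring. rewrite Cmod_opp.
  (* The weight is made constant below N so that it is decreasing from n = 1 on, as [abel_upper]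
     demands; on the tail it is n^{-a}. *)
  set (phi := fun n => Rpower (INR (max n N)) (- a)).
  assert (Pphi : forall n, 0 <= plog n * phi n) by (intros; apply Rmult_le_pos; [apply plog_nonneg | left; apply Rpower_pos]).
  eapply Rle_trans; [apply (csum1_diff_bound _ (fun n => 4 * (plog n * phi n))); auto|].
  - intros n Hn. unfold phi. rewrite Nat.max_l by lia. apply pterm_lterm_bound; [lia | unfold a; lra].
  - rewrite !rsum1_scal.
    assert (N0 : 0 <= rsum1 (fun n => plog n * phi n) N) by (apply rsum1_nonneg; auto).
    assert (A := abel_upper plog phi cheb M chebyshev).
    assert (A' : rsum1 (fun n => plog n * phi n) M <= cheb * rsum1 phi M).
    { apply A.
      - intros n Hn. unfold phi. destruct (Nat.le_gt_cases N n).
        + rewrite !Nat.max_l by lia. apply Rpower_decr; auto. unfold a; lra.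
        + rewrite !Nat.max_r by lia. lra.
      - intros n _. left. apply Rpower_pos. }
    assert (S1 : rsum1 phi N = INR N * Rpower (INR N) (- a)).
    { rewrite (rsum1_ext phi (fun _ => Rpower (INR N) (- a)) N).
      - clear. generalize (Rpower (INR N) (- a)). intros c. induction N as [|N IH]; [simpl; ring|].
        cbn [rsum1]. rewrite IH, S_INR. ring.
      - intros n Hn. unfold phi. now rewrite Nat.max_r by lia. }
    assert (S2 : rsum1 phi M - rsum1 phi N <= Rpower (INR N) (- (a - 1)) / (a - 1)).
    { eapply Rle_trans; [| apply (Rpower_sum_tail_le (a - 1) N M); [unfold a; lra | lia]].
      right. clear - HM HN. induction HM as [|M HM IH]; [ring|]. cbn [rsum1].
      replace (phi (S M)) with (Rpower (INR (S M)) (- (a - 1) - 1)); [lra|].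
      unfold phi. rewrite Nat.max_l by lia. f_equal. ring. }
    replace (INR N * Rpower (INR N) (- a)) with (Rpower (INR N) (1 - a)) in S1.
    2: { replace (1 - a) with (1 + - a) by ring. rewrite Rpower_plus, Rpower_1; auto. }
    replace (- (a - 1)) with (1 - a) in S2 by ring.
    assert (Q : Rpower (INR N) (1 - a) / (a - 1) <= 2 * Rpower (INR N) (1 - a)).
    { assert (Pp := Rpower_pos (INR N) (1 - a)). unfold Rdiv. rewrite Rmult_comm. apply Rmult_le_compat_r; [lra|].
      replace 2 with (/ (1 / 2)) by field. apply Rinv_le_contravar; unfold a; lra. }
    assert (Sum : rsum1 phi M <= 3 * Rpower (INR N) (1 - a)) by lra.
    assert (cheb * rsum1 phi M <= cheb * (3 * Rpower (INR N) (1 - a))) by (apply Rmult_le_compat_l; lra).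
    lra.
Qed.

Lemma gz_right s : 3 / 2 <= Re s -> Cmod (gz s) <= 12 * cheb.
Proof.
  intros Hs. assert (H := gz_tail 1 s (le_n 1) Hs). change (INR 1) with 1 in H. rewrite Rpower_1_l in H.
  replace (gz s) with (gz s + Sy 1 s)%C; [lra|].
  unfold Sy. simpl. unfold pterm. simpl. ring.
Qed.

(** The Poisson kernel with a Gaussian cutoff. On the line Re w = -x one has 1/w - 1/(w + 2x) =
    -2x/(x^2 + v^2), and e^{(w+x)^2} = e^{-v^2}: the contour kernel is real and of constant sign
    there, which is what makes positivity arguments available. *)
Definition pker (x v : R) : R := exp (- (v * v)) * (x / (x * x + v * v)).

Lemma pker_pos x v : 0 < x -> 0 < pker x v.
Proof. intros Hx. apply Rmult_lt_0_compat; [apply exp_pos | apply Rdiv_lt_0_compat; nra]. Qed.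

Lemma continuous_gauss v : continuous (fun v => exp (- (v * v))) v.
Proof. apply (ex_derive_continuous (fun v => exp (- (v * v)))). auto_derive; auto. Qed.

Lemma continuous_poisson x v : 0 < x -> continuous (fun v => x / (x * x + v * v)) v.
Proof. intros Hx. apply (ex_derive_continuous (fun v => x / (x * x + v * v))). auto_derive; nra. Qed.

Lemma continuous_pker x v : 0 < x -> continuous (pker x) v.
Proof.
  intros Hx. apply (continuous_mult (fun v => exp (- (v * v))) (fun v => x / (x * x + v * v)));
    auto using continuous_gauss, continuous_poisson.
Qed.

(** Lets Gaussian integrals be bounded through the arctangent, so that they cost at most PI. *)
Lemma gauss_le v : exp (- (v * v)) <= / (1 + v * v).
Proof.
  rewrite exp_Ropp. apply Rinv_le_contravar; [nra|]. destruct (Req_dec v 0) as [->|N].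
  - rewrite Rmult_0_r, exp_0. lra.
  - left. apply exp_ineq1. nra.
Qed.

Lemma RInt_poisson_le x H : 0 < x -> 0 <= H -> RInt (fun v => x / (x * x + v * v)) (- H) H <= PI.
Proof.
  intros Hx HH.
  rewrite (is_RInt_unique _ _ _ (atan (H / x) - atan (- H / x))).
  - generalize (atan_bound (H / x)) (atan_bound (- H / x)). lra.
  - apply (is_RInt_derive (V := R_CompleteNormedModule) (fun v => atan (v / x))).
    + intros v _. auto_derive; auto. unfold Rsqr. field. split; nra.
    + intros v _. now apply continuous_poisson.
Qed.

Lemma ex_RInt_poisson x H : 0 < x -> ex_RInt (fun v => x / (x * x + v * v)) (- H) H.
Proof. intros Hx. apply (ex_RInt_continuous (V := R_CompleteNormedModule)). intros; now apply continuous_poisson. Qed.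

Lemma ex_RInt_pker x H : 0 < x -> ex_RInt (pker x) (- H) H.
Proof. intros Hx. apply (ex_RInt_continuous (V := R_CompleteNormedModule)). intros; now apply continuous_pker. Qed.

Lemma RInt_pker_le x H : 0 < x -> 0 <= H -> RInt (pker x) (- H) H <= PI.
Proof.
  intros Hx HH. eapply Rle_trans; [| apply (RInt_poisson_le x H Hx HH)].
  apply RInt_le; auto using ex_RInt_pker, ex_RInt_poisson; [lra|].
  intros v _. unfold pker. rewrite <- (Rmult_1_l (x / (x * x + v * v))) at 2.
  apply Rmult_le_compat_r.
  - left. apply Rdiv_lt_0_compat; nra.
  - rewrite <- exp_0. apply exp_le. nra.
Qed.

Lemma Cmod_cexp_sqr u v : Cmod (cexp ((u, v) * (u, v))) = exp (u * u - v * v).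
Proof. rewrite Cmod_cexp. reflexivity. Qed.

Section Kernel.

Variables (V : C -> Prop) (h dh : C -> C) (sigma t x H r mu Bh B1 : R).
Hypotheses (Hx : 0 < x <= 3 / 2) (HH : 1 <= H) (Hr : 0 < r).
Hypothesis Hh : holo V h dh.
Hypothesis HV : forall w, sigma - x - r < Re w < sigma + 1 + r -> t - H - r < Im w < t + H + r -> V w.
Hypothesis HBh : forall w, sigma - x <= Re w <= sigma + 1 -> Rabs (Im w - t) = H -> Cmod (h w) <= Bh.
Hypothesis HB1 : forall v, - H <= v <= H -> Cmod (h (sigma + 1, t + v)) <= B1.

Definition kernel_integral : C :=
  CInt (fun v => h (sigma - x, t + v)%R * cexp (RtoC mu * (- x, v)%R) * RtoC (pker x v))%C (- H) H.

Lemma kernel_integrable : cintegrable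
  (fun v => h (sigma - x, t + v)%R * cexp (RtoC mu * (- x, v)%R) * RtoC (pker x v))%C (- H) H.
Proof.
  apply cintegrable_cont; [lra|]. intros v Hv. apply rcont_mult; [apply rcont_mult|].
  - apply (rcont_comp h (fun v => (sigma - x, t + v))).
    + apply rcont_pair; [apply continuous_const|]. apply (continuous_plus (fun _ => t) (fun v => v)); [apply continuous_const | apply continuous_id].
    + eapply holo_ccont; [exact Hh|]. apply HV; simpl; lra.
  - apply rcont_cexp. apply rcont_mult; [apply rcont_const | apply rcont_vert].
  - apply rcont_RtoC. apply continuous_pker; lra.
Qed.

(** Cauchy on -x <= Re w <= 1 with 2x/(w (w + 2x)) = 1/w - 1/(w + 2x). Only the pole w = 0 is
    inside, with residue e^{x^2} h(s), and the left side becomes -2 [kernel_integral]. The 7 bounds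
    (1 + x)^2 <= 25/4; the 15 is twice 3 times the largest width 5/2. *)
Lemma kernel_bound :
  Cmod (2 * kernel_integral - 2 * PI * (RtoC (exp (x * x)) * h (sigma, t))) <=
    PI * B1 * exp (7 + mu) + 15 * Bh * exp (7 + 3 * Rabs mu - H * H).
Proof.
  set (s := (sigma, t) : C).
  set (U := fun w => V (s + w)%C /\ (w + RtoC (2 * x) <> 0)%C).
  set (G := fun w => (h (s + w) * (cexp ((w + RtoC x) * (w + RtoC x)) * (RtoC (2 * x) / (w + RtoC (2 * x))) * cexp (RtoC mu * w)))%C).
  set (r' := Rmin r (x / 2)). assert (Hr' : 0 < r') by (apply Rmin_glb_lt; lra).
  assert (Rr := Rmin_l r (x / 2)). assert (Rx := Rmin_r r (x / 2)). fold r' in Rr, Rx.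
  assert (HU : forall w, - x - r' < Re w < 1 + r' -> - H - r' < Im w < H + r' -> U w).
  { intros w W1 W2. split.
    - apply HV; simpl; unfold Re, Im in *; lra.
    - intros E. apply (f_equal Re) in E. simpl in E. unfold Re in W1. lra. }
  assert (HG : exists dG, holo U G dG).
  { eexists. unfold G. apply holo_mult.
    - apply (holo_sub (fun w => V (s + w)%C)); [now intros w (A & B)|]. apply holo_shift, Hh.
    - apply holo_mult; [apply holo_mult|].
      + apply holo_cexp. apply holo_mult; apply holo_plus; try apply holo_id; apply holo_const.
      + apply holo_div; [apply holo_const | apply holo_plus; [apply holo_id | apply holo_const] |].
        intros w (A & B). exact B.
      + apply holo_cexp, holo_scal, holo_id. }
  destruct HG as (dG & HG).
  assert (Bh0 : 0 <= Bh).
  { eapply Rle_trans; [apply Cmod_ge_0 | apply (HBh (sigma, t + H))]; simpl; [lra|].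
    replace (t + H - t) with H by ring. apply Rabs_right; lra. }
  assert (B10 : 0 <= B1) by (eapply Rle_trans; [apply Cmod_ge_0 | apply (HB1 0)]; lra).
  assert (Hor : forall u Y, - x <= u <= 1 -> Rabs Y = H -> Cmod (G (u, Y) / (u, Y)) <= 3 * Bh * exp (7 + 3 * Rabs mu - H * H)).
  { intros u Y Hu HY. assert (NY : Y <> 0) by (intros ->; rewrite Rabs_R0 in HY; lra).
    assert (YY : Y * Y = H * H) by (rewrite <- HY; destruct (Rcase_abs Y); [rewrite Rabs_left | rewrite Rabs_right]; lra).
    rewrite Cmod_div by (now apply pair_im_neq_0). unfold G. rewrite !Cmod_mult.
    assert (h1 : Cmod (h (s + (u, Y))) <= Bh).
    { apply HBh; simpl; [lra|]. replace (t + Y - t) with Y by ring. auto. }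
    assert (h2 : Cmod (cexp (((u, Y) + RtoC x) * ((u, Y) + RtoC x))) <= exp (7 - H * H)).
    { replace ((u, Y) + RtoC x)%C with (u + x, Y) by (apply Ceq_of; simpl; ring).
      rewrite Cmod_cexp_sqr. apply exp_le. nra. }
    assert (h3 : Cmod (RtoC (2 * x) / ((u, Y) + RtoC (2 * x))) <= 3).
    { replace ((u, Y) + RtoC (2 * x))%C with (u + 2 * x, Y) by (apply Ceq_of; simpl; ring).
      rewrite Cmod_div, Cmod_RtoC_le by (try lra; now apply pair_im_neq_0).
      assert (Q := Im_le_Cmod (u + 2 * x, Y)). simpl in Q. rewrite HY in Q.
      apply (Rmult_le_reg_r (Cmod (u + 2 * x, Y))); [lra|]. unfold Rdiv. rewrite Rmult_assoc, Rinv_l by lra. lra. }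
    assert (h4 : Cmod (cexp (RtoC mu * (u, Y))) <= exp (3 * Rabs mu)).
    { rewrite Cmod_cexp. apply exp_le. simpl. rewrite Rmult_0_l, Rminus_0_r.
      eapply Rle_trans; [apply Rle_abs|]. rewrite Rabs_mult.
      assert (Rabs u <= 3) by (apply Rabs_le; lra). generalize (Rabs_pos mu). nra. }
    assert (h5 : 1 <= Cmod (u, Y)).
    { assert (Q := Im_le_Cmod (u, Y)). simpl in Q. rewrite HY in Q. lra. }
    replace (7 + 3 * Rabs mu - H * H) with ((7 - H * H) + 3 * Rabs mu) by ring. rewrite exp_plus.
    replace (3 * Bh * (exp (7 - H * H) * exp (3 * Rabs mu))) with (Bh * (exp (7 - H * H) * 3 * exp (3 * Rabs mu)) * 1) by ring.
    unfold Rdiv. apply Rmult_le_compat.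
    - repeat apply Rmult_le_pos; apply Cmod_ge_0.
    - left; apply Rinv_0_lt_compat; lra.
    - apply Rmult_le_compat; auto using Cmod_ge_0; [repeat apply Rmult_le_pos; apply Cmod_ge_0|].
      apply Rmult_le_compat; auto using Cmod_ge_0; [repeat apply Rmult_le_pos; apply Cmod_ge_0|].
      apply Rmult_le_compat; auto using Cmod_ge_0.
    - apply Rle_trans with (/ 1); [apply Rinv_le_contravar; lra | lra]. }
  assert (CR := cauchy_rectangle_bound U G dG x 1 H r' ltac:(lra) Rlt_0_1 ltac:(lra) Hr' HG HU
     (3 * Bh * exp (7 + 3 * Rabs mu - H * H))
     (fun u Hu => Hor u H Hu (Rabs_right H ltac:(lra)))
     (fun u Hu => Hor u (- H) Hu ltac:(rewrite Rabs_Ropp; apply Rabs_right; lra))).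
  assert (LI : CInt (fun v => G (- x, v)%R / (- x, v)%R)%C (- H) H = (- (2) * kernel_integral)%C).
  { unfold kernel_integral. rewrite <- CInt_scal by apply kernel_integrable.
    apply CInt_ext; [lra|]. intros v Hv. unfold G, pker.
    replace (s + (- x, v)%R)%C with (sigma - x, t + v) by (apply Ceq_of; simpl; ring).
    replace ((- x, v)%R + RtoC x)%C with (0, v) by (apply Ceq_of; simpl; ring).
    replace ((- x, v)%R + RtoC (2 * x))%C with (x, v) by (apply Ceq_of; simpl; ring).
    replace ((0, v) * (0, v))%C with (RtoC (- (v * v))) by (apply Ceq_of; simpl; ring).
    rewrite cexp_RtoC, (RtoC_mult (exp (- (v * v)))).
    assert (N1 : (- x, v) <> RtoC 0) by (apply pair_re_neq_0; lra).
    assert (N2 : (x, v) <> RtoC 0) by (apply pair_re_neq_0; lra).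
    assert (P : x * x + v * v <> 0) by nra.
    assert (E : RtoC (x / (x * x + v * v)) = (- RtoC x / ((x, v) * (- x, v)%R))%C).
    { replace ((x, v) * (- x, v)%R)%C with (- RtoC (x * x + v * v))%C by (apply Ceq_of; simpl; ring).
      rewrite RtoC_div by auto. field. intros Z; apply RtoC_inj in Z; auto. }
    rewrite E, (RtoC_mult 2 x). field. auto. }
  assert (G0 : G 0 = (RtoC (exp (x * x)) * h s)%C).
  { unfold G. rewrite !Cplus_0_r, !Cplus_0_l, Cmult_0_r, cexp_0, <- RtoC_mult, cexp_RtoC. field.
    intros Z; apply RtoC_inj in Z; lra. }
  rewrite LI, G0 in CR.
  set (I := kernel_integral) in *.
  assert (RB : Cmod (CInt (fun v => G (1, v) / (1, v))%C (- H) H) <= PI * B1 * exp (7 + mu)).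
  { apply Rle_trans with (RInt (fun v => (B1 * exp (7 + mu)) * (1 / (1 * 1 + v * v))) (- H) H).
    - apply CInt_bound; [lra | | |].
      + apply cintegrable_cont; [lra|]. intros v Hv. apply rcont_div; [apply pair_re_neq_0; lra | | apply rcont_vert].
        apply (rcont_comp G (fun v => (1, v))); [apply rcont_vert|]. eapply holo_ccont; [exact HG|]. apply HU; simpl; lra.
      + apply (ex_RInt_scal (fun v => 1 / (1 * 1 + v * v))). apply ex_RInt_poisson. lra.
      + intros v Hv. rewrite Cmod_div by (apply pair_re_neq_0; lra). unfold G. rewrite !Cmod_mult.
        assert (h1 : Cmod (h (s + (1, v))) <= B1).
        { replace (s + (1, v))%C with (sigma + 1, t + v) by (apply Ceq_of; reflexivity). now apply HB1. }
        assert (h2 : Cmod (cexp (((1, v) + RtoC x) * ((1, v) + RtoC x))) <= exp 7 * (1 / (1 * 1 + v * v))).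
        { replace ((1, v) + RtoC x)%C with (1 + x, v) by (apply Ceq_of; simpl; ring).
          rewrite Cmod_cexp_sqr. replace ((1 + x) * (1 + x) - v * v) with ((1 + x) * (1 + x) + - (v * v)) by ring.
          rewrite exp_plus. apply Rmult_le_compat; try (left; apply exp_pos).
          - apply exp_le. nra.
          - eapply Rle_trans; [apply gauss_le|]. unfold Rdiv. rewrite !Rmult_1_l. lra. }
        assert (h3 : Cmod (RtoC (2 * x) / ((1, v) + RtoC (2 * x))) <= 1).
        { replace ((1, v) + RtoC (2 * x))%C with (1 + 2 * x, v) by (apply Ceq_of; simpl; ring).
          rewrite Cmod_div, Cmod_RtoC_le by (try lra; apply pair_re_neq_0; lra).
          assert (Q := Cmod_vert (1 + 2 * x) v ltac:(lra)).
          apply (Rmult_le_reg_r (Cmod (1 + 2 * x, v))); [lra|]. unfold Rdiv. rewrite Rmult_assoc, Rinv_l by lra. lra. }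
        assert (h4 : Cmod (cexp (RtoC mu * (1, v))) = exp mu).
        { rewrite Cmod_cexp. f_equal. simpl. ring. }
        assert (h5 := Cmod_vert 1 v ltac:(lra)).
        rewrite h4, exp_plus.
        replace (B1 * (exp 7 * exp mu) * (1 / (1 * 1 + v * v))) with (B1 * (exp 7 * (1 / (1 * 1 + v * v)) * 1 * exp mu) * 1) by ring.
        unfold Rdiv at 1. apply Rmult_le_compat.
        * repeat apply Rmult_le_pos; try apply Cmod_ge_0. left; apply exp_pos.
        * left; apply Rinv_0_lt_compat; lra.
        * apply Rmult_le_compat; auto using Cmod_ge_0; [repeat apply Rmult_le_pos; try apply Cmod_ge_0; left; apply exp_pos|].
          apply Rmult_le_compat_r; [left; apply exp_pos|].
          apply Rmult_le_compat; auto using Cmod_ge_0.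
        * apply Rle_trans with (/ 1); [apply Rinv_le_contravar; lra | lra].
    - rewrite (RInt_scal (V := R_CompleteNormedModule) (fun v => 1 / (1 * 1 + v * v))) by (apply ex_RInt_poisson; lra).
      unfold scal; simpl; unfold mult; simpl.
      assert (Q := RInt_poisson_le 1 H Rlt_0_1 ltac:(lra)).
      replace (PI * B1 * exp (7 + mu)) with (B1 * exp (7 + mu) * PI) by ring.
      apply Rmult_le_compat_l; auto. apply Rmult_le_pos; auto. left; apply exp_pos. }
  set (RI := CInt (fun v => G (1, v) / (1, v))%C (- H) H) in *.
  replace (2 * I - 2 * PI * (exp (x * x) * h s))%C with ((RI - - (2) * I - 2 * PI * (exp (x * x) * h s)) - RI)%C by ring.
  eapply Rle_trans; [apply Cmod_minus_le|].
  assert (Pe := exp_pos (7 + 3 * Rabs mu - H * H)).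
  assert (2 * (3 * Bh * exp (7 + 3 * Rabs mu - H * H)) * (x + 1) <= 15 * Bh * exp (7 + 3 * Rabs mu - H * H)).
  { replace (2 * (3 * Bh * exp (7 + 3 * Rabs mu - H * H)) * (x + 1)) with ((6 * (x + 1)) * (Bh * exp (7 + 3 * Rabs mu - H * H))) by ring.
    rewrite (Rmult_assoc 15). apply Rmult_le_compat_r; [apply Rmult_le_pos; lra | lra]. }
  lra.
Qed.

End Kernel.

(* The kernel identity at mu = 0 bounds the Poisson mass of |Re g| on the left
   line by |g(s)| itself; at mu = +-log y, with the conjugate of one added to the
   other, only Re g1 remains on the left line, damped by y^{-x}. *)
Lemma gz_selfbound (sigma t x H : R) (N : nat) (a Bh S0 S1 : R) : RH ->
  0 < x <= 3 / 2 -> 1 <= H -> (1 <= N)%nat -> 1 / 2 < sigma - x -> sigma <= 2 -> 1 < t - H -> 0 <= a ->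
  exp (- (x * ln (INR N))) <= / 8 ->
  (forall v, - H <= v <= H -> - a <= Re (gz (sigma - x, t + v))) ->
  (forall w, sigma - x <= Re w <= sigma + 1 -> Rabs (Im w - t) = H -> Cmod (gz w) <= Bh) ->
  (forall w, sigma - x <= Re w -> Cmod (Sy N w) <= S0) ->
  Cmod (Sy N (sigma, t)) <= S1 ->
  Cmod (gz (sigma, t)) <= 2 * S1
   + exp (- (x * ln (INR N))) *
     (PI * (12 * cheb) * exp 7 + 15 * Bh * exp (7 - H * H) + 4 * PI * a + 2 * PI * S0)
   + (PI * (12 * cheb * Rpower (INR N) (- sigma)) * exp (7 + ln (INR N))
      + 15 * (Bh + S0) * exp (7 + 3 * ln (INR N) - H * H)).
Proof.
  intros HRH Hx HH HN Hs1 Hs2 Ht Ha HY HA HB HS0 HS1.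
  set (mu := ln (INR N)) in *. set (Y := exp (- (x * mu))) in *.
  assert (Hmu : 0 <= mu).
  { unfold mu. rewrite <- ln_1. apply ln_le_mono; [lra|]. change 1 with (INR 1). now apply le_INR. }
  assert (PYp : 0 < Y) by apply exp_pos.
  assert (Pch := cheb_pos). assert (PIp := PI_RGT_0). assert (PI4 := PI_4). assert (PI3 : 3 < PI) by (generalize PI2_3_2; lra).
  set (r := Rmin (sigma - x - 1 / 2) 1). assert (Hr : 0 < r) by (apply Rmin_glb_lt; lra).
  assert (r1 := Rmin_l (sigma - x - 1 / 2) 1). assert (r2 := Rmin_r (sigma - x - 1 / 2) 1). fold r in r1, r2.
  set (V := fun w => gz_dom w /\ half_plane (/ 2) w).
  assert (HV : forall w, sigma - x - r < Re w < sigma + 1 + r -> t - H - r < Im w < t + H + r -> V w).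
  { intros w W1 W2. split; [split|].
    - lra.
    - intros ->. simpl in W2. lra.
    - unfold half_plane. lra. }
  assert (Hg : holo V gz (cder gz)) by (apply (holo_sub gz_dom); [now intros w (A & B) | now apply holo_gz]).
  assert (HSy : holo V (Sy N) (cder (Sy N))) by (apply (holo_sub (half_plane (/ 2))); [now intros w (A & B) | apply holo_Sy]).
  set (g1 := fun w => (gz w + Sy N w)%C).
  assert (Hg1 := holo_plus V _ _ _ _ Hg HSy). fold g1 in Hg1.
  set (s := (sigma, t) : C).
  set (E := exp (x * x)). assert (HE : 1 <= E) by (unfold E; rewrite <- exp_0; apply exp_le; nra).
  set (e1 := PI * (12 * cheb) * exp 7 + 15 * Bh * exp (7 - H * H)).
  set (e2 := PI * (12 * cheb * Rpower (INR N) (- sigma)) * exp (7 + mu) + 15 * (Bh + S0) * exp (7 + 3 * mu - H * H)).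
  assert (Bh0 : 0 <= Bh).
  { eapply Rle_trans; [apply Cmod_ge_0 | apply (HB (sigma, t + H))]; simpl; [lra|].
    replace (t + H - t) with H by ring. apply Rabs_right; lra. }
  assert (S00 : 0 <= S0) by (eapply Rle_trans; [apply Cmod_ge_0 | apply (HS0 s)]; simpl; lra).
  assert (S10 : 0 <= S1) by (eapply Rle_trans; [apply Cmod_ge_0 | apply HS1]).
  assert (K1 : Cmod (2 * kernel_integral gz sigma t x H 0 - 2 * PI * (RtoC E * gz s)) <= e1).
  { assert (K := kernel_bound V gz (cder gz) sigma t x H r 0 Bh (12 * cheb) Hx HH Hr Hg HV HB).
    eapply Rle_trans; [apply K|].
    - intros v Hv. apply gz_right. simpl. lra.
    - unfold e1. rewrite Rabs_R0, Rplus_0_r. right. f_equal. f_equal. f_equal. ring. }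
  assert (HB1 : forall w, sigma - x <= Re w <= sigma + 1 -> Rabs (Im w - t) = H -> Cmod (g1 w) <= Bh + S0).
  { intros w W1 W2. eapply Rle_trans; [apply Cmod_triangle|]. generalize (HB w W1 W2) (HS0 w ltac:(lra)). lra. }
  assert (HR1 : forall v, - H <= v <= H -> Cmod (g1 (sigma + 1, t + v)) <= 12 * cheb * Rpower (INR N) (- sigma)).
  { intros v Hv. unfold g1. eapply Rle_trans; [apply gz_tail; auto; simpl; lra|]. simpl Re.
    right. f_equal. f_equal. ring. }
  assert (Rp := Rpower_pos (INR N) (- sigma)).
  assert (K2 : Cmod (2 * kernel_integral g1 sigma t x H mu - 2 * PI * (RtoC E * g1 s)) <= e2).
  { eapply Rle_trans; [apply (kernel_bound V g1 _ sigma t x H r mu (Bh + S0) (12 * cheb * Rpower (INR N) (- sigma)) Hx HH Hr Hg1 HV HB1 HR1)|].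
    unfold e2. rewrite Rabs_right by lra. lra. }
  assert (K3 : Cmod (2 * kernel_integral g1 sigma t x H (- mu) - 2 * PI * (RtoC E * g1 s)) <= e2).
  { eapply Rle_trans; [apply (kernel_bound V g1 _ sigma t x H r (- mu) (Bh + S0) (12 * cheb * Rpower (INR N) (- sigma)) Hx HH Hr Hg1 HV HB1 HR1)|].
    unfold e2. rewrite Rabs_Ropp, Rabs_right by lra. apply Rplus_le_compat_r.
    apply Rmult_le_compat_l; [apply Rmult_le_pos; [lra|]; apply Rmult_le_pos; lra|]. apply exp_le. lra. }
  set (I1 := kernel_integral gz sigma t x H 0) in *.
  set (I2 := kernel_integral g1 sigma t x H mu) in *.
  set (I3 := kernel_integral g1 sigma t x H (- mu)) in *.
  assert (Int1 := kernel_integrable V gz (cder gz) sigma t x H r 0 Hx HH Hr Hg HV).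
  assert (Int2 := kernel_integrable V g1 _ sigma t x H r mu Hx HH Hr Hg1 HV).
  assert (Int3 := kernel_integrable V g1 _ sigma t x H r (- mu) Hx HH Hr Hg1 HV).
  assert (IntC : cintegrable (fun v => Cconj (g1 (sigma - x, t + v)%R * cexp (RtoC (- mu) * (- x, v)%R) * RtoC (pker x v))) (- H) H).
  { destruct Int3 as (A & B). split; [exact A|]. simpl.
    apply (ex_RInt_opp (fun v => Im (g1 (sigma - x, t + v)%R * cexp (RtoC (- mu) * (- x, v)%R) * RtoC (pker x v)))). exact B. }
  (* On the left line e^{mu w} = Y e^{i mu v}, whereas the conjugate of e^{-mu w} is e^{i mu v}/Y.
     The weight Y^2 equalises the two, and g1 + conj(g1) = 2 Re g1 appears under a single
     oscillating factor of modulus Y. *)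
  set (Z := (I2 + RtoC (Y * Y) * Cconj I3)%C).
  assert (EZ : Z = CInt (fun v => RtoC (2 * Re (g1 (sigma - x, t + v)%R)) * cexp (RtoC mu * (- x, v)%R) * RtoC (pker x v))%C (- H) H).
  { unfold Z, I2, I3, kernel_integral. rewrite <- CInt_conj by exact Int3.
    rewrite <- CInt_scal by exact IntC. rewrite <- CInt_plus; [| exact Int2 | apply cintegrable_scal, IntC].
    apply CInt_ext; [lra|]. intros v Hv. set (gv := g1 (sigma - x, t + v)).
    rewrite !Cmult_conj, <- cexp_conj.
    assert (Ek : (RtoC (Y * Y) * cexp (Cconj (RtoC (- mu) * (- x, v)%R)))%C = cexp (RtoC mu * (- x, v)%R)).
    { unfold Y. rewrite <- exp_plus, <- cexp_RtoC, <- cexp_add. f_equal. apply Ceq_of; simpl; ring. }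
    replace (Cconj (RtoC (pker x v))) with (RtoC (pker x v)) by (apply Ceq_of; simpl; ring).
    replace (RtoC (2 * Re gv)) with (gv + Cconj gv)%C by (apply Ceq_of; simpl; unfold Re; ring).
    replace (RtoC (Y * Y) * (Cconj gv * cexp (Cconj (RtoC (- mu) * (- x, v)%R)) * RtoC (pker x v)))%C with
      (Cconj gv * (RtoC (Y * Y) * cexp (Cconj (RtoC (- mu) * (- x, v)%R))) * RtoC (pker x v))%C by ring.
    rewrite Ek. ring. }
  assert (Cg : forall v, - H <= v <= H -> rcont (fun v => g1 (sigma - x, t + v)) v).
  { intros v Hv. apply (rcont_comp g1 (fun v => (sigma - x, t + v))).
    - apply rcont_pair; [apply continuous_const|]. apply (continuous_plus (fun _ => t) (fun v => v)); [apply continuous_const | apply continuous_id].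
    - eapply holo_ccont; [exact Hg1|]. apply HV; simpl; lra. }
  assert (Ex1 : ex_RInt (fun v => Re (gz (sigma - x, t + v)) * pker x v) (- H) H).
  { destruct Int1 as (A & _). eapply ex_RInt_ext; [| exact A]. intros v _.
    cbv beta. rewrite re_scal_r, Cmult_0_l, cexp_0, Cmult_1_r. reflexivity. }
  assert (ReI1 : RInt (fun v => Re (gz (sigma - x, t + v)) * pker x v) (- H) H = Re I1).
  { unfold I1, kernel_integral. simpl. apply RInt_ext. intros v _.
    change (Re (gz (sigma - x, t + v)) * pker x v = Re (gz (sigma - x, t + v)%R * cexp (RtoC 0 * (- x, v)%R) * RtoC (pker x v))).
    rewrite re_scal_r. f_equal. rewrite Cmult_0_l, cexp_0, Cmult_1_r. reflexivity. }
  assert (Ex2 := ex_RInt_pker x H ltac:(lra)).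
  (* From Re g >= -a follows |Re g| <= Re g + 2a. The integral of Re g against the positive kernel
     is exactly Re I1, which the identity at mu = 0 evaluates through g(s). *)
  assert (BZ : Cmod Z <= 2 * Y * (Cmod I1 + (2 * a + S0) * PI)).
  { rewrite EZ.
    apply Rle_trans with (RInt (fun v => (2 * Y) * (Re (gz (sigma - x, t + v)) * pker x v + (2 * a + S0) * pker x v)) (- H) H).
    - apply CInt_bound; [lra | | |].
      + apply cintegrable_cont; [lra|]. intros v Hv. apply rcont_mult; [apply rcont_mult|].
        * apply rcont_RtoC. apply (continuous_scal_r 2 (fun v => Re (g1 (sigma - x, t + v)))). apply rcont_re. now apply Cg.
        * apply rcont_cexp. apply rcont_mult; [apply rcont_const | apply rcont_vert].
        * apply rcont_RtoC. apply continuous_pker; lra.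
      + apply (ex_RInt_scal (fun v => Re (gz (sigma - x, t + v)) * pker x v + (2 * a + S0) * pker x v)).
        apply (ex_RInt_plus (fun v => Re (gz (sigma - x, t + v)) * pker x v) (fun v => (2 * a + S0) * pker x v)); auto.
        apply (ex_RInt_scal (pker x)). exact Ex2.
      + intros v Hv. rewrite !Cmod_mult, Cmod_cexp, Cmod_R.
        assert (Pk := pker_pos x v ltac:(lra)). rewrite Cmod_RtoC_le by lra.
        replace (Re (RtoC mu * (- x, v)%R)) with (- (x * mu)) by (simpl; ring). fold Y.
        rewrite Rabs_mult, Rabs_right by lra.
        assert (Q1 := HA v Hv). assert (Q2 := HS0 (sigma - x, t + v) ltac:(simpl; lra)).
        assert (Q3 := re_le_Cmod (Sy N (sigma - x, t + v))).
        assert (Q4 : Rabs (Re (g1 (sigma - x, t + v))) <= Re (gz (sigma - x, t + v)) + (2 * a + S0)).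
        { unfold g1. rewrite re_plus. set (u1 := Re (gz (sigma - x, t + v))) in *. set (u2 := Re (Sy N (sigma - x, t + v))) in *.
          assert (Rabs u2 <= S0) by lra. unfold Rabs in *. destruct (Rcase_abs (u1 + u2)), (Rcase_abs u2); lra. }
        replace (2 * Y * (Re (gz (sigma - x, t + v)) * pker x v + (2 * a + S0) * pker x v)) with
          (2 * (Re (gz (sigma - x, t + v)) + (2 * a + S0)) * Y * pker x v) by ring.
        apply Rmult_le_compat_r; [lra|]. apply Rmult_le_compat_r; lra.
    - rewrite (RInt_scal (V := R_CompleteNormedModule) (fun v => Re (gz (sigma - x, t + v)) * pker x v + (2 * a + S0) * pker x v)).
      2: { apply (ex_RInt_plus (fun v => Re (gz (sigma - x, t + v)) * pker x v) (fun v => (2 * a + S0) * pker x v)); auto.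
           apply (ex_RInt_scal (pker x)). exact Ex2. }
      unfold scal; simpl; unfold mult; simpl. apply Rmult_le_compat_l; [lra|].
      rewrite (RInt_plus (V := R_CompleteNormedModule) (fun v => Re (gz (sigma - x, t + v)) * pker x v) (fun v => (2 * a + S0) * pker x v)); auto.
      2: { apply (ex_RInt_scal (pker x)). exact Ex2. }
      rewrite (RInt_scal (V := R_CompleteNormedModule) (pker x)) by exact Ex2.
      rewrite ReI1. change (Re I1 + (2 * a + S0) * RInt (pker x) (- H) H <= Cmod I1 + (2 * a + S0) * PI). apply Rplus_le_compat.
      + eapply Rle_trans; [apply Rle_abs | apply re_le_Cmod].
      + apply Rmult_le_compat_l; [lra|]. apply RInt_pker_le; lra. }
  assert (BI1 : 2 * Cmod I1 <= 2 * PI * E * Cmod (gz s) + e1).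
  { generalize (Cmod_sub_le (2 * I1) (2 * PI * (RtoC E * gz s))). rewrite !Cmod_mult, !Cmod_RtoC_le by lra. lra. }
  assert (Low : 2 * PI * E * ((1 - Y * Y) * Cmod (g1 s)) <= 2 * Cmod Z + e2 + Y * Y * e2).
  { assert (L1 : (1 - Y * Y) * Cmod (g1 s) <= Cmod (g1 s + RtoC (Y * Y) * Cconj (g1 s))).
    { generalize (Cmod_sub_le (g1 s) (g1 s + RtoC (Y * Y) * Cconj (g1 s))).
      replace (g1 s - (g1 s + (Y * Y)%R * Cconj (g1 s)))%C with (- (RtoC (Y * Y) * Cconj (g1 s)))%C by ring.
      rewrite Cmod_opp, Cmod_mult, Cmod_conj, Cmod_RtoC_le by nra. lra. }
    assert (L2 : Cmod (2 * PI * RtoC E * (g1 s + RtoC (Y * Y) * Cconj (g1 s))) <= 2 * Cmod Z + e2 + Y * Y * e2).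
    { replace (2 * PI * RtoC E * (g1 s + RtoC (Y * Y) * Cconj (g1 s)))%C with
        (2 * Z - (2 * I2 - 2 * PI * (RtoC E * g1 s)) - RtoC (Y * Y) * Cconj (2 * I3 - 2 * PI * (RtoC E * g1 s)))%C.
      - eapply Rle_trans; [apply Cmod_minus_le|]. rewrite (Cmod_mult (RtoC (Y * Y))), Cmod_conj, Cmod_RtoC_le by nra.
        apply Rplus_le_compat; [| apply Rmult_le_compat_l; [nra | exact K3]].
        eapply Rle_trans; [apply Cmod_minus_le|]. rewrite Cmod_mult, Cmod_RtoC_le by lra. lra.
      - unfold Z. rewrite Cminus_conj, !Cmult_conj.
        replace (Cconj 2) with (RtoC 2) by (apply Ceq_of; simpl; ring).
        replace (Cconj PI) with (RtoC PI) by (apply Ceq_of; simpl; ring).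
        replace (Cconj (RtoC E)) with (RtoC E) by (apply Ceq_of; simpl; ring). ring. }
    rewrite !Cmod_mult, !Cmod_RtoC_le in L2 by lra.
    eapply Rle_trans; [| exact L2]. apply Rmult_le_compat_l; [nra | exact L1]. }
  assert (e2p : 0 <= e2).
  { eapply Rle_trans; [apply Cmod_ge_0 | exact K2]. }
  assert (e1p : 0 <= e1).
  { eapply Rle_trans; [apply Cmod_ge_0 | exact K1]. }
  assert (Gg : Cmod (gz s) <= Cmod (g1 s) + S1).
  { replace (gz s) with (g1 s - Sy N s)%C by (unfold g1; ring).
    eapply Rle_trans; [apply Cmod_minus_le|]. unfold s at 2. lra. }
  set (G1 := Cmod (g1 s)) in *. assert (G10 : 0 <= G1) by apply Cmod_ge_0.
  assert (YY : Y * Y <= / 64) by nra.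
  assert (PE : 3 <= PI * E) by nra.
  set (P := PI * E) in *.
  assert (F1 : 2 * (P * ((1 - Y * Y) * G1)) <= 4 * Y * (Cmod I1 + (2 * a + S0) * PI) + e2 + Y * Y * e2).
  { unfold P. lra. }
  assert (F2 : 4 * Y * Cmod I1 <= 2 * Y * (2 * P * (G1 + S1) + e1)).
  { replace (4 * Y * Cmod I1) with (2 * Y * (2 * Cmod I1)) by ring. apply Rmult_le_compat_l; [lra|].
    eapply Rle_trans; [exact BI1|]. unfold P. apply Rplus_le_compat_r.
    replace (2 * PI * E * Cmod (gz s)) with (2 * (PI * E) * Cmod (gz s)) by ring. apply Rmult_le_compat_l; [unfold P in PE; lra | lra]. }
  (* The self-bound closes here: as Y <= 1/8, the occurrences of [G1] on the right have total weight
     below its weight on the left and can be absorbed. *)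
  assert (F3 : 4 * Y * (P * G1) <= / 2 * (P * G1)) by (apply Rmult_le_compat_r; [nra | lra]).
  assert (F4 : 4 * Y * (P * S1) <= / 2 * (P * S1)) by (apply Rmult_le_compat_r; [nra | lra]).
  assert (F5 : Y * Y * e2 <= / 64 * e2) by (apply Rmult_le_compat_r; lra).
  assert (F6 : Y * Y * (P * G1) <= / 64 * (P * G1)) by (apply Rmult_le_compat_r; [nra | lra]).
  set (W := Y * (e1 + 4 * PI * a + 2 * PI * S0)).
  assert (W0 : 0 <= W).
  { apply Rmult_le_pos; [lra|]. assert (0 <= PI * a) by nra. assert (0 <= PI * S0) by nra. lra. }
  assert (F7 : 2 * (P * G1) - 2 * (Y * Y * (P * G1)) <= 4 * Y * (P * G1) + 4 * Y * (P * S1) + 2 * W + e2 + Y * Y * e2).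
  { unfold W. lra. }
  assert (PG0 : 0 <= P * G1) by (apply Rmult_le_pos; lra).
  assert (F8 : 7 / 5 * (P * G1) <= / 2 * (P * S1) + 2 * W + 2 * e2) by lra.
  assert (F9 : P * G1 <= P * (S1 + W + e2)).
  { assert (3 * W <= P * W) by (apply Rmult_le_compat_r; lra).
    assert (3 * e2 <= P * e2) by (apply Rmult_le_compat_r; lra).
    assert (0 <= P * S1) by nra. lra. }
  assert (F10 : G1 <= S1 + W + e2) by (apply (Rmult_le_reg_l P); lra).
  lra.
Qed.

Lemma exp_ge_1_plus x : 1 + x <= exp x.
Proof. destruct (Req_dec x 0) as [->|N]; [rewrite exp_0; lra | left; now apply exp_ineq1]. Qed.

Lemma exp_pow2_ge x : 0 <= x -> (1 + x) * (1 + x) <= exp (2 * x).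
Proof.
  intros Hx. replace (2 * x) with (x + x) by ring. rewrite exp_plus.
  generalize (exp_ge_1_plus x). intros. apply Rmult_le_compat; lra.
Qed.

Lemma nat_above x : 0 <= x -> exists N : nat, x <= INR N <= x + 1.
Proof.
  intros Hx. destruct (nfloor_ex x Hx) as (n & A & B). exists (S n). rewrite S_INR. lra.
Qed.

Lemma gz_asymp e : RH -> 0 < e < 1 / 2 -> exists C l0, 0 < C /\ 10 <= l0 /\ forall l sigma t, l0 <= l ->
  exp (exp l) / 2 <= t <= 3 * exp (exp l) -> 1 / 2 + 4 / l <= sigma <= 2 ->
  Cmod (gz (sigma, t)) <= C * (exp ((2 - 2 * sigma) * l) + exp (2 * e * l)).
Proof.
  intros HRH He. destruct (gz_local HRH) as (A & PA & HA). assert (Pch := cheb_pos).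
  assert (PIp := PI_RGT_0).
  set (C1 := 12 * cheb / e). assert (PC1 : 0 < C1) by (apply Rdiv_lt_0_compat; lra).
  set (C2 := PI * (12 * cheb) * exp 7 + 15 * (4 * A + 12 * cheb) * exp 7 + 8 * PI * A + 48 * PI * cheb).
  set (C3 := PI * (12 * cheb) * exp 8 + 15 * (4 * A + 36 * cheb)).
  assert (P7 := exp_pos 7). assert (P8 := exp_pos 8). assert (P2 := exp_pos 2).
  assert (pc : 0 < PI * cheb) by nra. assert (pA : 0 < PI * A) by nra.
  assert (PC2 : 0 < C2) by (unfold C2; nra). assert (PC3 : 0 < C3) by (unfold C3; nra).
  exists (2 * C1 + exp 2 * C2 + C3), 10.
  assert (PC : 0 < exp 2 * C2) by nra.
  split; [lra|]. split; [lra|]. intros l sigma t Hl Ht Hs.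
  set (L := exp l) in *. assert (L1 : 1 + l <= L) by apply exp_ge_1_plus.
  assert (LL : L * L = exp (2 * l)) by (unfold L; rewrite <- exp_plus; f_equal; ring).
  assert (LL2 : (1 + l) * (1 + l) <= L * L) by (rewrite LL; apply exp_pow2_ge; lra).
  assert (TL : (1 + L / 2) * (1 + L / 2) <= exp L).
  { replace L with (2 * (L / 2)) at 3 by field. apply exp_pow2_ge. lra. }
  destruct (nat_above (L * L) ltac:(nra)) as (N & N1 & N2).
  assert (HN : (1 <= N)%nat) by (apply INR_le; simpl; nra).
  set (mu := ln (INR N)).
  assert (INp : 0 < INR N) by nra.
  assert (mu1 : 2 * l <= mu).
  { unfold mu. rewrite <- (ln_exp (2 * l)). apply ln_le_mono; [apply exp_pos | lra]. }
  assert (mu2 : mu <= 2 * l + 1).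
  { unfold mu. rewrite <- (ln_exp (2 * l + 1)). apply ln_le_mono; [lra|]. rewrite exp_plus, <- LL.
    generalize (exp_ge_1_plus 1). nra. }
  assert (il : 0 < / l <= / 10) by (split; [apply Rinv_0_lt_compat | apply Rinv_le_contravar]; lra).
  assert (ill : / l * l = 1) by (field; lra).
  (* At distance 1/l from the critical line the modulus bound of [gz_local] is still only 2 A L (1 +
     l). The hypothesis on sigma gives x >= 3/l, hence y^{-x} <= e^{-6} <= 1/8. *)
  set (x := sigma - 1 / 2 - / l).
  assert (x1 : 3 * / l <= x) by (unfold x, Rdiv in *; lra).
  assert (x2 : x <= 3 / 2) by (unfold x; lra).
  set (M1 := exp ((2 - 2 * sigma) * l)). set (M2 := exp (2 * e * l)).
  assert (PM1 : 0 < M1) by apply exp_pos.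
  assert (PM2 : 1 <= M2) by (unfold M2; generalize (exp_ge_1_plus (2 * e * l)); nra).
  assert (Yb : exp (- (x * mu)) <= exp 2 * exp ((1 - 2 * sigma) * l)).
  { rewrite <- exp_plus. apply exp_le. unfold x. nra. }
  assert (Hxm : exp (- (x * mu)) <= / 8).
  { rewrite exp_Ropp. apply Rinv_le_contravar; [lra|].
    apply Rle_trans with (exp (2 * 3)); [| apply exp_le; nra].
    eapply Rle_trans; [| apply exp_pow2_ge; lra]. lra. }
  assert (Bht : forall v, - L <= v <= L -> 3 <= t + v /\ 0 < ln (t + v) <= 2 * L).
  { intros v Hv. assert (3 <= t + v) by nra. split; [auto|]. split.
    - rewrite <- ln_1. apply ln_increasing; lra.
    - rewrite <- (ln_exp (2 * L)). apply ln_le_mono; [lra|].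
      replace (2 * L) with (L + L) by ring. rewrite exp_plus. nra. }
  set (Bh := 2 * A * L * (1 + l) + 12 * cheb).
  set (S0 := 8 * cheb * (3 * L)).
  assert (LM : 1 <= L) by lra.
  assert (Bh1 : Bh <= (4 * A + 12 * cheb) * exp (2 * l)).
  { rewrite <- LL. unfold Bh.
    assert (2 * A * L * (1 + l) <= 4 * A * (L * L)).
    { replace (4 * A * (L * L)) with (2 * A * L * (2 * L)) by ring. apply Rmult_le_compat_l; [nra | lra]. }
    assert (12 * cheb * 1 <= 12 * cheb * (L * L)) by (apply Rmult_le_compat_l; nra). lra. }
  assert (S01 : S0 <= 24 * cheb * exp (2 * l)).
  { rewrite <- LL. unfold S0. replace (8 * cheb * (3 * L)) with (24 * cheb * (L * 1)) by ring.
    apply Rmult_le_compat_l; [lra|]. apply Rmult_le_compat_l; lra. }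
  assert (e13 : exp 1 <= 3) by apply exp_le_3.
  assert (SB := gz_selfbound sigma t x L N (2 * A * L) Bh S0 (C1 * (M1 + M2)) HRH).
  eapply Rle_trans; [apply SB; clear SB; auto|].
  - lra.
  - unfold x. lra.
  - lra.
  - nra.
  - nra.
  - intros v Hv. destruct (Bht v Hv) as (h1 & h2 & h3).
    destruct (HA (sigma - x) (t + v) h1) as (h4 & _); [unfold x; lra|]. nra.
  - intros w Hw Hw2. assert (Hv : - L <= Im w - t <= L) by (apply Rabs_le_between; lra).
    destruct (Bht _ Hv) as (h1 & h2 & h3). replace (t + (Im w - t)) with (Im w) in * by ring.
    destruct (Rle_dec (Re w) 2) as [W|W].
    + destruct (HA (Re w) (Im w) h1) as (_ & h4); [unfold x in Hw; lra|].
      replace (Re w, Im w) with w in h4 by (apply surjective_pairing).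
      eapply Rle_trans; [exact h4|]. unfold Bh. apply Rle_trans with (2 * A * L * (1 + l)); [|lra].
      apply Rmult_le_compat; [nra | | nra |].
      * assert (0 < / (Re w - 1 / 2)) by (apply Rinv_0_lt_compat; unfold x in Hw; lra). lra.
      * apply Rplus_le_compat_l. rewrite <- (Rinv_inv l). apply Rinv_le_contravar; [lra | unfold x in Hw; lra].
    + eapply Rle_trans; [apply gz_right; lra|]. unfold Bh. assert (0 <= 2 * A * L * (1 + l)) by (apply Rmult_le_pos; nra). lra.
  - intros w Hw. eapply Rle_trans; [apply (Sy_bound N w (/ 2) HN); [lra | unfold x in Hw; lra]|].
    unfold S0. replace (4 * cheb / (1 - / 2)) with (8 * cheb) by field.
    apply Rmult_le_compat_l; [lra|]. unfold Rpower. fold mu.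
    apply Rle_trans with (exp (1 + l)); [apply exp_le; lra|]. rewrite exp_plus. fold L. nra.
  - set (a0 := Rmin sigma (1 - e)).
    assert (m1 := Rmin_l sigma (1 - e)). assert (m2 := Rmin_r sigma (1 - e)). fold a0 in m1, m2.
    assert (m3 : / 2 <= a0) by (apply Rmin_glb; unfold Rdiv in *; lra).
    eapply Rle_trans; [apply (Sy_bound N (sigma, t) a0 HN); simpl; lra|].
    assert (Q1 : 4 * cheb / (1 - a0) <= 4 * cheb / e).
    { apply Rmult_le_compat_l; [lra|]. apply Rinv_le_contravar; lra. }
    assert (Q2 : Rpower (INR N) (1 - a0) <= 3 * (M1 + M2)).
    { unfold Rpower. fold mu. apply Rle_trans with (exp (1 + (2 - 2 * a0) * l)).
      - apply exp_le. nra.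
      - rewrite exp_plus. apply Rmult_le_compat; try (left; apply exp_pos); auto.
        unfold a0, Rmin. destruct (Rle_dec sigma (1 - e)) as [c|c].
        + fold M1. lra.
        + replace ((2 - 2 * (1 - e)) * l) with (2 * e * l) by ring. fold M2. lra. }
    apply Rle_trans with (4 * cheb / e * (3 * (M1 + M2))).
    + apply Rmult_le_compat; auto; [left; apply Rdiv_lt_0_compat; lra | left; apply Rpower_pos].
    + unfold C1. right. field. lra.
  - fold mu. rewrite LL.
    assert (EL : 9 * l + 10 <= exp (2 * l)) by (rewrite <- LL; nra).
    assert (T2 : PI * (12 * cheb) * exp 7 + 15 * Bh * exp (7 - exp (2 * l)) + 4 * PI * (2 * A * L) + 2 * PI * S0 <= C2 * L).
    { assert (15 * Bh * exp (7 - exp (2 * l)) <= 15 * (4 * A + 12 * cheb) * exp 7 * 1).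
      { apply Rle_trans with (15 * ((4 * A + 12 * cheb) * exp (2 * l)) * exp (7 - exp (2 * l))).
        - apply Rmult_le_compat_r; [left; apply exp_pos|]. lra.
        - replace (7 - exp (2 * l)) with (7 + - exp (2 * l)) by ring. rewrite exp_plus.
          replace (15 * ((4 * A + 12 * cheb) * exp (2 * l)) * (exp 7 * exp (- exp (2 * l)))) with
            (15 * (4 * A + 12 * cheb) * exp 7 * (exp (2 * l) * exp (- exp (2 * l)))) by ring.
          apply Rmult_le_compat_l; [nra|]. rewrite <- exp_plus. apply Rle_trans with (exp 0); [apply exp_le; lra | rewrite exp_0; lra]. }
      assert (PI * (12 * cheb) * exp 7 * 1 <= PI * (12 * cheb) * exp 7 * L) by (apply Rmult_le_compat_l; nra).
      assert (15 * (4 * A + 12 * cheb) * exp 7 * 1 <= 15 * (4 * A + 12 * cheb) * exp 7 * L) by (apply Rmult_le_compat_l; nra).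
      unfold C2, S0. lra. }
    assert (T3 : exp (- (x * mu)) * (PI * (12 * cheb) * exp 7 + 15 * Bh * exp (7 - exp (2 * l)) + 4 * PI * (2 * A * L) + 2 * PI * S0) <= exp 2 * C2 * M1).
    { apply Rle_trans with ((exp 2 * exp ((1 - 2 * sigma) * l)) * (C2 * L)).
      - assert (0 < Bh) by (unfold Bh; assert (0 <= 2 * A * L * (1 + l)) by (apply Rmult_le_pos; nra); lra).
        apply Rmult_le_compat; auto; [left; apply exp_pos|].
        assert (E7 := exp_pos (7 - exp (2 * l))).
        assert (0 < PI * (12 * cheb) * exp 7) by (apply Rmult_lt_0_compat; nra).
        assert (0 < 15 * Bh * exp (7 - exp (2 * l))) by (apply Rmult_lt_0_compat; nra).
        assert (0 <= 4 * PI * (2 * A * L)) by (apply Rmult_le_pos; nra).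
        assert (0 <= 2 * PI * S0) by (apply Rmult_le_pos; unfold S0; nra). lra.
      - unfold M1. replace ((2 - 2 * sigma) * l) with ((1 - 2 * sigma) * l + l) by ring.
        rewrite exp_plus. fold L. right. ring. }
    assert (T4 : PI * (12 * cheb * Rpower (INR N) (- sigma)) * exp (7 + mu) <= PI * (12 * cheb) * exp 8 * (M1 + M2)).
    { replace (PI * (12 * cheb * Rpower (INR N) (- sigma)) * exp (7 + mu)) with
       (PI * (12 * cheb) * (Rpower (INR N) (- sigma) * exp (7 + mu))) by ring.
      rewrite (Rmult_assoc _ (exp 8)). apply Rmult_le_compat_l; [nra|].
      unfold Rpower. fold mu. rewrite <- exp_plus. destruct (Rle_dec sigma 1) as [c|c].
      - apply Rle_trans with (exp (8 + (2 - 2 * sigma) * l)); [apply exp_le; nra|]. rewrite exp_plus. fold M1. nra.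
      - apply Rle_trans with (exp 8); [apply exp_le; nra|]. nra. }
    assert (T5 : 15 * (Bh + S0) * exp (7 + 3 * mu - exp (2 * l)) <= 15 * (4 * A + 36 * cheb) * (M1 + M2)).
    { apply Rle_trans with (15 * ((4 * A + 36 * cheb) * exp (2 * l)) * exp (7 + 3 * mu - exp (2 * l))).
      - apply Rmult_le_compat_r; [left; apply exp_pos | lra].
      - replace (15 * ((4 * A + 36 * cheb) * exp (2 * l)) * exp (7 + 3 * mu - exp (2 * l))) with
          (15 * (4 * A + 36 * cheb) * (exp (2 * l) * exp (7 + 3 * mu - exp (2 * l)))) by ring.
        apply Rmult_le_compat_l; [lra|]. rewrite <- exp_plus. apply Rle_trans with (exp 0); [apply exp_le; lra | rewrite exp_0; lra]. }
    assert (T6 : exp 2 * C2 * M1 <= exp 2 * C2 * (M1 + M2)) by (apply Rmult_le_compat_l; lra).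
    assert (T7 : PI * (12 * cheb) * exp 8 * (M1 + M2) + 15 * (4 * A + 36 * cheb) * (M1 + M2) = C3 * (M1 + M2)) by (unfold C3; ring).
    lra.
Qed.

(** * The logarithm of zeta *)

Definition quadrant (a : R) (s : C) : Prop := a < Re s /\ 1 < Im s.

Definition c22 : C := (2, 2).

Lemma quadrant_open a : copen (quadrant a).
Proof.
  intros z (H1 & H2). exists (Rmin (Re z - a) (Im z - 1)). split; [apply Rmin_glb_lt; lra|]. intros w Hw.
  assert (m1 := Rmin_l (Re z - a) (Im z - 1)). assert (m2 := Rmin_r (Re z - a) (Im z - 1)).
  assert (R1 := re_le_Cmod (w - z)). assert (I1 := Im_le_Cmod (w - z)).
  rewrite Re_minus in R1. rewrite Im_minus in I1.
  apply Rabs_le_between in R1. apply Rabs_le_between in I1. split; lra.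
Qed.

Lemma quadrant_star a z u : a < 2 -> quadrant a z -> 0 <= u <= 1 -> quadrant a (c22 + RtoC u * (z - c22))%C.
Proof.
  intros Ha (H1 & H2) Hu. unfold quadrant, Re, Im in *. simpl. destruct (Rle_dec u (/ 2)); split; nra.
Qed.

(* [log zeta(s)] for [Re s > 1/2], [Im s > 1] under RH: the primitive of
   [zeta'/zeta] along the segment from [2 + 2i]. *)
Definition LZ (s : C) : C :=
  (LF c22 + (s - c22) * CInt (fun u => gz (c22 + RtoC u * (s - c22))) 0 1)%C.

Lemma holo_LZ : RH -> holo (quadrant (1 / 2)) LZ gz.
Proof.
  intros HRH.
  assert (Hg : holo (quadrant (1 / 2)) gz (cder gz)).
  { apply (holo_sub gz_dom); [| now apply holo_gz]. intros z (A & B). split; auto. intros ->. simpl in B. lra. }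
  assert (P := primitive_star _ gz _ c22 (quadrant_open (1 / 2)) ltac:(split; simpl; lra)
    (fun z u Hz => quadrant_star (1 / 2) z u ltac:(lra) Hz) Hg).
  intros z Hz. destruct (P z Hz) as (A & B). split; auto. unfold LZ.
  eapply cderiv_eq; [| apply cderiv_plus; [apply cderiv_const | exact A]]. ring.
Qed.

Lemma LZ_c22 : LZ c22 = LF c22.
Proof. unfold LZ. ring. Qed.

(** Both are primitives of [gz] on a region star-shaped about [c22], and they agree there. *)
Lemma LZ_LF s : RH -> 1 < Re s -> 1 < Im s -> LZ s = LF s.
Proof.
  intros HRH H1 H2. destruct holo_LF as (HL & _).
  assert (H : holo (quadrant 1) (fun s => LZ s + - (1) * LF s)%C (fun s => gz s + - (1) * cder LF s)%C).
  { apply holo_plus.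
    - apply (holo_sub (quadrant (1 / 2))); [| now apply holo_LZ]. intros z (A & B); split; lra.
    - apply holo_scal. apply (holo_sub (half_plane 1)); [| exact HL]. now intros z (A & B). }
  assert (E := holo_const_star (quadrant 1) _ _ c22 s H (fun z u Hz => quadrant_star 1 z u ltac:(lra) Hz)).
  cbv beta in E. rewrite LZ_c22 in E.
  replace (LZ s) with ((LZ s + - (1) * LF s) + LF s)%C by ring. rewrite E; [ring | | split; auto].
  intros w (Hw & _). rewrite gz_LF by auto. ring.
Qed.

Lemma cexp_LZ s : RH -> 1 / 2 < Re s -> 1 < Im s -> cexp (LZ s) = zeta s.
Proof.
  intros HRH H1 H2.
  assert (HZ : holo (quadrant (1 / 2)) zeta (cder zeta)).
  { apply (holo_sub zeta_dom); [| apply holo_zeta]. intros z (A & B). split; [lra|]. intros ->. simpl in B. lra. }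
  assert (H := holo_mult _ _ _ _ _ HZ (holo_cexp _ _ _ (holo_scal _ (- (1))%C _ _ (holo_LZ HRH)))).
  assert (E := holo_const_star (quadrant (1 / 2)) _ _ c22 s H (fun z u Hz => quadrant_star (1 / 2) z u ltac:(lra) Hz)).
  cbv beta in E. rewrite LZ_c22, (zeta_exp_LF c22) in E by (simpl; lra).
  rewrite <- !cexp_add in E. replace (LF c22 + - (1) * LF c22)%C with (RtoC 0) in E by ring. rewrite cexp_0 in E.
  replace (zeta s) with (cexp (LZ s) * (zeta s * cexp (- (1) * LZ s)))%C.
  - rewrite E; [ring | | split; auto]. intros w (A & B). unfold gz.
    assert (zeta w <> 0) by (apply zeta_nz; auto; intros ->; simpl in B; lra). field. auto.
  - replace (cexp (LZ s) * (zeta s * cexp (- (1) * LZ s)))%C with (zeta s * (cexp (LZ s) * cexp (- (1) * LZ s)))%C by ring.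
    rewrite <- cexp_add. replace (LZ s + - (1) * LZ s)%C with (RtoC 0) by ring. rewrite cexp_0. ring.
Qed.

Lemma rcont_LZ sigma t : RH -> 1 / 2 < sigma -> 1 < t -> rcont (fun t => LZ (sigma, t)) t.
Proof.
  intros HRH Hs Ht. apply (rcont_comp LZ (fun t => (sigma, t))); [apply rcont_vert|].
  eapply holo_ccont; [now apply holo_LZ | split; auto].
Qed.

Lemma continuous_of_rcont (f : R -> C) t : rcont f t -> continuous f t.
Proof.
  intros H. apply filterlim_locally. intros e. destruct (H e (cond_pos e)) as (d & Hd & Hf).
  exists (mkposreal d Hd). intros u Hu. specialize (Hf u Hu).
  assert (A := re_le_Cmod (f u - f t)). assert (B := Im_le_Cmod (f u - f t)).
  rewrite Re_minus in A. rewrite Im_minus in B. split; unfold ball; simpl; unfold AbsRing_ball, abs, minus, plus, opp; simpl.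
  - change (Rabs (Re (f u) - Re (f t)) < e). lra.
  - change (Rabs (Im (f u) - Im (f t)) < e). lra.
Qed.

Lemma continuous_im (f : R -> C) t : continuous f t -> continuous (fun u => Im (f u)) t.
Proof.
  intros H. apply (continuous_comp f (fun z : C => Im z)); auto. apply (continuous_snd (U := R_UniformSpace) (V := R_UniformSpace)).
Qed.

Lemma cos_1_lt x : 0 < x <= 1 -> cos x < 1.
Proof.
  intros Hx. rewrite <- cos_0. assert (P := PI2_3_2). apply cos_decreasing_1; lra.
Qed.

(** Two branches differ by a multiple of 2 PI i. The modulus k of the imaginary difference is
    continuous, below 1 far to the right, and never equal to 1 because cos k = 1 while cos 1 < 1. So
    k < 1 at sigma, and cos k = 1 then forces k = 0. *)
Lemma log_zeta_branch_unique t sigma L1 L2 :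
  log_zeta_branch t sigma L1 -> log_zeta_branch t sigma L2 -> L1 sigma = L2 sigma.
Proof.
  intros (A1 & B1 & D1) (A2 & B2 & D2).
  assert (E : forall u, sigma <= u -> cexp (L1 u - L2 u) = 1).
  { intros u Hu. rewrite cexp_minus, A1, <- A2 by auto. unfold Cdiv. apply Cinv_r, cexp_neq_0. }
  assert (Er : forall u, sigma <= u -> Re (L1 u) - Re (L2 u) = 0 /\ cos (Rabs (Im (L1 u) - Im (L2 u))) = 1).
  { intros u Hu. specialize (E u Hu). assert (M := Cmod_cexp (L1 u - L2 u)). rewrite E, Cmod_1, Re_minus in M.
    assert (Z : Re (L1 u) - Re (L2 u) = 0) by (apply exp_inv; rewrite exp_0; auto). split; auto.
    apply (f_equal Re) in E. unfold cexp in E. rewrite Re_minus, Z, Im_minus, exp_0 in E. simpl in E.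
    unfold Rabs. destruct (Rcase_abs _); [rewrite cos_neg|]; lra. }
  (* Extended by a constant to the left of sigma: the intermediate value theorem is applied to a
     function continuous on the whole line. *)
  set (k := fun u => Rabs (Im (L1 (Rmax sigma u)) - Im (L2 (Rmax sigma u)))).
  assert (Ck : Ranalysis1.continuity k).
  { intros u. apply continuity_pt_filterlim. unfold k.
    apply (continuous_comp (fun u => Rmax sigma u) (fun v => Rabs (Im (L1 v) - Im (L2 v)))).
    - apply continuity_pt_filterlim. apply (continuity_pt_ext (fun u => (sigma + u + Rabs (sigma - u)) / 2)).
      + intros v. unfold Rmax, Rabs. destruct (Rle_dec sigma v), (Rcase_abs (sigma - v)); lra.
      + apply continuity_pt_filterlim. apply (continuous_scal_l (fun u => sigma + u + Rabs (sigma - u)) (/ 2)).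
        apply (continuous_plus (fun u => sigma + u) (fun u => Rabs (sigma - u))).
        * apply (continuous_plus (fun _ => sigma) (fun u => u)); [apply continuous_const | apply continuous_id].
        * apply (continuous_comp (fun u => sigma - u) Rabs); [| apply continuous_Rabs].
          apply (continuous_minus (fun _ => sigma) (fun u => u)); [apply continuous_const | apply continuous_id].
    - assert (M := Rmax_l sigma u). apply (continuous_comp (fun v => Im (L1 v) - Im (L2 v)) Rabs); [| apply continuous_Rabs].
      apply (continuous_minus (fun v => Im (L1 v)) (fun v => Im (L2 v))); apply continuous_im; auto. }
  assert (C1 : forall u, k u <> 1).
  { intros u Hu. destruct (Er (Rmax sigma u) (Rmax_l _ _)) as (_ & H). fold (k u) in H. rewrite Hu in H.
    generalize (cos_1_lt 1). lra. }
  assert (Far : exists u, sigma <= u /\ k u < 1).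
  { assert (F1 := proj1 (filterlim_locally _ _) D1 (mkposreal (/ 2) ltac:(lra))).
    assert (F2 := proj1 (filterlim_locally _ _) D2 (mkposreal (/ 2) ltac:(lra))).
    destruct F1 as (M1 & F1), F2 as (M2 & F2).
    set (u := Rmax sigma (Rmax (M1 + 1) (M2 + 1))).
    assert (u1 := Rmax_l sigma (Rmax (M1 + 1) (M2 + 1))). assert (u2 := Rmax_r sigma (Rmax (M1 + 1) (M2 + 1))).
    assert (u3 := Rmax_l (M1 + 1) (M2 + 1)). assert (u4 := Rmax_r (M1 + 1) (M2 + 1)). fold u in u1, u2.
    exists u. split; auto. unfold k. rewrite Rmax_right by auto.
    destruct (F1 u ltac:(lra)) as (_ & G1), (F2 u ltac:(lra)) as (_ & G2).
    change (Rabs (Im (L1 u) - 0) < / 2) in G1. change (Rabs (Im (L2 u) - 0) < / 2) in G2.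
    apply Rabs_def2 in G1. apply Rabs_def2 in G2. apply Rabs_def1; lra. }
  destruct Far as (u & Hu & Hk).
  assert (Ks : k sigma < 1).
  { apply Rnot_le_lt. intros Hc. destruct (IVT_gen k sigma u 1 Ck) as (v & _ & Hv).
    - rewrite Rmin_right, Rmax_left; lra.
    - exact (C1 v Hv). }
  destruct (Er sigma (Rle_refl _)) as (Hr & Hc). unfold k in Ks. rewrite Rmax_left in Ks by lra.
  apply Ceq_of; [lra|]. destruct (Req_dec (Im (L1 sigma) - Im (L2 sigma)) 0) as [z|z]; [lra|].
  generalize (Rabs_pos_lt _ z) (cos_1_lt (Rabs (Im (L1 sigma) - Im (L2 sigma)))). lra.
Qed.

Lemma log_zeta_branch_LZ sigma t : RH -> 1 / 2 < sigma -> 1 < t ->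
  log_zeta_branch t sigma (fun u => LZ (u, t)).
Proof.
  intros HRH Hs Ht. split; [|split].
  - intros u Hu. apply cexp_LZ; simpl; auto; lra.
  - intros u Hu. apply continuous_of_rcont. apply (rcont_comp LZ (fun u => (u, t))); [apply rcont_horiz|].
    eapply holo_ccont; [now apply holo_LZ | split; simpl; lra].
  - apply filterlim_locally. intros e.
    (* Beyond M one has 2^{2-u} < e/9, so the decay bound 8 * 2^{2-u} is below e. *)
    set (M := Rmax 2 (2 - ln (e / 9) / ln 2)). assert (M1 := Rmax_l 2 (2 - ln (e / 9) / ln 2)).
    assert (M2 := Rmax_r 2 (2 - ln (e / 9) / ln 2)). fold M in M1, M2.
    exists M. intros u Hu. assert (Pe := cond_pos e).
    assert (B : Cmod (LZ (u, t)) < e).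
    { rewrite LZ_LF by (simpl; auto; lra). eapply Rle_lt_trans; [apply LF_decay; simpl; lra|]. simpl Re.
      assert (l2 : 0 < ln 2) by (rewrite <- ln_1; apply ln_increasing; lra).
      assert (Rpower 2 (2 - u) < e / 9); [|lra].
      unfold Rpower. rewrite <- (exp_ln (e / 9)) by lra. apply exp_increasing.
      apply (Rmult_lt_reg_r (/ ln 2)); [now apply Rinv_0_lt_compat|]. unfold Rdiv in M2.
      rewrite Rmult_assoc, Rinv_r by lra. lra. }
    assert (A := re_le_Cmod (LZ (u, t))). assert (A' := Im_le_Cmod (LZ (u, t))). split.
    + change (Rabs (Re (LZ (u, t)) - 0) < e). rewrite Rminus_0_r. lra.
    + change (Rabs (Im (LZ (u, t)) - 0) < e). rewrite Rminus_0_r. lra.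
Qed.

(** The value chosen by [epsilon] comes from some branch; existence makes the choice meaningful and
    uniqueness makes it the explicit primitive. *)
Lemma log_zeta_LZ sigma t : RH -> 1 / 2 < sigma -> 1 < t -> log_zeta (sigma, t) = LZ (sigma, t).
Proof.
  intros HRH Hs Ht. unfold log_zeta. assert (B := log_zeta_branch_LZ sigma t HRH Hs Ht).
  assert (S := epsilon_spec (inhabits (RtoC 0))
    (fun l => exists L, log_zeta_branch (Im (sigma, t)) (Re (sigma, t)) L /\ L (Re (sigma, t)) = l)
    (ex_intro _ (LZ (sigma, t)) (ex_intro _ (fun u => LZ (u, t)) (conj B eq_refl)))).
  destruct S as (L & HL & E). rewrite <- E. simpl in HL |- *. apply (log_zeta_branch_unique t sigma L _ HL B).
Qed.

Lemma is_RInt_exp_decay c l u v : l <> 0 ->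
  is_RInt (fun x => exp ((c - 2 * x) * l)) u v ((exp ((c - 2 * u) * l) - exp ((c - 2 * v) * l)) / (2 * l)).
Proof.
  intros Hl. replace ((exp ((c - 2 * u) * l) - exp ((c - 2 * v) * l)) / (2 * l)) with
    (minus (- exp ((c - 2 * v) * l) / (2 * l)) (- exp ((c - 2 * u) * l) / (2 * l)))
    by (unfold minus, plus, opp; simpl; field; auto).
  apply (is_RInt_derive (V := R_CompleteNormedModule) (fun x => - exp ((c - 2 * x) * l) / (2 * l))).
  - intros x _. auto_derive; auto. change (c + - (2 * x)) with (c - 2 * x). field; auto.
  - intros x _. apply (ex_derive_continuous (fun x => exp ((c - 2 * x) * l))). auto_derive; auto.
Qed.

(** Integrating L^{2-2u} over u from sigma to 2 gains the factor 1/(2 l); the integral starts from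
    log zeta(2 + it), which is at most 8. *)
Lemma LZ_asymp e : RH -> 0 < e < 1 / 2 -> exists C l0, 0 < C /\ 10 <= l0 /\ forall l sigma t, l0 <= l ->
  exp (exp l) / 2 <= t <= 3 * exp (exp l) -> 1 / 2 + 4 / l <= sigma ->
  Cmod (LZ (sigma, t)) <= C * (exp ((2 - 2 * sigma) * l) / l + exp (2 * e * l)).
Proof.
  intros HRH He. destruct (gz_asymp e HRH He) as (C & l0 & PC & Hl0 & HG).
  exists (8 + 2 * C), l0. split; [lra|]. split; [auto|]. intros l sigma t Hl Ht Hs.
  assert (il : 0 < / l) by (apply Rinv_0_lt_compat; lra).
  set (M2 := exp (2 * e * l)).
  assert (PM2 : 1 <= M2) by (unfold M2; generalize (exp_ge_1_plus (2 * e * l)); nra).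
  assert (Et : 3 < t).
  { generalize (exp_ge_1_plus l). intros. generalize (exp_ge_1_plus (exp l)). lra. }
  assert (P1 : 0 < exp ((2 - 2 * sigma) * l) / l) by (apply Rdiv_lt_0_compat; [apply exp_pos | lra]).
  assert (LFb : forall u, 2 <= u -> Cmod (LZ (u, t)) <= 8).
  { intros u Hu. rewrite LZ_LF by (simpl; auto; lra). eapply Rle_trans; [apply LF_bound; simpl; lra|]. simpl.
    assert (/ (u - 1) <= / 1) by (apply Rinv_le_contravar; lra). lra. }
  destruct (Rle_dec 2 sigma) as [S|S].
  { eapply Rle_trans; [now apply LFb|].
    assert (8 * 1 <= (8 + 2 * C) * (exp ((2 - 2 * sigma) * l) / l + M2)) by (apply Rmult_le_compat; lra). lra. }
  assert (S1 : 1 / 2 < sigma) by (unfold Rdiv in *; lra).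
  assert (HD : forall u, sigma <= u <= 2 -> rderiv (fun u => LZ (u, t)) u (gz (u, t)) /\ rcont (fun u => gz (u, t)) u).
  { intros u Hu. destruct (holo_LZ HRH (u, t)) as (A & B); [split; simpl; lra|]. split.
    - eapply rderiv_eq; [| apply (rderiv_comp LZ (fun u => (u, t)) u (gz (u, t)) (RtoC 1)); [| exact A]]; [ring|].
      split; simpl; auto_derive; auto.
    - apply (rcont_comp gz (fun u => (u, t))); [apply rcont_horiz | exact B]. }
  assert (ED : CInt (fun u => gz (u, t)) sigma 2 = (LZ (2, t)%R - LZ (sigma, t)%R)%C).
  { apply (CInt_deriv (fun u => LZ (u, t))); [lra| |]; intros u Hu; now apply HD. }
  assert (EI : is_RInt (fun x => C * (exp ((2 - 2 * x) * l) + M2)) sigma 2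
    (C * ((exp ((2 - 2 * sigma) * l) - exp ((2 - 2 * 2) * l)) / (2 * l) + (2 - sigma) * M2))).
  { apply (is_RInt_scal (fun x => exp ((2 - 2 * x) * l) + M2)).
    apply (is_RInt_plus (fun x => exp ((2 - 2 * x) * l)) (fun _ => M2)).
    - apply is_RInt_exp_decay. lra.
    - apply (is_RInt_const sigma 2 M2). }
  assert (BI : Cmod (CInt (fun u => gz (u, t)) sigma 2) <= C * (exp ((2 - 2 * sigma) * l) / l + 2 * M2)).
  { eapply Rle_trans; [apply (CInt_bound _ (fun x => C * (exp ((2 - 2 * x) * l) + M2))); [lra | | eexists; exact EI |]|].
    - apply cintegrable_cont; [lra|]. intros u Hu. now apply HD.
    - intros u Hu. apply HG; auto. unfold Rdiv in *; lra.
    - rewrite (is_RInt_unique _ _ _ _ EI). apply Rmult_le_compat_l; [lra|]. apply Rplus_le_compat.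
      + assert (0 < exp ((2 - 2 * 2) * l)) by apply exp_pos. assert (0 < exp ((2 - 2 * sigma) * l)) by apply exp_pos.
        unfold Rdiv. rewrite Rinv_mult. nra.
      + apply Rmult_le_compat_r; lra. }
  replace (LZ (sigma, t)) with (LZ (2, t)%R - CInt (fun u => gz (u, t)) sigma 2)%C by (rewrite ED; ring).
  eapply Rle_trans; [apply Cmod_minus_le|].
  assert (L2 := LFb 2 (Rle_refl _)).
  assert (0 <= C * (exp ((2 - 2 * sigma) * l) / l)) by (apply Rmult_le_pos; lra). nra.
Qed.

(** * Approximation by smoothed Dirichlet polynomials *)

(** The smoothing factor X^w e^{w^2} with X = e^{xi}. After n^{-w} is absorbed, xi becomes log(X/n),
    so negative values occur too. *)
Definition ew (xi : R) (w : C) : C := cexp (RtoC xi * w + w * w).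

Lemma Cmod_ew xi u v : Cmod (ew xi (u, v)) = exp (xi * u + u * u - v * v).
Proof. unfold ew. rewrite Cmod_cexp. f_equal. simpl. ring. Qed.

Lemma holo_ew xi U : exists d, holo U (ew xi) d.
Proof.
  eexists. unfold ew. apply holo_cexp. apply holo_plus; [apply holo_scal, holo_id | apply holo_mult; apply holo_id].
Qed.

Lemma exp_interval_le xi d u : - d <= u <= 3 -> 0 <= d -> exp (xi * u) <= exp (3 * xi) + exp (- (d * xi)).
Proof.
  intros Hu Hd. assert (P1 := exp_pos (3 * xi)). assert (P2 := exp_pos (- (d * xi))). destruct (Rle_dec 0 xi).
  - apply Rle_trans with (exp (3 * xi)); [apply exp_le; nra | lra].
  - apply Rle_trans with (exp (- (d * xi))); [apply exp_le; nra | lra].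
Qed.

Lemma CInt_gauss_bound f K H : 0 <= H -> 0 <= K -> cintegrable f (- H) H ->
  (forall v, - H <= v <= H -> Cmod (f v) <= K * exp (- (v * v))) -> Cmod (CInt f (- H) H) <= 4 * K.
Proof.
  intros HH HK Hf Hb. assert (P4 := PI_4). assert (Ex := ex_RInt_poisson 1 H Rlt_0_1).
  apply Rle_trans with (RInt (fun v => K * (1 / (1 * 1 + v * v))) (- H) H).
  - apply CInt_bound; auto; [lra | | ].
    + apply (ex_RInt_scal (fun v => 1 / (1 * 1 + v * v))). exact Ex.
    + intros v Hv. eapply Rle_trans; [now apply Hb|]. apply Rmult_le_compat_l; auto.
      eapply Rle_trans; [apply gauss_le|]. right. field. nra.
  - rewrite (RInt_scal (V := R_CompleteNormedModule) (fun v => 1 / (1 * 1 + v * v))) by exact Ex.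
    change (K * RInt (fun v => 1 / (1 * 1 + v * v)) (- H) H <= 4 * K).
    assert (RInt (fun v => 1 / (1 * 1 + v * v)) (- H) H <= 4) by (generalize (RInt_poisson_le 1 H Rlt_0_1 HH); lra). nra.
Qed.

(** The pole of 1/w at 0 yields h(0), and the right line Re w = 3 is kept. The left line costs 4
    (from PI <= 4) times 3 (from e^{d^2} <= 3) times 1/d; the horizontal sides, two of length at
    most 4, give the factor 8. *)
Lemma perron_bound (U : C -> Prop) h dh d xi H r B : 0 < d <= 1 -> 1 <= H -> 0 < r -> holo U h dh ->
  (forall w, - d - r < Re w < 3 + r -> - H - r < Im w < H + r -> U w) ->
  (forall w, - d <= Re w <= 3 -> - H <= Im w <= H -> Cmod (h w) <= B) ->
  Cmod (CInt (fun v => h (3, v) * ew xi (3, v) / (3, v))%C (- H) H - 2 * PI * h 0) <=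
    B * (12 / d * exp (- (d * xi)) + 8 * ((exp (3 * xi) + exp (- (d * xi))) * exp (9 - H * H))).
Proof.
  intros Hd HH Hr Hh HU HB. destruct (holo_ew xi U) as (de & He).
  set (G := fun w => (h w * ew xi w)%C). assert (HG := holo_mult U _ _ _ _ Hh He). fold G in HG.
  assert (B0 : 0 <= B) by (eapply Rle_trans; [apply Cmod_ge_0 | apply (HB 0)]; simpl; lra).
  set (M := B * ((exp (3 * xi) + exp (- (d * xi))) * exp (9 - H * H))).
  assert (Hor : forall u Y, - d <= u <= 3 -> Rabs Y = H -> Cmod (G (u, Y) / (u, Y)) <= M).
  { intros u Y Hu HY. assert (NY : Y <> 0) by (intros ->; rewrite Rabs_R0 in HY; lra).
    assert (YY : Y * Y = H * H) by (rewrite <- HY; destruct (Rcase_abs Y); [rewrite Rabs_left | rewrite Rabs_right]; lra).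
    assert (HY' : - H <= Y <= H) by (apply Rabs_le_between; lra).
    rewrite Cmod_div by (now apply pair_im_neq_0). unfold G. rewrite Cmod_mult, Cmod_ew.
    assert (h5 : 1 <= Cmod (u, Y)).
    { assert (Q := Im_le_Cmod (u, Y)). simpl in Q. rewrite HY in Q. lra. }
    assert (h1 := HB (u, Y) Hu HY').
    assert (h2 : exp (xi * u + u * u - Y * Y) <= (exp (3 * xi) + exp (- (d * xi))) * exp (9 - H * H)).
    { replace (xi * u + u * u - Y * Y) with (xi * u + (u * u - Y * Y)) by ring. rewrite exp_plus.
      apply Rmult_le_compat; try (left; apply exp_pos); [apply exp_interval_le; lra | apply exp_le; nra]. }
    rewrite <- (Rmult_1_r M). unfold Rdiv. apply Rmult_le_compat.
    - apply Rmult_le_pos; [apply Cmod_ge_0 | left; apply exp_pos].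
    - left; apply Rinv_0_lt_compat; lra.
    - apply Rmult_le_compat; auto using Cmod_ge_0. left; apply exp_pos.
    - apply Rle_trans with (/ 1); [apply Rinv_le_contravar; lra | lra]. }
  assert (CR := cauchy_rectangle_bound U G _ d 3 H r ltac:(lra) ltac:(lra) ltac:(lra) Hr HG HU M
     (fun u Hu => Hor u H Hu (Rabs_right H ltac:(lra)))
     (fun u Hu => Hor u (- H) Hu ltac:(rewrite Rabs_Ropp; apply Rabs_right; lra))).
  assert (E0 : G 0 = h 0).
  { unfold G, ew. replace (RtoC xi * 0 + 0 * 0)%C with (RtoC 0) by ring. rewrite cexp_0. ring. }
  rewrite E0 in CR.
  assert (Left : Cmod (CInt (fun v => G (- d, v)%R / (- d, v)%R)%C (- H) H) <= 4 * (B * (3 / d * exp (- (d * xi))))).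
  { assert (N : forall v, (- d, v) <> RtoC 0) by (intros v; apply pair_re_neq_0; lra).
    assert (Pe := exp_pos (- (d * xi))). assert (Pd : 0 < / d) by (apply Rinv_0_lt_compat; lra).
    apply CInt_gauss_bound; [lra | | |].
    - apply Rmult_le_pos; auto. unfold Rdiv. nra.
    - apply cintegrable_cont; [lra|]. intros v Hv. apply rcont_div; [apply N | | apply rcont_vert].
      apply (rcont_comp G (fun v => (- d, v))); [apply rcont_vert|]. eapply holo_ccont; [exact HG | apply HU; simpl; lra].
    - intros v Hv. rewrite Cmod_div by apply N. unfold G. rewrite Cmod_mult, Cmod_ew.
      assert (h1 := HB (- d, v) ltac:(simpl; lra) Hv).
      assert (h2 : exp (xi * - d + - d * - d - v * v) <= 3 * exp (- (d * xi)) * exp (- (v * v))).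
      { replace (xi * - d + - d * - d - v * v) with (d * d + (- (d * xi)) + (- (v * v))) by ring. rewrite !exp_plus.
        apply Rmult_le_compat_r; [left; apply exp_pos|]. apply Rmult_le_compat_r; [lra|].
        apply Rle_trans with (exp 1); [apply exp_le; nra | apply exp_le_3]. }
      assert (h3 : / Cmod (- d, v) <= / d).
      { apply Rinv_le_contravar; [lra|]. assert (Q := re_le_Cmod (- d, v)). simpl in Q. rewrite Rabs_left in Q; lra. }
      apply Rle_trans with (B * (3 * exp (- (d * xi)) * exp (- (v * v))) * / d).
      + unfold Rdiv. apply Rmult_le_compat; auto.
        * apply Rmult_le_pos; [apply Cmod_ge_0 | left; apply exp_pos].
        * left. apply Rinv_0_lt_compat, Cmod_pos, N.
        * apply Rmult_le_compat; auto using Cmod_ge_0. left; apply exp_pos.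
      + right. field. lra. }
  set (R1 := CInt (fun v => h (3, v) * ew xi (3, v) / (3, v))%C (- H) H) in *.
  change (CInt (fun v => G (3, v) / (3, v))%C (- H) H) with R1 in CR.
  set (L1 := CInt (fun v => G (- d, v)%R / (- d, v)%R)%C (- H) H) in *.
  replace (R1 - 2 * PI * h 0)%C with ((R1 - L1 - 2 * PI * h 0) + L1)%C by ring.
  eapply Rle_trans; [apply Cmod_triangle|].
  assert (M0 : 0 <= M).
  { unfold M. apply Rmult_le_pos; auto. apply Rmult_le_pos; [|left; apply exp_pos].
    generalize (exp_pos (3 * xi)) (exp_pos (- (d * xi))). lra. }
  assert (2 * M * (d + 3) <= 8 * M) by nra.
  replace (B * (12 / d * exp (- (d * xi)) + 8 * ((exp (3 * xi) + exp (- (d * xi))) * exp (9 - H * H)))) with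
    (8 * M + 4 * (B * (3 / d * exp (- (d * xi))))) by (unfold M; field; lra). lra.
Qed.

(** A smooth cutoff in log(X/n): near 1 for large xi, and O(e^{3 xi}) for negative xi. The exponent
    3 is the abscissa of the line of integration. *)
Definition Wt (xi H : R) : C := (RtoC (/ (2 * PI)) * CInt (fun v => ew xi (3, v) / (3, v))%C (- H) H)%C.

Lemma ew_integrable xi H : 0 <= H -> cintegrable (fun v => ew xi (3, v) / (3, v))%C (- H) H.
Proof.
  intros HH. apply cintegrable_cont; [lra|]. intros v Hv. apply rcont_div; [apply pair_re_neq_0; lra | | apply rcont_vert].
  apply (rcont_comp (ew xi) (fun v => (3, v))); [apply rcont_vert|].
  destruct (holo_ew xi (fun _ => True)) as (de & He). eapply holo_ccont; [exact He | exact I].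
Qed.

Lemma inv_2PI_le : 0 < / (2 * PI) <= / 6.
Proof.
  assert (P := PI2_3_2). split; [apply Rinv_0_lt_compat; lra | apply Rinv_le_contravar; lra].
Qed.

Lemma Cmod_ew_line xi v : Cmod (ew xi (3, v) / (3, v)) <= exp (9 + 3 * xi) * exp (- (v * v)).
Proof.
  rewrite Cmod_div by (apply pair_re_neq_0; lra). rewrite Cmod_ew.
  replace (xi * 3 + 3 * 3 - v * v) with ((9 + 3 * xi) + (- (v * v))) by ring. rewrite exp_plus.
  rewrite <- (Rmult_1_r (exp (9 + 3 * xi) * exp (- (v * v)))) at 2. unfold Rdiv.
  apply Rmult_le_compat_l; [left; apply Rmult_lt_0_compat; apply exp_pos|].
  apply Rle_trans with (/ 1); [| lra]. apply Rinv_le_contravar; [lra|].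
  assert (Q := re_le_Cmod (3, v)). simpl in Q. rewrite Rabs_right in Q; lra.
Qed.

Lemma Wt_bound xi H : 0 <= H -> Cmod (Wt xi H) <= exp (9 + 3 * xi).
Proof.
  intros HH. unfold Wt. assert (I := inv_2PI_le). rewrite Cmod_mult, Cmod_RtoC_le by lra.
  assert (B := CInt_gauss_bound _ (exp (9 + 3 * xi)) H HH (Rlt_le _ _ (exp_pos _)) (ew_integrable xi H HH)
    (fun v _ => Cmod_ew_line xi v)).
  assert (P := exp_pos (9 + 3 * xi)).
  assert (C0 := Cmod_ge_0 (CInt (fun v => ew xi (3, v) / (3, v))%C (- H) H)). nra.
Qed.

(** [perron_bound] with h = 1, divided by 2 PI >= 6. *)
Lemma Wt_near_1 d xi H : 0 < d <= 1 -> 1 <= H ->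
  Cmod (Wt xi H - 1) <= 2 / d * exp (- (d * xi)) + 2 * ((exp (3 * xi) + exp (- (d * xi))) * exp (9 - H * H)).
Proof.
  intros Hd HH.
  assert (B := perron_bound (fun _ => True) (fun _ => RtoC 1) (fun _ => RtoC 0) d xi H 1 1 Hd HH Rlt_0_1
    (holo_const _ _) (fun _ _ _ => I) (fun _ _ _ => Req_le _ _ Cmod_1)).
  assert (P := inv_2PI_le). assert (P3 := PI_RGT_0).
  replace (Wt xi H - 1)%C with (RtoC (/ (2 * PI)) * (CInt (fun v => 1 * ew xi (3, v) / (3, v))%C (- H) H - 2 * PI * 1))%C.
  - rewrite Cmod_mult, Cmod_RtoC_le by lra.
    set (X := Cmod (CInt (fun v => 1 * ew xi (3, v) / (3, v))%C (- H) H - 2 * PI * 1)) in *.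
    assert (X0 : 0 <= X) by apply Cmod_ge_0.
    assert (E1 := exp_pos (- (d * xi))). assert (E2 := exp_pos (3 * xi)). assert (E3 := exp_pos (9 - H * H)).
    assert (0 <= (exp (3 * xi) + exp (- (d * xi))) * exp (9 - H * H)) by (apply Rmult_le_pos; lra).
    unfold Rdiv in *. nra.
  - unfold Wt. rewrite (CInt_ext (fun v => 1 * ew xi (3, v) / (3, v))%C (fun v => ew xi (3, v) / (3, v))%C) by
      (try lra; intros v _; unfold Cdiv; ring).
    rewrite RtoC_inv, RtoC_mult by lra. field. intros E; apply (f_equal Re) in E; simpl in E; lra.
Qed.

Lemma CInt_csum1 (f : nat -> R -> C) a b N : (forall n, cintegrable (f n) a b) ->
  cintegrable (fun v => csum1 (fun n => f n v) N) a b /\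
  CInt (fun v => csum1 (fun n => f n v) N) a b = csum1 (fun n => CInt (f n) a b) N.
Proof.
  intros Hf. induction N as [|N (I1 & I2)]; cbn [csum1].
  - split.
    + split; simpl; apply ex_RInt_const.
    + rewrite CInt_const. ring.
  - split; [now apply cintegrable_plus|]. rewrite CInt_plus by auto. now rewrite I2.
Qed.

Lemma npow_ew n s w xi : (npow_neg n (s + w) * ew xi w = npow_neg n s * ew (xi - ln (INR n)) w)%C.
Proof.
  unfold npow_neg, ew. rewrite <- !cexp_add. f_equal. rewrite RtoC_minus. ring.
Qed.

Lemma csum1_mult_r f c N : (csum1 f N * c = csum1 (fun n => f n * c) N)%C.
Proof. induction N; cbn [csum1]; [ring|]. rewrite <- IHN. ring. Qed.

(* Here [Wt (xi - ln n) H] is the weight [W_n] with [X = e^xi], the contour being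
   truncated at height [H]. *)
Definition smooth_poly (z : C) (xi H : R) (N : nat) (s : C) : C :=
  csum1 (fun n => dz z n * Wt (xi - ln (INR n)) H * npow_neg n s)%C N.

Lemma smooth_poly_integral z xi H N s : 0 <= H ->
  let f := (fun v => csum1 (fun n => dz z n * npow_neg n (s + (3, v)%R)) N * ew xi (3, v) / (3, v))%C in
  cintegrable f (- H) H /\ smooth_poly z xi H N s = (RtoC (/ (2 * PI)) * CInt f (- H) H)%C.
Proof.
  intros HH f.
  assert (E : forall v, f v = csum1 (fun n => (dz z n * npow_neg n s) * (ew (xi - ln (INR n)) (3, v) / (3, v)))%C N).
  { intros v. unfold f, Cdiv. rewrite !csum1_mult_r. apply csum1_ext. intros n _.
    transitivity (dz z n * (npow_neg n (s + (3, v)) * ew xi (3, v)) * / (3, v))%C; [ring|].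
    rewrite npow_ew. ring. }
  assert (Hi : forall n, cintegrable (fun v => (dz z n * npow_neg n s) * (ew (xi - ln (INR n)) (3, v) / (3, v)))%C (- H) H).
  { intros n. apply cintegrable_scal. now apply ew_integrable. }
  destruct (CInt_csum1 _ _ _ N Hi) as (I1 & I2). split.
  - destruct I1 as (J1 & J2). split; [eapply ex_RInt_ext; [| exact J1] | eapply ex_RInt_ext; [| exact J2]]; intros v _; cbv beta; rewrite E; reflexivity.
  - rewrite (CInt_ext f _ (- H) H ltac:(lra) (fun v _ => E v)), I2, <- csum1_scal. apply csum1_ext. intros n _.
    rewrite CInt_scal by now apply ew_integrable. unfold Wt. ring.
Qed.

Lemma zeta_pow_approx z sigma t d xi H N B eta : RH -> 0 < d <= 1 -> 1 <= H -> 1 / 2 < sigma - d -> 1 < t - H ->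
  (forall u v, sigma - d <= u -> t - H <= v <= t + H -> Cmod (cexp (z * LZ (u, v))) <= B) ->
  (forall v, Cmod (cexp (z * LF (sigma + 3, v)) - csum1 (fun n => dz z n * npow_neg n (sigma + 3, v)%R)%C N) <= eta) ->
  Cmod (cexp (z * LZ (sigma, t)) - smooth_poly z xi H N (sigma, t)) <=
    B * (2 / d * exp (- (d * xi)) + 2 * ((exp (3 * xi) + exp (- (d * xi))) * exp (9 - H * H))) + eta * exp (9 + 3 * xi).
Proof.
  intros HRH Hd HH Hs Ht HB HN. set (s := (sigma, t) : C).
  set (U := fun w => quadrant (1 / 2) (s + w)%C).
  set (h := fun w => cexp (z * LZ (s + w))%C).
  assert (Hh : exists dh, holo U h dh).
  { eexists. unfold h. apply holo_cexp, holo_scal, holo_shift. now apply holo_LZ. }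
  destruct Hh as (dh & Hh).
  set (r := Rmin (sigma - d - 1 / 2) (t - H - 1)). assert (Hr : 0 < r) by (apply Rmin_glb_lt; lra).
  assert (r1 := Rmin_l (sigma - d - 1 / 2) (t - H - 1)). assert (r2 := Rmin_r (sigma - d - 1 / 2) (t - H - 1)). fold r in r1, r2.
  assert (HU : forall w, - d - r < Re w < 3 + r -> - H - r < Im w < H + r -> U w).
  { intros w W1 W2. unfold U, quadrant, Re, Im in *. simpl. lra. }
  assert (HB' : forall w, - d <= Re w <= 3 -> - H <= Im w <= H -> Cmod (h w) <= B).
  { intros w W1 W2. unfold h. replace (s + w)%C with (sigma + Re w, t + Im w) by (apply Ceq_of; reflexivity). apply HB; lra. }
  assert (PB := perron_bound U h dh d xi H r B Hd HH Hr Hh HU HB').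
  destruct (smooth_poly_integral z xi H N s ltac:(lra)) as (Jf & ->).
  set (f := (fun v => csum1 (fun n => dz z n * npow_neg n (s + (3, v)%R)) N * ew xi (3, v) / (3, v))%C) in *.
  set (g := (fun v => h (3, v) * ew xi (3, v) / (3, v))%C) in *.
  assert (Jg : cintegrable g (- H) H).
  { apply cintegrable_cont; [lra|]. intros v Hv. apply rcont_div; [apply pair_re_neq_0; lra | | apply rcont_vert].
    apply rcont_mult.
    - apply (rcont_comp h (fun v => (3, v))); [apply rcont_vert|]. eapply holo_ccont; [exact Hh | apply HU; simpl; lra].
    - apply (rcont_comp (ew xi) (fun v => (3, v))); [apply rcont_vert|].
      destruct (holo_ew xi (fun _ => True)) as (de & He). eapply holo_ccont; [exact He | exact I]. }
  assert (eta0 : 0 <= eta) by (eapply Rle_trans; [apply Cmod_ge_0 | apply (HN 0)]).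
  assert (B0 : 0 <= B) by (eapply Rle_trans; [apply Cmod_ge_0 | apply (HB' 0)]; simpl; lra).
  assert (Bd : Cmod (CInt g (- H) H - CInt f (- H) H) <= 4 * (eta * exp (9 + 3 * xi))).
  { rewrite <- CInt_minus by auto. apply CInt_gauss_bound; [lra | | now apply cintegrable_minus |].
    - apply Rmult_le_pos; [auto | left; apply exp_pos].
    - intros v Hv. unfold f, g, h.
      replace (s + (3, v))%C with (sigma + 3, t + v) by (apply Ceq_of; simpl; ring).
      rewrite LZ_LF by (simpl; auto; lra).
      replace (cexp (z * LF (sigma + 3, t + v)%R) * ew xi (3, v) / (3, v) -
        csum1 (fun n : nat => dz z n * npow_neg n (sigma + 3, t + v)%R)%C N * ew xi (3, v) / (3, v))%C with
       ((cexp (z * LF (sigma + 3, t + v)%R) - csum1 (fun n : nat => dz z n * npow_neg n (sigma + 3, t + v)%R)%C N) * (ew xi (3, v) / (3, v)))%C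
        by (unfold Cdiv; ring).
      rewrite Cmod_mult, (Rmult_assoc eta). apply Rmult_le_compat; auto using Cmod_ge_0, Cmod_ew_line. }
  assert (P := inv_2PI_le). assert (P3 := PI_RGT_0).
  replace (cexp (z * LZ s) - RtoC (/ (2 * PI)) * CInt f (- H) H)%C with
    (RtoC (/ (2 * PI)) * ((CInt g (- H) H - CInt f (- H) H) - (CInt g (- H) H - 2 * PI * h 0)))%C.
  2: { unfold h at 1. replace (s + 0)%C with s by ring. rewrite RtoC_inv, RtoC_mult by lra. field.
       intros E; apply (f_equal Re) in E; simpl in E; lra. }
  rewrite Cmod_mult, Cmod_RtoC_le by lra.
  assert (T := Cmod_minus_le (CInt g (- H) H - CInt f (- H) H) (CInt g (- H) H - 2 * PI * h 0)).
  set (X := Cmod ((CInt g (- H) H - CInt f (- H) H) - (CInt g (- H) H - 2 * PI * h 0))) in *.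
  assert (X0 : 0 <= X) by apply Cmod_ge_0.
  assert (E0 : 0 <= eta * exp (9 + 3 * xi)) by (apply Rmult_le_pos; [auto | left; apply exp_pos]).
  set (Q := (exp (3 * xi) + exp (- (d * xi))) * exp (9 - H * H)) in *.
  assert (Q0 : 0 <= Q).
  { apply Rmult_le_pos; [| left; apply exp_pos]. generalize (exp_pos (3 * xi)) (exp_pos (- (d * xi))). lra. }
  assert (P0 : 0 <= / d * exp (- (d * xi))) by (apply Rmult_le_pos; left; [apply Rinv_0_lt_compat; lra | apply exp_pos]).
  assert (BQ : 0 <= B * Q) by now apply Rmult_le_pos.
  assert (BP : 0 <= B * (/ d * exp (- (d * xi)))) by now apply Rmult_le_pos.
  apply Rle_trans with (/ 6 * X); [apply Rmult_le_compat_r; lra|].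
  unfold Rdiv in *. lra.
Qed.

(** * Mean values *)

Lemma npow_cross m n sigma t : (npow_neg m (sigma, t) * Cconj (npow_neg n (sigma, t)) =
  RtoC (Rpower (INR m) (- sigma) * Rpower (INR n) (- sigma)) * cexp (RtoC t * (0, ln (INR n) - ln (INR m))%R))%C.
Proof.
  unfold npow_neg, Rpower. rewrite <- cexp_conj, <- exp_plus, <- cexp_RtoC, <- !cexp_add. f_equal.
  apply Ceq_of; simpl; ring.
Qed.

Lemma rcont_osc w t : rcont (fun t => cexp (RtoC t * (0, w)%R))%C t.
Proof.
  apply rcont_cexp, rcont_mult; [| apply rcont_const]. apply rcont_RtoC. apply continuous_id.
Qed.

Lemma CInt_osc_bound w a b : a <= b -> w <> 0 -> Cmod (CInt (fun t => cexp (RtoC t * (0, w)%R))%C a b) <= 2 / Rabs w.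
Proof.
  intros Hab Hw. assert (Nw : (0, w) <> RtoC 0) by now apply pair_im_neq_0.
  assert (Mw : Cmod (0, w) = Rabs w).
  { apply Rle_antisym; [| apply (Im_le_Cmod (0, w))]. eapply Rle_trans; [apply Cmod_le_Re_Im|]. simpl. rewrite Rabs_R0. lra. }
  assert (Pw := Rabs_pos_lt w Hw).
  rewrite (CInt_deriv (fun t => / (0, w)%R * cexp (RtoC t * (0, w)%R))%C); [| auto | | intros; apply rcont_osc].
  2: { intros t _. eapply rderiv_eq; [| apply rderiv_scal; eapply (rderiv_comp cexp (fun t => RtoC t * (0, w)%R)%C);
      [apply rderiv_mult; [apply rderiv_RtoC | apply rderiv_const] | apply cderiv_cexp]]. cbv beta. field; auto. }
  replace (2 / Rabs w) with (/ Rabs w * 1 + / Rabs w * 1) by (field; lra).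
  eapply Rle_trans; [apply Cmod_minus_le|]. rewrite !Cmod_mult, !Cmod_cexp, Cmod_inv, Mw by auto.
  right. simpl Re. rewrite !Rmult_0_r, !Rmult_0_l, !Rminus_0_r, exp_0. reflexivity.
Qed.

Lemma ln_le_sub_1 x : 0 < x -> ln x <= x - 1.
Proof. intros Hx. generalize (exp_ge_1_plus (ln x)). rewrite exp_ln by auto. lra. Qed.

(** From ln x <= x - 1 at x = m/n, the gap is at least (n - m)/n. The cruder symmetric form 1/(mn)
    is kept because it lets the off-diagonal double sum factor into two single sums. *)
Lemma ln_INR_gap_lt m n : (1 <= m < n)%nat -> / (INR m * INR n) <= ln (INR n) - ln (INR m).
Proof.
  intros H. assert (Hm : 1 <= INR m) by (change 1 with (INR 1); apply le_INR; lia).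
  assert (Hn : INR m + 1 <= INR n) by (rewrite <- S_INR; apply le_INR; lia).
  assert (L := ln_le_sub_1 (INR m / INR n) ltac:(apply Rdiv_lt_0_compat; lra)).
  rewrite ln_div in L by lra. apply Rle_trans with (1 - INR m / INR n); [| lra].
  apply (Rmult_le_reg_r (INR m * INR n)); [nra|]. rewrite Rinv_l by nra.
  replace ((1 - INR m / INR n) * (INR m * INR n)) with (INR m * (INR n - INR m)) by (field; lra). nra.
Qed.

Lemma ln_INR_gap m n : (1 <= m)%nat -> (1 <= n)%nat -> m <> n ->
  / (INR m * INR n) <= Rabs (ln (INR n) - ln (INR m)).
Proof.
  intros Hm Hn Hne. destruct (Nat.lt_total m n) as [c|[c|c]]; [| lia |].
  - eapply Rle_trans; [apply ln_INR_gap_lt; lia | apply Rle_abs].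
  - rewrite Rmult_comm, Rabs_minus_sym. eapply Rle_trans; [apply ln_INR_gap_lt; lia | apply Rle_abs].
Qed.

Lemma csum1_zero N : csum1 (fun _ => RtoC 0) N = 0.
Proof. induction N as [|N IH]; cbn [csum1]; auto. rewrite IH. ring. Qed.

Lemma csum1_delta x m N : (1 <= m <= N)%nat -> csum1 (fun n => if Nat.eq_dec n m then x n else 0) N = (x m : C).
Proof.
  induction N as [|N IH]; intros H; [lia|]. cbn [csum1]. destruct (Nat.eq_dec (S N) m) as [e|e].
  - subst m. rewrite (csum1_ext _ (fun _ => RtoC 0)), csum1_zero; [ring|].
    intros n Hn. destruct (Nat.eq_dec n (S N)); [lia | auto].
  - rewrite IH by lia. ring.
Qed.

(** The diagonal is integrated exactly. Each off-diagonal term oscillates and contributes at most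
    2/|log(n/m)| <= 2 m n; the factors m and n turn the exponents -sigma into 1 - sigma, and the
    double sum becomes a product. *)
Lemma mean_value_poly (a b : nat -> C) sigma T N : 0 < T ->
  let D c t := csum1 (fun n => c n * npow_neg n (sigma, t))%C N in
  Cmod (CInt (fun t => D a t * Cconj (D b t))%C T (2 * T)
     - RtoC T * csum1 (fun n => a n * Cconj (b n) * RtoC (Rpower (INR n) (-2 * sigma)))%C N) <=
   2 * (rsum1 (fun n => Cmod (a n) * Rpower (INR n) (1 - sigma)) N *
        rsum1 (fun n => Cmod (b n) * Rpower (INR n) (1 - sigma)) N).
Proof.
  intros HT D.
  set (K := fun m n => RtoC (Rpower (INR m) (- sigma) * Rpower (INR n) (- sigma))).
  set (F := fun m n t => (a m * Cconj (b n) * K m n * cexp (RtoC t * (0, ln (INR n) - ln (INR m))%R))%C).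
  assert (IF0 : forall w, cintegrable (fun t => cexp (RtoC t * (0, w)%R))%C T (2 * T)).
  { intros w. apply cintegrable_cont; [lra|]. intros; apply rcont_osc. }
  assert (IF : forall m n, cintegrable (F m n) T (2 * T)) by (intros; apply cintegrable_scal, IF0).
  assert (E : forall t, (D a t * Cconj (D b t))%C = csum1 (fun m => csum1 (fun n => F m n t) N) N).
  { intros t. unfold D. rewrite csum1_mult_r. apply csum1_ext. intros m _.
    rewrite <- csum1_conj, <- csum1_scal. apply csum1_ext. intros n _. unfold F, K.
    rewrite Cmult_conj. rewrite <- !Cmult_assoc, <- npow_cross. ring. }
  rewrite (CInt_ext _ _ T (2 * T) ltac:(lra) (fun t _ => E t)).
  rewrite (proj2 (CInt_csum1 (fun m t => csum1 (fun n => F m n t) N) T (2 * T) N (fun m => proj1 (CInt_csum1 _ _ _ N (IF m))))).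
  rewrite <- csum1_scal, <- csum1_minus.
  replace (2 * (rsum1 (fun n => Cmod (a n) * Rpower (INR n) (1 - sigma)) N * rsum1 (fun n => Cmod (b n) * Rpower (INR n) (1 - sigma)) N))
    with (rsum1 (fun m => 2 * rsum1 (fun n => Cmod (b n) * Rpower (INR n) (1 - sigma)) N * (Cmod (a m) * Rpower (INR m) (1 - sigma))) N)
    by (rewrite rsum1_scal; ring).
  apply csum1_bound. intros m Hm.
  rewrite (proj2 (CInt_csum1 (F m) T (2 * T) N (IF m))).
  (* The diagonal term is spread over the inner index by an indicator, so that the difference can be
     estimated term by term. *)
  rewrite <- (csum1_delta (fun n => RtoC T * (a n * Cconj (b n) * RtoC (Rpower (INR n) (-2 * sigma))))%C m N Hm).
  rewrite <- csum1_minus.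
  replace (2 * rsum1 (fun n => Cmod (b n) * Rpower (INR n) (1 - sigma)) N * (Cmod (a m) * Rpower (INR m) (1 - sigma)))
    with (rsum1 (fun n => 2 * (Cmod (a m) * Rpower (INR m) (1 - sigma)) * (Cmod (b n) * Rpower (INR n) (1 - sigma))) N)
    by (rewrite rsum1_scal; ring).
  apply csum1_bound. intros n Hn.
  unfold F at 1. rewrite CInt_scal by apply IF0.
  assert (Rm := Rpower_pos (INR m) (1 - sigma)). assert (Rn := Rpower_pos (INR n) (1 - sigma)).
  assert (Pa := Cmod_ge_0 (a m)). assert (Pb := Cmod_ge_0 (b n)).
  destruct (Nat.eq_dec n m) as [->|c].
  - rewrite Rminus_diag.
    rewrite (CInt_ext _ (fun _ => RtoC 1) T (2 * T)) by (try lra; intros t _; change (0, 0) with (RtoC 0); rewrite Cmult_0_r; apply cexp_0).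
    rewrite CInt_const.
    replace (a m * Cconj (b m) * K m m * (RtoC (2 * T - T) * 1) - RtoC T * (a m * Cconj (b m) * RtoC (Rpower (INR m) (-2 * sigma))))%C with (RtoC 0).
    + rewrite Cmod_0. apply Rmult_le_pos; apply Rmult_le_pos; try lra. apply Rmult_le_pos; lra.
    + unfold K. rewrite <- Rpower_plus. replace (- sigma + - sigma) with (-2 * sigma) by ring.
      replace (2 * T - T) with T by ring. ring.
  - assert (Pm : 0 < INR m) by (apply lt_0_INR; lia). assert (Pn : 0 < INR n) by (apply lt_0_INR; lia).
    assert (G := ln_INR_gap m n ltac:(lia) ltac:(lia) ltac:(lia)).
    assert (Pmn : 0 < INR m * INR n) by nra. assert (Pi := Rinv_0_lt_compat _ Pmn).
    assert (Nz : ln (INR n) - ln (INR m) <> 0) by (intros z; rewrite z, Rabs_R0 in G; lra).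
    assert (O := CInt_osc_bound _ T (2 * T) ltac:(lra) Nz).
    assert (O2 : Cmod (CInt (fun t => cexp (RtoC t * (0, ln (INR n) - ln (INR m))%R))%C T (2 * T)) <= 2 * (INR m * INR n)).
    { eapply Rle_trans; [exact O|]. unfold Rdiv. apply Rmult_le_compat_l; [lra|].
      rewrite <- (Rinv_inv (INR m * INR n)). now apply Rinv_le_contravar. }
    replace (a m * Cconj (b n) * K m n * CInt (fun t => cexp (RtoC t * (0, ln (INR n) - ln (INR m))%R))%C T (2 * T) - 0)%C
      with (a m * Cconj (b n) * K m n * CInt (fun t => cexp (RtoC t * (0, ln (INR n) - ln (INR m))%R))%C T (2 * T))%C by ring.
    rewrite !Cmod_mult, Cmod_conj.
    assert (R1 : Rpower (INR m) (1 - sigma) = INR m * Rpower (INR m) (- sigma)) by (unfold Rminus; rewrite Rpower_plus, Rpower_1 by auto; auto).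
    assert (R2 : Rpower (INR n) (1 - sigma) = INR n * Rpower (INR n) (- sigma)) by (unfold Rminus; rewrite Rpower_plus, Rpower_1 by auto; auto).
    rewrite R1, R2. unfold K.
    assert (Q1 := Rpower_pos (INR m) (- sigma)). assert (Q2 := Rpower_pos (INR n) (- sigma)).
    rewrite Cmod_RtoC_le by nra.
    replace (2 * (Cmod (a m) * (INR m * Rpower (INR m) (- sigma))) * (Cmod (b n) * (INR n * Rpower (INR n) (- sigma)))) with
      (Cmod (a m) * Cmod (b n) * (Rpower (INR m) (- sigma) * Rpower (INR n) (- sigma)) * (2 * (INR m * INR n))) by ring.
    apply Rmult_le_compat_l; auto. apply Rmult_le_pos; nra.
Qed.

(** Induction on the ratio of consecutive coefficients: (k + n)^2 <= (k^2 + n)(n + 1), the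
    difference being n (k - 1)^2. *)
Lemma rdz_pp_sq_le k a : 0 <= k -> rdz_pp k a * rdz_pp k a <= rdz_pp (k * k) a.
Proof.
  intros Hk. induction a as [|a IH].
  - unfold rdz_pp. simpl. lra.
  - assert (E1 := rdz_pp_S k a). assert (E2 := rdz_pp_S (k * k) a).
    assert (P := rdz_pp_nonneg (k * k) a ltac:(nra)).
    assert (I0 := pos_INR a). rewrite S_INR in E1, E2. set (n := INR a) in *.
    assert (Q : (k + n) * (k + n) <= (k * k + n) * (n + 1)) by (assert (0 <= n * ((k - 1) * (k - 1))) by (apply Rmult_le_pos; [auto | apply Rle_0_sqr]); lra).
    apply (Rmult_le_reg_r ((n + 1) * (n + 1))); [nra|].
    replace (rdz_pp k (S a) * rdz_pp k (S a) * ((n + 1) * (n + 1))) with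
      ((rdz_pp k (S a) * (n + 1)) * (rdz_pp k (S a) * (n + 1))) by ring.
    replace (rdz_pp (k * k) (S a) * ((n + 1) * (n + 1))) with ((rdz_pp (k * k) (S a) * (n + 1)) * (n + 1)) by ring.
    rewrite E1, E2.
    replace (rdz_pp k a * (k + n) * (rdz_pp k a * (k + n))) with ((rdz_pp k a * rdz_pp k a) * ((k + n) * (k + n))) by ring.
    apply Rle_trans with (rdz_pp (k * k) a * ((k * k + n) * (n + 1))); [| lra].
    apply Rmult_le_compat; auto; nra.
Qed.

Lemma rsum1_sq_le c f A : 0 <= c -> (forall a, 0 <= f a) -> c * c + rsum1 (fun a => f a * f a) A <= (c + rsum1 f A) * (c + rsum1 f A).
Proof.
  intros Hc Hf. induction A as [|A IH]; cbn [rsum1]; [lra|].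
  assert (P := Hf (S A)). assert (Q := rsum1_nonneg f A (fun n _ => Hf n)). nra.
Qed.

Lemma Rpower_ge_min y q : 0 < y -> 1 <= q <= 2 -> Rmin y (y * y) <= Rpower y q.
Proof.
  intros Hy Hq. destruct (Rle_dec 1 y) as [c|c].
  - apply Rle_trans with y; [apply Rmin_l|]. rewrite <- (Rpower_1 y Hy) at 1. apply Rle_Rpower; lra.
  - apply Rle_trans with (y * y); [apply Rmin_r|].
    assert (L : ln y <= 0) by (rewrite <- ln_1; apply ln_le_mono; lra).
    rewrite <- (exp_ln y Hy) at 1 2. rewrite <- exp_plus. unfold Rpower. apply exp_le. nra.
Qed.

(* [d_k^2] is dominated both by the square of the Euler factor with parameter
   [k] and by the factor with parameter [k^2]; interpolating the two exponents
   gives a series over primes that converges for [q sigma > 1]. *)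
Lemma local_square_le k x q A : 0 < k -> 0 < x <= 3 / 4 -> 1 <= q <= 2 ->
  1 + rsum1 (fun a => (rdz_pp k a * rdz_pp k a) * (x ^ a * x ^ a)) A <= exp (8 * Rpower (k * x) q).
Proof.
  intros Hk Hx Hq. assert (L1 := local_factor_le k x A ltac:(lra) Hx).
  assert (L2 := local_factor_le (k * k) (x * x) A ltac:(nra) ltac:(nra)).
  assert (Z : forall c, rdz_pp c 0 = 1) by (intros; unfold rdz_pp; simpl; lra).
  rewrite Z in L1, L2.
  assert (Px : forall a, 0 <= x ^ a) by (intros; apply pow_le; lra).
  assert (B1 : 1 + rsum1 (fun a => (rdz_pp k a * rdz_pp k a) * (x ^ a * x ^ a)) A <= exp (8 * (k * x))).
  { assert (S := rsum1_sq_le 1 (fun a => rdz_pp k a * x ^ a) A ltac:(lra)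
      (fun a => Rmult_le_pos _ _ (rdz_pp_nonneg k a ltac:(lra)) (Px a))).
    rewrite Rmult_1_l in S.
    rewrite (rsum1_ext (fun a => (rdz_pp k a * rdz_pp k a) * (x ^ a * x ^ a)) (fun a => rdz_pp k a * x ^ a * (rdz_pp k a * x ^ a)))
      by (intros; ring).
    eapply Rle_trans; [exact S|]. replace (8 * (k * x)) with (4 * k * x + 4 * k * x) by ring. rewrite exp_plus.
    assert (0 <= rsum1 (fun a => rdz_pp k a * x ^ a) A).
    { apply rsum1_nonneg. intros a _. apply Rmult_le_pos; [apply rdz_pp_nonneg; lra | auto]. }
    apply Rmult_le_compat; lra. }
  assert (B2 : 1 + rsum1 (fun a => (rdz_pp k a * rdz_pp k a) * (x ^ a * x ^ a)) A <= exp (8 * (k * x * (k * x)))).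
  { eapply Rle_trans; [apply Rplus_le_compat_l, rsum1_le | eapply Rle_trans; [exact L2 | apply exp_le]].
    - intros a _. cbv beta. rewrite Rpow_mult_distr. apply Rmult_le_compat_r; [apply Rmult_le_pos; auto | apply rdz_pp_sq_le; lra].
    - assert (0 <= k * x * (k * x)) by nra. lra. }
  assert (M := Rpower_ge_min (k * x) q ltac:(nra) Hq). unfold Rmin in M. destruct (Rle_dec (k * x) (k * x * (k * x))).
  - eapply Rle_trans; [exact B1 | apply exp_le; lra].
  - eapply Rle_trans; [exact B2 | apply exp_le; lra].
Qed.

Definition dd (z1 z2 : C) (sigma : R) (n : nat) : R :=
  Cmod (dz z1 n) * Cmod (dz z2 n) * Rpower (INR n) (- (2 * sigma)).

Lemma dd_nonneg z1 z2 sigma n : 0 <= dd z1 z2 sigma n.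
Proof. apply Rmult_le_pos; [apply Rmult_le_pos; apply Cmod_ge_0 | left; apply Rpower_pos]. Qed.

Lemma rsum1_dd_le z1 z2 k sigma q N : 0 < k -> Cmod z1 <= k -> Cmod z2 <= k -> / 2 <= sigma ->
  1 <= q <= 2 -> 1 < q * sigma ->
  rsum1 (dd z1 z2 sigma) N <= exp (8 * Rpower k q * (1 + / (q * sigma - 1))).
Proof.
  intros Hk H1 H2 Hs Hq Hqs.
  apply Rle_trans with (exp (psumR (fun p => 8 * Rpower (k * Rpower (INR p) (- sigma)) q) N)).
  - apply euler_upper; [| intros; apply dd_nonneg |].
    + split.
      * unfold dd. rewrite !dz_one, Cmod_1. change (INR 1) with 1. rewrite Rpower_1_l. f_equal; ring.
      * intros p a m Hp Hd Hm. rewrite <- RtoC_mult. f_equal. unfold dd.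
        rewrite !dz_mul, rpow_mul, !Cmod_mult by (auto using pow_pos_nat, prime_pos). ring.
    + intros p Hp _ A. set (x := Rpower (INR p) (- sigma)).
      assert (Hx : 0 < x <= 3 / 4).
      { split; [apply Rpower_pos|]. apply Rpower_prime_le; auto; [lra|]. apply Rpower_2_neg_half. lra. }
      eapply Rle_trans; [| apply (local_square_le k x q A Hk Hx Hq)].
      unfold csum0. eapply Rle_trans; [apply Cmod_triangle|]. apply Rplus_le_compat.
      * simpl Nat.pow. unfold dd. rewrite !dz_one, Cmod_1. change (INR 1) with 1. rewrite Rpower_1_l, !Rmult_1_r, Cmod_1. lra.
      * apply csum1_bound. intros a _. rewrite Cmod_RtoC_le by apply dd_nonneg. unfold dd.
        rewrite !dz_pow, rpow_pow by (auto using prime_pos).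
        replace (- (2 * sigma)) with (- sigma + - sigma) by ring. rewrite Rpower_plus. fold x. rewrite Rpow_mult_distr.
        apply Rmult_le_compat_r; [apply Rmult_le_pos; apply pow_le; lra|].
        apply Rmult_le_compat; try apply Cmod_ge_0; now apply Cmod_dz_pp_le.
  - apply exp_le. eapply Rle_trans; [apply psumR_le with (d := fun n => 8 * Rpower k q * Rpower (INR n) (- (q * sigma - 1) - 1))|].
    + intros. apply Rmult_le_pos; [| left; apply Rpower_pos]. generalize (Rpower_pos k q). lra.
    + intros p _ _. right. unfold Rpower.
      rewrite ln_mult by (auto; apply exp_pos). rewrite ln_exp, Rmult_assoc, <- exp_plus. f_equal. f_equal. ring.
    + rewrite rsum1_scal. apply Rmult_le_compat_l; [generalize (Rpower_pos k q); lra|]. apply Rpower_sum_le. lra.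
Qed.

(** Connects the componentwise [Series] defining [dz_series] with convergence of complex partial
    sums; the bound B on the absolute sums gives absolute convergence. *)
Lemma ccvg_dz_series z1 z2 sigma B : (forall N, rsum1 (dd z1 z2 sigma) N <= B) ->
  ccvg (csum1 (dz_term z1 z2 sigma)) (dz_series z1 z2 sigma).
Proof.
  intros HB.
  assert (T : forall n, Cmod (dz_term z1 z2 sigma n) <= dd z1 z2 sigma n).
  { intros n. unfold dz_term, dd. rewrite !Cmod_mult, Cmod_RtoC_le by (left; apply Rpower_pos).
    right. f_equal. f_equal. ring. }
  destruct (unif_cvg_series (fun _ => True) (fun n _ => dz_term z1 z2 sigma n) (dd z1 z2 sigma)
     (bounded_tail _ B (fun n _ => dd_nonneg _ _ _ n) HB) (fun n z _ _ => T n)) as (_ & P).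
  specialize (P (RtoC 0) I). cbv beta in P. set (l := clim _) in P.
  (* [Series] starts at index 0 with argument [S n], so its N-th partial sum already has N + 1
     terms. *)
  assert (E : forall f : nat -> R, forall N, sum_n (fun n => f (S n)) N = rsum1 f (S N)).
  { intros f N. induction N as [|N IH]; [rewrite sum_O; simpl; ring|].
    rewrite sum_Sn, IH. reflexivity. }
  assert (E1 : forall N, Re (csum1 (dz_term z1 z2 sigma) N) = rsum1 (fun n => Re (dz_term z1 z2 sigma n)) N).
  { induction N as [|N IH]; [reflexivity|]. cbn [csum1 rsum1]. now rewrite re_plus, IH. }
  assert (E2 : forall N, Im (csum1 (dz_term z1 z2 sigma) N) = rsum1 (fun n => Im (dz_term z1 z2 sigma n)) N).
  { induction N as [|N IH]; [reflexivity|]. cbn [csum1 rsum1]. now rewrite im_plus, IH. }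
  replace (dz_series z1 z2 sigma) with l; [exact P|].
  apply Ceq_of; symmetry.
  - change (Series (fun n => Re (dz_term z1 z2 sigma (S n))) = Re l). apply is_series_unique.
    change (is_lim_seq (sum_n (fun n => Re (dz_term z1 z2 sigma (S n)))) (Re l)). apply (is_lim_seq_ext (fun N => Re (csum1 (dz_term z1 z2 sigma) (S N)))).
    + intros N. rewrite E1. symmetry. apply (E (fun n => Re (dz_term z1 z2 sigma n))).
    + apply (is_lim_seq_incr_1 (fun N => Re (csum1 (dz_term z1 z2 sigma) N))). now apply ccvg_re.
  - change (Series (fun n => Im (dz_term z1 z2 sigma (S n))) = Im l). apply is_series_unique.
    change (is_lim_seq (sum_n (fun n => Im (dz_term z1 z2 sigma (S n)))) (Im l)). apply (is_lim_seq_ext (fun N => Im (csum1 (dz_term z1 z2 sigma) (S N)))).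
    + intros N. rewrite E2. symmetry. apply (E (fun n => Im (dz_term z1 z2 sigma n))).
    + apply (is_lim_seq_incr_1 (fun N => Im (csum1 (dz_term z1 z2 sigma) N))). now apply ccvg_im.
Qed.

(** * The moment *)

Lemma Cconj_RtoC x : Cconj (RtoC x) = RtoC x.
Proof. apply Ceq_of; simpl; ring. Qed.

Lemma Cconj_conj (z : C) : Cconj (Cconj z) = z.
Proof. apply Ceq_of; unfold Re, Im; simpl; ring. Qed.

Lemma dz_conj z n : Cconj (dz z n) = dz (Cconj z) n.
Proof.
  assert (R : forall a, Cconj (rising z a) = rising (Cconj z) a).
  { induction a as [|a IH]; cbn [rising]; [apply Cconj_RtoC|]. now rewrite Cmult_conj, IH, Cplus_conj, Cconj_RtoC. }
  unfold dz. induction (prime.primes n) as [|p s IH]; cbn [fold_right]; [apply Cconj_RtoC|].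
  rewrite Cmult_conj, IH. unfold dz_pp. now rewrite Cmult_conj, R, Cconj_RtoC.
Qed.

Lemma moment_integrand_LZ z1 z2 sigma t : RH -> 1 / 2 < sigma -> 1 < t ->
  moment_integrand z1 z2 sigma t = (cexp (z1 * LZ (sigma, t)%R) * Cconj (cexp (Cconj z2 * LZ (sigma, t)%R)))%C.
Proof.
  intros HRH Hs Ht. unfold moment_integrand, zeta_pow, zeta_conj_pow. rewrite log_zeta_LZ by auto.
  now rewrite <- cexp_conj, Cmult_conj, Cconj_conj.
Qed.

Lemma moment_CInt z1 z2 sigma T : 0 < T ->
  moment z1 z2 sigma T = (RtoC (/ T) * CInt (moment_integrand z1 z2 sigma) T (2 * T))%C.
Proof.
  intros HT. unfold moment, CInt. generalize (RInt (fun t => Re (moment_integrand z1 z2 sigma t)) T (2 * T)).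
  generalize (RInt (fun t => Im (moment_integrand z1 z2 sigma t)) T (2 * T)). intros a b.
  apply Ceq_of; simpl; unfold Rdiv; ring.
Qed.

Lemma rcont_csum1 (f : nat -> R -> C) N t : (forall n, rcont (f n) t) -> rcont (fun t => csum1 (fun n => f n t) N) t.
Proof. intros H. induction N as [|N IH]; cbn [csum1]; [apply rcont_const | now apply rcont_plus]. Qed.

Lemma rcont_npow n sigma t : rcont (fun t => npow_neg n (sigma, t)) t.
Proof.
  unfold npow_neg. apply rcont_cexp, rcont_mult; [apply rcont_opp, rcont_vert | apply rcont_const].
Qed.

Lemma rcont_smooth_poly z xi H N sigma t : rcont (fun t => smooth_poly z xi H N (sigma, t)) t.
Proof.
  unfold smooth_poly. apply (rcont_csum1 (fun n t => dz z n * Wt (xi - ln (INR n)) H * npow_neg n (sigma, t))%C).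
  intros n. apply rcont_mult; [apply rcont_const | apply rcont_npow].
Qed.

(** The second factor of the integrand is the conjugate of zeta^{conj z2}, so the same pointwise
    approximation is used for z1 and conj z2. The error comes from expanding the product: x - p and
    y - q appear once each, and once together. *)
Lemma moment_smooth_diff z1 z2 sigma T xi H N B E : RH -> 1 / 2 < sigma -> 1 < T ->
  (forall z t, z = z1 \/ z = Cconj z2 -> T <= t <= 2 * T ->
     Cmod (cexp (z * LZ (sigma, t)%R)) <= B /\ Cmod (cexp (z * LZ (sigma, t)%R) - smooth_poly z xi H N (sigma, t)) <= E) ->
  Cmod (moment z1 z2 sigma T - RtoC (/ T) * CInt (fun t => smooth_poly z1 xi H N (sigma, t) *
     Cconj (smooth_poly (Cconj z2) xi H N (sigma, t)))%C T (2 * T)) <= E * (2 * B + E).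
Proof.
  intros HRH Hs HT HA.
  rewrite moment_CInt by lra.
  rewrite (CInt_ext (moment_integrand z1 z2 sigma) (fun t => cexp (z1 * LZ (sigma, t)%R) * Cconj (cexp (Cconj z2 * LZ (sigma, t)%R)))%C)
    by (try lra; intros t Ht; apply moment_integrand_LZ; auto; lra).
  set (u := fun t => (cexp (z1 * LZ (sigma, t)%R) * Cconj (cexp (Cconj z2 * LZ (sigma, t)%R)))%C).
  set (w := fun t => (smooth_poly z1 xi H N (sigma, t) * Cconj (smooth_poly (Cconj z2) xi H N (sigma, t)))%C).
  assert (Ju : cintegrable u T (2 * T)).
  { apply cintegrable_cont; [lra|]. intros t Ht.
    assert (rcont (fun t => LZ (sigma, t)) t) by (apply rcont_LZ; auto; lra).
    apply rcont_mult; [| apply rcont_conj]; apply rcont_cexp, rcont_mult; auto using rcont_const. }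
  assert (Jw : cintegrable w T (2 * T)).
  { apply cintegrable_cont; [lra|]. intros t Ht. apply rcont_mult; [| apply rcont_conj]; apply rcont_smooth_poly. }
  replace (RtoC (/ T) * CInt u T (2 * T) - RtoC (/ T) * CInt w T (2 * T))%C with
    (RtoC (/ T) * (CInt u T (2 * T) - CInt w T (2 * T)))%C by ring.
  assert (iT : 0 < / T) by (apply Rinv_0_lt_compat; lra).
  rewrite <- CInt_minus, Cmod_mult, Cmod_RtoC_le by (auto; lra).
  assert (BB : Cmod (CInt (fun t => u t - w t)%C T (2 * T)) <= E * (2 * B + E) * (2 * T - T)).
  { apply CInt_bound_const; [lra | now apply cintegrable_minus |]. intros t Ht. unfold u, w.
    destruct (HA z1 t (or_introl eq_refl) Ht) as (a1 & a2). destruct (HA (Cconj z2) t (or_intror eq_refl) Ht) as (b1 & b2).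
    set (x := cexp (z1 * LZ (sigma, t))) in *. set (y := cexp (Cconj z2 * LZ (sigma, t))) in *.
    set (p := smooth_poly z1 xi H N (sigma, t)) in *. set (q := smooth_poly (Cconj z2) xi H N (sigma, t)) in *.
    replace (x * Cconj y - p * Cconj q)%C with ((x - p) * Cconj y + x * Cconj (y - q) - (x - p) * Cconj (y - q))%C
      by (rewrite Cminus_conj; ring).
    eapply Rle_trans; [apply Cmod_minus_le|]. eapply Rle_trans; [apply Rplus_le_compat_r, Cmod_triangle|].
    rewrite !Cmod_mult, !Cmod_conj.
    assert (Cmod (x - p) * Cmod y <= E * B) by (apply Rmult_le_compat; auto using Cmod_ge_0).
    assert (Cmod x * Cmod (y - q) <= B * E) by (apply Rmult_le_compat; auto using Cmod_ge_0).
    assert (Cmod (x - p) * Cmod (y - q) <= E * E) by (apply Rmult_le_compat; auto using Cmod_ge_0). lra. }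
  replace (E * (2 * B + E)) with (/ T * (E * (2 * B + E) * (2 * T - T))) by (field; lra).
  apply Rmult_le_compat_l; lra.
Qed.

(** The weight contributes e^{9+3 xi} n^{-3}, which turns n^{1-sigma} into at most n^{-2}, uniformly
    in N; the Euler product at abscissa 2 then costs exp(8 k). Two such sums are the source of the
    power X^6. *)
Lemma smooth_weight_sum z k sigma xi H N : Cmod z <= k -> 0 <= sigma -> 0 <= H ->
  rsum1 (fun n => Cmod (dz z n * Wt (xi - ln (INR n)) H) * Rpower (INR n) (1 - sigma)) N <= exp (9 + 3 * xi + 8 * k).
Proof.
  intros Hk Hs HH. assert (k0 : 0 <= k) by (eapply Rle_trans; [apply Cmod_ge_0 | exact Hk]).
  apply Rle_trans with (rsum1 (fun n => exp (9 + 3 * xi) * (Cmod (dz z n) * Rpower (INR n) (- (2)))) N).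
  - apply rsum1_le. intros n Hn. rewrite Cmod_mult.
    assert (l0 : 0 <= ln (INR n)) by (rewrite <- ln_1; apply ln_le_mono; [lra | change 1 with (INR 1); apply le_INR; lia]).
    assert (W := Wt_bound (xi - ln (INR n)) H HH).
    replace (exp (9 + 3 * xi) * (Cmod (dz z n) * Rpower (INR n) (- (2)))) with
      (Cmod (dz z n) * (exp (9 + 3 * xi) * Rpower (INR n) (- (2)))) by ring.
    rewrite Rmult_assoc. apply Rmult_le_compat_l; [apply Cmod_ge_0|].
    eapply Rle_trans; [apply Rmult_le_compat_r; [left; apply Rpower_pos | exact W]|].
    unfold Rpower. rewrite <- !exp_plus. apply exp_le. nra.
  - rewrite rsum1_scal, (exp_plus (9 + 3 * xi)). apply Rmult_le_compat_l; [left; apply exp_pos|].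
    eapply Rle_trans; [apply (rsum1_dz_le z k 2 N); auto; lra|]. apply exp_le.
    assert (P := psumR_Rpower_le 2 N ltac:(lra)). replace (1 + / (2 - 1)) with 2 in P by field. nra.
Qed.

(** |W_n - 1| is at most Om n^d, because replacing xi by xi - log n in the bound costs at most n^d.
    The resulting n^{2d} is absorbed by moving the abscissa from sigma to sigma - d. *)
Lemma smooth_diag_diff z1 z2 sigma d xi H N Om Q : 0 < d <= 1 -> 1 <= H -> 0 <= xi ->
  2 / d * exp (- (d * xi)) + 2 * ((exp (3 * xi) + exp (- (d * xi))) * exp (9 - H * H)) <= Om -> Om <= 1 ->
  rsum1 (dd z1 z2 (sigma - d)) N <= Q ->
  Cmod (csum1 (fun n => (dz z1 n * Wt (xi - ln (INR n)) H) * Cconj (dz (Cconj z2) n * Wt (xi - ln (INR n)) H) *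
     RtoC (Rpower (INR n) (-2 * sigma)))%C N - csum1 (dz_term z1 z2 sigma) N) <= 3 * Om * Q.
Proof.
  intros Hd HH Hxi HOm HOm1 HQ. rewrite <- csum1_minus.
  assert (Om0 : 0 < Om).
  { eapply Rlt_le_trans; [| exact HOm]. assert (0 < / d) by (apply Rinv_0_lt_compat; lra).
    assert (E1 := exp_pos (- (d * xi))). assert (E2 := exp_pos (3 * xi)). assert (E3 := exp_pos (9 - H * H)).
    apply Rplus_lt_0_compat; [unfold Rdiv; nra|]. assert (0 < (exp (3 * xi) + exp (- (d * xi))) * exp (9 - H * H)) by nra. lra. }
  apply Rle_trans with (rsum1 (fun n => 3 * Om * dd z1 z2 (sigma - d) n) N); [| rewrite rsum1_scal; apply Rmult_le_compat_l; lra].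
  apply csum1_bound. intros n Hn.
  assert (l0 : 0 <= ln (INR n)) by (rewrite <- ln_1; apply ln_le_mono; [lra | change 1 with (INR 1); apply le_INR; lia]).
  set (W := Wt (xi - ln (INR n)) H). set (nd := exp (d * ln (INR n))).
  assert (Hnd : 1 <= nd) by (unfold nd; generalize (exp_ge_1_plus (d * ln (INR n))); nra).
  assert (w1 : Cmod (W - 1) <= Om * nd).
  { eapply Rle_trans; [apply (Wt_near_1 d _ H Hd HH)|].
    eapply Rle_trans; [| apply Rmult_le_compat_r; [lra | exact HOm]].
    assert (e1 : exp (- (d * (xi - ln (INR n)))) = exp (- (d * xi)) * nd) by (unfold nd; rewrite <- exp_plus; f_equal; ring).
    assert (e2 : exp (3 * (xi - ln (INR n))) <= exp (3 * xi) * nd) by (unfold nd; rewrite <- exp_plus; apply exp_le; nra).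
    rewrite e1.
    replace ((2 / d * exp (- (d * xi)) + 2 * ((exp (3 * xi) + exp (- (d * xi))) * exp (9 - H * H))) * nd) with
      (2 / d * (exp (- (d * xi)) * nd) + 2 * ((exp (3 * xi) * nd + exp (- (d * xi)) * nd) * exp (9 - H * H))) by ring.
    apply Rplus_le_compat_l. apply Rmult_le_compat_l; [lra|].
    apply Rmult_le_compat_r; [left; apply exp_pos | lra]. }
  rewrite Cmult_conj, dz_conj, Cconj_conj. unfold dz_term.
  replace (dz z1 n * W * (dz z2 n * Cconj W) * RtoC (Rpower (INR n) (-2 * sigma)) - dz z1 n * dz z2 n * RtoC (Rpower (INR n) (-2 * sigma)))%C
    with (dz z1 n * dz z2 n * RtoC (Rpower (INR n) (-2 * sigma)) * ((W - 1) * Cconj (W - 1) + (W - 1) + Cconj (W - 1)))%C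
    by (rewrite Cminus_conj, Cconj_RtoC; ring).
  rewrite !Cmod_mult, Cmod_RtoC_le by (left; apply Rpower_pos).
  (* This is |W|^2 - 1 written through W - 1; each of its three terms is at most Om n^{2d}, using Om
     <= 1 and n^d >= 1. *)
  assert (w2 : Cmod ((W - 1) * Cconj (W - 1) + (W - 1) + Cconj (W - 1)) <= 3 * Om * (nd * nd)).
  { eapply Rle_trans; [apply Cmod_triangle|]. eapply Rle_trans; [apply Rplus_le_compat_r, Cmod_triangle|].
    rewrite Cmod_mult, Cmod_conj. set (x := Cmod (W - 1)) in *. assert (x0 : 0 <= x) by apply Cmod_ge_0.
    assert (x * x <= Om * nd * (Om * nd)) by (apply Rmult_le_compat; auto).
    assert (Om * nd <= Om * (nd * nd)) by (apply Rmult_le_compat_l; nra).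
    assert (Om * nd * (Om * nd) <= Om * (nd * nd)).
    { replace (Om * nd * (Om * nd)) with (Om * (Om * (nd * nd))) by ring. apply Rmult_le_compat_l; [lra|].
      assert (0 <= nd * nd) by nra. nra. }
    lra. }
  unfold dd. assert (P := Rpower_pos (INR n) (-2 * sigma)).
  replace (Rpower (INR n) (- (2 * (sigma - d)))) with (Rpower (INR n) (-2 * sigma) * (nd * nd)).
  2: { unfold nd, Rpower. rewrite <- !exp_plus. f_equal. ring. }
  assert (A := Cmod_ge_0 (dz z1 n)). assert (A' := Cmod_ge_0 (dz z2 n)).
  replace (3 * Om * (Cmod (dz z1 n) * Cmod (dz z2 n) * (Rpower (INR n) (-2 * sigma) * (nd * nd)))) with
    (Cmod (dz z1 n) * Cmod (dz z2 n) * Rpower (INR n) (-2 * sigma) * (3 * Om * (nd * nd))) by ring.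
  apply Rmult_le_compat_l; auto. apply Rmult_le_pos; [| lra]. now apply Rmult_le_pos.
Qed.

Lemma dz_tail_uniform z k sigma e : Cmod z <= k -> 0 <= sigma -> 0 < e -> exists N0, forall N, (N0 <= N)%nat -> forall v,
  Cmod (cexp (z * LF (sigma + 3, v)) - csum1 (fun n => dz z n * npow_neg n (sigma + 3, v)%R)%C N) <= e.
Proof.
  intros Hk Hs He. set (g := fun n => Cmod (dz z n) * Rpower (INR n) (- (2))).
  assert (k0 : 0 <= k) by (eapply Rle_trans; [apply Cmod_ge_0 | exact Hk]).
  destruct (bounded_tail g (exp (8 * k))) with (e := e) as (N0 & HN0); auto.
  - intros n _. apply Rmult_le_pos; [apply Cmod_ge_0 | left; apply Rpower_pos].
  - intros n. eapply Rle_trans; [apply (rsum1_dz_le z k 2 n); auto; lra|]. apply exp_le.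
    assert (P := psumR_Rpower_le 2 n ltac:(lra)). replace (1 + / (2 - 1)) with 2 in P by field. nra.
  - exists N0. intros N HN v.
    assert (D := dz_dirichlet z (sigma + 3, v) ltac:(simpl; lra)).
    apply (ccvg_le (fun m => csum1 (fun n => dz z n * npow_neg n (sigma + 3, v)%R)%C m - csum1 (fun n => dz z n * npow_neg n (sigma + 3, v)%R)%C N)%C _ _ N).
    + intros m Hm. eapply Rle_trans; [apply (csum1_diff_bound _ g); auto | apply HN0; lia].
      intros n Hn. unfold g. rewrite Cmod_mult, Cmod_npow. apply Rmult_le_compat_l; [apply Cmod_ge_0|].
      apply Rle_Rpower; [change 1 with (INR 1); apply le_INR; lia | simpl; lra].
    + unfold Cminus. apply ccvg_plus; [exact D | apply ccvg_const].
Qed.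

(** With x = eta l/3, e^{eta l} is at least x^3, which exceeds C l^2 once l is at least 27
    C/eta^3. *)
Lemma exp_beats_quadratic C eta : 0 < C -> 0 < eta -> exists l0, 1 <= l0 /\ forall l, l0 <= l ->
  C * l * l * exp ((1 - eta) * l) <= exp l.
Proof.
  intros HC He. set (c := eta * eta * eta). assert (Hc : 0 < c) by (unfold c; repeat apply Rmult_lt_0_compat; auto).
  assert (P : 0 < 27 * C / c) by (apply Rdiv_lt_0_compat; lra).
  exists (1 + 27 * C / c). split; [lra|]. intros l Hl.
  replace l with ((1 - eta) * l + 3 * (eta * l / 3)) at 4 by field. rewrite exp_plus, (Rmult_comm _ (exp ((1 - eta) * l))).
  apply Rmult_le_compat_l; [left; apply exp_pos|].
  set (x := eta * l / 3). assert (Px : 0 < x) by (unfold x; nra).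
  replace (3 * x) with (x + x + x) by ring. rewrite !exp_plus.
  assert (E := exp_ge_1_plus x).
  apply Rle_trans with (x * x * x).
  - unfold x. replace (eta * l / 3 * (eta * l / 3) * (eta * l / 3)) with (c * l / 27 * (l * l)) by (unfold c; field).
    rewrite Rmult_assoc. apply Rmult_le_compat_r; [nra|].
    apply (Rmult_le_reg_r (27 / c)); [apply Rdiv_lt_0_compat; lra|].
    replace (c * l / 27 * (27 / c)) with l by (field; lra). replace (C * (27 / c)) with (27 * C / c) by (field; lra). lra.
  - apply Rmult_le_compat; try lra; [nra|]. apply Rmult_le_compat; lra.
Qed.

(** The exponent q in [rsum1_dd_le] has to satisfy q (sigma - d) > 1 for convergence, and q (2 sigma
    - 1) <= 1 - eta up to O(1/l), so that k^q is a power of L with exponent below 1. The constant 40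
    is the cost 2 * 20 of replacing sigma by sigma - 10/l in the second condition. *)
Lemma dd_asymp eps : 0 < eps < 1 / 2 -> exists C, 0 < C /\ forall l sigma z1 z2 N, 20 <= l ->
  1 / 2 + 20 / l <= sigma <= 1 - eps ->
  Cmod z1 <= exp ((2 * sigma - 1) * l) -> Cmod z2 <= exp ((2 * sigma - 1) * l) ->
  rsum1 (dd z1 z2 (sigma - 10 / l)) N <= exp (C * l * exp ((1 - eps / 2) * l)).
Proof.
  intros He. set (eta := eps / 2). assert (ieta : 0 < / eta) by (apply Rinv_0_lt_compat; unfold eta; lra).
  assert (P40 := exp_pos 40).
  exists (8 * exp 40 * (2 + / eta)). split; [nra|]. intros l sigma z1 z2 N Hl Hs H1 H2.
  assert (il : 0 < / l) by (apply Rinv_0_lt_compat; lra). assert (ill : l * / l = 1) by (field; lra).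
  set (s' := sigma - 10 / l). unfold Rdiv in Hs, s'.
  assert (Hs' : 1 / 2 + 10 * / l <= s' <= 1 - eps) by (unfold s'; lra).
  set (k := exp ((2 * sigma - 1) * l)) in *. assert (Pk : 0 < k) by apply exp_pos.
  assert (Main : exists q, 1 <= q <= 2 /\ 1 < q * s' /\ / (q * s' - 1) <= / eta + l /\ q * ((2 * sigma - 1) * l) <= 40 + (1 - eta) * l).
  { destruct (Rle_dec (1 + eta) (2 * s')) as [c|c].
    - assert (is' : / s' * s' = 1) by (field; lra). assert (Ps : 0 < / s') by (apply Rinv_0_lt_compat; lra).
      assert (Q : 1 + eps <= / s') by (apply (Rmult_le_reg_r s'); [lra|]; rewrite is'; nra).
      assert (q2 : (1 + eta) * / s' <= 2) by (apply (Rmult_le_reg_r s'); [lra|]; rewrite Rmult_assoc, is'; lra).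
      (* Away from 1/2: q s' - 1 is exactly eta, and q (2 s' - 1) = (1 + eta)(2 - 1/s') <= (1 +
         eta)(1 - 2 eta), since s' <= 1 - eps. *)
      exists ((1 + eta) * / s'). replace ((1 + eta) * / s' * s') with (1 + eta) by (rewrite Rmult_assoc, is'; ring).
      repeat split; try (unfold eta in *; lra).
      + unfold eta in *; nra.
      + replace (1 + eta - 1) with eta by ring. lra.
      + replace (2 * sigma - 1) with ((2 * s' - 1) + 20 * / l) by (unfold s'; ring).
        replace ((1 + eta) * / s' * ((2 * s' - 1 + 20 * / l) * l)) with
          ((1 + eta) * (2 * (/ s' * s') - / s') * l + 20 * ((1 + eta) * / s') * (l * / l)) by ring.
        rewrite is', ill. assert ((1 + eta) * (2 * 1 - / s') <= 1 - eta) by (unfold eta in *; nra).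
        assert ((1 + eta) * (2 * 1 - / s') * l <= (1 - eta) * l) by (apply Rmult_le_compat_r; lra). lra.
    (* Near 1/2 the largest exponent q = 2 is taken; 2 s' - 1 >= 20/l bounds the sum over primes by
       a multiple of l, and k^2 is still a small power of L. *)
    - exists 2. repeat split; try lra.
      + assert (/ (2 * s' - 1) <= l); [| lra]. rewrite <- (Rinv_inv l). apply Rinv_le_contravar; lra.
      + replace (2 * sigma - 1) with ((2 * s' - 1) + 20 * / l) by (unfold s'; ring).
        replace (2 * ((2 * s' - 1 + 20 * / l) * l)) with (2 * (2 * s' - 1) * l + 40 * (l * / l)) by ring. rewrite ill.
        assert (2 * (2 * s' - 1) * l <= (1 - eta) * l) by (apply Rmult_le_compat_r; unfold eta in *; lra). lra. }
  destruct Main as (q & Hq & Hqs & Hi & Hk).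
  eapply Rle_trans; [apply (rsum1_dd_le z1 z2 k s' q N); auto; lra|]. apply exp_le.
  assert (Kq : Rpower k q <= exp 40 * exp ((1 - eta) * l)).
  { unfold Rpower, k. rewrite ln_exp, <- exp_plus. apply exp_le. lra. }
  assert (P1 := Rpower_pos k q). assert (Pq : 0 < / (q * s' - 1)) by (apply Rinv_0_lt_compat; lra).
  apply Rle_trans with (8 * (exp 40 * exp ((1 - eta) * l)) * ((2 + / eta) * l)).
  - apply Rmult_le_compat; try lra. nra.
  - right. ring.
Qed.

(** With M = exp(-rho/50), the error splits into the pointwise approximation (3 M), the off-diagonal
    terms (M), the weights on the diagonal (3 M) and the truncation of the series (M), which add up
    to the constant 8. *)
Lemma moment_asymp eps : RH -> 0 < eps < 1 / 2 -> exists b l0, 0 < b /\ 0 < l0 /\ forall l sigma z1 z2, l0 <= l ->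
  1 / 2 + 20 / l <= sigma <= 1 - eps ->
  Cmod z1 <= b * exp ((2 * sigma - 1) * l) -> Cmod z2 <= b * exp ((2 * sigma - 1) * l) ->
  Cmod (moment z1 z2 sigma (exp (exp l)) - dz_series z1 z2 sigma) <= 8 * exp (- (exp l / (50 * l))).
Proof.
  intros HRH He.
  destruct (LZ_asymp (eps / 2) HRH ltac:(lra)) as (C1 & l1 & PC1 & Hl1 & HLZ).
  destruct (dd_asymp eps He) as (C2 & PC2 & HQ).
  destruct (exp_beats_quadratic (10 * C2) (eps / 2) ltac:(lra) ltac:(lra)) as (m1 & Hm1 & G1).
  destruct (exp_beats_quadratic 1 eps ltac:(lra) ltac:(lra)) as (m2 & Hm2 & G2).
  destruct (exp_beats_quadratic 100 (2 * eps) ltac:(lra) ltac:(lra)) as (m3 & Hm3 & G3).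
  destruct (exp_beats_quadratic 10 1 ltac:(lra) ltac:(lra)) as (m4 & Hm4 & G4).
  assert (P20 := exp_pos 20).
  (* Going left by 10/l multiplies L^{2-2 sigma} by e^{20}; this c makes |z log zeta| at most
     rho/10. The minimum with 1 keeps |z| <= k, as [dd_asymp] asks. *)
  set (c := / (10 * (C1 * (exp 20 + 1)))).
  assert (Pc : 0 < c) by (apply Rinv_0_lt_compat; nra).
  exists (Rmin 1 c), (100 + l1 + m1 + m2 + m3 + m4).
  split; [apply Rmin_glb_lt; lra|]. split; [lra|]. intros l sigma z1 z2 Hl Hs H1 H2.
  specialize (G1 l ltac:(lra)). specialize (G2 l ltac:(lra)). specialize (G3 l ltac:(lra)). specialize (G4 l ltac:(lra)).
  assert (il : 0 < / l) by (apply Rinv_0_lt_compat; lra). assert (ill : l * / l = 1) by (field; lra).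
  set (L := exp l) in *. set (rho := L / l). set (T := exp L).
  assert (HL : 1 + l <= L) by apply exp_ge_1_plus.
  assert (LL : 101 * L <= L * L) by (apply Rmult_le_compat_r; lra).
  assert (Lr : L = l * rho) by (unfold rho; field; lra).
  set (k := exp ((2 * sigma - 1) * l)) in *. assert (Pk : 0 < k) by apply exp_pos.
  (* The facts [F1] to [F5] convert largeness of l into multiples of rho and L: the diagonal sum is
     exp(rho/10) at most, and k, rho are at most L/100. *)
  assert (F1 : C2 * l * exp ((1 - eps / 2) * l) <= rho / 10).
  { apply (Rmult_le_reg_l l); [lra|]. rewrite Lr in G1. lra. }
  assert (F2 : exp ((1 - eps) * l) <= rho).
  { apply (Rmult_le_reg_l l); [lra|]. rewrite <- Lr. assert (0 < exp ((1 - eps) * l)) by apply exp_pos. nra. }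
  assert (F3 : k <= L / 100).
  { apply Rle_trans with (exp ((1 - 2 * eps) * l)); [apply exp_le; nra|].
    assert (0 < exp ((1 - 2 * eps) * l)) by apply exp_pos.
    assert (exp ((1 - 2 * eps) * l) * 1 <= exp ((1 - 2 * eps) * l) * (l * l)) by (apply Rmult_le_compat_l; nra). lra. }
  assert (F4 : 10 * l <= rho).
  { apply (Rmult_le_reg_l l); [lra|]. rewrite <- Lr. replace ((1 - 1) * l) with 0 in G4 by ring. rewrite exp_0 in G4. lra. }
  assert (F5 : rho <= L / 100) by (assert (100 * rho <= l * rho) by (apply Rmult_le_compat_r; lra); lra).
  assert (HT : 4 * L + 4 <= T).
  { unfold T. replace L with (2 * (L / 2)) at 2 by field. eapply Rle_trans; [| apply exp_pow2_ge; lra]. lra. }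
  set (d := 10 / l). assert (Hd : 0 < d <= 1) by (unfold d, Rdiv; split; [lra|]; apply (Rmult_le_reg_l l); [lra|]; lra).
  set (xi := L / 10). assert (Hdx : d * xi = rho) by (unfold d, xi, rho; field; lra).
  assert (Sd : 1 / 2 + 4 / l <= sigma - d) by (unfold d, Rdiv in *; lra).
  assert (Sd' : 1 / 2 < sigma - d) by (unfold Rdiv in *; lra).
  assert (kc : Rmin 1 c * k <= 1 * k) by (apply Rmult_le_compat_r; [lra | apply Rmin_l]).
  assert (z1k : Cmod z1 <= k) by lra.
  assert (z2k : Cmod z2 <= k) by lra.
  set (B := exp (rho / 10)). set (E := exp (- (rho / 2))).
  assert (HB1 : 1 <= B) by (unfold B; generalize (exp_ge_1_plus (rho / 10)); lra).
  assert (PE : 0 < E) by apply exp_pos.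
  assert (E1 : E <= 1) by (apply Rle_trans with (exp 0); [apply exp_le; lra | rewrite exp_0; lra]).
  assert (HB : forall z, Cmod z <= Rmin 1 c * k -> forall u t, sigma - d <= u -> T / 2 <= t <= 3 * T -> Cmod (cexp (z * LZ (u, t)%R)) <= B).
  { intros z Hz u t Hu Ht. rewrite Cmod_cexp. apply exp_le.
    eapply Rle_trans; [apply Rle_abs|]. eapply Rle_trans; [apply re_le_Cmod|]. rewrite Cmod_mult.
    assert (B1 := HLZ l u t ltac:(lra) Ht ltac:(lra)).
    assert (B2 : exp ((2 - 2 * u) * l) <= exp 20 * exp ((2 - 2 * sigma) * l)).
    { rewrite <- exp_plus. apply exp_le. assert (d * l = 10) by (unfold d; field; lra).
      assert ((sigma - u) * l <= d * l) by (apply Rmult_le_compat_r; lra). lra. }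
    replace (2 * (eps / 2) * l) with (eps * l) in B1 by field.
    assert (k1 : k * exp ((2 - 2 * sigma) * l) = L) by (unfold k, L; rewrite <- exp_plus; f_equal; ring).
    assert (k2 : k * exp (eps * l) <= rho).
    { eapply Rle_trans; [| exact F2]. unfold k. rewrite <- exp_plus. apply exp_le.
      rewrite <- Rmult_plus_distr_r. apply Rmult_le_compat_r; lra. }
    apply Rle_trans with (c * k * (C1 * (exp 20 * exp ((2 - 2 * sigma) * l) / l + exp (eps * l)))).
    - apply Rmult_le_compat; auto using Cmod_ge_0.
      + eapply Rle_trans; [exact Hz|]. apply Rmult_le_compat_r; [lra | apply Rmin_r].
      + eapply Rle_trans; [exact B1|]. apply Rmult_le_compat_l; [lra|]. apply Rplus_le_compat_r.
        unfold Rdiv. apply Rmult_le_compat_r; lra.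
    - replace (c * k * (C1 * (exp 20 * exp ((2 - 2 * sigma) * l) / l + exp (eps * l)))) with
        (c * C1 * (exp 20 * ((k * exp ((2 - 2 * sigma) * l)) / l) + k * exp (eps * l))) by (field; lra).
      rewrite k1. fold rho.
      apply Rle_trans with (c * C1 * (exp 20 * rho + rho)).
      + apply Rmult_le_compat_l; [apply Rmult_le_pos; lra|]. apply Rplus_le_compat_l. exact k2.
      + right. unfold c. field. split; lra. }
  (* The error of the weights. Its main part l exp(-rho)/5 is far below E = exp(-rho/2), even after
     multiplication by the bound B = exp(rho/10) of zeta^z; the Gaussian part is of size
     exp(-L^2). *)
  set (Om := 2 / d * exp (- (d * xi)) + 2 * ((exp (3 * xi) + exp (- (d * xi))) * exp (9 - L * L))).
  assert (HOm : B * Om <= 3 / 4 * E).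
  { unfold Om. rewrite Hdx. replace (2 / d) with (l / 5) by (unfold d; field; lra).
    assert (A1 : B * (l / 5 * exp (- rho)) <= E / 4).
    { replace (B * (l / 5 * exp (- rho))) with (l / 5 * (exp (- (rho / 2)) * exp (- (rho * 2 / 5)))).
      2: { unfold B. rewrite <- exp_plus. replace (exp (rho / 10) * (l / 5 * exp (- rho))) with (l / 5 * (exp (rho / 10) * exp (- rho))) by ring.
           rewrite <- exp_plus. f_equal. f_equal. field. }
      fold E. assert (A : l / 5 * exp (- (rho * 2 / 5)) <= / 4).
      { rewrite exp_Ropp. assert (X := exp_ge_1_plus (rho * 2 / 5)).
        apply (Rmult_le_reg_r (exp (rho * 2 / 5))); [lra|]. rewrite Rmult_assoc, Rinv_l by lra. lra. }
      replace (l / 5 * (E * exp (- (rho * 2 / 5)))) with (E * (l / 5 * exp (- (rho * 2 / 5)))) by ring.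
      apply Rle_trans with (E * / 4); [apply Rmult_le_compat_l; lra | lra]. }
    assert (A2 : B * ((exp (3 * xi) + exp (- rho)) * exp (9 - L * L)) <= E / 4).
    { apply Rle_trans with (B * (2 * exp (3 * xi) * exp (9 - L * L))).
      - apply Rmult_le_compat_l; [lra|]. apply Rmult_le_compat_r; [left; apply exp_pos|].
        assert (exp (- rho) <= exp (3 * xi)) by (apply exp_le; unfold xi; lra). lra.
      - replace (B * (2 * exp (3 * xi) * exp (9 - L * L))) with (2 * exp (rho / 10 + 3 * xi + (9 - L * L))) by (unfold B; rewrite !exp_plus; ring).
        apply Rle_trans with (2 * exp (- (rho / 2) + - (2 * 3))).
        + apply Rmult_le_compat_l; [lra|]. apply exp_le. unfold xi. lra.
        + rewrite exp_plus. fold E. assert (X := exp_pow2_ge 3 ltac:(lra)).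
          assert (exp (- (2 * 3)) <= / 16) by (rewrite exp_Ropp; apply Rinv_le_contravar; lra).
          apply Rle_trans with (2 * (E * / 16)); [| lra]. apply Rmult_le_compat_l; [lra|]. apply Rmult_le_compat_l; lra. }
    lra. }
  assert (Om1 : Om <= E).
  { assert (0 <= Om); [| assert (1 * Om <= B * Om) by (apply Rmult_le_compat_r; lra); lra]. unfold Om. assert (X1 := exp_pos (- (d * xi))). assert (X2 := exp_pos (3 * xi)). assert (X3 := exp_pos (9 - L * L)).
    assert (0 < / d) by (apply Rinv_0_lt_compat; lra).
    assert (0 <= (exp (3 * xi) + exp (- (d * xi))) * exp (9 - L * L)) by (apply Rmult_le_pos; lra).
    unfold Rdiv. assert (0 <= 2 * / d * exp (- (d * xi))) by (apply Rmult_le_pos; lra). lra. }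
  (* Chosen to cancel the factor exp(9 + 3 xi) of [zeta_pow_approx], so that the truncation
     contributes E/4 next to the 3/4 E coming from [Om]. *)
  set (eta := E / 4 * exp (- (9 + 3 * xi))). assert (Peta : 0 < eta) by (apply Rmult_lt_0_compat; [lra | apply exp_pos]).
  assert (eta1 : eta * exp (9 + 3 * xi) = E / 4).
  { unfold eta. rewrite Rmult_assoc, <- exp_plus. replace (- (9 + 3 * xi) + (9 + 3 * xi)) with 0 by ring. rewrite exp_0. ring. }
  assert (z2k' : Cmod (Cconj z2) <= k) by (now rewrite Cmod_conj).
  destruct (dz_tail_uniform z1 k sigma eta z1k ltac:(lra) Peta) as (N1 & HN1).
  destruct (dz_tail_uniform (Cconj z2) k sigma eta z2k' ltac:(lra) Peta) as (N2 & HN2).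
  set (Q := exp (C2 * l * exp ((1 - eps / 2) * l))).
  assert (HQ' : forall N, rsum1 (dd z1 z2 (sigma - d)) N <= Q) by (intros N; apply HQ; auto; lra).
  assert (HQs : forall N, rsum1 (dd z1 z2 sigma) N <= Q).
  { intros N. eapply Rle_trans; [| apply (HQ' N)]. apply rsum1_le. intros n Hn. unfold dd.
    apply Rmult_le_compat_l; [apply Rmult_le_pos; apply Cmod_ge_0|].
    apply Rle_Rpower; [change 1 with (INR 1); apply le_INR; lia | lra]. }
  destruct (ccvg_dz_series z1 z2 sigma Q HQs E PE) as (N3 & HN3).
  (* One length serves both Dirichlet polynomials and the truncation of the main term. *)
  set (N := (N1 + N2 + N3)%nat). specialize (HN1 N ltac:(unfold N; lia)). specialize (HN2 N ltac:(unfold N; lia)).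
  specialize (HN3 N ltac:(unfold N; lia)).
  assert (App : forall z t, Cmod z <= Rmin 1 c * k ->
     (forall v, Cmod (cexp (z * LF (sigma + 3, v)) - csum1 (fun n => dz z n * npow_neg n (sigma + 3, v)%R)%C N) <= eta) ->
     T <= t <= 2 * T -> Cmod (cexp (z * LZ (sigma, t)%R)) <= B /\ Cmod (cexp (z * LZ (sigma, t)%R) - smooth_poly z xi L N (sigma, t)) <= E).
  { intros z t Hz Hv Ht. split; [apply HB; auto; lra|].
    eapply Rle_trans; [apply (zeta_pow_approx z sigma t d xi L N B eta HRH Hd); auto; try lra|].
    - intros u v Hu Hv'. apply HB; auto. lra.
    - fold Om. rewrite eta1. lra. }
  assert (S1 : Cmod (moment z1 z2 sigma T - RtoC (/ T) * CInt (fun t => smooth_poly z1 xi L N (sigma, t) *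
     Cconj (smooth_poly (Cconj z2) xi L N (sigma, t)))%C T (2 * T)) <= E * (2 * B + E)).
  { apply moment_smooth_diff; auto; try lra. intros z t [-> | ->] Ht; apply App; auto. now rewrite Cmod_conj. }
  set (a := fun n => (dz z1 n * Wt (xi - ln (INR n)) L)%C).
  set (b := fun n => (dz (Cconj z2) n * Wt (xi - ln (INR n)) L)%C).
  assert (PT : 0 < T) by lra. assert (iT : 0 < / T) by now apply Rinv_0_lt_compat.
  assert (S2 := mean_value_poly a b sigma T N PT). cbv zeta in S2.
  assert (S3 := smooth_weight_sum z1 k sigma xi L N z1k ltac:(lra) ltac:(lra)).
  assert (S4 := smooth_weight_sum (Cconj z2) k sigma xi L N z2k' ltac:(lra) ltac:(lra)).
  assert (S5 := smooth_diag_diff z1 z2 sigma d xi L N E Q Hd ltac:(lra) ltac:(unfold xi; lra) Om1 E1 (HQ' N)).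
  change (rsum1 (fun n => Cmod (a n) * Rpower (INR n) (1 - sigma)) N <= exp (9 + 3 * xi + 8 * k)) in S3.
  change (rsum1 (fun n => Cmod (b n) * Rpower (INR n) (1 - sigma)) N <= exp (9 + 3 * xi + 8 * k)) in S4.
  set (I0 := CInt (fun t => smooth_poly z1 xi L N (sigma, t) * Cconj (smooth_poly (Cconj z2) xi L N (sigma, t)))%C T (2 * T)) in *.
  change (CInt _ T (2 * T)) with I0 in S2.
  set (Dg := csum1 (fun n => (a n * Cconj (b n) * RtoC (Rpower (INR n) (-2 * sigma)))%C) N) in *.
  change (Cmod (Dg - csum1 (dz_term z1 z2 sigma) N) <= 3 * E * Q) in S5.
  set (M := exp (- (L / (50 * l)))).
  assert (EM : L / (50 * l) = rho / 50) by (unfold rho; field; lra).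
  replace (moment z1 z2 sigma T - dz_series z1 z2 sigma)%C with
    ((moment z1 z2 sigma T - RtoC (/ T) * I0) + RtoC (/ T) * (I0 - RtoC T * Dg) + (Dg - csum1 (dz_term z1 z2 sigma) N)
      + (csum1 (dz_term z1 z2 sigma) N - dz_series z1 z2 sigma))%C.
  2: { assert (X : (RtoC (/ T) * RtoC T = 1)%C) by (rewrite <- RtoC_mult, Rinv_l by lra; auto).
       transitivity (moment z1 z2 sigma T - (RtoC (/ T) * RtoC T) * Dg + Dg - dz_series z1 z2 sigma)%C; [ring|]. rewrite X. ring. }
  assert (M1 : E * (2 * B + E) <= 3 * M).
  { apply Rle_trans with (3 * (E * B)); [assert (E * E <= E * B) by (apply Rmult_le_compat_l; lra); lra|]. apply Rmult_le_compat_l; [lra|].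
    unfold E, B, M. rewrite <- exp_plus, EM. apply exp_le. lra. }
  (* The exponent is at most 19 - L + 6 L/10 + 16 L/100: xi = L/10 and k <= L/100 leave a fixed
     fraction of L to spare. *)
  assert (M2 : Cmod (RtoC (/ T) * (I0 - RtoC T * Dg)) <= M).
  { rewrite Cmod_mult, Cmod_RtoC_le by lra.
    apply Rle_trans with (/ T * (2 * (exp (9 + 3 * xi + 8 * k) * exp (9 + 3 * xi + 8 * k)))).
    - apply Rmult_le_compat_l; [lra|]. eapply Rle_trans; [exact S2|]. apply Rmult_le_compat_l; [lra|].
      apply Rmult_le_compat; auto; apply rsum1_nonneg; intros n _;
        (apply Rmult_le_pos; [apply Cmod_ge_0 | left; apply Rpower_pos]).
    - unfold T. rewrite <- exp_Ropp. assert (e2 : 2 <= exp 1) by (generalize (exp_ge_1_plus 1); lra).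
      apply Rle_trans with (exp (- L) * (exp 1 * (exp (9 + 3 * xi + 8 * k) * exp (9 + 3 * xi + 8 * k)))).
      + apply Rmult_le_compat_l; [left; apply exp_pos|]. apply Rmult_le_compat_r; [|lra].
        left; apply Rmult_lt_0_compat; apply exp_pos.
      + rewrite <- !exp_plus. unfold M. rewrite EM. apply exp_le. unfold xi. lra. }
  assert (M3 : 3 * E * Q <= 3 * M).
  { rewrite Rmult_assoc. apply Rmult_le_compat_l; [lra|]. unfold E, Q, M. rewrite <- exp_plus, EM. apply exp_le. lra. }
  assert (M4 : E <= M) by (unfold E, M; rewrite EM; apply exp_le; lra).
  eapply Rle_trans; [apply Cmod_triangle|]. eapply Rle_trans; [apply Rplus_le_compat_r, Cmod_triangle|].
  eapply Rle_trans; [apply Rplus_le_compat_r, Rplus_le_compat_r, Cmod_triangle|]. lra.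
Qed.

Theorem theorem1p2 :
  RH ->
  forall eps : R, 0 < eps ->
  exists K b : R, 0 < K /\ 0 < b /\
  exists C0 T0 : R,
  forall T : R, T0 <= T ->
  forall sigma : R, 1/2 + K / ln (ln T) <= sigma <= 1 - eps ->
  forall z1 z2 : C,
    Cmod z1 <= b * Rpower (ln T) (2 * sigma - 1) ->
    Cmod z2 <= b * Rpower (ln T) (2 * sigma - 1) ->
    Cmod (Cminus (moment z1 z2 sigma T) (dz_series z1 z2 sigma))
      <= C0 * exp (- (ln T / (50 * ln (ln T)))).
Proof.
  intros HRH eps Heps.
  (* The parametrisation T = exp(exp l), under which log T and log log T are [exp l] and l. *)
  assert (Rd : forall l0 T, 0 < l0 -> exp (exp l0) <= T -> exists l, l0 <= l /\ T = exp (exp l)).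
  { intros l0 T Hl HT. assert (PT : 0 < T) by (generalize (exp_pos (exp l0)); lra).
    assert (A : exp l0 <= ln T) by (rewrite <- (ln_exp (exp l0)); apply ln_le_mono; auto; apply exp_pos).
    assert (P := exp_pos l0). exists (ln (ln T)). split.
    - rewrite <- (ln_exp l0). now apply ln_le_mono.
    - rewrite !exp_ln; lra. }
  destruct (Rlt_dec eps (1 / 2)) as [c|c].
  - destruct (moment_asymp eps HRH (conj Heps c)) as (b & l0 & Pb & Pl & HM).
    (* The 20 is the distance 20/l from the critical line assumed in [moment_asymp]. *)
    exists 20, b. split; [lra|]. split; [auto|]. exists 8, (exp (exp l0)).
    intros T HT sigma Hs z1 z2 H1 H2. destruct (Rd l0 T Pl HT) as (l & Hl & ->).
    unfold Rpower in H1, H2. rewrite !ln_exp in *. now apply HM.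
  (* For eps >= 1/2 the range of sigma is empty: it would require 1/2 + 1/l <= 1 - eps <= 1/2. The
     threshold exp(exp 1) makes l >= 1, hence 1/l positive. *)
  - exists 1, 1. split; [lra|]. split; [lra|]. exists 0, (exp (exp 1)).
    intros T HT sigma Hs z1 z2 H1 H2. destruct (Rd 1 T Rlt_0_1 HT) as (l & Hl & ->).
    rewrite !ln_exp in Hs. assert (0 < 1 / l) by (apply Rdiv_lt_0_compat; lra). lra.
Qed.
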